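(* Let $\Omega\subseteq\mathbf{R}^n$ ($n\geq 2$) be a bounded domain with smooth boundary. Let $F,G\in\mathcal{A}$, with $p=\frac{2}{n-2}$ when $n>2$, and let $K\in\mathcal{A}$, with $K(x,0,0)=0$ for all $x\in\Omega$, satisfy the following conditions: $(a_1)$ one has $$\lim_{s^2+t^2\to+\infty}\frac{\sup_{x\in\Omega}(|F(x,s,t)|+|G(x,s,t)|)}{s^2+t^2}=0;$$ $(a_2)$ there is $\eta\in\left]0,\frac{\lambda_1}{2}\right[$ such that $$K(x,s,t)\leq\eta(s^2+t^2)$$ for all $x\in\Omega$, $s,t\in\mathbf{R}$; $(a_3)$ one has $$\mathrm{meas}(\{x\in\Omega:0<|F(x,0,0)|^2+|G(x,0,0)|^2\})>0$$ and $$|F(x,0,0)|^2+|G(x,0,0)|^2\leq|F(x,s,t)|^2+|G(x,s,t)|^2$$ for all $x\in\Omega$, $s,t\in\mathbf{R}$; $(a_4)$ one has $$\mathrm{meas}\left(\left\{x\in\Omega:\inf_{(s,t)\in\mathbf{R}^2}(F(x,0,0)F(x,s,t)+G(x,0,0)G(x,s,t))<|F(x,0,0)|^2+|G(x,0,0)|^2\right\}\right)>0.$$ Then, for every convex set $S\subseteq L^\infty(\Omega)\times L^\infty(\Omega)$ dense in $L^2(\Omega)\times L^2(\Omega)$, there exists $(\alpha,\beta)\in S$ such that the problem $$\begin{cases}-\Delta u=\alpha(x)F_u(x,u,v)+\beta(x)G_u(x,u,v)+K_u(x,u,v)&\text{in }\Omega\\ -\Delta v=\alpha(x)F_v(x,u,v)+\beta(x)G_v(x,u,v)+K_v(x,u,v)&\text{in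 }\Omega\\ u=v=0&\text{on }\partial\Omega\end{cases}$$ has at least three weak solutions, two of which are global minima in $H^1_0(\Omega)\times H^1_0(\Omega)$ of the functional $$(u,v)\mapsto\frac12\left(\int_\Omega|\nabla u(x)|^2dx+\int_\Omega|\nabla v(x)|^2dx\right)-\int_\Omega(\alpha(x)F(x,u(x),v(x))+\beta(x)G(x,u(x),v(x))+K(x,u(x),v(x)))\,dx.$$
   Context: $\mathcal{A}$ denotes the class of all functions $H:\Omega\times\mathbf{R}^2\to\mathbf{R}$, $(x,u,v)\mapsto H(x,u,v)$, which are measurable in $\Omega$ (i.e. $H(\cdot,u,v)$ is measurable for each $(u,v)$), $C^1$ in $\mathbf{R}^2$ (i.e. $H(x,\cdot,\cdot)$ is $C^1$ for each $x$) and satisfy $$\sup_{(x,u,v)\in\Omega\times\mathbf{R}^2}\frac{|H_u(x,u,v)|+|H_v(x,u,v)|}{1+|u|^p+|v|^p}<+\infty$$ for some $p>0$, with $p<\frac{n+2}{n-2}$ when $n>2$. Here $H_u$ (resp. $H_v$) is the derivative of $H$ with respect to $u$ (resp. $v$). Saying that $H\in\mathcal{A}$ ''with $p=\frac{2}{n-2}$ when $n>2$'' means that, when $n>2$, the growth condition $\sup_{(x,u,v)\in\Omega\times\mathbf{R}^2}\frac{|H_u(x,u,v)|+|H_v(x,u,v)|}{1+|u|^p+|v|^p}<+\infty$ holds with the exponent $p=\frac{2}{n-2}$ (when $n=2$, with some $p>0$). $\lambda_1$ is the first eigenvalue of the Dirichlet problem $-\Delta u=\lambda u$ in $\Omega$,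 $u=0$ on $\partial\Omega$. $\mathrm{meas}$ denotes Lebesgue measure. For $H:\Omega\times\mathbf{R}^2\to\mathbf{R}$, a weak solution of the problem $-\Delta u=H_u(x,u,v)$, $-\Delta v=H_v(x,u,v)$ in $\Omega$, $u=v=0$ on $\partial\Omega$, is any $(u,v)\in H^1_0(\Omega)\times H^1_0(\Omega)$ such that $$\int_\Omega\nabla u(x)\nabla\varphi(x)dx=\int_\Omega H_u(x,u(x),v(x))\varphi(x)dx,\qquad\int_\Omega\nabla v(x)\nabla\psi(x)dx=\int_\Omega H_v(x,u(x),v(x))\psi(x)dx$$ for all $\varphi,\psi\in H^1_0(\Omega)$. The problem in the claim is of this form with $H(x,u,v)=\alpha(x)F(x,u,v)+\beta(x)G(x,u,v)+K(x,u,v)$. *)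

(* Defs.v *)
From HB Require Import structures.
From mathcomp Require Import all_boot all_order all_algebra.
From mathcomp Require Import all_classical all_reals all_analysis.

Set Implicit Arguments.
Unset Strict Implicit.
Unset Printing Implicit Defensive.

Import Order.TTheory GRing.Theory Num.Theory.
Import numFieldNormedType.Exports.

Local Open Scope classical_set_scope.
Local Open Scope ring_scope.

Section lebesgue_outer_measure.
Context {R : realType} {n : nat}.
Local Open Scope ereal_scope.

Definition box (ab : 'rV[R]_n * 'rV[R]_n) : set 'rV[R]_n :=
  [set x | forall i, (ab.1 0 i < x 0 i <= ab.2 0 i)%R].

(* The positive part makes a box with [b_i <= a_i] count as degenerate. *)
Definition box_volume (ab : 'rV[R]_n * 'rV[R]_n) : R :=
  (\prod_(i < n) Num.max 0 (ab.2 0 i - ab.1 0 i))%R.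

(* The predicate [D] selects the indices that are used, so that finite (and
   empty) families of boxes are allowed; this matters only when n = 0, where no
   box is empty. *)
Definition box_cover (A : set 'rV[R]_n) :
    set (pred nat * (nat -> 'rV[R]_n * 'rV[R]_n)) :=
  [set DB : pred nat * _ |
    A `<=` \bigcup_(k in [set k | DB.1 k]) box (DB.2 k)].

Definition lebesgue_outer (A : set 'rV[R]_n) : \bar R :=
  ereal_inf [set \sum_(0 <= k <oo | DB.1 k) (box_volume (DB.2 k))%:E
            | DB in box_cover A].

Lemma box_volume_ge0 ab : (0 <= box_volume ab)%R.
Proof. by apply: prodr_ge0 => i _; rewrite le_max lexx. Qed.

Let vol_ge0 ab : 0 <= (box_volume ab)%:E.
Proof. by rewrite lee_fin box_volume_ge0. Qed.

Lemma lebesgue_outer_ge0 A : 0 <= lebesgue_outer A.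
Proof.
by apply: le_ereal_inf_tmp => _ [DB _ <-]; apply: nneseries_ge0 => *.
Qed.

Lemma le_lebesgue_outer :
  {homo lebesgue_outer : A B / A `<=` B >-> A <= B}.
Proof.
move=> A B AB; apply/ereal_inf_le_tmp => x [DB BDB <-].
by exists DB => //; exact: subset_trans AB BDB.
Qed.

Lemma lebesgue_outer0 : lebesgue_outer set0 = 0.
Proof.
apply/eqP; rewrite eq_le lebesgue_outer_ge0 andbT.
apply: ereal_inf_lbound; exists ((pred0 : pred nat), (fun=> (0%R, 0%R))) => //=.
by rewrite eseries_pred0.
Qed.

Lemma lebesgue_outer_sigma_subadditive : sigma_subadditive lebesgue_outer.
Proof.
move=> A; have [[i ioo]|] := pselect (exists i, lebesgue_outer (A i) = +oo).
  rewrite (eseries_pinfty _ _ ioo) ?leey// => k _.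
  by rewrite -ltNye (lt_le_trans _ (lebesgue_outer_ge0 _)).
rewrite -forallNE => Aoo.
suff add2e (e : {posnum R}) : lebesgue_outer (\bigcup_n A n) <=
    \sum_(i <oo) lebesgue_outer (A i) + e%:num%:E.
  by apply/lee_addgt0Pr => _/posnumP[].
rewrite (le_trans _ (epsilon_trick _ _ _))//; last first.
  by move=> k; exact: lebesgue_outer_ge0.
pose P k DB := box_cover (A k) DB /\
  \sum_(0 <= j <oo | DB.1 j) (box_volume (DB.2 j))%:E <=
  lebesgue_outer (A k) + (e%:num / (2 ^ k.+1)%:R)%:E.
have [G PG] : {G & forall k, P k (G k)}.
  apply: (@choice _ _ P) => k; rewrite /P /lebesgue_outer.
  set S := (X in ereal_inf X); move infS : (ereal_inf S) => iS.
  case: iS infS => [r Sr|Soo|Soo].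
  - have en1 : (0 < e%:num / (2 ^ k.+1)%:R)%R by [].
    have /(lb_ereal_inf_adherent en1) : ereal_inf S \is a fin_num by rewrite Sr.
    move=> [x [B AnB muBx] xS].
    by exists B; split => //; rewrite muBx -Sr; exact/ltW.
  - by have := Aoo k; rewrite /lebesgue_outer Soo.
  - suff : lbound S 0 by move/le_ereal_inf_tmp; rewrite Soo.
    by move=> /= _ [B AnB <-]; exact: nneseries_ge0.
pose D (ij : nat * nat) := (G ij.1).1 ij.2.
pose v (ij : nat * nat) := (box_volume ((G ij.1).2 ij.2))%:E.
have v0 ij : 0 <= v ij by exact: vol_ge0.
have /card_esym/ppcard_eqP[f] := card_nat2.
apply: (@le_trans _ _ (\esum_(ij in [set ij | D ij]) v ij)).
  apply: ereal_inf_lbound.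
  exists (D \o f, fun k => (G (f k).1).2 (f k).2).
    move=> t [i _ /(PG i).1[j /= Dij Bijt]].
    by exists (f^-1%FUN (i, j)) => /=; rewrite /= /D invK ?inE.
  rewrite nneseries_esum//; symmetry; apply: (reindex_esum _ _ f) => //.
  split.
  - by move=> k.
  - by move=> k l _ _; apply: inj; rewrite ?inE.
  - by move=> ij Dij; exists (f^-1%FUN ij) => /=; rewrite ?invK ?inE.
have -> : [set ij | D ij] = [set: nat] `*`` (fun i => [set j | (G i).1 j]).
  by apply/seteqP; split => ij /=; [move=> ?; split|case].
rewrite -(esum_esum (a := fun i j => v (i, j)))//.
rewrite -nneseries_esumT; last by move=> i; exact: esum_ge0.
apply: lee_nneseries => [i _ _|i _].
  by apply: esum_ge0 => *; exact: v0.
by apply: le_trans (PG i).2; rewrite nneseries_esum.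
Qed.

HB.instance Definition _ := isOuterMeasure.Build R 'rV[R]_n lebesgue_outer
  lebesgue_outer0 lebesgue_outer_ge0 le_lebesgue_outer
  lebesgue_outer_sigma_subadditive.

(* [measurable] on R^n means Lebesgue (i.e. Caratheodory) measurable. *)
HB.instance Definition _ :=
  Measurable.copy 'rV[R]_n (caratheodory_type lebesgue_outer).

Definition lebesgue_rV : set 'rV[R]_n -> \bar R := lebesgue_outer.

Let lebesgue_rV_sigma_additive : semi_sigma_additive lebesgue_rV.
Proof. exact: (@caratheodory_measure_sigma_additive R 'rV[R]_n). Qed.

HB.instance Definition _ := isMeasure.Build _ 'rV[R]_n R lebesgue_rV
  lebesgue_outer0 lebesgue_outer_ge0 lebesgue_rV_sigma_additive.

End lebesgue_outer_measure.
Arguments lebesgue_rV : clear implicits.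

Section smooth.
Context {R : realType} {n : nat}.

Definition partial (i : 'I_n) (f : 'rV[R]_n -> R) : 'rV[R]_n -> R :=
  fun x => 'D_(delta_mx 0 i) f x.

(* C^oo: every iterated partial derivative is differentiable everywhere. *)
Definition smooth (f : 'rV[R]_n -> R) : Prop :=
  forall (s : seq 'I_n) (x : 'rV[R]_n), differentiable (foldr partial f s) x.

Definition domain (Omega : set 'rV[R]_n) : Prop :=
  [/\ open Omega, connected Omega & Omega !=set0].

End smooth.

(* Up to choosing the coordinate [i] and the orientation [b] of its axis, Omega
   is locally the epigraph of a C^oo function of the other coordinates.  The
   balls are those of the sup norm, that is, cubes. *)
Definition smooth_boundary {R : realType} {n : nat} (Omega : set 'rV[R]_n) :
    Prop :=
  forall x0, (closure Omega `\` interior Omega) x0 ->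
  exists (r : R) (i : 'I_n) (b : bool) (gamma : 'rV[R]_n.-1 -> R),
    [/\ 0 < r, smooth gamma &
     forall x, ball x0 r x ->
       (Omega x <-> gamma (col' i x) < (-1) ^+ b * x 0 i)].

(* Functions on Omega are represented by functions on R^n whose values off Omega
   are irrelevant, and elements of the Lebesgue and Sobolev spaces by functions
   rather than by classes modulo almost everywhere equality in Omega; hence
   "nonzero" and "distinct" are to be read up to that equality. *)

Section sobolev.
Context {R : realType} {n : nat} (Omega : set 'rV[R]_n).
Local Notation leb := (lebesgue_rV R n).
Implicit Types (u v phi g : 'rV[R]_n -> R) (i : 'I_n).

Definition L2norm_sqr u : \bar R := (\int[leb]_(x in Omega) (u x ^+ 2)%R%:E)%E.

Definition L2 u : Prop := measurable_fun Omega u /\ (L2norm_sqr u < +oo)%E.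

Definition Linfty u : Prop :=
  measurable_fun Omega u /\
  exists M : R, {ae leb, forall x, Omega x -> `|u x| <= M}.

Definition test_function phi : Prop :=
  smooth phi /\
  exists K : set 'rV[R]_n,
    [/\ compact K, K `<=` Omega & forall x, ~ K x -> phi x = 0].

Definition weak_partial i u g : Prop :=
  forall phi, test_function phi ->
    \int[leb]_(x in Omega) (u x * partial i phi x) =
    - \int[leb]_(x in Omega) (g x * phi x).

(* A representative of the weak i-th partial derivative in L^2, which is unique
   up to almost everywhere equality in Omega. *)
Definition wpartial i u : 'rV[R]_n -> R :=
  xget (fun=> 0) [set g | L2 g /\ weak_partial i u g].

Definition H1 u : Prop :=
  L2 u /\ forall i, exists g, L2 g /\ weak_partial i u g.

Definition H1norm_sqr u : \bar R :=
  (L2norm_sqr u + \sum_(i < n) L2norm_sqr (wpartial i u))%E.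

Definition H10 u : Prop :=
  H1 u /\
  forall e : R, 0 < e ->
    exists phi, test_function phi /\ (H1norm_sqr (u \- phi)%R < e%:E)%E.

Definition grad_dot u v : 'rV[R]_n -> R :=
  fun x => \sum_(i < n) wpartial i u x * wpartial i v x.

Definition dirichlet_eigenvalue (l : R) : Prop :=
  exists u, [/\ H10 u, ~ ae_eq leb Omega u (cst 0) &
    forall phi, H10 phi ->
      \int[leb]_(x in Omega) grad_dot u phi x =
      l * \int[leb]_(x in Omega) (u x * phi x)].

(* The first eigenvalue is the least one. *)
Definition lambda1 : R := inf [set l | dirichlet_eigenvalue l].

End sobolev.

Section system.
Context {R : realType} {n : nat} (Omega : set 'rV[R]_n).
Local Notation leb := (lebesgue_rV R n).
Implicit Types (H : 'rV[R]_n -> R -> R -> R) (u v : 'rV[R]_n -> R).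

Definition D_u H : 'rV[R]_n -> R -> R -> R := fun x s t => derive1 (H x ^~ t) s.
Definition D_v H : 'rV[R]_n -> R -> R -> R := fun x s t => derive1 (H x s) t.

Definition C1 (h : R -> R -> R) : Prop :=
  [/\ forall s t, derivable (h ^~ t) s 1 /\ derivable (h s) t 1,
      continuous (fun z : R * R => derive1 (h ^~ z.2) z.1) &
      continuous (fun z : R * R => derive1 (h z.1) z.2)].

Definition growth H (p : R) : Prop :=
  (ereal_sup [set ((`|D_u H z.1 z.2.1 z.2.2| + `|D_v H z.1 z.2.1 z.2.2|) /
                   (1 + `|z.2.1| `^ p + `|z.2.2| `^ p))%R%:E
             | z in Omega `*` [set: R * R]] < +oo)%E.

Definition classA H : Prop :=
  [/\ forall s t, measurable_fun Omega (fun x => H x s t),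
      forall x, Omega x -> C1 (H x) &
      exists p : R,
        [/\ 0 < p, ((2 < n)%N -> p < (n%:R + 2) / (n%:R - 2)) & growth H p]].

Definition classA_crit H : Prop :=
  classA H /\ ((2 < n)%N -> growth H (2 / (n%:R - 2))).

Definition weak_solution H (w : ('rV[R]_n -> R) * ('rV[R]_n -> R)) : Prop :=
  let: (u, v) := w in
  [/\ H10 Omega u, H10 Omega v,
      forall phi, H10 Omega phi ->
        \int[leb]_(x in Omega) grad_dot Omega u phi x =
        \int[leb]_(x in Omega) (D_u H x (u x) (v x) * phi x) &
      forall psi, H10 Omega psi ->
        \int[leb]_(x in Omega) grad_dot Omega v psi x =
        \int[leb]_(x in Omega) (D_v H x (u x) (v x) * psi x)].

Definition energy H (w : ('rV[R]_n -> R) * ('rV[R]_n -> R)) : R :=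
  let: (u, v) := w in
  2^-1 * (\int[leb]_(x in Omega) grad_dot Omega u u x +
          \int[leb]_(x in Omega) grad_dot Omega v v x) -
  \int[leb]_(x in Omega) H x (u x) (v x).

Definition global_minimum H (w : ('rV[R]_n -> R) * ('rV[R]_n -> R)) : Prop :=
  [/\ H10 Omega w.1, H10 Omega w.2 &
      forall w', H10 Omega w'.1 -> H10 Omega w'.2 -> energy H w <= energy H w'].

Definition ae_equal (w w' : ('rV[R]_n -> R) * ('rV[R]_n -> R)) : Prop :=
  ae_eq leb Omega w.1 w'.1 /\ ae_eq leb Omega w.2 w'.2.

Definition dense_in_L2xL2 (S : set (('rV[R]_n -> R) * ('rV[R]_n -> R))) : Prop :=
  forall f g, L2 Omega f -> L2 Omega g ->
  forall e : R, 0 < e -> exists ab, S ab /\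
    (L2norm_sqr Omega (f \- ab.1)%R + L2norm_sqr Omega (g \- ab.2)%R < e%:E)%E.

End system.

Definition sqr_norm_pinfty (R : realType) : set_system (R * R) :=
  filter_from [set: R] (fun M => [set z | M < z.1 ^+ 2 + z.2 ^+ 2]).
Arguments sqr_norm_pinfty R : clear implicits.

(* Main.v *)
(* For fixed (alpha, beta) in S the functional is J(w) = |w|^2 / 2 - Psi(w) on
   E = H^1_0 x H^1_0, with Psi weakly continuous and gradient T compact, and J is
   coercive by (a_1), (a_2).  If J has two distinct global minima, a mountain
   pass argument (run on finite chains instead of paths, deformed by
   x -> x - t (x - T x)) gives a third critical point.  So assume that for every
   (alpha, beta) in S the global minimum is unique.

   Write phi(w) = (F(., w), G(., w)) in L^2 x L^2, I(w) = |w|^2 / 2 - int K(., w),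
   and for mu > 0 let g(w, y) = I(w) - <phi(w), y> - mu |y|^2 / 2.  On a polytope
   of S uniqueness of the minimum and Danskin's argument give a saddle point of
   g; with y close to - zeta(w) / mu, where zeta = phi |phi(0)| / |phi| is
   bounded by (a_3), growing polytopes yield
   sup_S inf_w g >= |phi(0)|^2 / (2 mu).  As g(0, y) is strongly concave in y
   this forces near-maximizers to - phi(0) / mu, so that
   mu I(w) >= <phi(0) - phi(w), phi(0)> for all w; mu -> 0 gives
   <phi(w), phi(0)> >= |phi(0)|^2 for all w in E.  Testing with w = q theta_k,
   where theta_k are test functions tending to the indicator of
   {F(., 0) F(., q) + G(., 0) G(., q) < F(., 0)^2 + G(., 0)^2}, contradicts (a_4).

   H^1_0 being the closure of the test functions, the inequalities of Poincare,
   Rellich and Sobolev are only needed for C^1 functions with compact support,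
   where they follow from averages over dyadic cubes. *)
Require Import Defs.
From mathcomp Require Import all_boot all_order all_algebra.
From mathcomp Require Import all_classical all_reals all_analysis.
From mathcomp Require Import measurable_realfun.
From mathcomp Require Import lra.

Set Implicit Arguments.
Unset Strict Implicit.
Unset Printing Implicit Defensive.

Import Order.TTheory GRing.Theory Num.Theory.
Import numFieldNormedType.Exports.

Local Open Scope classical_set_scope.
Local Open Scope ring_scope.

(** * Semi-inner-product spaces *)

(** A borderline exponent shapes the proof. For n > 2, twice 2/(n-2) + 1 is the critical Sobolev
    exponent r = 2n/(n-2), so the growth of F and G only just puts phi(w) in L^2: the embedding into
    L^r has to be proved at the critical exponent, and phi is in general not compact into L^2. This
    is why zeta replaces phi in the minimax argument: it is bounded, hence converges strongly in L^2
    as soon as w converges almost everywhere, and still |zeta| = |phi(0)| and <phi, zeta> >=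
    |phi(0)|^2. The gradients T, on the other hand, are compact because p + 1 < r strictly.

    Functions equal almost everywhere are not identified, so the Hilbert space theory is developed
    for positive semidefinite forms on a subspace, where points count up to distance 0. Weak
    compactness of H^1_0 is derived from Rellich compactness in L^2.

    With chains of small step, the mountain pass needs a single descent step applied to each point
    of one chain; neither a flow nor continuity of a deformation in time enters. *)

Definition subsequence (s : nat -> nat) := {homo s : i j / (i < j)%N}.

Lemma subsequence_ge s : subsequence s -> forall k, (k <= s k)%N.
Proof.
move=> hs; elim=> // k IH; exact: leq_ltn_trans IH (hs _ _ (ltnSn k)).
Qed.

Lemma subsequence_comp s t :
  subsequence s -> subsequence t -> subsequence (s \o t).
Proof. by move=> hs ht i j ij; apply/hs/ht. Qed.

Lemma cvg_subsequence (T : topologicalType) (u : nat -> T) (l : T) s :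
  subsequence s -> u @ \oo --> l -> u (s k) @[k --> \oo] --> l.
Proof.
move=> hs ul; suff h : s @ \oo --> \oo by apply: (@cvg_comp _ _ _ s u) h ul.
move=> A [N _ NA]; exists N => // k /= Nk.
by apply: NA => /=; exact: leq_trans Nk (subsequence_ge hs k).
Qed.

Lemma exists_subsequence (P : nat -> nat -> Prop) :
  (forall k N, exists i, (N <= i)%N /\ P k i) ->
  exists s, subsequence s /\ forall k, P k (s k).
Proof.
move=> H.
have [f Hf] : {f : nat * nat -> nat & forall kN, (kN.2 <= f kN)%N /\ P kN.1 (f kN)}.
  by apply: (@choice _ _ (fun kN i => (kN.2 <= i)%N /\ P kN.1 i)) => -[k N]; exact: H.
pose s := fix s k := if k is k'.+1 then f (k, (s k').+1) else f (0, 0)%N.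
exists s; split; last by case=> [|k] /=; [have [] := Hf (0,0)%N|have [] := Hf (k.+1, (s k).+1)].
have sS k : (s k < s k.+1)%N by have [] := Hf (k.+1, (s k).+1) => /=.
by move=> i j; elim: j => // j IH; rewrite ltnS leq_eqVlt => /orP[/eqP->//|/IH h];
  exact: ltn_trans h (sS j).
Qed.

Lemma not_eventually (P : nat -> Prop) :
  ~ (\forall k \near \oo, P k) -> forall N, exists i, (N <= i)%N /\ ~ P i.
Proof.
move=> H N; apply: contrapT => H'; apply: H; exists N => // i /= Ni.
by apply: contrapT => Pi; apply: H'; exists i.
Qed.

Section semi_inner_product.
Context {R : realType} {V : lmodType R}.
Implicit Types (E : set V) (B : V -> V -> R).

(** The form is only semidefinite, since functions that agree almost everywhere are distinct points
    at distance 0, and it is only constrained on [E], since the integrals that define the forms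
    below obey no algebraic rules for arbitrary functions. *)
Record semi_ip E B : Prop := SemiIp {
  ip0 : E 0;
  ipP : forall a x y, E x -> E y -> E (a *: x + y);
  ipC : forall x y, E x -> E y -> B x y = B y x;
  ipl : forall a x y z, E x -> E y -> E z -> B (a *: x + y) z = a * B x z + B y z;
  ip_ge0 : forall x, E x -> 0 <= B x x }.

Definition nrm B x : R := Num.sqrt (B x x).

Definition ip_complete E B := forall x_ : nat -> V, (forall k, E (x_ k)) ->
  (forall e : R, 0 < e -> exists N, forall i j, (N <= i)%N -> (N <= j)%N ->
     nrm B (x_ i - x_ j) < e) ->
  exists2 x, E x & nrm B (x_ k - x) @[k --> \oo] --> 0.

Definition weak_cvg E B (x_ : nat -> V) x :=
  E x /\ forall w, E w -> B (x_ k) w @[k --> \oo] --> B x w.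

Definition nbounded B (x_ : nat -> V) := exists M, forall k, nrm B (x_ k) <= M.

Definition weak_compact E B := forall x_, (forall k, E (x_ k)) -> nbounded B x_ ->
  exists s x, subsequence s /\ weak_cvg E B (x_ \o s) x.

Section theory.
Variables (E : set V) (B : V -> V -> R) (hB : semi_ip E B).
Local Notation "\N( x )" := (nrm B x) (at level 0, x at level 99).

Lemma ipZ a x : E x -> E (a *: x).
Proof. by move=> Ex; rewrite -[_ *: _]addr0; apply: (ipP hB) => //; exact: (ip0 hB). Qed.

Lemma ipA x y : E x -> E y -> E (x + y).
Proof. by move=> Ex Ey; rewrite -[x]scale1r; exact: (ipP hB). Qed.

Lemma ipN x : E x -> E (- x).
Proof. by rewrite -scaleN1r; exact: ipZ. Qed.

Lemma ipB x y : E x -> E y -> E (x - y).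
Proof. by move=> Ex Ey; apply: ipA => //; exact: ipN. Qed.

Lemma ip0l x : E x -> B 0 x = 0.
Proof.
move=> Ex; have := ipl hB 1 (ip0 hB) (ip0 hB) Ex.
by rewrite scaler0 addr0 mul1r => /eqP; rewrite -subr_eq0 opprD addrA subrr sub0r oppr_eq0 => /eqP.
Qed.

Lemma ipZl a x y : E x -> E y -> B (a *: x) y = a * B x y.
Proof. by move=> Ex Ey; have := ipl hB a Ex (ip0 hB) Ey; rewrite !addr0 ip0l// addr0. Qed.

Lemma ipDl x y z : E x -> E y -> E z -> B (x + y) z = B x z + B y z.
Proof. by move=> Ex Ey Ez; rewrite -{1}[x]scale1r (ipl hB)// mul1r. Qed.

Lemma ipNl x y : E x -> E y -> B (- x) y = - B x y.
Proof. by move=> Ex Ey; rewrite -scaleN1r ipZl// mulN1r. Qed.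

Lemma ipBl x y z : E x -> E y -> E z -> B (x - y) z = B x z - B y z.
Proof. by move=> Ex Ey Ez; rewrite ipDl// ?ipNl//; exact: ipN. Qed.

Lemma ipZr a x y : E x -> E y -> B y (a *: x) = a * B y x.
Proof. by move=> Ex Ey; rewrite (ipC hB)// ?ipZl// 1?(ipC hB)//; exact: ipZ. Qed.

Lemma ipDr x y z : E x -> E y -> E z -> B z (x + y) = B z x + B z y.
Proof.
by move=> Ex Ey Ez; rewrite (ipC hB)//; [rewrite ipDl// (ipC hB Ex)// (ipC hB Ey)|exact: ipA].
Qed.

Lemma ipNr x y : E x -> E y -> B y (- x) = - B y x.
Proof. by move=> Ex Ey; rewrite -scaleN1r ipZr// mulN1r. Qed.

Lemma ipBr x y z : E x -> E y -> E z -> B z (x - y) = B z x - B z y.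
Proof. by move=> Ex Ey Ez; rewrite ipDr// ?ipNr//; exact: ipN. Qed.

Lemma nrm_ge0 x : 0 <= \N(x). Proof. exact: sqrtr_ge0. Qed.

Lemma nrm_sqr x : E x -> \N(x) ^+ 2 = B x x.
Proof. by move=> Ex; rewrite sqr_sqrtr// (ip_ge0 hB). Qed.

Lemma ip_sqrD x y : E x -> E y -> B (x + y) (x + y) = B x x + 2 * B x y + B y y.
Proof.
move=> Ex Ey; rewrite ipDl// ?ipDr//; try exact: ipA.
by rewrite (ipC hB Ey Ex); lra.
Qed.

Lemma ip_sqrB x y : E x -> E y -> B (x - y) (x - y) = B x x - 2 * B x y + B y y.
Proof.
move=> Ex Ey; rewrite ip_sqrD//; last exact: ipN.
rewrite ipNr// ipNl ?ipNr//; [lra|exact: ipN].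
Qed.

Lemma ip_sqrZ a x : E x -> B (a *: x) (a *: x) = a ^+ 2 * B x x.
Proof. by move=> Ex; rewrite ipZl// ?ipZr//; [lra|exact: ipZ]. Qed.

Lemma cauchy_schwarz x y : E x -> E y -> `|B x y| <= \N(x) * \N(y).
Proof.
move=> Ex Ey.
have Q s t : 0 <= s ^+ 2 * B x x + 2 * s * t * B x y + t ^+ 2 * B y y.
  have Esx := ipZ s Ex; have Ety := ipZ t Ey.
  have := ip_ge0 hB (ipA Esx Ety).
  by rewrite ip_sqrD// !ip_sqrZ// ipZr// ipZl//; lra.
have xx := ip_ge0 hB Ex; have yy := ip_ge0 hB Ey.
rewrite -(@ler_pXn2r _ 2)// ?nnegrE//; last by rewrite mulr_ge0// nrm_ge0.
rewrite exprMn !nrm_sqr// real_normK ?num_real//.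
have [y0|y0] := eqVneq (B y y) 0.
  (* With a = [B x x] and b = [B x y] this reads - b^2 (a + 2) >= 0, so b = 0. *)
  have := Q (B x y) (- (B x x + 1)); rewrite y0 !mulr0.
  by have := mulr_ge0 (sqr_ge0 (B x y)) xx; have := sqr_ge0 (B x y); lra.
have := Q (B y y) (- B x y).
have yp : 0 < B y y by rewrite lt_neqAle eq_sym y0.
have -> : B y y ^+ 2 * B x x + 2 * B y y * - B x y * B x y + (- B x y) ^+ 2 * B y y
  = (B x x * B y y - B x y ^+ 2) * B y y by lra.
by rewrite pmulr_lge0// subr_ge0.
Qed.

Lemma ip_le x y : E x -> E y -> B x y <= \N(x) * \N(y).
Proof. by move=> Ex Ey; exact: le_trans (ler_norm _) (cauchy_schwarz Ex Ey). Qed.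

Lemma nrmD x y : E x -> E y -> \N(x + y) <= \N(x) + \N(y).
Proof.
move=> Ex Ey; rewrite -(@ler_pXn2r _ 2)// ?nnegrE ?addr_ge0 ?nrm_ge0//.
rewrite nrm_sqr; last exact: ipA.
rewrite ip_sqrD// sqrrD !nrm_sqr// lerD2r lerD2l mulr_natl.
by rewrite lerMn2r/= ip_le.
Qed.

Lemma nrmZ a x : E x -> \N(a *: x) = `|a| * \N(x).
Proof. by move=> Ex; rewrite /nrm ip_sqrZ// sqrtrM ?sqr_ge0// sqrtr_sqr. Qed.

Lemma nrmN x : E x -> \N(- x) = \N(x).
Proof. by move=> Ex; rewrite -scaleN1r nrmZ// normrN1 mul1r. Qed.

Lemma nrmBC x y : E x -> E y -> \N(x - y) = \N(y - x).
Proof. by move=> Ex Ey; rewrite -nrmN ?opprB//; exact: ipB. Qed.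

Lemma nrm0 : \N(0) = 0. Proof. by rewrite /nrm ip0l ?sqrtr0//; exact: (ip0 hB). Qed.

Lemma nrmB_trans y x z : E x -> E y -> E z -> \N(x - z) <= \N(x - y) + \N(y - z).
Proof.
move=> Ex Ey Ez; have -> : x - z = (x - y) + (y - z) by rewrite addrA subrK.
by apply: nrmD; exact: ipB.
Qed.

Lemma nrm_leDB x y : E x -> E y -> \N(x) <= \N(y) + \N(x - y).
Proof.
by move=> Ex Ey; rewrite -{1}(subrKC y x); apply: nrmD => //; exact: ipB.
Qed.

Lemma nrm_dist x y : E x -> E y -> `|\N(x) - \N(y)| <= \N(x - y).
Proof.
move=> Ex Ey; rewrite ler_norml; apply/andP; split.
  by have := nrm_leDB Ey Ex; rewrite (nrmBC Ey Ex); lra.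
by have := nrm_leDB Ex Ey; lra.
Qed.

Lemma nrm0_ip x y : E x -> E y -> \N(x) = 0 -> B x y = 0.
Proof.
move=> Ex Ey x0; apply/eqP; rewrite -normr_le0.
by apply: le_trans (cauchy_schwarz Ex Ey) _; rewrite x0 mul0r.
Qed.

Lemma nrmB0_ip x y w : E x -> E y -> E w -> \N(x - y) = 0 -> B x w = B y w.
Proof.
move=> Ex Ey Ew h; have := nrm0_ip (ipB Ex Ey) Ew h.
by rewrite ipBl// => /eqP; rewrite subr_eq0 => /eqP.
Qed.

Lemma parallelogram x y : E x -> E y ->
  \N(x - y) ^+ 2 = 2 * \N(x) ^+ 2 + 2 * \N(y) ^+ 2 - 4 * \N(2^-1 *: (x + y)) ^+ 2.
Proof.
move=> Ex Ey; have Exy := ipA Ex Ey.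
rewrite (nrm_sqr (ipB Ex Ey)) (nrm_sqr (ipZ _ Exy)) !nrm_sqr//.
by rewrite ip_sqrZ// ip_sqrB// ip_sqrD//; lra.
Qed.

Lemma cvg_ip x_ x w : (forall k, E (x_ k)) -> E x -> E w ->
  \N(x_ k - x) @[k --> \oo] --> 0 -> B (x_ k) w @[k --> \oo] --> B x w.
Proof.
move=> Ex_ Ex Ew h.
apply/cvgrPdist_le => e e0.
have : (\N(w) * \N(x_ k - x)) @[k --> \oo] --> \N(w) * 0 by apply: cvgMr.
rewrite mulr0 => /cvgrPdist_le/(_ e e0); apply: filterS => k.
rewrite sub0r normrN ger0_norm ?mulr_ge0 ?nrm_ge0// => hk.
rewrite -ipBl//; apply: le_trans (cauchy_schwarz (ipB Ex (Ex_ k)) Ew) _.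
by rewrite mulrC nrmBC.
Qed.

Lemma cvg_nrm x_ x : (forall k, E (x_ k)) -> E x ->
  \N(x_ k - x) @[k --> \oo] --> 0 -> \N(x_ k) @[k --> \oo] --> \N(x).
Proof.
move=> Ex_ Ex h; apply/cvgrPdist_le => e e0.
have /cvgrPdist_le/(_ e e0) := h; apply: filterS => k.
rewrite sub0r normrN ger0_norm ?nrm_ge0// => hk.
by apply: le_trans (nrm_dist Ex (Ex_ k)) _; rewrite nrmBC.
Qed.

Lemma strong_weak_cvg x_ x : (forall k, E (x_ k)) -> E x ->
  \N(x_ k - x) @[k --> \oo] --> 0 -> weak_cvg E B x_ x.
Proof. by move=> Ex_ Ex h; split=> // w Ew; exact: cvg_ip. Qed.

Lemma weak_cvg_unique x_ x y : weak_cvg E B x_ x -> weak_cvg E B x_ y -> \N(x - y) = 0.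
Proof.
move=> [Ex hx] [Ey hy]; have Exy := ipB Ex Ey.
apply/eqP; rewrite -sqrf_eq0 nrm_sqr// ipBl// subr_eq0; apply/eqP.
exact: cvg_unique (hx _ Exy) (hy _ Exy).
Qed.

Lemma weak_cvg_subseq x_ x s : subsequence s -> weak_cvg E B x_ x ->
  weak_cvg E B (x_ \o s) x.
Proof. by move=> hs [Ex h]; split=> // w Ew; apply: (cvg_subsequence hs (h w Ew)). Qed.

Lemma weak_cvg_shift x_ y_ x : (forall k, E (x_ k)) -> (forall k, E (y_ k)) ->
  weak_cvg E B x_ x -> \N(x_ k - y_ k) @[k --> \oo] --> 0 -> weak_cvg E B y_ x.
Proof.
move=> Ex Ey [hx h] d; split=> // w Ew.
have -> : (fun k => B (y_ k) w) = (fun k => B (x_ k) w - B (x_ k - y_ k) w).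
  by apply/funext => k; rewrite ipBl//; lra.
rewrite -[X in _ --> X]subr0; apply: cvgB; first exact: h.
have E0 := ip0 hB; rewrite -(ip0l Ew); apply: (cvg_ip (x_ := fun k => x_ k - y_ k)) => //.
  by move=> k; exact: ipB.
by under eq_fun do rewrite subr0.
Qed.

(** The Radon-Riesz property: in |x_k - x|^2 = |x_k|^2 - 2 B(x_k, x) + |x|^2 the middle term
    converges to - 2 |x|^2. *)
Lemma weak_strong_cvg x_ x : (forall k, E (x_ k)) -> weak_cvg E B x_ x ->
  (forall e : R, 0 < e -> \forall k \near \oo, \N(x_ k) ^+ 2 <= \N(x) ^+ 2 + e) ->
  \N(x_ k - x) @[k --> \oo] --> 0.
Proof.
move=> Ex_ [Ex h] hn; apply/cvgr0Pnorm_le => e e0.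
have e2 : 0 < e ^+ 2 by rewrite exprn_gt0.
have /cvgrPdist_le/(_ (e ^+ 2 / 4)) := h x Ex.
have e4 : 0 < e ^+ 2 / 4 by rewrite divr_gt0.
have e22 : 0 < e ^+ 2 / 2 by rewrite divr_gt0.
move=> /(_ e4) h1; near=> k.
have hk1 : `|B x x - B (x_ k) x| <= e ^+ 2 / 4 by near: k.
have hk2 : \N(x_ k) ^+ 2 <= \N(x) ^+ 2 + e ^+ 2 / 2 by near: k; exact: hn.
rewrite ger0_norm ?nrm_ge0// -(@ler_pXn2r _ 2)// ?nnegrE ?nrm_ge0 ?(ltW e0)//.
rewrite nrm_sqr; last exact: ipB.
rewrite ip_sqrB//; move: hk1 hk2; rewrite !nrm_sqr// ler_norml => /andP[h2 h3] h4.
lra.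
Unshelve. all: by end_near. Qed.

(* A minimizing sequence of [|x|^2 / 2 - l x] is Cauchy by the parallelogram
   identity. *)
Lemma riesz (l : V -> R) C : ip_complete E B ->
  (forall a x y, E x -> E y -> l (a *: x + y) = a * l x + l y) ->
  (forall x, E x -> `|l x| <= C * \N(x)) ->
  exists2 y, E y & forall x, E x -> l x = B y x.
Proof.
move=> cE lin bd; have E0 := ip0 hB.
have l0 : l 0 = 0.
  have := lin 1 0 0 E0 E0; rewrite scaler0 addr0 mul1r => h; lra.
have lZ a x : E x -> l (a *: x) = a * l x.
  by move=> Ex; have := lin a x 0 Ex E0; rewrite !addr0 l0 addr0.
have lD x y : E x -> E y -> l (x + y) = l x + l y.
  by move=> Ex Ey; have := lin 1 x y Ex Ey; rewrite scale1r mul1r.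
pose q x := \N(x) ^+ 2 / 2 - l x.
pose A := [set q x | x in E].
have lbA x : E x -> - (C ^+ 2 / 2) <= q x.
  move=> Ex; rewrite /q; have := bd x Ex; rewrite ler_norml => /andP[_ h].
  have := sqr_ge0 (\N(x) - C); rewrite sqrrB; set X := \N(x) in h *.
  by move=> h2; lra.
have infA : has_inf A.
  split; first by exists (q 0), 0.
  by exists (- (C ^+ 2 / 2)) => _ [x Ex <-]; exact: lbA.
pose m := inf A.
have mle x : E x -> m <= q x.
  by move=> Ex; apply: ge_inf; [case: infA|exists x].
have [x_ Hx] : {x_ : nat -> V & forall k, E (x_ k) /\ q (x_ k) < m + k.+1%:R^-1}.
  apply: (@choice _ _ (fun k x => E x /\ q x < m + k.+1%:R^-1)) => k.
  have k0 : 0 < k.+1%:R^-1 :> R by rewrite invr_gt0.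
  by have [_ [x Ex <-] h] := inf_adherent k0 infA; exists x.
have Ex_ k := (Hx k).1.
have par x y : E x -> E y -> \N(x - y) ^+ 2 <= 4 * (q x - m) + 4 * (q y - m).
  move=> Ex Ey; rewrite parallelogram//.
  have Exy := ipA Ex Ey; have := mle _ (ipZ 2^-1 Exy).
  by rewrite {1}/q lZ// lD// /q => h; lra.
have [y Ey yx] : exists2 y, E y & \N(x_ k - y) @[k --> \oo] --> 0.
  apply: cE => // e e0.
  have e8 : 0 < e ^+ 2 / 8 by rewrite divr_gt0// exprn_gt0.
  have [N _ HN] : \forall k \near \oo, k.+1%:R^-1 < e ^+ 2 / 8.
    exact: (near_infty_natSinv_lt (PosNum e8)).
  exists N => i j Ni Nj.
  rewrite -(@ltr_pXn2r _ 2)// ?nnegrE ?nrm_ge0 ?(ltW e0)//.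
  apply: le_lt_trans (par _ _ (Ex_ i) (Ex_ j)) _.
  have := HN i Ni; have := HN j Nj; have := (Hx i).2; have := (Hx j).2 => /=.
  by move: (q _) (q _) (_^-1) (_^-1) => u v a b; lra.
exists y => //.
have qy : q y <= m.
  have qc : q (x_ k) @[k --> \oo] --> q y.
    apply: cvgB.
      apply: cvgMl; rewrite expr2; under eq_fun do rewrite expr2.
      by apply: cvgM; exact: cvg_nrm.
    apply/cvgrPdist_le => e e0.
    have : (C * \N(x_ k - y)) @[k --> \oo] --> C * 0 by apply: cvgMr.
    rewrite mulr0 => /cvgrPdist_le/(_ e e0); apply: filterS => k hk.
    have -> : l y - l (x_ k) = l (y - x_ k).
      by rewrite -scaleN1r lD ?lZ ?mulN1r//; exact: ipZ.
    apply: le_trans (bd _ (ipB Ey (Ex_ k))) _; rewrite nrmBC//.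
    by move: hk; rewrite sub0r normrN; exact: le_trans (ler_norm _).
  apply: (ler_cvg_to qc (g := fun k => m + harmonic k) (l' := m)).
    by rewrite -[X in _ --> X]addr0; apply: cvgD; [exact: cvg_cst|exact: cvg_harmonic].
  by near=> k; exact: ltW (Hx k).2.
move=> x Ex.
(* Variation of [q] at its minimizer y in the direction x. *)
have F t : 0 <= t * (B y x - l x) + t ^+ 2 * (B x x / 2).
  have Etx := ipZ t Ex.
  have := le_trans qy (mle _ (ipA Ey Etx)).
  rewrite /q (lD _ _ Ey Etx) lZ// !nrm_sqr//; last exact: ipA.
  by rewrite ip_sqrD// ipZr// ip_sqrZ//; lra.
apply/eqP; rewrite -subr_eq0 -sqrf_eq0 eq_le sqr_ge0 andbT.
have xx := ip_ge0 hB Ex.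
(* The optimal t has denominator [B x x], which may vanish; adding 1 avoids the case and still
   leaves a negative right-hand side unless [l x = B y x]. *)
have := F ((l x - B y x) / (B x x + 1)).
set c := (B x x + 1)^-1; have c0 : 0 < c by rewrite invr_gt0; lra.
have cE1 : c * (B x x + 1) = 1 by rewrite mulVf//; apply: lt0r_neq0; lra.
set b := l x - B y x.
have -> : b * c * (B y x - l x) + (b * c) ^+ 2 * (B x x / 2)
   = - (b ^+ 2 * c) * (1 - c * (B x x + 1) / 2 + c / 2) by rewrite /b; lra.
rewrite cE1 => h.
have : b ^+ 2 * (c * (1 - 1 / 2 + c / 2)) <= 0 by lra.
by rewrite pmulr_lle0// mulr_gt0//; lra.
Unshelve. all: by end_near. Qed.

End theory.

(* The convex hulls of the tails of [x_] have minimal [B]-norms that increase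
   to a limit; near-minimizers are [B]-Cauchy by the parallelogram identity and
   stay [C]-close to the sequence. *)
Lemma tail_limit E B C (x_ : nat -> V) M : semi_ip E B -> semi_ip E C ->
  ip_complete E B -> (forall k, E (x_ k)) -> (forall k, nrm B (x_ k) <= M) ->
  (exists P, forall x, E x -> nrm C x <= P * nrm B x) ->
  (forall e : R, 0 < e -> exists N, forall i j, (N <= i)%N -> (N <= j)%N ->
     nrm C (x_ i - x_ j) < e) ->
  exists x, [/\ E x, nrm B x <= M & nrm C (x_ k - x) @[k --> \oo] --> 0].
Proof.
move=> hB hC cE Ex_ xM [P HP] cau.
pose cvx (A : set V) := forall x y (t : R), 0 <= t <= 1 -> A x -> A y ->
  A (t *: x + (1 - t) *: y).
(* The convex hull of a tail, as an intersection of convex sets: membership is used by instantiating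
   [A], and no finite convex combination is ever written. *)
pose H k := [set y | forall A, cvx A -> (forall j, (k <= j)%N -> A (x_ j)) -> A y].
have cvxE : cvx E by move=> x y t _ Ex Ey; apply: (ipP hB) => //; exact: (ipZ hB).
have HE k y : H k y -> E y by apply.
have Hx k : H k (x_ k) by move=> A _; apply.
have HH k l y : (k <= l)%N -> H l y -> H k y.
  by move=> kl h A cA hA; apply: h => // j lj; apply: hA; exact: leq_trans lj.
have Hmid k x y : H k x -> H k y -> H k (2^-1 *: (x + y)).
  move=> hx hy A cA hA; rewrite scalerDr.
  have e2 : 2^-1 = 1 - 2^-1 :> R by lra.
  have -> : 2^-1 *: y = (1 - 2^-1) *: y by rewrite -e2.
  apply: (cA); [by apply/andP; split; lra|exact: (hx A)|exact: (hy A)].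
have HB k y : H k y -> nrm C (y - x_ k) <= nrm C (y - x_ k). by [].
have ballcvx z r : E z -> cvx [set y | E y /\ nrm C (y - z) <= r].
  move=> Ez x y t /andP[t0 t1] [Ex hx] [Ey hy].
  split; first by apply: cvxE; rewrite ?t0.
  have -> : t *: x + (1 - t) *: y - z = t *: (x - z) + (1 - t) *: (y - z).
    by rewrite !scalerBr addrACA -opprD -scalerDl subrKC scale1r.
  have Exz := ipB hC Ex Ez; have Eyz := ipB hC Ey Ez.
  apply: le_trans (nrmD hC (ipZ hC _ Exz) (ipZ hC _ Eyz)) _.
  rewrite !(nrmZ hC)// !ger0_norm ?subr_ge0//.
  have : t * nrm C (x - z) <= t * r by rewrite ler_wpM2l.
  have : (1 - t) * nrm C (y - z) <= (1 - t) * r by rewrite ler_wpM2l// subr_ge0.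
  lra.
have HM0 : 0 <= M by apply: le_trans (xM 0); exact: nrm_ge0.
pose d k := inf [set nrm B y | y in H k].
have dinf k : has_inf [set nrm B y | y in H k].
  split; first by exists (nrm B (x_ k)), (x_ k).
  by exists 0 => _ [y _ <-]; exact: nrm_ge0.
have dle k y : H k y -> d k <= nrm B y.
  by move=> hy; apply: ge_inf; [case: (dinf k)|exists y].
have d0 k : 0 <= d k.
  by apply: lb_le_inf; [case: (dinf k)|move=> _ [y _ <-]; exact: nrm_ge0].
have dM k : d k <= M by apply: le_trans (dle _ _ (Hx k)) (xM k).
have dnd : {homo d : k l / (k <= l)%N >-> k <= l}.
  move=> k l kl; apply: lb_le_inf; first by case: (dinf l).
  by move=> _ [y hy <-]; apply: dle; exact: HH hy.
have dcv : cvgn d.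
  by apply: nondecreasing_is_cvgn => //; exists M => _ [k _ <-].
have [y_ Hy] : {y_ : nat -> V & forall k, H k (y_ k) /\ nrm B (y_ k) < d k + harmonic k}.
  apply: (@choice _ _ (fun k y => H k y /\ nrm B y < d k + harmonic k)) => k.
  have [_ [y hy <-] h] := inf_adherent (harmonic_gt0 k) (dinf k).
  by exists y.
have Ey_ k : E (y_ k) := HE _ _ (Hy k).1.
have dlim k : d k <= lim (d @ \oo) by apply: nondecreasing_cvgn_le.
have limM : lim (d @ \oo) <= M by apply: limr_le => //; near=> k.
have [y Ey yy] : exists2 y, E y & nrm B (y_ k - y) @[k --> \oo] --> 0.
  apply: cE => // e e0.
  pose L : R := lim (d @ \oo); rewrite -/L in dlim limM *.
  (* The two norms will be below [L + Num.min (q / 4) 1] and that of the midpoint above [L - q / 4],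
     so the parallelogram identity bounds the squared distance by 4 q L + q < 8 q (L + 1) = e^2. *)
  pose q := e ^+ 2 / (8 * (L + 1)).
  have L0 : 0 <= L by apply: le_trans (dlim 0); exact: d0.
  have q0 : 0 < q by rewrite divr_gt0 ?exprn_gt0//; lra.
  have qE : q * (8 * (L + 1)) = e ^+ 2 by rewrite divfK//; apply: lt0r_neq0; lra.
  have [N1 _ HN1] : \forall k \near \oo, L - q / 4 <= d k.
    by apply: (cvgr_ge L dcv); lra.
  have q4 : 0 < Num.min (q / 4) 1 by rewrite lt_min; apply/andP; split; lra.
  have [N2 _ HN2] := near_infty_natSinv_lt (PosNum q4).
  exists (maxn N1 N2).
  suff W i j : (maxn N1 N2 <= i)%N -> (i <= j)%N -> nrm B (y_ i - y_ j) < e.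
    move=> i j Ni Nj; have [ij|/ltnW ji] := leqP i j; first exact: W.
    by rewrite (nrmBC hB)//; exact: W.
  rewrite geq_max => /andP[Ni1 Ni2] ij.
  rewrite -(@ltr_pXn2r _ 2)// ?nnegrE ?nrm_ge0 ?(ltW e0)//.
  rewrite (parallelogram hB)//.
  have hm := dle _ _ (Hmid _ _ _ (Hy i).1 (HH _ _ _ ij (Hy j).1)).
  have := HN1 i Ni1; have := HN2 i Ni2; have := HN2 j (leq_trans Ni2 ij).
  rewrite /= !lt_min => /andP[j1 j2] /andP[i1 i2] di.
  have hi := (Hy i).2; have hj := (Hy j).2; rewrite /harmonic/= in hi hj.
  have dj := dlim j; have di' := dlim i.
  have si (u : R) : 0 <= u -> u < L + Num.min (q / 4) 1 -> u ^+ 2 <= L ^+ 2 + L * q / 2 + q / 4.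
    have := q4; set m := Num.min _ _ => m0 u0 uL.
    have m1 : m <= q / 4 by rewrite /m ge_min lexx.
    have m2 : m <= 1 by rewrite /m ge_min lexx orbT.
    have : u ^+ 2 <= (L + m) ^+ 2 by rewrite ler_pXn2r ?nnegrE//; lra.
    have : L * m <= L * (q / 4) by rewrite ler_wpM2l.
    have : m * m <= m * 1 by rewrite ler_wpM2l//; lra.
    lra.
  have {}hi : nrm B (y_ i) < L + Num.min (q / 4) 1.
    have : i.+1%:R^-1 < Num.min (q / 4) 1 by rewrite lt_min i1.
    by move: hi; move: (_^-1) (Num.min _ _) => u v; lra.
  have {}hj : nrm B (y_ j) < L + Num.min (q / 4) 1.
    have : j.+1%:R^-1 < Num.min (q / 4) 1 by rewrite lt_min j1.
    by move: hj; move: (_^-1) (Num.min _ _) => u v; lra.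
  have {}hi := si _ (nrm_ge0 B _) hi.
  have {}hj := si _ (nrm_ge0 B _) hj.
  have sm : L ^+ 2 - q / 2 * L <= nrm B (2^-1 *: (y_ i + y_ j)) ^+ 2.
    have [neg|pos] := leP (L - q / 4) 0.
      apply: le_trans (sqr_ge0 _); nra.
    have : (L - q / 4) ^+ 2 <= nrm B (2^-1 *: (y_ i + y_ j)) ^+ 2.
      by rewrite ler_pXn2r ?nnegrE ?nrm_ge0//; lra.
    by have := sqr_ge0 (q / 4); lra.
  have : 0 <= q * L by rewrite mulr_ge0// ltW.
  lra.
exists y; split => //.
  apply: le_trans limM.
  apply: (ler_cvg_to (cvg_nrm hB Ey_ Ey yy)
    (g := fun k => lim (d @ \oo) + harmonic k)).
    by rewrite -[X in _ --> X]addr0; apply: cvgD; [exact: cvg_cst|exact: cvg_harmonic].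
  by near=> k; have := dlim k; have := (Hy k).2; lra.
apply/cvgr0Pnorm_le => e e0.
have e2 : 0 < e / 3 by lra.
have P1 : 0 < `|P| + 1 by have := normr_ge0 P; lra.
have [N HN] := cau _ e2.
have : ((`|P| + 1) * nrm B (y_ k - y)) @[k --> \oo] --> (`|P| + 1) * 0 by apply: cvgMr.
rewrite mulr0 => /cvgr0Pnorm_le/(_ _ e2) h.
near=> k.
have Nk : (N <= k)%N by near: k; exact: nbhs_infty_ge.
have h1 : nrm C (y_ k - x_ k) <= e / 3.
  (* This ball is convex and contains the k-th tail, hence also [y_ k], which lies in the hull of
     that tail. *)
  suff [] : [set y | E y /\ nrm C (y - x_ k) <= e / 3] (y_ k) by [].
  apply: (Hy k).1; first exact: ballcvx.
  by move=> j kj; split => //; apply/ltW/HN => //; exact: leq_trans kj.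
have h2 : `|(`|P| + 1) * nrm B (y_ k - y)| <= e / 3 by near: k.
rewrite ger0_norm ?nrm_ge0//.
apply: le_trans (nrmB_trans hC (Ex_ k) (Ey_ k) Ey) _.
rewrite (nrmBC hC)//.
have h3 : nrm C (y_ k - y) <= e / 3.
  apply: le_trans (HP _ (ipB hB (Ey_ k) Ey)) _.
  apply: le_trans h2; rewrite normrM (ger0_norm (nrm_ge0 _ _)).
  rewrite ler_wpM2r ?nrm_ge0//; apply: le_trans (ler_norm P) _.
  by rewrite ger0_norm; lra.
lra.
Unshelve. all: by end_near. Qed.

(** By [tail_limit], the B-norm is lower semicontinuous along C-convergent bounded sequences.
    Applied to x_k + t w' with t large, this bounds B(x_k, w') from below in the limit; w' = w and
    w' = - w together give convergence. *)
Lemma tail_weak_cvg E B C (x_ : nat -> V) M x : semi_ip E B -> semi_ip E C ->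
  ip_complete E B -> (forall k, E (x_ k)) -> (forall k, nrm B (x_ k) <= M) ->
  (exists P, forall x, E x -> nrm C x <= P * nrm B x) ->
  (forall x, E x -> nrm C x = 0 -> nrm B x = 0) -> E x ->
  nrm C (x_ k - x) @[k --> \oo] --> 0 -> weak_cvg E B x_ x.
Proof.
move=> hB hC cE Ex_ xM HP C0 Ex xx; split=> // w Ew.
have cauchy y_ y : (forall k, E (y_ k)) -> E y -> nrm C (y_ k - y) @[k --> \oo] --> 0 ->
    forall e : R, 0 < e -> exists N, forall i j, (N <= i)%N -> (N <= j)%N ->
      nrm C (y_ i - y_ j) < e.
  move=> Ey_ Ey yy e e0; have e3 : 0 < e / 3 by lra.
  have /cvgr0Pnorm_le/(_ _ e3) [N _ HN] := yy.
  exists N => i j Ni Nj; apply: le_lt_trans (nrmB_trans hC (Ey_ i) Ey (Ey_ j)) _.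
  rewrite [X in _ + X](nrmBC hC)//.
  by have := HN i Ni; have := HN j Nj => /=; rewrite !ger0_norm ?nrm_ge0//; lra.
have lsc y_ y m : (forall k, E (y_ k)) -> E y -> nrm C (y_ k - y) @[k --> \oo] --> 0 ->
    (forall k, nrm B (y_ k) <= m) -> nrm B y <= m.
  move=> Ey_ Ey yy ym.
  have [z [Ez zm zy]] := tail_limit hB hC cE Ey_ ym HP (cauchy _ _ Ey_ Ey yy).
  suff /(C0 _ (ipB hB Ey Ez)) yz0 : nrm C (y - z) = 0.
    by have := nrm_leDB hB Ey Ez; lra.
  apply/eqP; rewrite eq_le nrm_ge0 andbT.
  rewrite -[X in _ <= X](addr0 0).
  apply: (cvgr_to_ge (cvgD yy zy)); near=> k.
  by apply: le_trans (nrmB_trans hC Ey (Ey_ k) Ez) _; rewrite [X in X + _](nrmBC hC).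
(* lower semicontinuity of the norm along [x_ + t w] for large [t] *)
have half (e : R) w' : 0 < e -> E w' -> \forall k \near \oo, B x w' - e <= B (x_ k) w'.
  move=> e0 Ew'; apply: contrapT => /not_eventually H.
  have [s [hs Hs]] := exists_subsequence (fun _ : nat => H).
  (* With this t, |x + t w'|^2 <= m would force B(x, x) <= M^2 - 2 t e = -1. *)
  pose t := (M ^+ 2 + 1) / (2 * e).
  have tE : t * (2 * e) = M ^+ 2 + 1 by rewrite divfK//; apply: lt0r_neq0; lra.
  have t0 : 0 <= t by rewrite divr_ge0//; have := sqr_ge0 M; lra.
  pose m := M ^+ 2 + 2 * t * (B x w' - e) + t ^+ 2 * B w' w'.
  have Etw := ipZ hB t Ew'.
  have le k : B (x_ (s k) + t *: w') (x_ (s k) + t *: w') <= m.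
    rewrite (ip_sqrD hB)// (ipZr hB)// (ip_sqrZ hB)//.
    have : B (x_ (s k)) (x_ (s k)) <= M ^+ 2.
      rewrite -(nrm_sqr hB)// ler_pXn2r ?nnegrE ?nrm_ge0//.
      by apply: le_trans (xM 0); exact: nrm_ge0.
    have : B (x_ (s k)) w' <= B x w' - e by have := Hs k; move/negP; rewrite -ltNge => /ltW.
    by rewrite /m => h1 h2; have := ler_wpM2l t0 h1; lra.
  have : nrm B (x + t *: w') <= Num.sqrt m.
    apply: (lsc (fun k => x_ (s k) + t *: w')).
    - by move=> k; exact: (ipA hB).
    - exact: (ipA hB).
    - have -> : (fun k => nrm C (x_ (s k) + t *: w' - (x + t *: w'))) =
          (fun k => nrm C (x_ (s k) - x)).
        by apply/funext => k; rewrite opprD addrACA subrr addr0.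
      exact: (cvg_subsequence hs xx).
    - by move=> k; rewrite /nrm ler_wsqrtr.
  have m0 : 0 <= m.
    by apply: le_trans (le 0%N); apply: (ip_ge0 hB); exact: (ipA hB).
  rewrite -(@ler_pXn2r _ 2)// ?nnegrE ?nrm_ge0 ?sqrtr_ge0// !sqr_sqrtr//; last first.
    by apply: (ip_ge0 hB); exact: (ipA hB).
  rewrite (ip_sqrD hB)// (ipZr hB)// (ip_sqrZ hB)// /m.
  by have := ip_ge0 hB Ex; lra.
apply/cvgrPdist_le => e e0.
have h1 := half e w e0 Ew.
have h2 := half e (- w) e0 (ipN hB Ew).
near=> k.
have : B x w - e <= B (x_ k) w by near: k.
have : B x (- w) - e <= B (x_ k) (- w) by near: k.
by rewrite !(ipNr hB)// ler_norml => k1 k2; apply/andP; split; lra.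
Unshelve. all: by end_near. Qed.

End semi_inner_product.

(** * Existence of a third critical point *)

Section critical_points.
Context {R : realType} {V : lmodType R}.
Variables (E : set V) (B : V -> V -> R).
Hypotheses (hB : semi_ip E B) (cpt : weak_compact E B).
Local Notation "\N( x )" := (nrm B x) (at level 0, x at level 99).

Definition weakly_continuous (f : V -> R) := forall x_ x, (forall k, E (x_ k)) ->
  nbounded B x_ -> weak_cvg E B x_ x -> f (x_ k) @[k --> \oo] --> f x.

Lemma nbounded_comp x_ s : nbounded B x_ -> nbounded B (x_ \o s).
Proof. by move=> [M h]; exists M => k; exact: h. Qed.

Lemma weakly_continuous_bounded f (M : R) : weakly_continuous f ->
  exists C, forall x, E x -> \N(x) <= M -> `|f x| <= C.
Proof.
move=> wf; apply: contrapT => H.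
have {}H k : exists x, [/\ E x, \N(x) <= M & k%:R < `|f x| ].
  apply: contrapT => H'; apply: H; exists k%:R => x Ex xM.
  by rewrite leNgt; apply/negP => h; apply: H'; exists x.
have [x_ Hx] := choice H.
have [|s [x [hs wx]]] := cpt (x_ := x_) (fun k => let: And3 h _ _ := Hx k in h).
  by exists M => k; have [] := Hx k.
have : `|f (x_ (s k))| @[k --> \oo] --> `|f x|.
  apply: cvg_norm; apply: (wf (x_ \o s)) => //.
    by move=> k; have [] := Hx (s k).
  by exists M => k; have [] := Hx (s k).
have f1 : `|f x| < `|f x| + 1 by rewrite ltrDl.
move=> /cvgr_le/(_ _ f1) h.
near \oo => k.
have : `|f (x_ (s k))| <= `|f x| + 1 by near: k.
apply/negP; rewrite -ltNge; have [_ _] := Hx (s k); apply: le_lt_trans.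
apply: (@le_trans _ _ k%:R); last by rewrite ler_nat subsequence_ge.
by apply: ltW; near: k; exact: nbhs_infty_gtr.
Unshelve. all: by end_near. Qed.

Variable Psi : V -> R.
Hypothesis Psi_w : weakly_continuous Psi.

Definition half_sq_minus x : R := \N(x) ^+ 2 / 2 - Psi x.
Local Notation J := half_sq_minus.

Definition coercive_on (f : V -> R) := forall a : R, exists M, forall x, E x -> f x <= a -> \N(x) <= M.

Hypothesis J_coer : coercive_on J.

(** The tangent B(x_k, x) - |x|^2 / 2 of half the squared norm at x lies below |x_k|^2 / 2 and is
    weakly continuous in x_k. *)
Lemma J_lsc x_ x a_ a : (forall k, E (x_ k)) -> nbounded B x_ -> weak_cvg E B x_ x ->
  (forall k, J (x_ k) <= a_ k) -> a_ @ \oo --> a -> J x <= a.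
Proof.
move=> Ex_ bx wx Ja aa; have [Ex hx] := wx.
have : (B (x_ k) x - \N(x) ^+ 2 / 2 - Psi (x_ k)) @[k --> \oo] -->
       B x x - \N(x) ^+ 2 / 2 - Psi x.
  by apply: cvgB; [apply: cvgB; [exact: hx|exact: cvg_cst]|exact: Psi_w bx wx].
have -> : B x x - \N(x) ^+ 2 / 2 - Psi x = J x by rewrite /J (nrm_sqr hB)//; lra.
move=> h; apply: (ler_cvg_to h aa); near=> k.
apply: le_trans (Ja k); rewrite /J.
have := ip_ge0 hB (ipB hB (Ex_ k) Ex).
by rewrite (ip_sqrB hB)// !(nrm_sqr hB)//; lra.
Unshelve. all: by end_near. Qed.

(** As Psi converges, an upper bound of J that tends to J x bounds the norms by that of x in the
    limit, and [weak_strong_cvg] applies. *)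
Lemma J_strong x_ x a_ : (forall k, E (x_ k)) -> nbounded B x_ -> weak_cvg E B x_ x ->
  (forall k, J (x_ k) <= a_ k) -> a_ @ \oo --> J x -> \N(x_ k - x) @[k --> \oo] --> 0.
Proof.
move=> Ex_ bx wx Ja aa; have [Ex hx] := wx.
apply: (weak_strong_cvg hB Ex_ wx) => e e0.
have : 2 * (a_ k + Psi (x_ k)) @[k --> \oo] --> 2 * (J x + Psi x).
  by apply: cvgMr; apply: cvgD => //; exact: Psi_w.
have -> : 2 * (J x + Psi x) = \N(x) ^+ 2 by rewrite /J; lra.
have x1 : \N(x) ^+ 2 < \N(x) ^+ 2 + e by rewrite ltrDl.
move=> /cvgr_le/(_ _ x1); apply: filterS => k.
by apply: le_trans; have := Ja k; rewrite /J; lra.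
Qed.

Lemma J_min : exists2 x, E x & forall y, E y -> J x <= J y.
Proof.
have E0 := ip0 hB.
have [M HM] := J_coer (J 0).
have [C HC] := weakly_continuous_bounded M Psi_w.
(* Where J <= J 0, coercivity bounds the norm by [M], hence Psi by [C]. *)
have lb x : E x -> Num.min (J 0) (- C) <= J x.
  move=> Ex; rewrite ge_min; have [//|/ltW h] := leP (J 0) (J x) => /=.
  have := HC x Ex (HM x Ex h); rewrite ler_norml => /andP[_ h2].
  by rewrite /J; have := sqr_ge0 \N(x); lra.
pose A := [set J x | x in E].
have infA : has_inf A.
  by split; [exists (J 0), 0|exists (Num.min (J 0) (- C)) => _ [x Ex <-]; exact: lb].
have mle x : E x -> inf A <= J x by move=> Ex; apply: ge_inf; [case: infA|exists x].
have [x_ Hx] : {x_ : nat -> V & forall k, E (x_ k) /\ J (x_ k) < inf A + harmonic k}.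
  apply: (@choice _ _ (fun k x => E x /\ J x < inf A + harmonic k)) => k.
  by have [_ [x Ex <-] h] := inf_adherent (harmonic_gt0 k) infA; exists x.
have [M' HM'] := J_coer (inf A + 1).
have bx : nbounded B x_.
  exists M' => k; apply: HM'; first exact: (Hx k).1.
  apply/ltW/(lt_le_trans (Hx k).2); rewrite lerD2l /harmonic/=.
  by rewrite invf_le1// ler1n.
have [s [x [hs wx]]] := cpt (fun k => (Hx k).1) bx.
exists x; first by case: wx.
move=> y Ey; apply: le_trans (mle y Ey).
apply: (J_lsc (fun k => (Hx (s k)).1) (nbounded_comp s bx) wx
  (fun k => ltW (Hx (s k)).2)).
rewrite -[X in _ --> X]addr0; apply: cvgD; first exact: cvg_cst.
by apply: (cvg_subsequence hs); exact: cvg_harmonic.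
Qed.

Variable T : V -> V.
Hypothesis ET : forall x, E x -> E (T x).
Hypothesis T_w : forall x_ x, (forall k, E (x_ k)) ->
  nbounded B x_ -> weak_cvg E B x_ x -> \N(T (x_ k) - T x) @[k --> \oo] --> 0.
Hypothesis Psi_d : forall M e : R, 0 < e -> exists2 d, 0 < d & forall x h, E x -> E h ->
  \N(x) <= M -> \N(h) <= d -> `|Psi (x + h) - Psi x - B (T x) h| <= e * \N(h).

Definition critical x := \N(x - T x) = 0.

Lemma T_bounded (M : R) : exists C, forall x, E x -> \N(x) <= M -> \N(T x) <= C.
Proof.
have [C HC] := @weakly_continuous_bounded (fun x => \N(T x)) M (fun x_ x Ex bx wx =>
  cvg_nrm hB (fun k => ET (Ex k)) (ET (let: conj h _ := wx in h)) (T_w Ex bx wx)).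
by exists C => x Ex xM; have := HC x Ex xM; rewrite ger0_norm// nrm_ge0.
Qed.

(** With g = x - T x, the step - t g changes the quadratic part by - t B(x, g) + t^2 |g|^2 / 2 and
    Psi by - t B(T x, g) up to e t |g|; since t <= 1, the sum is at most - t |g|^2 / 2 + t e |g|. *)
Lemma descent (M e : R) : 0 < e -> exists2 t0, 0 < t0 <= 1 & forall t x, 0 < t <= t0 ->
  E x -> \N(x) <= M ->
  J (x - t *: (x - T x)) <= J x - t * \N(x - T x) ^+ 2 / 2 + t * e * \N(x - T x).
Proof.
move=> e0; have [d d0 Hd] := Psi_d M e0.
have [C HC] := T_bounded M.
(* A bound of |x - T x| on the ball, so that t <= d / q keeps the increment within the radius d of
   uniform differentiability. *)
pose q := 1 + `|M| + `|C|.
have q0 : 0 < q by have := normr_ge0 M; have := normr_ge0 C; rewrite /q; lra.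
exists (Num.min 1 (d / q)).
  by rewrite lt_min ltr01 divr_gt0//= ge_min lexx.
move=> t x /andP[t0]; rewrite le_min => /andP[t1 td] Ex xM.
have ETx := ET Ex; set g := x - T x; have Eg : E g by exact: (ipB hB).
have Eh := ipZ hB (- t) Eg.
have gq : \N(g) <= q.
  have := nrmD hB Ex (ipN hB ETx); rewrite (nrmN hB)// -/g.
  by have := HC x Ex xM; have := ler_norm M; have := ler_norm C; rewrite /q; lra.
have nh : \N(- t *: g) = t * \N(g) by rewrite (nrmZ hB)// normrN ger0_norm// ltW.
have hd : \N(- t *: g) <= d.
  rewrite nh; apply: le_trans (_ : d / q * q <= d); last by rewrite divfK// lt0r_neq0.
  by apply: ler_pM => //; [exact: ltW|exact: nrm_ge0].
have := Hd x (- t *: g) Ex Eh xM hd; rewrite nh ler_norml => /andP[h _].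
rewrite -scaleNr /J (nrm_sqr hB); last exact: (ipA hB).
rewrite (ip_sqrD hB)// (ip_sqrZ hB)// (ipZr hB)//.
move: h; rewrite (ipZr hB)// !(nrm_sqr hB)//.
have -> : B g g = B x g - B (T x) g by rewrite -(ipBl hB).
have : t ^+ 2 * (B x g - B (T x) g) <= t * (B x g - B (T x) g).
  rewrite -(ipBl hB)// -/g ler_wpM2r ?(ip_ge0 hB)//.
  by rewrite expr2 ler_piMl// ltW.
by rewrite sqrrN; lra.
Qed.

Lemma minimum_critical x : E x -> (forall y, E y -> J x <= J y) -> critical x.
Proof.
move=> Ex xmin; apply/eqP; rewrite eq_le nrm_ge0 andbT leNgt; apply/negP => c0.
have e0 : 0 < \N(x - T x) / 4 by rewrite divr_gt0.
have [t0 /andP[t00 t01] Ht] := descent \N(x) e0.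
have h1 : 0 < t0 <= t0 by rewrite t00 lexx.
have Ey : E (x - t0 *: (x - T x)).
  by apply: (ipB hB) => //; apply: (ipZ hB); apply: (ipB hB) => //; exact: ET.
have := le_trans (xmin _ Ey) (Ht t0 x h1 Ex (lexx _)).
move: c0; set c := \N(_) => c0 h.
have : 0 < t0 * (c * c) by rewrite !mulr_gt0.
by move: h; rewrite expr2; lra.
Qed.

(** The constant sequence x converges weakly to every point at distance 0 from x, so Psi takes the
    same value at these points. *)
Lemma J_equiv x y : E x -> E y -> \N(x - y) = 0 -> J x = J y.
Proof.
move=> Ex Ey xy.
have nxy : \N(x) = \N(y).
  have := nrm_leDB hB Ex Ey; have := nrm_leDB hB Ey Ex; rewrite (nrmBC hB)// xy; lra.
rewrite /J nxy; congr (_ - _).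
have wc z : E z -> \N(x - z) = 0 -> Psi x = Psi z.
  move=> Ez xz; apply: (@cvg_unique _ _ (Psi x @[k --> \oo])) => //.
  - exact: cvg_cst.
  - apply: (Psi_w (x_ := fun=> x)) => //; first by exists \N(x).
    by apply: (strong_weak_cvg hB) => //; rewrite xz; exact: cvg_cst.
exact: wc.
Qed.

Lemma strong_J x_ x : (forall k, E (x_ k)) -> E x -> \N(x_ k - x) @[k --> \oo] --> 0 ->
  J (x_ k) @[k --> \oo] --> J x.
Proof.
move=> Ex_ Ex h; apply: cvgB.
  by apply: cvgMl; rewrite expr2; under eq_fun do rewrite expr2; apply: cvgM; exact: (cvg_nrm hB).
apply: Psi_w => //; last exact: (strong_weak_cvg hB).
have /cvgP/cvg_seq_bounded[M [_ HM]] := cvg_nrm hB Ex_ Ex h.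
exists (M + 1) => k; apply: le_trans (ler_norm _) _.
by apply: (HM (M + 1)); rewrite ?ltrDl.
Qed.

(** Otherwise two bounded sequences at vanishing distance from each other would have a common weak
    limit along a subsequence, and T would send both strongly to the same point. *)
Lemma T_uniform (M e : R) : 0 < e -> exists2 d, 0 < d & forall x y, E x -> E y ->
  \N(x) <= M -> \N(y) <= M -> \N(x - y) <= d -> \N(T x - T y) <= e.
Proof.
move=> e0; apply: contrapT => H.
have {}H k : exists xy : V * V, [/\ E xy.1 /\ E xy.2, \N(xy.1) <= M /\ \N(xy.2) <= M,
    \N(xy.1 - xy.2) <= harmonic k & e < \N(T xy.1 - T xy.2) ].
  apply: contrapT => H'; apply: H; exists (harmonic k); first exact: harmonic_gt0.
  move=> x y Ex Ey xM yM xy; rewrite leNgt; apply/negP => h; apply: H'.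
  by exists (x, y).
have [z Hz] := choice H.
have E1 k : E (z k).1 by have [[]] := Hz k.
have E2 k : E (z k).2 by have [[]] := Hz k.
have b1 : nbounded B (fun k => (z k).1) by exists M => k; have [_ []] := Hz k.
have b2 : nbounded B (fun k => (z k).2) by exists M => k; have [_ []] := Hz k.
have [s [x [hs wx]]] := cpt E1 b1.
have d0 : \N((z (s k)).1 - (z (s k)).2) @[k --> \oo] --> 0.
  apply: (squeeze_cvgr (f := fun=> 0) (h := fun k => harmonic (s k))).
  - by near=> k; rewrite nrm_ge0/=; have [] := Hz (s k).
  - exact: cvg_cst.
  - by apply: (cvg_subsequence hs); exact: cvg_harmonic.
have wy : weak_cvg E B (fun k => (z (s k)).2) x.
  exact: (weak_cvg_shift hB (fun k => E1 (s k)) (fun k => E2 (s k)) wx d0).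
have Ex : E x by case: wx.
have c1 := T_w (fun k => E1 (s k)) (nbounded_comp s b1) wx.
have c2 := T_w (fun k => E2 (s k)) (nbounded_comp s b2) wy.
have e3 : 0 < e / 3 by lra.
have /cvgr0Pnorm_le/(_ _ e3) h1 := c1; have /cvgr0Pnorm_le/(_ _ e3) h2 := c2.
near \oo => k.
have : `|\N(T (z (s k)).1 - T x)| <= e / 3 by near: k.
have : `|\N(T (z (s k)).2 - T x)| <= e / 3 by near: k.
rewrite !ger0_norm ?nrm_ge0// => k2 k1.
have [_ _ _] := Hz (s k); apply/negP; rewrite -leNgt.
apply: le_trans (nrmB_trans hB (ET (E1 _)) (ET Ex) (ET (E2 _))) _.
by rewrite (nrmBC hB (ET Ex) (ET (E2 _))); lra.
Unshelve. all: by end_near. Qed.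

Section third.
Variables w1 w2 : V.
Hypotheses (E1 : E w1) (E2 : E w2).
Hypotheses (min1 : forall y, E y -> J w1 <= J y) (min2 : forall y, E y -> J w2 <= J y).
Hypothesis w12 : 0 < \N(w1 - w2).
Hypothesis no3 : forall x, E x -> critical x -> \N(x - w1) = 0 \/ \N(x - w2) = 0.

Let m := J w1.
Let mE : J w2 = m. Proof. by apply/eqP; rewrite eq_le min1// min2. Qed.

(* By weak compactness a minimizing sequence near the sphere would converge
   strongly to a third global minimum. *)
Lemma annulus : let r := \N(w1 - w2) / 2 in exists tau e : R, [/\ 0 < tau, 0 < e &
  forall x, E x -> `|\N(x - w1) - r| <= e -> m + tau <= J x].
Proof.
move=> r; apply: contrapT => H.
have {}H k : exists x, [/\ E x, `|\N(x - w1) - r| <= harmonic k & J x < m + harmonic k].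
  apply: contrapT => H'; apply: H; exists (harmonic k), (harmonic k).
  split; [exact: harmonic_gt0..|move=> x Ex xr].
  by rewrite leNgt; apply/negP => h; apply: H'; exists x.
have [x_ Hx] := choice H.
have Ex_ k : E (x_ k) by have [] := Hx k.
have h1 k : harmonic k <= 1 :> R by rewrite /harmonic/= invf_le1// ler1n.
have bx : nbounded B x_.
  exists (r + 1 + \N(w1)) => k; have [_ + _] := Hx k; rewrite ler_norml => /andP[_ h].
  by have := nrm_leDB hB (Ex_ k) E1; have := h1 k; lra.
have [s [x [hs wx]]] := cpt Ex_ bx; have Ex : E x by case: wx.
have cs : m + harmonic (s k) @[k --> \oo] --> m.
  rewrite -[X in _ --> X]addr0; apply: cvgD; first exact: cvg_cst.
  by apply: (cvg_subsequence hs); exact: cvg_harmonic.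
have le k : J (x_ (s k)) <= m + harmonic (s k) by have [_ _ /ltW] := Hx (s k).
have Jx : J x = m.
  by apply/eqP; rewrite eq_le min1// andbT; exact: (J_lsc (fun k => Ex_ (s k)) (nbounded_comp s bx) wx le).
have st : \N(x_ (s k) - x) @[k --> \oo] --> 0.
  by apply: (J_strong (fun k => Ex_ (s k)) (nbounded_comp s bx) wx le); rewrite Jx.
have c1 : \N(x_ (s k) - w1) @[k --> \oo] --> \N(x - w1).
  apply: (cvg_nrm hB (x_ := fun k => x_ (s k) - w1)).
  - by move=> k; exact: (ipB hB).
  - exact: (ipB hB).
  have -> // : (fun k => \N(x_ (s k) - w1 - (x - w1))) = (fun k => \N(x_ (s k) - x)).
  by apply/funext => k; rewrite opprB addrA subrK.
have c2 : \N(x_ (s k) - w1) @[k --> \oo] --> r.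
  apply/cvgrPdist_le => e e0.
  have /cvgr0Pnorm_le/(_ _ e0) := cvg_subsequence hs (@cvg_harmonic R).
  apply: filterS => k; rewrite ger0_norm ?harmonic_ge0//; apply: le_trans.
  by rewrite distrC; have [] := Hx (s k).
have xr : \N(x - w1) = r by exact: cvg_unique c1 c2.
have xm y : E y -> J x <= J y by rewrite Jx; exact: min1.
have [|x2] := no3 Ex (minimum_critical Ex xm).
  by rewrite xr /r => h; move: w12; lra.
have := nrmB_trans hB E1 Ex E2; rewrite x2 (nrmBC hB E1 Ex) xr /r.
by move: w12; lra.
Qed.

(** The sublevel {J <= a} joins w1 to w2 by chains of arbitrarily small step. The infimum of the
    good levels plays the part of the mountain pass level; endpoints are prescribed up to distance
    0. *)
Let good (a : R) := forall e : R, 0 < e -> exists (N : nat) (p : nat -> V),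
  [/\ forall i, (i <= N)%N -> E (p i) /\ J (p i) <= a,
      \N(p 0%N - w1) = 0, \N(p N - w2) = 0 &
      forall i, (i < N)%N -> \N(p i - p i.+1) <= e].

Lemma good_segment : exists a, good a.
Proof.
have [C HC] := weakly_continuous_bounded (\N(w1) + \N(w1 - w2)) Psi_w.
exists ((\N(w1) + \N(w1 - w2)) ^+ 2 / 2 + C) => e e0.
set d := \N(w1 - w2) in HC *.
have [N [N0 HN]] : exists N : nat, (0 < N)%N /\ d / N%:R <= e.
  exists (Num.trunc (d / e)).+1; split=> //.
  have h : d / e < (Num.trunc (d / e)).+1%:R.
    by exact: truncnS_gt.
  rewrite ler_pdivrMr// mulrC -ler_pdivrMr//; exact: ltW.
exists N, (fun i => w1 + (i%:R / N%:R) *: (w2 - w1)).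
have Ed := ipB hB E2 E1.
have E' i : E (w1 + (i%:R / N%:R) *: (w2 - w1)) by apply: (ipA hB) => //; exact: (ipZ hB).
have NR : 0 < N%:R :> R by rewrite ltr0n.
split.
- move=> i iN; split=> //.
  have hn : \N(w1 + (i%:R / N%:R) *: (w2 - w1)) <= \N(w1) + d.
    apply: le_trans (nrmD hB E1 (ipZ hB _ Ed)) _.
    rewrite lerD2l (nrmZ hB)// (nrmBC hB)// -/d ger0_norm ?divr_ge0//.
    by rewrite ler_piMl ?nrm_ge0// ler_pdivrMr// mul1r ler_nat.
  have := HC _ (E' i) hn; rewrite ler_norml => /andP[h _].
  have : \N(w1 + (i%:R / N%:R) *: (w2 - w1)) ^+ 2 <= (\N(w1) + d) ^+ 2.
    by rewrite ler_pXn2r ?nnegrE ?nrm_ge0// addr_ge0// nrm_ge0.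
  by rewrite /J; lra.
- by rewrite mul0r scale0r addr0 subrr (nrm0 hB).
- by rewrite divff ?lt0r_neq0// scale1r subrKC subrr (nrm0 hB).
- move=> i iN; rewrite opprD addrACA subrr add0r -scalerBl -mulrBl.
  rewrite -[i.+1]addn1 natrD opprD addrA subrr sub0r mulN1r.
  by rewrite (nrmZ hB)// (nrmBC hB)// -/d normrN ger0_norm ?invr_ge0// mulrC.
Qed.

(** A chain of step at most e cannot jump over the annulus of half-width e around the sphere of
    radius r: its first point at distance at least r from w1 lies in it. *)
Lemma good_lower : exists2 tau, 0 < tau & forall a, good a -> m + tau <= a.
Proof.
have [tau [e [tau0 e0 H]]] := annulus.
exists tau => // a ga.
have [N [p [hp p0 pN ps]]] := ga e e0.
set r := \N(w1 - w2) / 2 in H.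
have r0 : 0 < r by rewrite /r divr_gt0.
have hN : r <= \N(p N - w1).
  have [EpN _] := hp N (leqnn N).
  have := nrmB_trans hB E1 EpN E2; rewrite pN (nrmBC hB E1 EpN) addr0 /r.
  by move: w12; set u := \N(w1 - w2); set v := \N(_); lra.
have ex : exists i, (i <= N)%N && (r <= \N(p i - w1)) by exists N; rewrite leqnn.
case: (ex_minnP ex) => -[|i] /andP[iN hi] imin.
  by move: hi; rewrite p0; lra.
have [Ei _] := hp i (ltnW iN); have [Ei1 Ji1] := hp i.+1 iN.
apply: le_trans Ji1; apply: H => //.
have hi' : \N(p i - w1) < r.
  rewrite ltNge; apply/negP => h.
  have := imin i; rewrite h ltnW//= => /(_ isT); rewrite ltnn.
  by [].
have := nrmB_trans hB Ei1 Ei E1; rewrite (nrmBC hB Ei1 Ei).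
by have := ps i iN; rewrite ger0_norm; lra.
Qed.

(** Near the mountain pass level c the gradient stays away from 0, because all critical points are
    at the level m < c. One descent step [eta] then turns a chain just above c into one below c,
    still of small step and with the same endpoints up to distance 0, against the choice of c. *)
Lemma third_contradiction : False.
Proof.
have [a0 ga0] := good_segment; have [tau tau0 Htau] := good_lower.
have infG : has_inf [set a | good a].
  by split; [exists a0|exists (m + tau) => a; exact: Htau].
set c := inf [set a | good a].
have cm : m + tau <= c by apply: lb_le_inf; [exists a0|move=> a; exact: Htau].
have crit_m x : E x -> critical x -> J x = m.
  move=> Ex /(no3 Ex)[h|h]; first exact: J_equiv h.
  by rewrite -mE; exact: J_equiv h.
(* A Palais-Smale argument: if x_k - T x_k tends to 0 on this strip, then x_k converges strongly to
   T x, x being its weak limit. So x is critical, of level m < c - tau / 2, while J (T x) is at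
   least c - tau / 2. *)
have [sg sg0 Hsg] : exists2 sg, 0 < sg & forall x, E x -> c - tau / 2 <= J x <= c + 1 ->
    sg <= \N(x - T x).
  apply: contrapT => H.
  have {}H k : exists x, [/\ E x, c - tau / 2 <= J x, J x <= c + 1 & \N(x - T x) < harmonic k].
    apply: contrapT => H'; apply: H; exists (harmonic k); first exact: harmonic_gt0.
    move=> x Ex /andP[x1 x2]; rewrite leNgt; apply/negP => h; apply: H'; by exists x.
  have [x_ Hx] := choice H.
  have Ex_ k : E (x_ k) by have [] := Hx k.
  have [M HM] := J_coer (c + 1).
  have bx : nbounded B x_ by exists M => k; apply: HM => //; have [] := Hx k.
  have [s [x [hs wx]]] := cpt Ex_ bx; have Ex : E x by case: wx.
  have ct := T_w (fun k => Ex_ (s k)) (nbounded_comp s bx) wx.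
  have d0 : \N(x_ (s k) - T (x_ (s k))) @[k --> \oo] --> 0.
    apply: (squeeze_cvgr (f := fun=> 0) (h := fun k => harmonic (s k))).
    - by near=> k; rewrite nrm_ge0/=; have [_ _ _ /ltW] := Hx (s k).
    - exact: cvg_cst.
    - by apply: (cvg_subsequence hs); exact: cvg_harmonic.
  have st : \N(x_ (s k) - T x) @[k --> \oo] --> 0.
    have h : \N(x_ (s k) - T (x_ (s k))) + \N(T (x_ (s k)) - T x) @[k --> \oo] --> 0.
      by rewrite -[X in _ --> X]addr0; exact: cvgD.
    apply: (squeeze_cvgr _ (cvg_cst 0) h).
    by near=> k; rewrite nrm_ge0/=; apply: (nrmB_trans hB) => //; exact: ET.
  have wT := strong_weak_cvg hB (fun k => Ex_ (s k)) (ET Ex) st.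
  have xT := weak_cvg_unique hB wx wT.
  have cx : critical x by [].
  have sx := strong_J (fun k => Ex_ (s k)) (ET Ex) st.
  have : c - tau / 2 <= J (T x).
    by apply: (cvgr_to_ge sx); near=> k; have [] := Hx (s k).
  by rewrite -(J_equiv Ex (ET Ex) xT) (crit_m x Ex cx); lra.
have [M HM] := J_coer (c + 1).
have e0 : 0 < sg / 4 by lra.
have [t0 /andP[t00 t01] Ht] := descent M e0.
(* The second bound gives t sg^2 <= tau. Below the strip a step may raise J, but by at most t sg^2 /
   32 (with [e] = sg / 4 in [descent]), which is small compared with the margin tau / 2. *)
pose t := Num.min t0 (tau / (sg ^+ 2 + 1)).
have sg2 : 0 < sg ^+ 2 by rewrite exprn_gt0.
have t1 : 0 < t by rewrite lt_min t00 divr_gt0//; lra.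
have tt : t <= t0 by rewrite ge_min lexx.
have tsg : t * sg ^+ 2 <= tau.
  apply: (@le_trans _ _ (tau / (sg ^+ 2 + 1) * (sg ^+ 2 + 1))); last first.
    by rewrite divfK//; apply: lt0r_neq0; lra.
  apply: ler_pM; [exact: ltW|exact: ltW|by rewrite ge_min lexx orbT|lra].
have tsg' : 0 < t * sg ^+ 2 by rewrite mulr_gt0.
(* Twice [st] is at most t sg^2 / 4, the least decrease where the gradient has norm at least sg; and
   [st] <= 1 keeps the chain below the level c + 1. *)
pose st := Num.min 1 (t * sg ^+ 2 / 8).
have st0 : 0 < st by rewrite lt_min ltr01/=; lra.
have st1 : st <= 1 by rewrite ge_min lexx.
have st2 : st <= t * sg ^+ 2 / 8 by rewrite ge_min lexx orbT.
have [a ga alt] := inf_adherent st0 infG.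
rewrite -/c in alt.
pose eta x := x - t *: (x - T x).
have Eeta x : E x -> E (eta x).
  move=> Ex; apply: (ipB hB) => //; apply: (ipZ hB); apply: (ipB hB) => //; exact: ET.
have Jeta x : E x -> J x <= a -> J (eta x) <= c - st.
  move=> Ex xa; have xc : J x <= c + 1 by lra.
  have ht : 0 < t <= t0 by rewrite t1.
  have := Ht t x ht Ex (HM x Ex xc); rewrite -/(eta x).
  set g := \N(x - T x); have g0 : 0 <= g by exact: nrm_ge0.
  have [h|h] := leP (c - tau / 2) (J x).
    have gs : sg <= g by apply: Hsg => //; rewrite h.
    have : 0 <= t * ((g - sg) * (g + sg / 2)).
      by apply: mulr_ge0; [exact: ltW|apply: mulr_ge0; lra].
    by move: sg2 st2 alt xa; rewrite !expr2; lra.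
  have : 0 <= t * (g - sg / 4) ^+ 2 by rewrite mulr_ge0 ?sqr_ge0// ltW.
  by move: tsg st2 h; rewrite !expr2; lra.
suff : good (c - st).
  by move=> h; have := ge_inf (let: conj _ h := infG in h) h; rewrite -/c; lra.
move=> e e0'.
have t1' : t <= 1 by lra.
have e2 : 0 < e / 2 by lra.
(* The map [eta] is (1 - t) id + t T, so a chain of step at most e / 2 whose image under T has step
   at most e / 2 is sent to a chain of step at most e. *)
have [d d0 Hd] := T_uniform M e2.
have ed : 0 < Num.min d (e / 2) by rewrite lt_min d0 e2.
have [N [p [hp p0 pN ps]]] := ga _ ed.
have pM i : (i <= N)%N -> \N(p i) <= M.
  by move=> iN; have [Ei Ji] := hp i iN; apply: HM => //; lra.
(* The endpoints of the chain are only at distance 0 from the minima; T preserves distance 0 on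
   bounded sets by [T_uniform], so x - T x has norm 0 as well. *)
have near_eta x w : E x -> E w -> (forall y, E y -> J w <= J y) -> \N(x - w) = 0 ->
    \N(eta x - w) = 0.
  move=> Ex Ew wmin xw.
  have cw := minimum_critical Ew wmin.
  have xT : \N(T x - T w) = 0.
    apply/eqP; rewrite eq_le nrm_ge0 andbT; apply/ler_addgt0Pl => e' e'0.
    have [d' d'0 Hd'] := T_uniform (Num.max \N(x) \N(w)) e'0.
    by rewrite addr0; apply: Hd' => //; rewrite ?le_max ?lexx ?orbT// xw ltW.
  have Ex' := ET Ex; have Ew' := ET Ew.
  have xTx : \N(x - T x) = 0.
    apply/eqP; rewrite eq_le nrm_ge0 andbT.
    apply: le_trans (nrmB_trans hB Ex Ew Ex') _.
    apply: le_trans (lerD (lexx _) (nrmB_trans hB Ew Ew' Ex')) _.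
    by rewrite xw cw (nrmBC hB Ew' Ex') xT !addr0.
  apply/eqP; rewrite eq_le nrm_ge0 andbT /eta.
  apply: le_trans (nrmB_trans hB (Eeta _ Ex) Ex Ew) _.
  rewrite xw addr0 /eta addrAC subrr add0r (nrmN hB) ?(nrmZ hB) ?xTx ?mulr0//.
  - exact: (ipB hB).
  - by apply: (ipZ hB); exact: (ipB hB).
exists N, (eta \o p); split.
- move=> i iN; have [Ei Ji] := hp i iN; split; [exact: Eeta|exact: Jeta].
- by apply: near_eta => //; have [] := hp 0%N (leq0n N).
- by apply: near_eta => //; have [] := hp N (leqnn N).
- move=> i iN; have [Ei _] := hp i (ltnW iN); have [Ei1 _] := hp i.+1 iN.
  have ETi := ET Ei; have ETi1 := ET Ei1.
  have -> : (eta \o p) i - (eta \o p) i.+1 =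
      (1 - t) *: (p i - p i.+1) + t *: (T (p i) - T (p i.+1)).
    rewrite /= /eta; move: (p i) (p i.+1) (T (p i)) (T (p i.+1)) => x y u v.
    have sACA (b1 b2 b3 b4 : V) : b1 - b2 - (b3 - b4) = b1 - b3 - (b2 - b4).
      by rewrite !opprD !opprK addrACA.
    by rewrite sACA -scalerBr sACA scalerBl scale1r scalerBr opprB addrA addrAC.
  apply: le_trans (nrmD hB (ipZ hB _ (ipB hB Ei Ei1)) (ipZ hB _ (ipB hB ETi ETi1))) _.
  rewrite !(nrmZ hB); try exact: (ipB hB).
  rewrite !ger0_norm; [|exact: ltW|lra].
  have := ps i iN; rewrite le_min => /andP[pd pe].
  have := Hd _ _ Ei Ei1 (pM _ (ltnW iN)) (pM _ iN) pd.
  move: (nrm_ge0 B (p i - p i.+1)) (nrm_ge0 B (T (p i) - T (p i.+1))) pe.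
  set u := \N(_); set v := \N(_) => u0 v0 ue ve.
  have : t * v <= 1 * v by rewrite ler_wpM2r.
  have : (1 - t) * u <= 1 * u by rewrite ler_wpM2r//; lra.
  lra.
Unshelve. all: by end_near. Qed.
End third.

Lemma third_critical_point w1 w2 : E w1 -> E w2 ->
  (forall y, E y -> J w1 <= J y) -> (forall y, E y -> J w2 <= J y) ->
  \N(w1 - w2) != 0 ->
  exists x, [/\ E x, critical x, \N(w1 - x) != 0 & \N(w2 - x) != 0].
Proof.
move=> E1 E2 m1 m2 w12; apply: contrapT => H.
apply: (third_contradiction E1 E2 m1 m2); first by rewrite lt_neqAle eq_sym w12 nrm_ge0.
move=> x Ex cx; apply: contrapT => /not_orP[/eqP h1 /eqP h2]; apply: H; exists x.
by split=> //; rewrite (nrmBC hB).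
Qed.

End critical_points.

(** * Integration on a measure space *)

Section integration.
Context d (T : measurableType d) (R : realType) (mu : {measure set T -> \bar R}).
Variables (D : set T) (mD : measurable D).
Implicit Types f g h : T -> R.

Definition integ f := mu.-integrable D (EFin \o f).

Local Notation I f := (\int[mu]_(x in D) f x).

Lemma integ_measurable f : integ f -> measurable_fun D f.
Proof. by move=> /measurable_int/measurable_EFinP. Qed.

Lemma integ_ext f g : (forall x, D x -> f x = g x) -> integ f -> integ g.
Proof. by move=> fg; apply: eq_integrable => // x; rewrite inE => Dx /=; rewrite fg. Qed.

Lemma Rint_ext f g : (forall x, D x -> f x = g x) -> I f = I g.
Proof. by move=> fg; apply: eq_Rintegral => x; rewrite inE => Dx; exact: fg. Qed.

Lemma integD f g : integ f -> integ g -> integ (fun x => f x + g x).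
Proof. by move=> hf hg; have := integrableD mD hf hg; apply: eq_integrable. Qed.

Lemma integZ (a : R) f : integ f -> integ (fun x => a * f x).
Proof. by move=> hf; have := integrableZl mD a hf; apply: eq_integrable. Qed.

Lemma integB f g : integ f -> integ g -> integ (fun x => f x - g x).
Proof. by move=> hf hg; have := integrableB mD hf hg; apply: eq_integrable. Qed.

Lemma integ_le f g : measurable_fun D f -> (forall x, D x -> `|f x| <= g x) ->
  integ g -> integ f.
Proof.
move=> mf fg; apply: (le_integrable mD); first exact/measurable_EFinP.
by move=> x Dx /=; rewrite lee_fin; apply: le_trans (fg x Dx) (ler_norm _).
Qed.

Lemma integ_norm f : integ f -> integ (fun x => `|f x|).
Proof. by move=> hf; have := integrable_abse hf; apply: eq_integrable. Qed.

Lemma integ_sum (J : Type) (s : seq J) (h : J -> T -> R) :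
  (forall j, integ (h j)) -> integ (fun x => \sum_(j <- s) h j x).
Proof.
move=> hh; elim: s => [|j s IH].
  by apply: (@integ_ext (fun=> 0)) (integrable0 _ _) => x _; rewrite big_nil.
by apply: (@integ_ext (fun x => h j x + \sum_(j <- s) h j x));
  [move=> x _; rewrite big_cons|exact: integD].
Qed.

Lemma Rint_sum (J : Type) (s : seq J) (h : J -> T -> R) : (forall j, integ (h j)) ->
  \int[mu]_(x in D) (\sum_(j <- s) h j x) = \sum_(j <- s) I (h j).
Proof.
move=> hh; elim: s => [|j s IH].
  rewrite big_nil (@Rint_ext _ (fun=> 0)) ?Rintegral_cst ?mul0r// => x _.
  by rewrite big_nil.
rewrite big_cons -IH -RintegralD//; [|exact: hh|exact: integ_sum].
by apply: Rint_ext => x _; rewrite big_cons.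
Qed.

Lemma ae_imp_eq (P : T -> Prop) (U : Type) (f g : T -> U) :
  (forall x, D x -> P x -> f x = g x) -> {ae mu, forall x, D x -> P x} -> ae_eq mu D f g.
Proof. by move=> H; rewrite /ae_eq; apply: filterS => x h Dx; apply: H => //; exact: h. Qed.

Lemma ae_eq_imp (U W : Type) (f g : T -> U) (f' g' : T -> W) :
  (forall x, D x -> f x = g x -> f' x = g' x) -> ae_eq mu D f g -> ae_eq mu D f' g'.
Proof. by move=> H; rewrite /ae_eq; apply: filterS => x h Dx; apply: H => //; exact: h. Qed.

Lemma integ_ae f g : measurable_fun D f -> integ g -> ae_eq mu D f g -> integ f.
Proof.
move=> mf hg fg; apply/integrableP; split; first exact/measurable_EFinP.
move/integrableP : hg => [mg]; apply: le_lt_trans.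
rewrite le_eqVlt; apply/orP; left; apply/eqP; apply: ge0_ae_eq_integral => //.
- by apply: measurableT_comp => //; exact/measurable_EFinP.
- exact: measurableT_comp.
- by apply: ae_eq_imp fg => x Dx /= ->.
Qed.

Lemma Rint_ae f g : measurable_fun D f -> measurable_fun D g -> ae_eq mu D f g -> I f = I g.
Proof.
move=> mf mg fg; congr fine; apply: ae_eq_integral => //; try exact/measurable_EFinP.
by apply: ae_eq_imp fg => x Dx /= ->.
Qed.

Lemma Rint_le f g : integ f -> integ g -> (forall x, D x -> f x <= g x) -> I f <= I g.
Proof. exact: le_Rintegral. Qed.

Lemma Rint_ge0 f : (forall x, D x -> 0 <= f x) -> 0 <= I f.
Proof. exact: Rintegral_ge0. Qed.

Lemma Rint_eq0_ae f : (forall x, D x -> 0 <= f x) -> integ f -> I f = 0 ->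
  ae_eq mu D f (cst 0).
Proof.
move=> f0 hf i0.
have := (ae_eq_integral_abs mu mD (measurable_int mu hf)).1.
have fin : (\int[mu]_(x in D) (f x)%:E)%E \is a fin_num by exact: integrable_fin_num.
have -> : (\int[mu]_(x in D) `|(EFin \o f) x|)%E = 0%E.
  rewrite (eq_integral (EFin \o f)); last first.
    by move=> x; rewrite inE => Dx /=; rewrite ger0_norm// f0.
  by rewrite -(fineK fin); move: i0; rewrite /Rintegral => ->.
by move=> /(_ erefl); apply: ae_eq_imp => x Dx /= [].
Qed.

Lemma EFin_Rint f : integ f -> (I f)%:E = (\int[mu]_(x in D) (f x)%:E)%E.
Proof. by move=> hf; rewrite /Rintegral fineK//; exact: integrable_fin_num. Qed.

Lemma ge0_integ f : measurable_fun D f -> (forall x, D x -> 0 <= f x) ->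
  (\int[mu]_(x in D) (f x)%:E < +oo)%E -> integ f.
Proof.
move=> mf f0 h; apply/integrableP; split; first exact/measurable_EFinP.
rewrite (eq_integral (EFin \o f))// => x; rewrite inE => Dx /=.
by rewrite ger0_norm// f0.
Qed.

Lemma integ_lty f : integ f -> (\int[mu]_(x in D) (f x)%:E < +oo)%E.
Proof. by move=> hf; rewrite -EFin_Rint// ltry. Qed.

Lemma dct (f_ : nat -> T -> R) f g : (forall k : nat, measurable_fun D (f_ k)) -> measurable_fun D f ->
  {ae mu, forall x, D x -> f_ ^~ x @ \oo --> f x} -> integ g ->
  {ae mu, forall x (k : nat), D x -> `|f_ k x| <= g x} ->
  integ f /\ I (f_ k) @[k --> \oo] --> I f.
Proof.
move=> mf_ mf cf hg fg.
have [|||||h1 _ h2] := @dominated_convergence _ T R mu D mD (fun k => EFin \o f_ k)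
  (EFin \o f) (EFin \o g).
- by move=> k; exact/measurable_EFinP.
- exact/measurable_EFinP.
- by apply: filterS cf => x h Dx; apply: cvg_EFin; [exact: nearW|exact: h].
- exact: hg.
- by apply: filterS fg => x h k Dx /=; rewrite lee_fin; exact: h.
split => //; apply: fine_cvg; rewrite fineK; first exact: h2.
exact: integrable_fin_num.
Qed.

Lemma fatou_ae (f_ : nat -> T -> R) f (C : R) : (forall k, measurable_fun D (f_ k)) ->
  measurable_fun D f -> (forall k x, D x -> 0 <= f_ k x) ->
  (forall x, D x -> 0 <= f x) ->
  {ae mu, forall x, D x -> f_ ^~ x @ \oo --> f x} ->
  (forall k, (\int[mu]_(x in D) (f_ k x)%:E <= C%:E)%E) ->
  integ f /\ I f <= C.
Proof.
move=> mf_ mf f0_ f0 cf bd.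
have h : (\int[mu]_(x in D) (f x)%:E <= C%:E)%E.
  apply: (@le_trans _ _ (\int[mu]_(x in D) limn_einf (fun k => (f_ k x)%:E))%E); last first.
    apply: le_trans (fatou mu mD (f := fun k => EFin \o f_ k) _ _) _.
    - by move=> k; exact/measurable_EFinP.
    - by move=> k x Dx; rewrite lee_fin f0_.
    - rewrite limn_einf_lim; apply: lime_le; first exact: is_cvg_einfs.
      apply: nearW => k; apply: le_trans (bd k).
      by apply: ereal_inf_lbound; exists k => /=.
  have ml : measurable_fun D (fun x => limn_einf (fun k => (f_ k x)%:E)).
    rewrite /limn_einf; apply: measurableT_comp => //.
    apply: measurable_fun_limn_esup => k; apply: measurableT_comp => //.
    exact/measurable_EFinP.
  rewrite le_eqVlt; apply/orP; left; apply/eqP; apply: ae_eq_integral => //.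
    exact/measurable_EFinP.
  apply: ae_imp_eq cf => x Dx h.
  have /cvg_limn_einf_sup[-> _] // : (fun k => (f_ k x)%:E) @ \oo --> (f x)%:E.
  by apply: cvg_EFin => //; exact: nearW.
have hf : integ f by apply: ge0_integ => //; apply: le_lt_trans h _; rewrite ltry.
by split=> //; rewrite -lee_fin EFin_Rint.
Qed.

(** By monotone convergence the sum of the h k is integrable, hence finite almost everywhere, where
    its terms tend to 0. *)
Lemma ae_cvg0_of_summable (h : nat -> T -> R) (C : R) :
  (forall k, integ (h k)) -> (forall k x, D x -> 0 <= h k x) ->
  (forall k, \sum_(0 <= i < k) I (h i) <= C) ->
  {ae mu, forall x, D x -> h ^~ x @ \oo --> 0}.
Proof.
move=> hh h0 hC.
have mh k : measurable_fun D (EFin \o h k) by exact: measurable_int (hh k).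
have h0' k x : D x -> (0 <= (h k x)%:E)%E by move=> Dx; rewrite lee_fin h0.
have fin : (\int[mu]_(x in D) \sum_(k <oo) (h k x)%:E < +oo)%E.
  rewrite (integral_nneseries mu mD mh h0').
  apply: (@le_lt_trans _ _ C%:E); last by rewrite ltry.
  apply: lime_le.
    by apply: is_cvg_nneseries => k _ _; apply: integral_ge0 => x Dx; exact: h0'.
  apply: nearW => k; rewrite (eq_bigr (fun i => (I (h i))%:E)); last first.
    by move=> i _; rewrite EFin_Rint.
  by rewrite sumEFin lee_fin.
have ms : measurable_fun D (fun x => \sum_(k <oo) (h k x)%:E)%E.
  apply: (ge0_emeasurable_sum (h := fun k x => (h k x)%:E) (P := xpredT)).
    by move=> k x Dx _; exact: h0'.
  by move=> k _; exact: mh.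
have iS : mu.-integrable D (fun x => \sum_(k <oo) (h k x)%:E)%E.
  apply/integrableP; split => //.
  rewrite (eq_integral (fun x => \sum_(k <oo) (h k x)%:E)%E)// => x; rewrite inE => Dx.
  by rewrite gee0_abs//; apply: nneseries_ge0 => k _ _; exact: h0'.
apply: filterS (integrable_ae mD iS) => x fx Dx.
have sf : (\sum_(k <oo) (h k x)%:E < +oo)%E.
  have := fx Dx; rewrite ge0_fin_numE//.
  by apply: nneseries_ge0 => k _ _; exact: h0'.
have tc := nneseries_tail_cvg sf (fun k _ => h0' k x Dx).
suff : (h k x)%:E @[k --> \oo] --> 0%E by move=> /fine_cvgP[_].
apply: (squeeze_cvge _ (cvg_cst 0%E) tc); apply: nearW => k.
rewrite h0'//= (@nneseries_split _ _ k 1)//; last by move=> i _; exact: h0'.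
rewrite addn1 big_nat1 leeDl//; apply: nneseries_ge0 => i _ _; exact: h0'.
Qed.

Definition sqinteg f := measurable_fun D f /\ integ (fun x => f x ^+ 2).

Definition dot f g : R := I (fun x => f x * g x).

Lemma sqinteg_mul f g : sqinteg f -> sqinteg g -> integ (fun x => f x * g x).
Proof.
move=> [mf hf] [mg hg]; apply: (@integ_le _ (fun x => f x ^+ 2 + g x ^+ 2)).
- exact: measurable_funM.
- move=> x Dx; rewrite normrM -(real_normK (num_real (f x))) -(real_normK (num_real (g x))).
  have := sqr_ge0 (`|f x| - `|g x|); have := sqr_ge0 `|f x|; have := sqr_ge0 `|g x|.
  by rewrite sqrrB; lra.
- exact: integD.
Qed.

Lemma sqinteg0 : sqinteg (fun=> 0).
Proof.
split; first exact: measurable_cst.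
by apply: (@integ_ext (fun=> 0)) (integrable0 _ _) => x _; rewrite expr0n.
Qed.

Lemma sqintegZD (a : R) f g : sqinteg f -> sqinteg g -> sqinteg (fun x => a * f x + g x).
Proof.
move=> sf sg; have [mf hf] := sf; have [mg hg] := sg; split.
  by apply: measurable_funD => //; apply: measurable_funM => //; exact: measurable_cst.
apply: (@integ_ext (fun x => a ^+ 2 * f x ^+ 2 + (2 * a) * (f x * g x) + g x ^+ 2)).
  by move=> x _; lra.
by apply: integD => //; apply: integD; apply: integZ => //; exact: sqinteg_mul.
Qed.

(** The codomain [R^o], that is R as a module over itself, gives the function space the left module
    structure that [semi_ip] asks for. *)
Lemma semi_ip_dot : @semi_ip R (T -> R^o) sqinteg dot.
Proof.
split.
- exact: sqinteg0.
- by move=> a x y; exact: sqintegZD.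
- by move=> f g _ _; apply: Rint_ext => x _; rewrite mulrC.
- move=> a f g h sf sg sh; rewrite /dot.
  have h1 := sqinteg_mul sf sh; have h2 := sqinteg_mul sg sh.
  rewrite -RintegralZl// -RintegralD//; last exact: (integZ a h1).
  by apply: Rint_ext => x _ /=; rewrite mulrDl mulrA.
- by move=> f sf; apply: Rint_ge0 => x _; rewrite -expr2 sqr_ge0.
Qed.

Local Notation nrm2 := (@nrm R (T -> R^o) dot).

Lemma dotE f : dot f f = I (fun x => f x ^+ 2).
Proof. by apply: Rint_ext => x _; rewrite expr2. Qed.

Lemma nrm2_eq0 f : sqinteg f -> nrm2 f = 0 -> ae_eq mu D f (cst 0).
Proof.
move=> [mf hf] /eqP; rewrite /nrm sqrtr_eq0 => h.
have /Rint_eq0_ae : I (fun x => f x ^+ 2) = 0.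
  by apply/eqP; rewrite eq_le -dotE h dotE Rint_ge0// => x _; rewrite sqr_ge0.
move=> /(_ (fun x _ => sqr_ge0 (f x)) hf); apply: ae_eq_imp => x Dx /= /eqP.
by rewrite sqrf_eq0 => /eqP.
Qed.

Lemma sqinteg_ae f g : sqinteg f -> measurable_fun D g -> ae_eq mu D g f -> sqinteg g.
Proof.
move=> [mf hf] mg e; split => //; apply: integ_ae hf _; first exact: measurable_funX.
by apply: ae_eq_imp e => x Dx ->.
Qed.

Lemma dot_ae f f' g : sqinteg f -> sqinteg f' -> sqinteg g -> ae_eq mu D f f' ->
  dot f g = dot f' g.
Proof.
move=> sf sf' sg e; apply: Rint_ae.
- exact: (integ_measurable (sqinteg_mul sf sg)).
- exact: (integ_measurable (sqinteg_mul sf' sg)).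
- by apply: ae_eq_imp e => x Dx ->.
Qed.

Lemma nrm2_cvg_ae (f_ : nat -> T -> R) f : (forall k, sqinteg (f_ k)) -> sqinteg f ->
  nrm2 ((f_ k : T -> R^o) - f) @[k --> \oo] --> 0 ->
  exists s, subsequence s /\ {ae mu, forall x, D x -> f_ (s k) x @[k --> \oo] --> f x}.
Proof.
move=> sf_ sf cf.
have P k N : exists i, (N <= i)%N /\ I (fun x => (f_ i x - f x) ^+ 2) <= 2^-1 ^+ k.
  have e0 : 0 < Num.sqrt (2^-1 ^+ k) :> R by rewrite sqrtr_gt0 exprn_gt0.
  have /cvgr0Pnorm_le/(_ _ e0)[M _ HM] := cf.
  exists (maxn N M); split; first exact: leq_maxl.
  have := HM (maxn N M) (leq_maxr _ _); rewrite /= ger0_norm ?nrm_ge0//.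
  by rewrite /nrm ler_sqrt ?exprn_ge0// dotE.
have [s [hs Hs]] := exists_subsequence P; exists s; split => //.
have h k : integ (fun x => (f_ (s k) x - f x) ^+ 2).
  have [] // := sqintegZD (-1) sf (sf_ (s k)).
  by move=> _; apply: integ_ext => x _; rewrite mulN1r addrC.
have := @ae_cvg0_of_summable (fun k x => (f_ (s k) x - f x) ^+ 2) 2 h.
move=> /(_ (fun k x _ => sqr_ge0 _)) H.
apply: filterS (H _) => [x {}H Dx|k].
  have /cvgr0Pnorm_le {}H := H Dx.
  apply/cvgrPdist_le => e e0; have e2 : 0 < e ^+ 2 by rewrite exprn_gt0.
  apply: filterS (H _ e2) => k; rewrite normrX distrC.
  by rewrite ler_pXn2r ?nnegrE// ltW.
apply: (@le_trans _ _ (\sum_(0 <= i < k) 2^-1 ^+ i)).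
  by apply: ler_sum => i _; exact: Hs.
rewrite big_mkord; have := @subrX1 R 2^-1 k => E.
have : 0 <= 2^-1 ^+ k :> R by rewrite exprn_ge0.
by move: E; set S := \sum_(i < _) _; lra.
Qed.

(** The Riesz-Fischer theorem. Along a subsequence the squared increments have integral at most
    8^-k, so those multiplied by 4^k tend to 0 almost everywhere; there the increments are
    eventually at most 2^-k and the subsequence is Cauchy. *)
Lemma nrm2_complete : @ip_complete R (T -> R^o) sqinteg dot.
Proof.
move=> f_ sf_ cau; have hS := semi_ip_dot.
have P k N : exists i, (N <= i)%N /\ forall j, (i <= j)%N ->
    nrm2 (f_ j - f_ i) ^+ 2 <= 8^-1 ^+ k.
  have e0 : 0 < Num.sqrt (8^-1 ^+ k) :> R by rewrite sqrtr_gt0 exprn_gt0.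
  have [M HM] := cau _ e0; exists (maxn N M); split; first exact: leq_maxl.
  move=> j hj; have Mj : (M <= j)%N by apply: leq_trans hj; exact: leq_maxr.
  have /ltW := HM j _ Mj (leq_maxr N M).
  rewrite -(@ler_pXn2r _ 2)// ?nnegrE ?nrm_ge0 ?sqrtr_ge0// => h1.
  by apply: le_trans h1 _; rewrite sqr_sqrtr// exprn_ge0.
have [s [hs Hs]] := exists_subsequence P.
pose dk k x := f_ (s k.+1) x - f_ (s k) x.
have sdk k : sqinteg (dk k) by exact: (ipB hS (sf_ _) (sf_ _)).
have h k : integ (fun x => 4 ^+ k * dk k x ^+ 2) by apply: integZ; have [] := sdk k.
have := @ae_cvg0_of_summable (fun k x => 4 ^+ k * dk k x ^+ 2) 2 h.
move=> /(_ (fun k x _ => mulr_ge0 (exprn_ge0 _ (ler0n R 4)) (sqr_ge0 _))) H.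
have {}H : {ae mu, forall x, D x -> cvgn (fun k => f_ (s k) x)}.
  apply: filterS (H _) => [x {}H Dx|k].
    have /cvgr0Pnorm_le/(_ 1 ltr01)[N _ HN] := H Dx.
    have dx k : (N <= k)%N -> `|dk k x| <= 2^-1 ^+ k.
      move=> /HN /=; rewrite normrM normrX ger0_norm ?exprn_ge0//.
      rewrite normrX => h1; rewrite -(@ler_pXn2r _ 2)// ?nnegrE ?exprn_ge0//.
      rewrite -exprM mulnC exprM.
      have -> : 2^-1 ^+ 2 = 4^-1 :> R by rewrite expr2; lra.
      by rewrite exprVn -[leRHS]mul1r ler_pdivlMr ?exprn_gt0// mulrC.
    have tel i m : (N <= i)%N ->
        `|f_ (s i) x - f_ (s (i + m)%N) x| <= 2 * 2^-1 ^+ i - 2 * 2^-1 ^+ (i + m).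
      move=> Ni; elim: m => [|m IH]; first by rewrite addn0 !subrr normr0.
      have := dx (i + m)%N (leq_trans Ni (leq_addr _ _)); rewrite /dk addnS.
      rewrite exprS; move: IH; rewrite !ler_norml => /andP[h1 h2] /andP[h3 h4].
      by apply/andP; split; lra.
    apply/cauchy_cvgP/cauchy_exP => e e0.
    have e2 : 0 < e / 2 by lra.
    have [M _ HM] := near_infty_natSinv_expn_lt (PosNum e2).
    exists (f_ (s (maxn N M)) x); exists (maxn N M) => // j /= hj.
    rewrite /ball /= -(subnKC hj).
    apply: le_lt_trans (tel _ _ (leq_maxl _ _)) _.
    have := HM _ (leq_maxr N M); rewrite /= div1r -exprVn.
    have : 0 <= 2^-1 ^+ (maxn N M + (j - maxn N M)) :> R by rewrite exprn_ge0.
    lra.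
  apply: (@le_trans _ _ (\sum_(0 <= i < k) 2^-1 ^+ i)).
    apply: ler_sum => i _; rewrite RintegralZl//; last by have [] := sdk i.
    have := Hs i (s i.+1) (ltnW (hs _ _ (ltnSn i))).
    rewrite (nrm_sqr hS) ?dotE; last exact: (ipB hS).
    move=> h1; have := ler_wpM2l (exprn_ge0 i (ler0n R 4)) h1.
    rewrite -exprMn; have -> : 4 * 8^-1 = 2^-1 :> R by lra.
    by [].
  rewrite big_mkord; have := @subrX1 R 2^-1 k => E.
  have : 0 <= 2^-1 ^+ k :> R by rewrite exprn_ge0.
  by move: E; set S := \sum_(i < _) _; lra.
(* The upper limit is measurable and agrees with the limit wherever that exists. *)
pose f x := fine (limn_esup (fun k => (f_ (s k) x)%:E)).
have mf : measurable_fun D f.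
  apply: measurableT_comp; first exact: fine_measurable.
  by apply: measurable_fun_limn_esup => k; apply/measurable_EFinP; have [] := sf_ (s k).
have cf : {ae mu, forall x, D x -> f_ (s k) x @[k --> \oo] --> f x}.
  apply: filterS H => x h' Dx; have /cvg_ex[l hl] := h' Dx.
  suff -> : f x = l by [].
  rewrite /f; have /cvg_limn_einf_sup[_ ->] // : (fun k => (f_ (s k) x)%:E) @ \oo --> l%:E.
  by apply: cvg_EFin => //; exact: nearW.
(* Fatou's lemma along the subsequence turns the Cauchy bound into a bound on the distance to f; the
   shift by N puts its indices in the range of the Cauchy bound. *)
have key e : 0 < e -> exists N, forall i, (N <= i)%N ->
    integ (fun x => (f_ i x - f x) ^+ 2) /\ I (fun x => (f_ i x - f x) ^+ 2) <= e ^+ 2.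
  move=> e0; have [N HN] := cau e e0; exists N => i Ni.
  apply: (@fatou_ae (fun k x => (f_ i x - f_ (s (k + N)%N) x) ^+ 2)).
  - move=> k; apply: measurable_funX; apply: measurable_funB; first by have [] := sf_ i.
    by have [] := sf_ (s (k + N)%N).
  - by apply: measurable_funX; apply: measurable_funB => //; have [] := sf_ i.
  - by move=> k x _; exact: sqr_ge0.
  - by move=> x _; exact: sqr_ge0.
  - apply: filterS cf => x h' Dx; have {}h' := h' Dx.
    have h2 : f_ i x - f_ (s (k + N)%N) x @[k --> \oo] --> f_ i x - f x.
      apply: cvgB; first exact: cvg_cst.
      apply: (cvg_subsequence (s := fun k => (k + N)%N) _ h') => a b.
      by rewrite ltn_add2r.
    under eq_fun do rewrite expr2; rewrite expr2; exact: cvgM.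
  - move=> k; have sB : sqinteg (f_ i \- f_ (s (k + N)%N)) := ipB hS (sf_ i) (sf_ _).
    rewrite -EFin_Rint; last by have [] := sB.
    rewrite lee_fin -(dotE (f_ i \- f_ (s (k + N)%N))) -(nrm_sqr hS sB).
    rewrite ler_pXn2r ?nnegrE ?nrm_ge0 ?(ltW e0)//; apply/ltW/HN => //.
    by apply: leq_trans (leq_addl k N) _; exact: subsequence_ge.
have sf : sqinteg f.
  have [N HN] := key 1 ltr01.
  have sB : sqinteg (fun x => f_ N x - f x).
    split; last exact: (HN N (leqnn N)).1.
    by apply: measurable_funB => //; have [] := sf_ N.
  have := sqintegZD (-1) sB (sf_ N).
  suff -> : (fun x => -1 * (f_ N x - f x) + f_ N x) = f by [].
  by apply/funext => x; lra.
exists f => //; apply/cvgr0Pnorm_le => e e0.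
have [N HN] := key e e0; exists N => // i /= /HN[_ h1].
rewrite ger0_norm ?nrm_ge0// -(@ler_pXn2r _ 2)// ?nnegrE ?nrm_ge0 ?(ltW e0)//.
by rewrite (nrm_sqr hS) ?dotE//; exact: (ipB hS).
Qed.

End integration.

Section support.
Context d (T : measurableType d) (R : realType) (mu : {measure set T -> \bar R}).
Variables (D Q : set T) (f : T -> R).
Hypotheses (mD : measurable D) (mQ : measurable Q).
Hypothesis f0 : forall x, D x -> ~ Q x -> f x = 0.

Lemma restrict_supp (a : R -> \bar R) : a 0 = 0%E -> (a \o f) \_ (D `&` Q) = (a \o f) \_ D.
Proof.
move=> a0; apply/funext => x; rewrite !patchE.
case: ifPn => [/set_mem[Dx Qx]|]; first by rewrite mem_set.
rewrite notin_setE => nDQ; case: ifPn => // /set_mem Dx /=.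
by rewrite f0// => Qx; apply: nDQ.
Qed.

Lemma integ_supp : integ mu (D `&` Q) f -> integ mu D f.
Proof.
rewrite /integ => /(integrable_mkcond _ (measurableI _ _ mD mQ)).
by rewrite restrict_supp// => /(integrable_mkcond _ mD).
Qed.

Lemma Rint_supp : \int[mu]_(x in D `&` Q) f x = \int[mu]_(x in D) f x.
Proof.
by rewrite /Rintegral integral_mkcond [in RHS]integral_mkcond -(restrict_supp (a := EFin)).
Qed.
End support.

(** * Lebesgue measure on boxes and cubes *)

Section row_vectors.
Context {R : realType} {n : nat}.
Implicit Types x y a h : 'rV[R]_n.

Lemma rV_coord_le x i : `|x 0 i| <= `|x|.
Proof.
rewrite [leRHS]/Num.norm /= mx_normrE; apply/bigmax_geP; right => /=.
by exists (0, i).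
Qed.

Lemma rV_norm_le x (M : R) : 0 <= M -> (forall i, `|x 0 i| <= M) -> `|x| <= M.
Proof.
move=> M0 H; rewrite [leLHS]/Num.norm /= mx_normrE; apply/bigmax_leP; split => //=.
by move=> [i j] _ /=; rewrite (ord1 i).
Qed.

Lemma rV_ball x y (r : R) : 0 < r -> (forall i, `|x 0 i - y 0 i| < r) -> ball x r y.
Proof.
move=> r0 H; rewrite -ball_normE/= /ball_/=.
rewrite [ltLHS]/Num.norm /= mx_normrE; apply/bigmax_ltP; split => //=.
by move=> [i j] _ /=; rewrite (ord1 i) !mxE.
Qed.

Local Notation leb := (lebesgue_rV R n).
Local Notation measurable := (@measurable _ 'rV[R]_n).

Definition cut_hi (i : 'I_n) (c : R) (ab : 'rV[R]_n * 'rV[R]_n) :=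
  (ab.1, \row_j if j == i then Num.min (ab.2 0 j) c else ab.2 0 j) : 'rV[R]_n * 'rV[R]_n.
Definition cut_lo (i : 'I_n) (c : R) (ab : 'rV[R]_n * 'rV[R]_n) :=
  (\row_j (if j == i then Num.max (ab.1 0 j) c else ab.1 0 j), ab.2) : 'rV[R]_n * 'rV[R]_n.

Lemma box_volume_cut i c ab :
  box_volume (cut_hi i c ab) + box_volume (cut_lo i c ab) = box_volume ab.
Proof.
rewrite /box_volume !(bigD1 (P := xpredT) i)//=.
have e1 (F1 F2 : 'I_n -> R) : (forall j, j != i -> F1 j = F2 j) ->
  \prod_(j < n | j != i) F1 j = \prod_(j < n | j != i) F2 j by move=> H; apply: eq_bigr.
rewrite (e1 _ (fun j => Num.max 0 (ab.2 0 j - ab.1 0 j))); last first.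
  by move=> j /negPf ji; rewrite mxE ji.
rewrite [X in _ + _ * X](e1 _ (fun j => Num.max 0 (ab.2 0 j - ab.1 0 j))); last first.
  by move=> j /negPf ji; rewrite mxE ji.
rewrite -mulrDl; congr (_ * _); rewrite !mxE eqxx.
move: (ab.1 0 i) (ab.2 0 i) => a b.
by case: (leP b c) => ?; case: (leP a c) => ?; do ?case: (leP 0 _) => ?; lra.
Qed.

(** Cutting every box of a cover of X along the hyperplane x_i = c gives covers of the two parts of
    X whose volumes add up to the original ones: this is Caratheodory's criterion. *)
Lemma measurable_halfspace i (c : R) : measurable [set x : 'rV[R]_n | x 0 i <= c].
Proof.
apply: le_caratheodory_measurable => X /=.
apply: le_ereal_inf_tmp => _ [DB XDB <-].
pose D1 := (DB.1, cut_hi i c \o DB.2); pose D2 := (DB.1, cut_lo i c \o DB.2).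
have c1 : box_cover (X `&` [set x : 'rV[R]_n | x 0 i <= c]) D1.
  move=> x [/XDB[k Dk Hk] xc]; exists k => // j /=; rewrite mxE.
  by have /andP[-> h] := Hk j; case: eqP => [ji|//]; rewrite le_min h ji.
have c2 : box_cover (X `&` ~` [set x : 'rV[R]_n | x 0 i <= c]) D2.
  move=> x [/XDB[k Dk Hk] /negP]; rewrite -ltNge => xc; exists k => // j /=; rewrite mxE.
  by have /andP[h ->] := Hk j; case: eqP => [ji|_]; rewrite ?gt_max h ?ji ?xc.
apply: (@le_trans _ _ (\sum_(0 <= k <oo | D1.1 k) (box_volume (D1.2 k))%:E +
    \sum_(0 <= k <oo | D2.1 k) (box_volume (D2.2 k))%:E)%E).
  by apply: leeD; apply: ereal_inf_lbound; [exists D1|exists D2].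
rewrite -nneseriesD; last 2 first.
  by move=> k _ _; rewrite lee_fin box_volume_ge0.
  by move=> k _ _; rewrite lee_fin box_volume_ge0.
by apply: lee_nneseries => [k _ _|k _]; rewrite -EFinD box_volume_cut// lee_fin box_volume_ge0.
Qed.

Lemma measurable_box ab : measurable (box ab).
Proof.
have -> : box ab = \bigcap_(i in [set: 'I_n])
    ([set x : 'rV[R]_n | x 0 i <= ab.2 0 i] `\` [set x : 'rV[R]_n | x 0 i <= ab.1 0 i]).
  apply/seteqP; split=> x /= H i.
    by move=> _; have /andP[h1 h2] := H i; split => //=; apply/negP; rewrite -ltNge.
  by have [/= -> /negP] := H i I; rewrite -ltNge => ->.
apply: fin_bigcap_measurable => // i _; apply: measurableD; exact: measurable_halfspace.
Qed.

Definition transl h x : 'rV[R]_n := x + h.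

Lemma lebesgue_outer_shift_le h A : (leb (transl h @^-1` A) <= leb A)%E.
Proof.
apply: le_ereal_inf_tmp => _ [DB ADB <-]; apply: ereal_inf_lbound.
exists (DB.1, fun k => ((DB.2 k).1 - h, (DB.2 k).2 - h)).
  move=> x /= /ADB[k Dk Hk]; exists k => // i /=; have := Hk i.
  by rewrite /transl !mxE => /andP[h1 h2]; apply/andP; split; lra.
congr (limn _); apply/funext => m; apply: eq_bigr => k _; congr EFin.
by apply: eq_bigr => i _ /=; rewrite !mxE; congr (Num.max _ _); lra.
Qed.

Lemma lebesgue_outer_shift h A : leb (transl h @^-1` A) = leb A.
Proof.
apply/eqP; rewrite eq_le lebesgue_outer_shift_le/=.
have {1}-> : A = transl (- h) @^-1` (transl h @^-1` A).
  by apply/seteqP; split=> x /=; rewrite /transl subrK.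
exact: lebesgue_outer_shift_le.
Qed.

Lemma measurable_shift_set h A : measurable A -> measurable (transl h @^-1` A).
Proof.
move=> mA; have {}mA : leb.-caratheodory A := mA.
suff : leb.-caratheodory (transl h @^-1` A) by [].
move=> X.
have E (Y : set 'rV[R]_n) : Y = transl h @^-1` (transl (- h) @^-1` Y).
  by apply/seteqP; split=> x /=; rewrite /transl addrK.
rewrite {2 3}(E X) preimage_setC -!preimage_setI !lebesgue_outer_shift.
by have := mA (transl (- h) @^-1` X); rewrite lebesgue_outer_shift.
Qed.

Lemma measurable_shift h : measurable_fun setT (transl h : 'rV[R]_n -> 'rV[R]_n).
Proof. by move=> _ A mA; rewrite setTI; exact: measurable_shift_set. Qed.

Lemma integral_shift h (D : set 'rV[R]_n) (f : 'rV[R]_n -> \bar R) :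
  measurable D -> measurable_fun D f -> {in D, forall x, 0 <= f x}%E ->
  (\int[leb]_(x in transl h @^-1` D) f (transl h x) = \int[leb]_(x in D) f x)%E.
Proof.
move=> mD mf f0.
rewrite -(ge0_integral_pushforward (measurable_shift h) leb mD mf f0).
apply: eq_measure_integral => [|? A mA _]; first exact: measurable_shift.
by rewrite /pushforward; exact: lebesgue_outer_shift.
Qed.

Lemma lebesgue_bounded_lty A : bounded_set A -> (leb A < +oo)%E.
Proof.
move=> [M0 [_ HM0]]; pose M := M0 + 1.
have AM : A `<=` [set x | `|x| <= M] by move=> x Ax; apply: HM0 Ax; rewrite ltrDl.
(* The margin 1 is for the lower faces, which a box does not contain. *)
pose b : 'rV[R]_n := const_mx (M + 1).
apply: (@le_lt_trans _ _ (box_volume (- b, b))%:E); last by rewrite ltry.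
apply: ereal_inf_lbound; exists (pred1 0%N : pred nat, fun=> (- b, b)) => /=.
  move=> x /AM /= xM; exists 0%N => //= i; rewrite !mxE.
  by have := le_trans (rV_coord_le x i) xM; rewrite ler_norml => /andP[h1 h2]; apply/andP; split; lra.
rewrite eseries_mkcond (@nneseries_split _ _ 0 1)//; last first.
  by move=> k _; case: ifP => // _; rewrite lee_fin box_volume_ge0.
by rewrite big_nat1/= eseries0 ?adde0// => -[].
Qed.

(* Every open set is the union of the boxes of the grids of mesh [1/(m+1)] whose
   closures it contains. *)
Lemma open_bigcup_boxes (U : set 'rV[R]_n) : open U ->
  exists (D : pred nat) (ab : nat -> 'rV[R]_n * 'rV[R]_n),
    U = \bigcup_(k in [set k | D k]) box (ab k) /\
    forall k, D k -> [set x : 'rV[R]_n | forall i, (ab k).1 0 i <= x 0 i <= (ab k).2 0 i] `<=` U.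
Proof.
move=> oU.
pose ab (z : 'rV[int]_n * nat) : 'rV[R]_n * 'rV[R]_n :=
  (\row_i ((z.1 0 i - 1)%:~R / z.2.+1%:R), \row_i ((z.1 0 i)%:~R / z.2.+1%:R)).
pose cl z := [set x : 'rV[R]_n | forall i, (ab z).1 0 i <= x 0 i <= (ab z).2 0 i].
pose D (k : nat) := if unpickle k is Some z then `[< cl z `<=` U >] else false.
pose AB (k : nat) := if unpickle k is Some z then ab z else (0, 0).
exists D, AB; split; last first.
  by move=> k; rewrite /D /AB; case: unpickle => // z /asboolP.
have bc z : box (ab z) `<=` cl z.
  by move=> x H i; have /andP[h1 h2] := H i; rewrite ltW.
apply/seteqP; split => x; last first.
  by move=> [k]; rewrite /= /D /AB; case: unpickle => // z /asboolP h /bc; exact: h.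
move=> Ux; have /nbhs_ballP[r /= r0 rU] : nbhs x U by exact: open_nbhs_nbhs.
have [m _ Hm] := near_infty_natSinv_lt (PosNum r0).
have {}Hm := Hm m (leqnn m); rewrite /= in Hm.
pose z : 'rV[int]_n * nat := (\row_i Num.ceil (x 0 i * m.+1%:R), m).
have m0 : 0 < m.+1%:R :> R by rewrite ltr0n.
have bz : box (ab z) x.
  move=> i; rewrite !mxE ltr_pdivrMr// ler_pdivlMr//; exact: ceil_itv.
exists (pickle z); rewrite /= /D /AB pickleK//.
apply/asboolP => y H; apply: rU; apply: rV_ball => // i.
have := bz i; have := H i; rewrite !mxE; change z.2 with m.
move=> /andP[h1 h2] /andP[h3 h4].
apply: le_lt_trans Hm; rewrite intrD mulrBl div1r in h1 h3.
move: h1 h2 h3 h4; set u := (Num.ceil _)%:~R / _; set v := _^-1 => h1 h2 h3 h4.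
by rewrite ler_norml; apply/andP; split; lra.
Qed.

Lemma open_measurable_rV (U : set 'rV[R]_n) : open U -> measurable U.
Proof.
move=> /open_bigcup_boxes[D [ab [-> _]]].
by apply: bigcup_measurable => k _; exact: measurable_box.
Qed.

Lemma continuous_measurable_rV (f : 'rV[R]_n -> R) : continuous f -> measurable_fun setT f.
Proof.
move=> cf; apply: (measurability _ (RGenOInfty.measurableE R)).
move=> _ [_ [a ->]] <-; rewrite setTI; apply: open_measurable_rV.
by apply: open_comp; [move=> x _; exact: cf|rewrite set_itvoy; exact: open_gt].
Qed.

Definition cube (a : 'rV[R]_n) (s : R) := box (a, a + const_mx s).

Lemma measurable_cube a s : measurable (cube a s).
Proof. exact: measurable_box. Qed.

Lemma cubeP a s x : cube a s x <-> forall i, a 0 i < x 0 i <= a 0 i + s.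
Proof. by split=> H i; have := H i; rewrite /= !mxE. Qed.

Lemma cube_shift h a s : transl h @^-1` (cube a s) = cube (a - h) s.
Proof.
apply/seteqP; split=> x /cubeP H; apply/cubeP => i; have := H i; rewrite !mxE;
  move=> /andP[h1 h2]; apply/andP; split; lra.
Qed.

(** The product formula s^n is never established: the estimates rely on translation invariance, on
    the scaling [vol_half], and on the positivity of [vol], which is drawn from (a_3) at the end. *)
Definition vol (s : R) : R := fine (leb (cube 0 s)).

Lemma bounded_cube a (s : R) : bounded_set (cube a s).
Proof.
exists (`|a| + `|s|); split; first exact: num_real.
move=> M hM x /cubeP H; apply: rV_norm_le.
  by apply: ltW; apply: le_lt_trans hM; rewrite addr_ge0.
move=> i; have /andP[h1 h2] := H i; have := rV_coord_le a i.
have := ler_norm s; have := normr_ge0 s; rewrite !ler_norml => ? ? /andP[? ?]; apply/andP; split; lra.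
Qed.

Lemma leb_cube_lty a s : (leb (cube a s) < +oo)%E.
Proof.
exact/lebesgue_bounded_lty/bounded_cube.
Qed.

Lemma leb_cube a s : leb (cube a s) = (vol s)%:E.
Proof.
rewrite /vol fineK; last by rewrite ge0_fin_numE ?leb_cube_lty.
by rewrite -(lebesgue_outer_shift a) cube_shift subrr.
Qed.

Lemma vol_ge0 s : 0 <= vol s. Proof. by rewrite fine_ge0. Qed.

Definition child (a : 'rV[R]_n) (s : R) (b : {ffun 'I_n -> bool}) : 'rV[R]_n :=
  \row_i (a 0 i + (s / 2) * (b i)%:R).

Lemma child_sub a (s : R) (b : {ffun 'I_n -> bool}) : 0 <= s -> cube (child a s b) (s / 2) `<=` cube a s.
Proof.
move=> s0 x /cubeP H; apply/cubeP => i; have := H i; rewrite !mxE.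
by case: (b i); rewrite ?mulr1 ?mulr0 => /andP[h1 h2]; apply/andP; split; lra.
Qed.

Lemma cube_child a (s : R) x : 0 <= s -> cube a s x ->
  forall b : {ffun 'I_n -> bool}, cube (child a s b) (s / 2) x <-> b = [ffun i => a 0 i + s / 2 < x 0 i].
Proof.
move=> s0 /cubeP Hx b; split.
  move=> /cubeP H; apply/ffunP => i; rewrite ffunE; have := H i; rewrite !mxE.
  by case: (b i); rewrite ?mulr1 ?mulr0 => /andP[h1 h2]; apply/esym;
    [lra|apply/negbTE; rewrite -leNgt; lra].
move=> ->; apply/cubeP => i; rewrite !mxE ffunE; have /andP[h1 h2] := Hx i.
by case: (ltP (a 0 i + s / 2) (x 0 i)) => h3; rewrite ?mulr1 ?mulr0; apply/andP; split; lra.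
Qed.

Lemma Rint_children a (s : R) (f : 'rV[R]_n -> R) : 0 <= s -> integ leb (cube a s) f ->
  \int[leb]_(x in cube a s) f x =
  \sum_(b : {ffun 'I_n -> bool}) \int[leb]_(x in cube (child a s b) (s / 2)) f x.
Proof.
move=> s0 hf; rewrite Rintegral_mkcond.
under eq_bigr do rewrite Rintegral_mkcond.
rewrite -big_enum -(Rint_sum measurableT); last first.
  move=> b; rewrite /integ -restrict_EFin; apply/(integrable_mkcond _ (measurable_cube _ _)).
  by apply: integrableS hf; [exact: measurable_cube|exact: measurable_cube|exact: child_sub].
apply: Rint_ext => x _; rewrite big_enum/= patchE; case: ifPn => xQ; last first.
  rewrite big1// => b _; rewrite patchE; case: ifPn => // /set_mem/(child_sub s0) h.
  by move: xQ; rewrite notin_setE.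
have {}xQ := set_mem xQ; pose b0 : {ffun 'I_n -> bool} := [ffun i => a 0 i + s / 2 < x 0 i].
rewrite (bigD1 b0)//= big1 ?addr0; last first.
  move=> b bb; rewrite patchE; case: ifPn => // /set_mem /(cube_child s0 xQ) e.
  by rewrite e eqxx in bb.
by rewrite patchE mem_set//; exact/(cube_child s0 xQ).
Qed.

Lemma Rint_cst_cube a (s r : R) : \int[leb]_(x in cube a s) r = r * vol s.
Proof.
rewrite Rintegral_cst; last exact: measurable_cube.
by congr (_ * _); exact: (congr1 fine (leb_cube a s)).
Qed.

Lemma integ_cst_bounded (D : set 'rV[R]_n) (r : R) : measurable D -> bounded_set D ->
  integ leb D (fun=> r).
Proof.
move=> mD bD; apply: (integ_ext mD (f := fun x => r * 1)); first by move=> x _; rewrite mulr1.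
apply: (integZ mD); apply: ge0_integ => //.
by rewrite integral_cst ?mul1e//; exact: lebesgue_bounded_lty.
Qed.

Lemma vol_half (s : R) : 0 <= s -> vol s = (2 ^ n)%:R * vol (s / 2).
Proof.
move=> s0; have h := integ_cst_bounded 1 (measurable_cube 0 s) (bounded_cube 0 s).
have := Rint_children s0 h; rewrite Rint_cst_cube mul1r => ->.
rewrite (eq_bigr (fun=> vol (s / 2))); last by move=> b _; rewrite Rint_cst_cube mul1r.
by rewrite sumr_const card_ffun card_bool card_ord mulr_natl.
Qed.

End row_vectors.

(** * Compactly supported functions of class C^1 *)

Section compact_support.
Context {R : realType} {n : nat}.
Local Notation leb := (lebesgue_rV R n).
Implicit Types (f g : 'rV[R]_n -> R) (x y h : 'rV[R]_n) (D : set 'rV[R]_n).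

Definition Cc f := continuous f /\ exists M : R, forall x, M < `|x| -> f x = 0.

Definition C1c f := [/\ forall x, differentiable f x,
  forall i, continuous (partial i f) & exists M : R, forall x, M < `|x| -> f x = 0].

Lemma Cc_bounded f : Cc f -> exists2 C, 0 <= C & forall x, `|f x| <= C.
Proof.
move=> [cf [M HM]].
pose K := [set x : 'rV[R]_n | `|x| <= `|M|].
have cK : compact K.
  apply: bounded_closed_compact.
    by exists `|M|; split=> [|N MN x /= xM]; [exact: num_real|apply: le_trans xM (ltW MN)].
  apply: (closed_comp (f := fun x : 'rV[R]_n => `|x|) (D := [set z | z <= `|M|])).
    by move=> x _; exact: norm_continuous.
  exact: closed_le.
have K0 : K !=set0 by exists 0; rewrite /K/= normr0.
have cg : continuous (fun x => `|f x|).
  by move=> x; apply: continuous_comp; [exact: cf|exact: norm_continuous].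
have [c _ Hc] := EVT_max_rV K0 cK (continuous_subspaceT cg).
exists `|f c| => // x; have [xM|xM] := leP `|x| `|M|; first by apply: Hc; rewrite inE.
by rewrite HM ?normr0//; apply: le_lt_trans xM; exact: ler_norm.
Qed.

Lemma Cc_uniform f (e : R) : Cc f -> 0 < e ->
  exists2 d : R, 0 < d & forall x h, `|h| <= d -> `|f (x + h) - f x| <= e.
Proof.
move=> [cf [M HM]] e0.
(* For x outside this ball and |h| <= 1, both x and x + h are off the support. *)
pose K := [set x : 'rV[R]_n | `|x| <= `|M| + 1].
have cK : compact K.
  apply: bounded_closed_compact.
    by exists (`|M| + 1); split=> [|N MN x /= xM]; [exact: num_real|apply: le_trans xM (ltW MN)].
  apply: (closed_comp (f := fun x : 'rV[R]_n => `|x|) (D := [set z | z <= `|M| + 1])).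
    by move=> x _; exact: norm_continuous.
  exact: closed_le.
have /compact_near_coveringP nc := cK.
have H0 : forall x, K x -> \forall x' \near x & h \near nbhs (0 : 'rV[R]_n), `|f (x' + h) - f x'| <= e.
  move=> x _.
  have c1 : (fun z : 'rV[R]_n * 'rV[R]_n => f (z.1 + z.2)) @ (x, 0) --> f (x + 0).
    by apply: (cvg_comp (fun z : 'rV[R]_n * 'rV[R]_n => z.1 + z.2) f (add_continuous _)); exact: cf.
  have c2 : (fun z : 'rV[R]_n * 'rV[R]_n => f z.1) @ (x, 0) --> f x.
    by apply: (@continuous_comp _ _ _ fst f (x, 0)); [exact: cvg_fst|exact: cf].
  have c3 : f (z.1 + z.2) - f z.1 @[z --> (x, (0 : 'rV[R]_n))] --> f (x + 0) - f x by exact: cvgB.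
  by rewrite addr0 subrr in c3; have /cvgr0Pnorm_le/(_ e e0) := c3.
have H1 : nbhs (0 : 'rV[R]_n) [set h | K `<=` (fun x => `|f (x + h) - f x| <= e)].
  exact: nc H0.
have /nbhs_ballP[d /= d0 Hd] := H1.
 exists (Num.min (d / 2) 1).
  by rewrite lt_min ltr01 divr_gt0.
move=> x h hd; have hd1 : `|h| < d.
  by apply: le_lt_trans hd _; rewrite gt_min; apply/orP; left; lra.
have hd2 : `|h| <= 1 by apply: le_trans hd _; rewrite ge_min lexx orbT.
have [xM|xM] := leP `|x| (`|M| + 1).
  by apply: (Hd h) => //; rewrite -ball_normE/= /ball_/= sub0r normrN.
have nM := ler_norm M.
have nx : M < `|x| by lra.
have nxh : M < `|x + h| by have := ler_normB (x + h) h; rewrite addrK; lra.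
by rewrite (HM x)// (HM (x + h))// subrr normr0 ltW.
Qed.

Lemma Cc_measurable f D : measurable D -> Cc f -> measurable_fun D f.
Proof.
move=> mD [cf _]; apply: measurable_funS (continuous_measurable_rV cf) => //.
Qed.

Lemma Cc_integ f D : measurable D -> Cc f -> integ leb D f.
Proof.
move=> mD hf; have [C C0 HC] := Cc_bounded hf; have [_ [M HM]] := hf.
pose Q := cube (- const_mx (`|M| + 1)) (2 * (`|M| + 1)) : set 'rV[R]_n.
have mQ : measurable Q by exact: measurable_cube.
have hQ : integ leb (D `&` Q) f.
  have mDQ : measurable (D `&` Q) by exact: measurableI.
  apply: (integ_le mDQ (g := fun=> C)) => //; first exact: Cc_measurable.
  apply: integ_cst_bounded => //.
  have [N [N0 HN]] := bounded_cube (- const_mx (`|M| + 1) : 'rV[R]_n) (2 * (`|M| + 1)).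
  by exists N; split=> // m Nm x [_ /HN]; exact.
apply: integ_supp hQ => // x _ nQ; apply: HM; rewrite ltNge; apply/negP => xM.
apply: nQ; apply/cubeP => i; rewrite !mxE.
have := le_trans (rV_coord_le x i) (le_trans xM (ler_norm M)).
by rewrite ler_norml => /andP[h1 h2]; apply/andP; split; lra.
Qed.

Lemma CcM f g : Cc f -> Cc g -> Cc (fun x => f x * g x).
Proof.
move=> [cf [M HM]] [cg _]; split; first by move=> x; exact: (cvgM (cf x) (cg x)).
by exists M => x /HM ->; rewrite mul0r.
Qed.

Lemma CcZD a f g : Cc f -> Cc g -> Cc (fun x => a * f x + g x).
Proof.
move=> [cf [M HM]] [cg [N HN]]; split.
  by move=> x; exact: (cvgD (cvgM (cvg_cst a) (cf x)) (cg x)).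
exists (Num.max M N) => x; rewrite gt_max => /andP[/HM -> /HN ->].
by rewrite mulr0 addr0.
Qed.

Lemma Cc0 : Cc (fun=> 0).
Proof.
split; first exact: cst_continuous.
by exists 0.
Qed.

Lemma Cc_sum (I : Type) (s : seq I) (F : I -> 'rV[R]_n -> R) :
  (forall i, Cc (F i)) -> Cc (fun x => \sum_(i <- s) F i x).
Proof.
move=> hF; elim: s => [|i s IH].
  by under eq_fun do rewrite big_nil; exact: Cc0.
under eq_fun do rewrite big_cons -[F i _]mul1r; exact: CcZD.
Qed.

Lemma Cc_shift h f : Cc f -> Cc (fun x => f (x + h)).
Proof.
move=> [cf [M HM]]; split.
  move=> x; apply: (@continuous_comp _ _ _ (fun z => z + h) f); last exact: cf.
  exact: (cvgD (@cvg_id _ (nbhs x)) (cvg_cst h)).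
exists (M + `|h|) => x xM; apply: HM.
by have := ler_normB (x + h) h; rewrite addrK; lra.
Qed.

Lemma Cc_sqinteg f D : measurable D -> Cc f -> sqinteg leb D f.
Proof.
move=> mD hf; split; first exact: Cc_measurable.
by under eq_fun do rewrite expr2; apply: Cc_integ => //; exact: CcM.
Qed.

Lemma C1c_Cc f : C1c f -> Cc f.
Proof. by move=> [df _ ?]; split => // x; exact: differentiable_continuous. Qed.

Lemma partial_local0 f i x : (\forall y \near x, f y = 0) -> partial i f x = 0.
Proof.
move=> fx; rewrite /partial /derive; apply: cvg_lim => //.
apply: cvg_near_cst; near=> t.
rewrite /= (nbhs_singleton fx) subr0.
suff -> : f (t *: delta_mx 0 i + x) = 0 by rewrite scaler0.
near: t.
have c : t *: (delta_mx 0 i : 'rV[R]_n) + x @[t --> 0^'] --> x.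
  rewrite -[X in _ --> X]add0r; apply: cvgD; last exact: cvg_cst.
  rewrite -(scale0r (delta_mx 0 i : 'rV[R]_n)); apply: cvgZr_tmp.
  exact: nbhs_dnbhs.
exact: (c _ fx).
Unshelve. all: by end_near. Qed.

Lemma partial_supp f i (M : R) x : (forall y, M < `|y| -> f y = 0) -> M < `|x| ->
  partial i f x = 0.
Proof.
move=> HM xM; apply: partial_local0.
have c : (fun y : 'rV[R]_n => `|y|) @ x --> `|x| by exact: norm_continuous.
by apply: filterS (cvgr_gt _ c _ xM) => y; exact: HM.
Qed.

Lemma C1c_partial f i : C1c f -> Cc (partial i f).
Proof. by move=> [df cf [M HM]]; split => //; exists M => x; exact: partial_supp. Qed.

Definition dird f h x : R := \sum_(i < n) h 0 i * partial i f x.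

Lemma C1c_dird f h : C1c f -> Cc (dird f h).
Proof.
move=> hf; apply: Cc_sum => i; have := CcZD (h 0 i) (C1c_partial i hf) Cc0.
by under eq_fun do rewrite addr0.
Qed.

Lemma derive_dird f h x : differentiable f x -> 'D_h f x = dird f h x.
Proof.
move=> df; rewrite deriveE// {1}(row_sum_delta h) linear_sum.
by apply: eq_bigr => i _; rewrite linearZ/= /partial deriveE.
Qed.

Lemma mean_value f h x : C1c f ->
  exists2 t : R, 0 <= t <= 1 & f (x + h) - f x = dird f h (x + t *: h).
Proof.
move=> [df cf sf].
pose phi (t : R) := f (x + t *: h).
have dphi (t : R) : is_derive t 1 phi (dird f h (x + t *: h)).
  have E : (fun e : R => e^-1 *: ((phi \o shift t) (e *: (1 : R)) - phi t)) =
      (fun e : R => e^-1 *: ((f \o shift (x + t *: h)) (e *: h) - f (x + t *: h))).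
    apply/funext => e; congr (_ *: (_ - _)); rewrite /phi /=.
    have -> : e *: (1 : R) = e := mulr1 e.
    by congr f; rewrite scalerDl addrCA.
  apply: DeriveDef.
    by rewrite /derivable E; exact: (diff_derivable (df (x + t *: h))).
  by rewrite /derive E; exact: derive_dird.
have [|c c01 E] := @MVT_segment R phi (fun t => dird f h (x + t *: h)) 0 1 ler01 (fun t _ => dphi t).
  apply: continuous_subspaceT => t.
  by apply: differentiable_continuous; apply/derivable1_diffP; exact: ex_derive.
exists c; first by move: c01; rewrite in_itv.
by move: E; rewrite /phi scale1r scale0r addr0 subr0 mulr1.
Qed.

Lemma difference_quotient f h (e : R) : C1c f -> 0 < e ->
  \forall N \near \oo, forall x, `|N.+1%:R * (f (x + N.+1%:R^-1 *: h) - f x) - dird f h x| <= e.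
Proof.
move=> hf e0; have [d d0 Hd] := Cc_uniform (C1c_dird h hf) e0.
have q0 : 0 < d / (`|h| + 1) by rewrite divr_gt0// ltr_wpDl.
have := near_infty_natSinv_lt (PosNum q0); apply: filterS => N /= HN x.
have [t /andP[t0 t1] ->] := mean_value (N.+1%:R^-1 *: h) x hf.
have -> : dird f (N.+1%:R^-1 *: h) (x + t *: (N.+1%:R^-1 *: h)) =
    N.+1%:R^-1 * dird f h (x + t *: (N.+1%:R^-1 *: h)).
  by rewrite /dird big_distrr/=; apply: eq_bigr => i _; rewrite mxE mulrA.
rewrite mulrA divff ?pnatr_eq0// mul1r; apply: Hd.
rewrite scalerA normrZ ger0_norm ?mulr_ge0//.
apply: (@le_trans _ _ (d / (`|h| + 1) * (`|h| + 1))); last first.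
  by rewrite divfK// lt0r_neq0// ltr_wpDl.
apply: ler_pM => //; rewrite ?mulr_ge0 ?lerDl//.
apply: le_trans (ltW HN); by rewrite ler_piMl.
Qed.

Local Notation nrm2 D := (@nrm R ('rV[R]_n -> R^o) (@dot _ _ _ leb D)).

Lemma nrm2_le D f g : measurable D -> sqinteg leb D f -> sqinteg leb D g ->
  (forall x, D x -> `|f x| <= `|g x|) -> nrm2 D f <= nrm2 D g.
Proof.
move=> mD [_ hf] [_ hg] fg; rewrite /nrm ler_wsqrtr// !dotE; apply: (Rint_le mD) => // x Dx.
rewrite -(real_normK (num_real (f x))) -(real_normK (num_real (g x))).
by rewrite ler_pXn2r ?nnegrE//; exact: fg.
Qed.

Lemma nrm2_subset (D D' : set 'rV[R]_n) f : measurable D -> measurable D' -> D `<=` D' ->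
  sqinteg leb D' f -> nrm2 D f <= nrm2 D' f.
Proof.
move=> mD mD' DD' [mf hf]; rewrite /nrm ler_wsqrtr// !dotE -lee_fin.
have hD : integ leb D (fun x => f x ^+ 2) by exact: (integrableS mD' mD DD' hf).
rewrite !EFin_Rint//; apply: ge0_subset_integral => //.
- by apply/measurable_EFinP; exact: (integ_measurable hf).
- by move=> x _; rewrite lee_fin sqr_ge0.
Qed.

Lemma nrm2_transl D f h : measurable D -> Cc f ->
  nrm2 D (fun x => f (x + h)) = nrm2 (transl (- h) @^-1` D) f.
Proof.
move=> mD hf; congr Num.sqrt; rewrite !dotE; congr fine.
rewrite -(integral_shift (- h) (D := D) (f := fun x => (f (x + h) ^+ 2)%:E))//.
- by apply: eq_integral => x _; rewrite /transl subrK.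
- have /(Cc_sqinteg mD)[_ /integ_measurable/measurable_EFinP] := Cc_shift h hf.
  by [].
- by move=> x _; rewrite lee_fin sqr_ge0.
Qed.

(* [f (. + h) - f] telescopes into N increments of step h / N, each of which is a
   translate of the first one. *)
Lemma translation_estimate (D D' : set 'rV[R]_n) f h : measurable D -> measurable D' ->
  bounded_set D' -> (forall (t : R) x, 0 <= t <= 1 -> D x -> D' (x + t *: h)) -> C1c f ->
  nrm2 D (fun x => f (x + h) - f x) <= nrm2 D' (dird f h).
Proof.
move=> mD mD' bD' DD' hf; have hC := C1c_Cc hf.
have hS := semi_ip_dot leb mD; have hS' := semi_ip_dot leb mD'.
have sD' : forall g, Cc g -> sqinteg leb D' g by move=> g; exact: Cc_sqinteg.
have sD : forall g, Cc g -> sqinteg leb D g by move=> g; exact: Cc_sqinteg.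
(* A uniform error e / (m + 1) of the difference quotient has L^2 norm on D' at most e. *)
pose m := nrm2 D' (fun=> 1).
have s1 : sqinteg leb D' (fun=> 1).
  by split => //; under eq_fun do rewrite expr1n; exact: integ_cst_bounded.
apply/ler_addgt0Pr => e e0.
have m0 : 0 < e / (m + 1) by rewrite divr_gt0// ltr_wpDl// nrm_ge0.
near \oo => N.
have HN : forall x, `|N.+1%:R * (f (x + N.+1%:R^-1 *: h) - f x) - dird f h x| <= e / (m + 1).
  by near: N; exact: difference_quotient.
pose k : R := N.+1%:R; have k0 : 0 < k by rewrite /k ltr0n.
pose g x := f (x + k^-1 *: h) - f x.
have Cg : Cc g.
  have := CcZD (-1) hC (Cc_shift (k^-1 *: h) hC).
  by under eq_fun do rewrite mulN1r addrC.
have gD' : k * nrm2 D' g <= nrm2 D' (dird f h) + e.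
  have -> : k * nrm2 D' g = nrm2 D' (k *: (g : 'rV[R]_n -> R^o)).
    by rewrite (nrmZ hS') ?ger0_norm ?(ltW k0)//; exact: sD'.
  have sg : sqinteg leb D' (k *: (g : 'rV[R]_n -> R^o)) by apply: (ipZ hS'); exact: sD'.
  have sd := sD' _ (C1c_dird h hf).
  apply: le_trans (nrm_leDB hS' sg sd) _; rewrite lerD2l.
  have -> : e = e / (m + 1) * (m + 1) by rewrite divfK// lt0r_neq0// ltr_wpDl// nrm_ge0.
  apply: (@le_trans _ _ (e / (m + 1) * m)); last by rewrite ler_wpM2l ?(ltW m0)// lerDl.
  have -> : e / (m + 1) * m = nrm2 D' (e / (m + 1) *: ((fun=> 1) : 'rV[R]_n -> R^o)).
    by rewrite (nrmZ hS')// ger0_norm ?(ltW m0).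
  apply: nrm2_le => //.
  - exact: (ipB hS').
  - exact: (ipZ hS').
  - move=> x _; apply: le_trans (HN x) _.
    have -> : (e / (m + 1) *: ((fun=> 1) : 'rV[R]_n -> R^o)) x = e / (m + 1) := mulr1 _.
    by rewrite ger0_norm// ltW.
apply: le_trans gD'.
have tel (j : nat) : (j <= N.+1)%N ->
    nrm2 D (fun x => f (x + (j%:R / k) *: h) - f x) <= j%:R * nrm2 D' g.
  elim: j => [|j IH] hj.
    have -> : (fun x => f (x + (0%:R / k) *: h) - f x) = (fun=> 0).
      by apply/funext => x; rewrite mul0r scale0r addr0 subrr.
    by rewrite (nrm0 hS) mul0r.
  have CS (j' : nat) : Cc (fun x => f (x + (j'%:R / k) *: h) - f x).
    have := CcZD (-1) hC (Cc_shift ((j'%:R / k) *: h) hC).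
    by under eq_fun do rewrite mulN1r addrC.
  apply: le_trans (nrm_leDB hS (sD _ (CS j.+1)) (sD _ (CS j))) _.
  have -> : j.+1%:R * nrm2 D' g = j%:R * nrm2 D' g + nrm2 D' g by rewrite -natr1 mulrDl mul1r.
  apply: lerD; first by apply: IH; exact: ltnW.
  have -> : ((fun x => f (x + (j.+1%:R / k) *: h) - f x) : 'rV[R]_n -> R^o) -
      (fun x => f (x + (j%:R / k) *: h) - f x) = (fun x => g (x + (j%:R / k) *: h)).
    apply/funext => x; change (f (x + (j.+1%:R / k) *: h) - f x -
      (f (x + (j%:R / k) *: h) - f x) = g (x + (j%:R / k) *: h)).
    by rewrite /g -natr1 mulrDl div1r scalerDl addrA opprB addrA subrK.
  rewrite nrm2_transl//; apply: nrm2_subset => //; last exact: sD'.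
    exact: measurable_shift_set.
  move=> x /= Dx; rewrite -(subrK ((j%:R / k) *: h) x); apply: DD' => //.
  rewrite divr_ge0 ?(ltW k0)//= ler_pdivrMr// mul1r /k ler_nat; exact: ltnW.
have := tel N.+1 (leqnn _).
by rewrite -/k divff ?lt0r_neq0// scale1r.
Unshelve. all: by end_near. Qed.

End compact_support.

(** * Poincare inequality on cubes *)

Lemma sqr_sum_le (R : realDomainType) (I : Type) (s : seq I) (a : I -> R) :
  (\sum_(i <- s) a i) ^+ 2 <= (size s)%:R * \sum_(i <- s) a i ^+ 2.
Proof.
elim: s => [|i s IH]; first by rewrite !big_nil expr0n mul0r.
rewrite !big_cons /=; set S := \sum_(j <- s) a j in IH *; set Q := \sum_(j <- s) _ in IH *.
have cross : 2 * a i * S <= (size s)%:R * a i ^+ 2 + Q.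
  rewrite /S /Q; elim: (s) => [|j s' IH']; first by rewrite !big_nil mulr0 mul0r addr0.
  rewrite !big_cons /= -natr1; have := sqr_ge0 (a i - a j); rewrite sqrrB; lra.
by rewrite -natr1; lra.
Qed.

Lemma sqr_sum_fin_le (R : realDomainType) (I : finType) (a : I -> R) :
  (\sum_i a i) ^+ 2 <= #|I|%:R * \sum_i a i ^+ 2.
Proof. by have := sqr_sum_le (enum I) a; rewrite !big_enum cardT. Qed.

Section cube_estimates.
Context {R : realType} {n : nat}.
Local Notation leb := (lebesgue_rV R n).
Local Notation vol' := (@vol R n).
Implicit Types (f g : 'rV[R]_n -> R) (x y h a : 'rV[R]_n) (D : set 'rV[R]_n).
Local Notation nrm2 D := (@nrm R ('rV[R]_n -> R^o) (@dot _ _ _ leb D)).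

Lemma Rint_transl D f h : measurable D -> Cc f ->
  \int[leb]_(x in D) f (x + h) = \int[leb]_(x in transl (- h) @^-1` D) f x.
Proof.
move=> mD hf; congr fine.
have mf : measurable_fun setT (fun x => (f (x + h))%:E).
  by apply/measurable_EFinP; apply: Cc_measurable => //; exact: Cc_shift.
have hI : leb.-integrable (transl (- h) @^-1` D) ((fun x => (f (x + h))%:E) \o transl (- h)).
  apply: (eq_integrable (measurable_shift_set _ mD) (EFin \o f)).
    by move=> x _ /=; rewrite /transl subrK.
  by apply: Cc_integ => //; exact: measurable_shift_set.
have := integral_pushforward (measurable_shift (- h)) mf hI mD.
have -> : (\int[pushforward leb (transl (- h))]_(y in D) (f (y + h))%:E =
    \int[leb]_(x in D) (f (x + h))%:E)%E.
  apply: eq_measure_integral => [|? A mA _]; first exact: measurable_shift.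
  by rewrite /pushforward; exact: lebesgue_outer_shift.
by move=> ->; apply: eq_integral => x _ /=; rewrite /transl subrK.
Qed.

Definition grad_sqr f x : R := \sum_(i < n) partial i f x ^+ 2.

Lemma Cc_grad_sqr f : C1c f -> Cc (grad_sqr f).
Proof.
move=> hf; apply: Cc_sum => i; under eq_fun do rewrite expr2.
by apply: CcM; exact: C1c_partial.
Qed.

Lemma grad_sqr_ge0 f x : 0 <= grad_sqr f x.
Proof. by apply: sumr_ge0 => i _; exact: sqr_ge0. Qed.

Lemma dird_sqr_le f h x : dird f h x ^+ 2 <= n%:R * `|h| ^+ 2 * grad_sqr f x.
Proof.
apply: le_trans (sqr_sum_fin_le _) _; rewrite card_ord -mulrA ler_wpM2l//.
rewrite /grad_sqr big_distrr; apply: ler_sum => i _ /=.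
rewrite exprMn ler_wpM2r ?sqr_ge0// -(real_normK (num_real (h 0 i))).
by rewrite ler_pXn2r ?nnegrE// rV_coord_le.
Qed.

Lemma nrm2_dird_le D f h : measurable D -> C1c f ->
  nrm2 D (dird f h) ^+ 2 <= n%:R * `|h| ^+ 2 * \int[leb]_(x in D) grad_sqr f x.
Proof.
move=> mD hf; rewrite (nrm_sqr (semi_ip_dot leb mD)) ?dotE; last first.
  by apply: Cc_sqinteg => //; exact: C1c_dird.
have iG : integ leb D (grad_sqr f) by apply: Cc_integ => //; exact: Cc_grad_sqr.
rewrite -RintegralZl//; apply: (Rint_le mD).
- by have [] := Cc_sqinteg mD (C1c_dird h hf).
- exact: integZ.
- by move=> x _; exact: dird_sqr_le.
Qed.

(** The difference quotients of f have integral 0 by translation invariance, and they converge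
    uniformly to the partial derivative on a fixed cube outside which everything vanishes. *)
Lemma Rint_partial0 f i : C1c f -> \int[leb]_x partial i f x = 0.
Proof.
move=> hf; have hC := C1c_Cc hf; have hP := C1c_partial i hf.
have [_ _ [M HM]] := hf.
(* The margin 2 makes f vanish off Q also after a translation of length at most 1. *)
pose r := `|M| + 2; pose Q := cube (- const_mx r) (2 * r) : set 'rV[R]_n.
have mQ : measurable Q by exact: measurable_cube.
pose e_ : 'rV[R]_n := delta_mx 0 i.
have e1 : `|e_| <= 1.
  apply: rV_norm_le => // j; rewrite mxE eqxx/=; case: (j == i); rewrite ?normr1 ?normr0//.
have nQ x : ~ Q x -> `|M| + 2 <= `|x|.
  move=> nQ; rewrite leNgt; apply/negP => xM; apply: nQ; apply/cubeP => j; rewrite !mxE.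
  have := le_lt_trans (rV_coord_le x j) xM; rewrite ltr_norml /r => /andP[h1 h2].
  by apply/andP; split; lra.
have supp g : (forall x, ~ Q x -> g x = 0) -> \int[leb]_x g x = \int[leb]_(x in Q) g x.
  by move=> g0; rewrite -(@Rint_supp _ _ _ leb setT Q g (fun x _ => g0 x)) setTI.
have nM := ler_norm M.
have dE x : dird f e_ x = partial i f x.
  rewrite /dird (bigD1 i)//= mxE !eqxx mul1r big1 ?addr0// => j ji.
  by rewrite mxE eqxx (negPf ji) mul0r.
have pQ x : ~ Q x -> partial i f x = 0.
  by move=> /nQ xQ; apply: (partial_supp _ HM); lra.
have key (e : R) : 0 < e -> `|\int[leb]_x partial i f x| <= e * vol' (2 * r).
  move=> e0.
  near \oo => N.
  have HN : forall x, `|N.+1%:R * (f (x + N.+1%:R^-1 *: e_) - f x) - dird f e_ x| <= e.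
    by near: N; exact: difference_quotient.
  pose k : R := N.+1%:R; have k1 : 1 <= k by rewrite /k ler1n.
  have k0 : 0 < k by lra.
  pose g x := k * (f (x + k^-1 *: e_) - f x).
  have Cs := Cc_shift (k^-1 *: e_) hC.
  have gT : \int[leb]_x g x = 0.
    have i1 : integ leb setT (fun x => f (x + k^-1 *: e_)) by exact: Cc_integ.
    have i2 : integ leb setT f by exact: Cc_integ.
    rewrite RintegralZl//; last exact: integB.
    rewrite RintegralB// Rint_transl// preimage_setT subrr mulr0//.
  have gQ x : ~ Q x -> g x = 0.
    move=> /nQ xM; rewrite /g !HM ?subrr ?mulr0//; first lra.
    have := ler_normB (x + k^-1 *: e_) (k^-1 *: e_); rewrite addrK.
    have : `|k^-1 *: e_| <= 1.
      rewrite normrZ ger0_norm ?invr_ge0 ?(ltW k0)//.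
      by apply: mulr_ile1; rewrite ?invr_ge0 ?(ltW k0)// invf_le1.
    by move: (k^-1 *: e_) => z; lra.
  have Cg : Cc g.
    have := CcZD k (CcZD (-1) hC Cs) Cc0; rewrite /g.
    by under eq_fun do rewrite addr0 mulN1r addrC.
  have iP : integ leb Q (partial i f) by exact: Cc_integ.
  have ig : integ leb Q g by exact: Cc_integ.
  rewrite supp// -[X in `|X|]subr0 -gT (supp _ gQ) -RintegralB//.
  apply: le_trans (le_normr_Rintegral _ _) _ => //; first exact: integB.
  rewrite -[leRHS](Rint_cst_cube (- const_mx r)); apply: (Rint_le mQ).
  - by apply: (integ_norm mQ); exact: integB.
  - by apply: integ_cst_bounded => //; exact: bounded_cube.
  - by move=> x _; rewrite distrC -dE; exact: HN.
apply/eqP; rewrite -normr_le0; apply/ler_addgt0Pr => e e0; rewrite add0r.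
have v0 := vol_ge0 (n := n) (2 * r).
have v1 : 0 < vol' (2 * r) + 1 by lra.
have := key _ (divr_gt0 e0 v1); move/le_trans; apply.
rewrite -[leRHS](divfK (lt0r_neq0 v1) e) ler_wpM2l ?lerDl//.
by rewrite divr_ge0 ?(ltW v1)// ltW.
Unshelve. all: by end_near. Qed.

Lemma integration_by_parts_C1c f g i : C1c f -> C1c g ->
  \int[leb]_x (f x * partial i g x) = - \int[leb]_x (partial i f x * g x).
Proof.
move=> hf hg; have [df cf sf] := hf; have [dg cg sg] := hg.
have E j : partial j (fun x => f x * g x) = (fun x => f x * partial j g x + partial j f x * g x).
  apply/funext => x; rewrite /partial.
  have := deriveM (diff_derivable (v := delta_mx 0 j) (df x)) (diff_derivable (dg x)).
  by move=> ->; rewrite /GRing.scale/= [g x * _]mulrC.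
have Cf := C1c_Cc hf; have Cg := C1c_Cc hg.
have hfg : C1c (fun x => f x * g x).
  split.
  - by move=> x; exact: differentiableM.
  - move=> j; rewrite E; have [] // := CcZD 1 (CcM Cf (C1c_partial j hg)) (CcM (C1c_partial j hf) Cg).
    by under eq_fun do rewrite mul1r.
  - by have [M HM] := sf; exists M => x /HM ->; rewrite mul0r.
have := Rint_partial0 i hfg; rewrite E RintegralD//.
- by move/eqP; rewrite addr_eq0 => /eqP.
- by apply: Cc_integ => //; apply: CcM; [exact: C1c_Cc|exact: C1c_partial].
- by apply: Cc_integ => //; apply: CcM; [exact: C1c_partial|exact: C1c_Cc].
Qed.

Hypothesis vol_gt0 : forall s : R, 0 < s -> 0 < vol' s.

Definition avg a (s : R) f : R := (\int[leb]_(x in cube a s) f x) / vol' s.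
Definition osc a (s : R) f : R := \int[leb]_(x in cube a s) (f x - avg a s f) ^+ 2.
Definition genergy a (s : R) f : R := \int[leb]_(x in cube a s) grad_sqr f x.

Lemma genergy_ge0 a s f : 0 <= genergy a s f.
Proof. by apply: Rint_ge0 => x _; exact: grad_sqr_ge0. Qed.

Lemma genergy_children a (s : R) f : 0 <= s -> C1c f ->
  genergy a s f = \sum_(b : {ffun 'I_n -> bool}) genergy (child a s b) (s / 2) f.
Proof.
move=> s0 hf; apply: Rint_children => //.
by apply: Cc_integ; [exact: measurable_cube|exact: Cc_grad_sqr].
Qed.

(** Two children are translates of each other by a vector of norm at most s / 2, and the segments
    between corresponding points stay in the parent: the difference of averages is the average of an
    increment of f, controlled by [translation_estimate] and Cauchy-Schwarz. *)
Lemma avg_child_diff a (s : R) (b c : {ffun 'I_n -> bool}) f : 0 < s -> C1c f ->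
  (avg (child a s b) (s / 2) f - avg (child a s c) (s / 2) f) ^+ 2 <=
  n%:R * (s / 2) ^+ 2 * genergy a s f / vol' (s / 2).
Proof.
move=> s0 hf; have hC := C1c_Cc hf.
have s2 : 0 < s / 2 by rewrite divr_gt0.
have v0 := vol_gt0 s2; set v := vol' (s / 2) in v0 *.
pose h := child a s b - child a s c.
have hs : `|h| <= s / 2.
  apply: rV_norm_le; first exact: ltW.
  move=> i; rewrite !mxE; case: (b i); case: (c i); rewrite ?mulr1 ?mulr0 ler_norml; apply/andP; split; lra.
have mC : measurable (cube (child a s c) (s / 2)) by exact: measurable_cube.
have mQ : measurable (cube a s) by exact: measurable_cube.
have E : \int[leb]_(x in cube (child a s b) (s / 2)) f x =
         \int[leb]_(x in cube (child a s c) (s / 2)) f (x + h).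
  by rewrite (Rint_transl h mC hC) cube_shift opprK /h subrKC.
have Ch := Cc_shift h hC.
rewrite /avg -mulrBl E -RintegralB//; try exact: Cc_integ.
set X := \int[leb]_(x in _) _.
have hS := semi_ip_dot leb mC.
have Cd : Cc (fun x => f (x + h) - f x).
  by have := CcZD (-1) hC Ch; under eq_fun do rewrite mulN1r addrC.
have s1 : sqinteg leb (cube (child a s c) (s / 2)) (fun=> 1).
  split => //; under eq_fun do rewrite expr1n; apply: integ_cst_bounded => //; exact: bounded_cube.
have XE : X = dot leb (cube (child a s c) (s / 2)) (fun=> 1) (fun x => f (x + h) - f x).
  by apply: Rint_ext => x _; rewrite mul1r.
have X2 : X ^+ 2 <= v * (n%:R * (s / 2) ^+ 2 * genergy a s f).
  have := cauchy_schwarz hS s1 (Cc_sqinteg mC Cd); rewrite -XE => hX.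
  rewrite -(real_normK (num_real X)).
  apply: (@le_trans _ _ ((nrm2 (cube (child a s c) (s / 2)) (fun=> 1) *
      nrm2 (cube (child a s c) (s / 2)) (fun x => f (x + h) - f x)) ^+ 2)).
    by rewrite ler_pXn2r ?nnegrE// mulr_ge0 ?nrm_ge0.
  rewrite exprMn; apply: ler_pM; rewrite ?sqr_ge0//.
    rewrite (nrm_sqr hS)// dotE (@Rint_ext _ _ _ _ _ _ (fun=> 1)) ?Rint_cst_cube ?mul1r//.
    by move=> x _; rewrite expr1n.
  have te : nrm2 (cube (child a s c) (s / 2)) (fun x => f (x + h) - f x) <= nrm2 (cube a s) (dird f h).
    apply: translation_estimate => //; first exact: bounded_cube.
    move=> t x /andP[t0 t1] /cubeP Hx; apply/cubeP => i.
    have := Hx i; rewrite !mxE.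
    have : 0 <= t * s by rewrite mulr_ge0// ltW.
    have : t * s <= 1 * s by rewrite ler_wpM2r// ltW.
    by case: (b i); case: (c i); rewrite ?mulr1 ?mulr0 => h1 h2 /andP[h3 h4]; apply/andP; split; lra.
  apply: (@le_trans _ _ (nrm2 (cube a s) (dird f h) ^+ 2)).
    by rewrite ler_pXn2r ?nnegrE ?nrm_ge0.
  apply: le_trans (nrm2_dird_le _ mQ hf) _.
  rewrite ler_wpM2r ?genergy_ge0// ler_wpM2l// ler_pXn2r ?nnegrE//; exact: ltW.
rewrite expr2 mulrACA -expr2 ler_pdivlMr//.
have -> : X ^+ 2 * (v^-1 * v^-1) * v = X ^+ 2 / v.
  by rewrite -!mulrA mulVf ?mulr1// lt0r_neq0.
by rewrite ler_pdivrMr// mulrC.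
Qed.

Lemma avg_children a (s : R) f : 0 < s -> Cc f ->
  avg a s f = (2 ^ n)%:R^-1 * \sum_(b : {ffun 'I_n -> bool}) avg (child a s b) (s / 2) f.
Proof.
move=> s0 hC; rewrite /avg -mulr_suml -Rint_children ?(ltW s0)//.
  by rewrite vol_half ?ltW// invfM mulrCA.
by apply: Cc_integ => //; exact: measurable_cube.
Qed.

(** The average over the cube is the mean of those over its 2^n children, so the bound between two
    children passes to this difference by convexity of the square. *)
Lemma avg_child_sub a (s : R) (b : {ffun 'I_n -> bool}) f : 0 < s -> C1c f ->
  (avg (child a s b) (s / 2) f - avg a s f) ^+ 2 <=
  n%:R * (s / 2) ^+ 2 * genergy a s f / vol' (s / 2).
Proof.
move=> s0 hf; have hC := C1c_Cc hf; set K := leRHS.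
pose A (b : {ffun 'I_n -> bool}) := avg (child a s b) (s / 2) f.
have N0 : 0 < (2 ^ n)%:R :> R by rewrite ltr0n expn_gt0.
have cN : #|{ffun 'I_n -> bool}| = (2 ^ n)%N by rewrite card_ffun card_bool card_ord.
have -> : avg (child a s b) (s / 2) f - avg a s f = (2 ^ n)%:R^-1 * \sum_c (A b - A c).
  have sA : \sum_(c : {ffun 'I_n -> bool}) A b = (2 ^ n)%:R * A b.
    by rewrite sumr_const cN mulr_natl.
  rewrite sumrB sA (@avg_children a s f s0 hC) mulrBr mulrA mulVf ?mul1r//.
rewrite exprMn; apply: (@le_trans _ _ ((2 ^ n)%:R^-1 ^+ 2 * ((2 ^ n)%:R * \sum_(c : {ffun 'I_n -> bool}) K))).
  rewrite ler_wpM2l ?sqr_ge0//; apply: le_trans (sqr_sum_fin_le _) _.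
  rewrite cN ler_wpM2l//; apply: ler_sum => c _; exact: avg_child_diff.
have N1 : (2 ^ n)%:R != 0 :> R by exact: lt0r_neq0.
have -> : \sum_(c : {ffun 'I_n -> bool}) K = (2 ^ n)%:R * K by rewrite sumr_const cN mulr_natl.
by rewrite expr2 -!mulrA mulKf// mulKf.
Qed.

Lemma Rint_sqr_avg a (s c : R) f : 0 < s -> Cc f ->
  \int[leb]_(x in cube a s) (f x - c) ^+ 2 = osc a s f + vol' s * (avg a s f - c) ^+ 2.
Proof.
move=> s0 hC; have mQ : measurable (cube a s) by exact: measurable_cube.
have v0 := vol_gt0 s0.
have icst (r : R) : integ leb (cube a s) (fun=> r).
  by apply: integ_cst_bounded => //; exact: bounded_cube.
have i1 : integ leb (cube a s) f by exact: Cc_integ.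
have [_ i2] := Cc_sqinteg mQ hC.
have gen (r : R) : \int[leb]_(x in cube a s) (f x - r) ^+ 2 =
    \int[leb]_(x in cube a s) (f x ^+ 2) - 2 * r * (vol' s * avg a s f) + r ^+ 2 * vol' s.
  rewrite (@Rint_ext _ _ _ _ _ _ (fun x => f x ^+ 2 - (2 * r) * f x + r ^+ 2)); last first.
    by move=> x _; lra.
  rewrite RintegralD ?RintegralB ?RintegralZl ?Rint_cst_cube//; try exact: integZ.
  - have -> : vol' s * avg a s f = \int[leb]_(x in cube a s) f x.
      by rewrite /avg mulrC divfK// lt0r_neq0.
    lra.
  - exact: icst.
  - by apply: integB => //; exact: integZ.
by rewrite /osc !gen; lra.
Qed.

Lemma osc_children a (s : R) f : 0 < s -> C1c f ->
  osc a s f <= \sum_(b : {ffun 'I_n -> bool}) osc (child a s b) (s / 2) f +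
    (2 ^ n * n)%:R / 4 * s ^+ 2 * genergy a s f.
Proof.
move=> s0 hf; have hC := C1c_Cc hf; have s2 : 0 < s / 2 by rewrite divr_gt0.
have v0 := vol_gt0 s2.
rewrite {1}/osc Rint_children ?(ltW s0)//; last first.
  have mQ : measurable (cube a s) by exact: measurable_cube.
  have icst : integ leb (cube a s) (fun=> (avg a s f) ^+ 2).
    by apply: integ_cst_bounded => //; exact: bounded_cube.
  have i1 : integ leb (cube a s) f by exact: Cc_integ.
  have [_ i2] := Cc_sqinteg mQ hC.
  apply: (integ_ext mQ (f := fun x => f x ^+ 2 - (2 * avg a s f) * f x + avg a s f ^+ 2)).
    by move=> x _; lra.
  by apply: integD => //; apply: integB => //; exact: integZ.
have E b : \int[leb]_(x in cube (child a s b) (s / 2)) (f x - avg a s f) ^+ 2 =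
  osc (child a s b) (s / 2) f + vol' (s / 2) * (avg (child a s b) (s / 2) f - avg a s f) ^+ 2.
  exact: Rint_sqr_avg.
apply: (@le_trans _ _ (\sum_(b : {ffun 'I_n -> bool}) (osc (child a s b) (s / 2) f +
    vol' (s / 2) * (avg (child a s b) (s / 2) f - avg a s f) ^+ 2))).
  by apply: ler_sum => b _; rewrite E.
rewrite big_split/= lerD2l.
apply: (@le_trans _ _ (\sum_(b : {ffun 'I_n -> bool}) (n%:R * (s / 2) ^+ 2 * genergy a s f))).
  apply: ler_sum => b _; rewrite mulrC -ler_pdivlMr//; exact: avg_child_sub.
rewrite sumr_const card_ffun card_bool card_ord -mulr_natl natrM.
by rewrite le_eqVlt; apply/orP; left; apply/eqP; lra.
Qed.

(** Iteration of [osc_children] over k dyadic generations. With c = 2^n n, the first one costs c s^2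
    / 4 times the energy and by induction the later ones at most c (s / 2)^2, which together stay
    below c s^2. After k generations the oscillation left is that of a uniformly continuous function
    on tiny cubes. *)
Lemma poincare_cube a (s : R) f : 0 < s -> C1c f ->
  osc a s f <= (2 ^ n * n)%:R * s ^+ 2 * genergy a s f.
Proof.
move=> s0 hf; have hC := C1c_Cc hf.
have step (k : nat) (w : R) a' (s' : R) : 0 < s' -> 0 <= w ->
    (forall a'' x y, cube a'' (s' / 2 ^+ k) x -> cube a'' (s' / 2 ^+ k) y -> `|f x - f y| <= w) ->
    osc a' s' f <= w ^+ 2 * vol' s' + (2 ^ n * n)%:R * s' ^+ 2 * genergy a' s' f.
  elim: k a' s' => [|k IH] a' s' s'0 w0 Hw.
    rewrite expr0 divr1 in Hw; have v0 := vol_gt0 s'0.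
    have pg := mulr_ge0 (mulr_ge0 (ler0n R (2 ^ n * n)) (sqr_ge0 s')) (genergy_ge0 a' s' f).
    apply: (@le_trans _ _ (w ^+ 2 * vol' s')); last by rewrite lerDl.
    have mQ : measurable (cube a' s') by exact: measurable_cube.
    have icst (r : R) : integ leb (cube a' s') (fun=> r).
      by apply: integ_cst_bounded => //; exact: bounded_cube.
    have i1 : integ leb (cube a' s') f by exact: Cc_integ.
    have d x : cube a' s' x -> `|f x - avg a' s' f| <= w.
      move=> Qx; have -> : f x - avg a' s' f = (\int[leb]_(y in cube a' s') (f x - f y)) / vol' s'.
        by rewrite (RintegralB mQ (icst (f x)) i1) (Rint_cst_cube a' s' (f x)) mulrBl mulfK// lt0r_neq0.
      rewrite normrM [`|_^-1|]ger0_norm ?invr_ge0 ?(ltW v0)// ler_pdivrMr//.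
      have ib : integ leb (cube a' s') (fun y => f x - f y) by exact: integB.
      apply: le_trans (le_normr_Rintegral mQ ib) _.
      rewrite -(Rint_cst_cube a'); apply: (Rint_le mQ) => //; first exact: integ_norm.
      by move=> y Qy; exact: Hw Qx Qy.
    rewrite -(Rint_cst_cube a'); apply: (Rint_le mQ) => //; last first.
      move=> x Qx; rewrite -(real_normK (num_real (f x - _))) ler_pXn2r ?nnegrE//; exact: d.
    have [_ i2] := Cc_sqinteg mQ hC.
    apply: (integ_ext mQ (f := fun x => f x ^+ 2 - (2 * avg a' s' f) * f x + avg a' s' f ^+ 2)).
      by move=> x _; lra.
    by apply: integD => //; apply: integB => //; exact: integZ.
  apply: le_trans (osc_children _ s'0 hf) _.
  have s2 : 0 < s' / 2 by rewrite divr_gt0.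
  have {}IH b : osc (child a' s' b) (s' / 2) f <= w ^+ 2 * vol' (s' / 2) +
      (2 ^ n * n)%:R * (s' / 2) ^+ 2 * genergy (child a' s' b) (s' / 2) f.
    apply: IH => // a'' x y; have := Hw a'' x y.
    by rewrite exprS invfM mulrA.
  apply: (@le_trans _ _ (\sum_(b : {ffun 'I_n -> bool}) (w ^+ 2 * vol' (s' / 2) +
      (2 ^ n * n)%:R * (s' / 2) ^+ 2 * genergy (child a' s' b) (s' / 2) f) +
      (2 ^ n * n)%:R / 4 * s' ^+ 2 * genergy a' s' f)).
    by rewrite lerD2r; apply: ler_sum => b _; exact: IH.
  have e2 : \sum_(b : {ffun 'I_n -> bool}) ((2 ^ n * n)%:R * (s' / 2) ^+ 2 * genergy (child a' s' b) (s' / 2) f)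
      = (2 ^ n * n)%:R * (s' / 2) ^+ 2 * genergy a' s' f.
    by rewrite -big_distrr/= -genergy_children// ltW.
  rewrite big_split/= e2 sumr_const.
  rewrite card_ffun card_bool card_ord [vol' s']vol_half ?(ltW s'0)// -mulr_natl.
  have pg := mulr_ge0 (mulr_ge0 (ler0n R (2 ^ n * n)) (sqr_ge0 s')) (genergy_ge0 a' s' f).
  lra.
apply/ler_addgt0Pl => e e0.
have v0 := vol_gt0 s0.
(* Chosen so that the oscillation left in the last generation, [w ^+ 2 * vol' s], is e. *)
pose w := Num.sqrt (e / vol' s).
have w0 : 0 < w by rewrite sqrtr_gt0 divr_gt0.
have [d d0 Hd] := Cc_uniform hC w0.
have q0 : 0 < d / s by rewrite divr_gt0.
have [k _ Hk] := near_infty_natSinv_expn_lt (PosNum q0).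
have {}Hk := Hk k (leqnn k); rewrite /= div1r in Hk.
have -> : e = w ^+ 2 * vol' s.
  by rewrite sqr_sqrtr ?divfK ?lt0r_neq0// divr_ge0 ?ltW.
apply: (step k) => //; first exact: ltW.
move=> a'' x y /cubeP Hx /cubeP Hy.
rewrite -(subrKC y x); apply: Hd; apply: rV_norm_le; first exact: ltW.
move=> i; rewrite !mxE; have /andP[h1 h2] := Hx i; have /andP[h3 h4] := Hy i.
have : s / 2 ^+ k <= d by rewrite mulrC -ler_pdivlMr//; exact: ltW.
by rewrite ler_norml => h5; apply/andP; split; lra.
Qed.

End cube_estimates.

(** * Rellich compactness *)

Section rellich.
Context {R : realType} {n : nat}.
Local Notation leb := (lebesgue_rV R n).
Local Notation vol' := (@vol R n).
Implicit Types (f g : 'rV[R]_n -> R) (x y h a : 'rV[R]_n).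

Lemma sqr_le_norm (u r : R) : `|u| <= r -> u ^+ 2 <= r ^+ 2.
Proof.
rewrite ler_norml => /andP[h1 h2].
have : 0 <= (r - u) * (r + u) by apply: mulr_ge0; lra.
lra.
Qed.

Lemma partialZD f g (c : R) i x : differentiable f x -> differentiable g x ->
  partial i (fun y => c * f y + g y) x = c * partial i f x + partial i g x.
Proof.
move=> df dg; rewrite /partial.
have df' := diff_derivable (v := delta_mx 0 i) df.
have := deriveD (derivableZ (k := c) df') (diff_derivable (v := delta_mx 0 i) dg).
by rewrite deriveZ.
Qed.

Lemma C1cZD f g (c : R) : C1c f -> C1c g -> C1c (fun x => c * f x + g x).
Proof.
move=> [df cf [M HM]] [dg cg [N HN]]; split.
- move=> x; apply: (differentiableD (f := fun x => c * f x)); last exact: dg.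
  exact: (differentiableM (f := fun=> c) (differentiable_cst c x) (df x)).
- move=> i; have -> : partial i (fun x => c * f x + g x) =
      (fun x => c * partial i f x + partial i g x).
    by apply/funext => x; exact: partialZD.
  by move=> x; exact: (cvgD (cvgM (cvg_cst c) (cf i x)) (cg i x)).
- exists (Num.max M N) => x; rewrite gt_max => /andP[/HM -> /HN ->].
  by rewrite mulr0 addr0.
Qed.

Lemma C1cB f g : C1c f -> C1c g -> C1c (fun x => f x - g x).
Proof.
by move=> hf hg; have := C1cZD (-1) hg hf; under eq_fun do rewrite mulN1r addrC.
Qed.

Lemma partialB f g i x : C1c f -> C1c g ->
  partial i (fun y => f y - g y) x = partial i f x - partial i g x.
Proof.
move=> [df _ _] [dg _ _]; have := partialZD (-1) i (dg x) (df x).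
rewrite mulN1r addrC => <-; congr (partial i _ x); apply/funext => y.
by rewrite mulN1r addrC.
Qed.

Lemma grad_sqrB_le f g x : C1c f -> C1c g ->
  grad_sqr (fun y => f y - g y) x <= 2 * grad_sqr f x + 2 * grad_sqr g x.
Proof.
move=> hf hg; rewrite /grad_sqr !big_distrr -big_split/=; apply: ler_sum => i _.
rewrite partialB//; move: (partial i f x) (partial i g x) => u v.
by have := sqr_ge0 (u + v); rewrite sqrrB sqrrD; lra.
Qed.

Lemma genergyB_le a (s : R) f g : C1c f -> C1c g ->
  genergy a s (fun y => f y - g y) <= 2 * genergy a s f + 2 * genergy a s g.
Proof.
move=> hf hg; have mQ : measurable (cube a s) by exact: measurable_cube.
have i1 : integ leb (cube a s) (grad_sqr f) by apply: Cc_integ => //; exact: Cc_grad_sqr.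
have i2 : integ leb (cube a s) (grad_sqr g) by apply: Cc_integ => //; exact: Cc_grad_sqr.
have i3 := integZ mQ 2 i1; have i4 := integZ mQ 2 i2.
have e1 := RintegralZl 2 mQ i1; have e2 := RintegralZl 2 mQ i2.
have e3 := RintegralD mQ i3 i4.
have le3 : genergy a s (fun y => f y - g y) <=
    \int[leb]_(x in cube a s) (2 * grad_sqr f x + 2 * grad_sqr g x).
  apply: (Rint_le mQ).
  - by apply: Cc_integ => //; apply: Cc_grad_sqr; exact: C1cB.
  - exact: (integD mQ i3 i4).
  - by move=> x _; exact: grad_sqrB_le.
by apply: le_trans le3 _; rewrite e3 e1 e2.
Qed.

Section ultra.
Variables (U : set_system nat) (UU : UltraFilter U).

(** The supremum of the t with t <= x i for U-almost all i is the limit of x along U; for i in A, x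
    i is within e / 2 of it. *)
Lemma ultra_cauchy (x : nat -> R) (M e : R) : (forall i, `|x i| <= M) -> 0 < e ->
  exists2 A, U A & forall i j, A i -> A j -> `|x i - x j| <= e.
Proof.
move=> xM e0.
pose S := [set t : R | U [set i | t <= x i]].
have S0 : S (- M).
  apply: filterS (filterT : U setT) => i _ /=.
  by have := xM i; rewrite ler_norml => /andP[].
have Sub t : S t -> t <= M.
  move=> /filter_ex[i /= ti]; apply: le_trans ti _.
  by have := xM i; rewrite ler_norml => /andP[].
have hS : has_sup S by split; [exists (- M)|exists M].
have e2 : 0 < e / 2 by rewrite divr_gt0.
have [t St tl] := sup_adherent e2 hS.
have nS : ~ S (sup S + e / 2).
  by move=> /(sup_upper_bound hS); lra.
have [//|Uc] := in_ultra_setVsetC [set i | sup S + e / 2 <= x i] UU.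
exists ([set i | t <= x i] `&` ~` [set i | sup S + e / 2 <= x i]); first exact: filterI.
move=> i j /= [ti /negP] + [tj /negP]; rewrite -!ltNge => hi hj.
by rewrite ler_norml; apply/andP; split; lra.
Qed.

Hypothesis vol_gt0 : forall s : R, 0 < s -> 0 < vol' s.

(* Along an ultrafilter all the averages over the dyadic subcubes converge, without
   extraction of subsequences. *)
Lemma ultra_rellich (k : nat) a (s M e : R) (f_ : nat -> 'rV[R]_n -> R) : 0 < s -> 0 < e ->
  (forall i, C1c (f_ i)) -> (forall i, \int[leb]_(x in cube a s) f_ i x ^+ 2 <= M) ->
  exists2 A, U A & forall i j, A i -> A j ->
    \int[leb]_(x in cube a s) (f_ i x - f_ j x) ^+ 2 <=
    (2 ^ n * n)%:R * (s / 2 ^+ k) ^+ 2 * genergy a s (fun x => f_ i x - f_ j x) + e.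
Proof.
move=> + + hf; elim: k a s e => [|k IH] a s e s0 e0 fM.
  have v0 := vol_gt0 s0; have mQ : measurable (cube a s) by exact: measurable_cube.
  have avgM i : `|avg a s (f_ i)| <= Num.sqrt (M / vol' s).
    have := fM i; have := Rint_sqr_avg vol_gt0 a 0 s0 (C1c_Cc (hf i)).
    have -> : \int[leb]_(x in cube a s) (f_ i x - 0) ^+ 2 = \int[leb]_(x in cube a s) f_ i x ^+ 2.
      by apply: Rint_ext => x _; rewrite subr0.
    have : 0 <= osc a s (f_ i) by apply: Rint_ge0 => x _; exact: sqr_ge0.
    rewrite subr0 -sqrtr_sqr => h1 h2 h3; rewrite ler_wsqrtr// ler_pdivlMr// mulrC; lra.
  have e' : 0 < Num.sqrt (e / vol' s) by rewrite sqrtr_gt0 divr_gt0.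
  have [A UA HA] := ultra_cauchy avgM e'.
  exists A => // i j Ai Aj.
  have Cg := C1cB (hf i) (hf j).
  have := Rint_sqr_avg vol_gt0 a 0 s0 (C1c_Cc Cg); rewrite subr0.
  have -> : \int[leb]_(x in cube a s) (f_ i x - f_ j x - 0) ^+ 2 =
      \int[leb]_(x in cube a s) (f_ i x - f_ j x) ^+ 2.
    by apply: Rint_ext => x _; rewrite subr0.
  move=> ->; rewrite expr0 divr1; apply: lerD; first exact: poincare_cube.
  rewrite mulrC -ler_pdivlMr//.
  have -> : avg a s (fun x => f_ i x - f_ j x) = avg a s (f_ i) - avg a s (f_ j).
    by rewrite /avg RintegralB ?mulrBl//; apply: Cc_integ => //; exact: C1c_Cc.
  have := sqr_le_norm (HA i j Ai Aj).
  by rewrite sqr_sqrtr// divr_ge0// ltW.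
have v0 := vol_gt0 s0; have mQ : measurable (cube a s) by exact: measurable_cube.
have s2 : 0 < s / 2 by rewrite divr_gt0.
have N0 : 0 < (2 ^ n)%:R :> R by rewrite ltr0n expn_gt0.
have e2 : 0 < e / (2 ^ n)%:R by rewrite divr_gt0.
have {IH}H (b : {ffun 'I_n -> bool}) : exists A, U A /\ forall i j, A i -> A j ->
    \int[leb]_(x in cube (child a s b) (s / 2)) (f_ i x - f_ j x) ^+ 2 <=
    (2 ^ n * n)%:R * (s / 2 / 2 ^+ k) ^+ 2 *
    genergy (child a s b) (s / 2) (fun x => f_ i x - f_ j x) + e / (2 ^ n)%:R.
  have [|A UA HA] := IH (child a s b) (s / 2) (e / (2 ^ n)%:R) s2 e2; last by exists A.
  move=> i; apply: le_trans (fM i).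
  rewrite -!dotE -!(nrm_sqr (semi_ip_dot leb _)); try exact: measurable_cube;
    try (by apply: Cc_sqinteg; [exact: measurable_cube|exact: C1c_Cc]).
  rewrite ler_pXn2r ?nnegrE ?nrm_ge0//; apply: nrm2_subset.
  - exact: measurable_cube.
  - exact: measurable_cube.
  - exact/child_sub/ltW.
  - by apply: Cc_sqinteg; [exact: measurable_cube|exact: C1c_Cc].
have [A HA] := choice H.
exists [set i | forall b, A b i].
  by apply: (filter_forall (f := A)) => b; exact: (HA b).1.
move=> i j Ai Aj; have Cg := C1cB (hf i) (hf j).
rewrite Rint_children ?(ltW s0)//; last by have [] := Cc_sqinteg mQ (C1c_Cc Cg).
apply: (@le_trans _ _ (\sum_(b : {ffun 'I_n -> bool}) ((2 ^ n * n)%:R * (s / 2 / 2 ^+ k) ^+ 2 *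
    genergy (child a s b) (s / 2) (fun x => f_ i x - f_ j x) + e / (2 ^ n)%:R))).
  by apply: ler_sum => b _; apply: (HA b).2; [exact: Ai|exact: Aj].
rewrite big_split/=.
have e3 : \sum_(b : {ffun 'I_n -> bool}) ((2 ^ n * n)%:R * (s / 2 / 2 ^+ k) ^+ 2 *
    genergy (child a s b) (s / 2) (fun x => f_ i x - f_ j x)) =
    (2 ^ n * n)%:R * (s / 2 / 2 ^+ k) ^+ 2 * genergy a s (fun x => f_ i x - f_ j x).
  by rewrite -big_distrr/= -genergy_children// ltW.
have e4 : \sum_(b : {ffun 'I_n -> bool}) e / (2 ^ n)%:R = e.
  by rewrite sumr_const card_ffun card_bool card_ord -(mulr_natl (e / _)) mulrCA mulfV ?mulr1.
by rewrite e3 e4 (_ : s / 2 ^+ k.+1 = s / 2 / 2 ^+ k) // exprS invfM mulrA.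
Qed.

End ultra.

Hypothesis vol_gt0 : forall s : R, 0 < s -> 0 < vol' s.

Lemma rellich_C1c a (s M : R) (f_ : nat -> 'rV[R]_n -> R) : 0 < s ->
  (forall i, C1c (f_ i)) -> (forall i, \int[leb]_(x in cube a s) f_ i x ^+ 2 <= M) ->
  (forall i, genergy a s (f_ i) <= M) ->
  exists t, subsequence t /\ forall e : R, 0 < e -> exists N, forall i j, (N <= i)%N -> (N <= j)%N ->
    \int[leb]_(x in cube a s) (f_ (t i) x - f_ (t j) x) ^+ 2 <= e.
Proof.
move=> s0 hf fM gM.
have [U [UU Uoo]] := ultraFilterLemma (F := \oo) _.
have M0 : 0 <= M by apply: le_trans (gM 0%N); exact: genergy_ge0.
have H (k : nat) : exists A, U A /\ forall i j, A i -> A j ->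
    \int[leb]_(x in cube a s) (f_ i x - f_ j x) ^+ 2 <= k.+1%:R^-1.
  have k0 : 0 < k.+1%:R^-1 / 2 :> R by rewrite divr_gt0// invr_gt0.
  (* The energy of a difference is at most 4 M, so c / 2^m dominates the gradient term at generation
     m; the summand 1 makes c positive. *)
  pose c : R := (2 ^ n * n)%:R * s ^+ 2 * (4 * M) + 1.
  have c0 : 0 < c.
    have := mulr_ge0 (mulr_ge0 (ler0n R (2 ^ n * n)) (sqr_ge0 s)) (mulr_ge0 (ler0n R 4) M0).
    by rewrite /c; lra.
  have q0 : 0 < k.+1%:R^-1 / 2 / c by rewrite divr_gt0.
  have [m _ Hm] := near_infty_natSinv_expn_lt (PosNum q0).
  have {}Hm := Hm m (leqnn m); rewrite /= div1r in Hm.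
  have [A UA HA] := ultra_rellich UU vol_gt0 m s0 k0 hf fM.
  exists A; split => // i j Ai Aj; apply: le_trans (HA i j Ai Aj) _.
  have g4 : genergy a s (fun x => f_ i x - f_ j x) <= 4 * M.
    apply: le_trans (genergyB_le _ _ (hf i) (hf j)) _.
    have := gM i; have := gM j; clear; move: (genergy _ _ (f_ i)) (genergy _ _ (f_ j)) => u v.
    lra.
  have h1 : (2 ^ n * n)%:R * (s / 2 ^+ m) ^+ 2 * genergy a s (fun x => f_ i x - f_ j x) <= c * (2 ^+ m)^-1.
    rewrite exprMn mulrA -[X in X <= _]mulrAC.
    apply: ler_pM.
    - by rewrite mulr_ge0 ?genergy_ge0// mulr_ge0 ?sqr_ge0.
    - exact: sqr_ge0.
    - rewrite /c -[leLHS]addr0; apply: lerD => //; apply: ler_wpM2l => //.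
      by rewrite mulr_ge0 ?sqr_ge0.
    - rewrite expr2 ler_piMr ?invr_ge0 ?exprn_ge0// invf_le1 ?exprn_gt0//.
      by rewrite exprn_ege1// ler1n.
  have h2 : c * (2 ^+ m)^-1 <= k.+1%:R^-1 / 2.
    by rewrite mulrC -ler_pdivlMr//; exact: ltW.
  by have := lerD (le_trans h1 h2) (lexx (k.+1%:R^-1 / 2)); rewrite -splitr.
have [A HA] := choice H.
(* The finite intersections of the A l belong to U, which refines the filter at infinity, so they
   contain arbitrarily large indices: one diagonal subsequence serves all precisions. *)
pose P k i := forall l, (l <= k)%N -> A l i.
have [k N|t [ht Ht]] := @exists_subsequence P.
  have : U ([set i | forall l, (l < k.+1)%N -> A l i] `&` [set i | (N <= i)%N]).
    apply: filterI; last by apply: Uoo; exists N.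
    elim: k.+1 => [|m IH]; first by apply: filterS (filterT : U setT) => i _ l.
    apply: filterS2 IH (HA m).1 => i IH Ai l; rewrite ltnS leq_eqVlt => /orP[/eqP->//|].
    exact: IH.
  by move=> /filter_ex[i [/= Hi Ni]]; exists i; split=> // l lk; exact: Hi.
exists t; split => // e e0.
have [N _ HN] := near_infty_natSinv_lt (PosNum e0).
exists N => i j Ni Nj; apply: le_trans (ltW (HN N (leqnn N))).
by apply: (HA N).2; [exact: (Ht i)|exact: (Ht j)].
Qed.

End rellich.

(** * Sobolev inequality *)

Section sobolev_inequality.
Context {R : realType} {n : nat}.
Local Notation leb := (lebesgue_rV R n).
Local Notation vol' := (@vol R n).
Implicit Types (D : set 'rV[R]_n) (f g : 'rV[R]_n -> R) (x y h a : 'rV[R]_n).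

Definition vanish_off (Q : set 'rV[R]_n) f :=
  C1c f /\ forall x, ~ Q x -> f x = 0 /\ forall i, partial i f x = 0.

Lemma partial_comp (h : R -> R) f i x : derivable h (f x) 1 -> differentiable f x ->
  partial i (h \o f) x = derive1 h (f x) * partial i f x.
Proof.
move=> /derivable1_diffP dh df; rewrite /partial deriveE; last exact: differentiable_comp.
by rewrite diff_comp// diff1E// deriveE//= -[LHS]/(_ * _) mulrC.
Qed.

Lemma C1c_comp (h : R -> R) f : (forall u, derivable h u 1) -> continuous (derive1 h) -> h 0 = 0 ->
  C1c f -> C1c (h \o f).
Proof.
move=> dh ch h0 [df cf [M HM]]; split.
- by move=> x; apply: differentiable_comp => //; apply/derivable1_diffP.
- move=> i; have -> : partial i (h \o f) = (fun x => derive1 h (f x) * partial i f x).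
    by apply/funext => x; exact: partial_comp.
  have cf' : continuous f by move=> x; exact: differentiable_continuous.
  by move=> x; exact: (cvgM (continuous_comp (cf' x) (ch (f x))) (cf i x)).
- by exists M => x /HM /= ->.
Qed.

Lemma vanish_off_comp Q (h : R -> R) f : (forall u, derivable h u 1) -> continuous (derive1 h) -> h 0 = 0 ->
  vanish_off Q f -> vanish_off Q (h \o f).
Proof.
move=> dh ch h0 [hf H]; split; first exact: C1c_comp.
move=> x /H[/= fx dx]; split; first by rewrite fx.
by move=> i; rewrite partial_comp ?dx ?mulr0//; case: hf.
Qed.

Lemma measurable_level D f (c t : R) : measurable D -> Cc f ->
  measurable_fun D (fun x => (t < `|f x - c|)%R%:R : R).
Proof.
move=> mD hf.
have m1 : measurable_fun D (fun x => t < `|f x - c|).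
  apply: measurable_fun_ltr; first exact: measurable_cst.
  apply: measurableT_comp; first exact: normr_measurable.
  by apply: measurable_funB; [exact: Cc_measurable|exact: measurable_cst].
have mb : measurable_fun setT (fun b : bool => b%:R : R) by move=> _ B mB.
exact: (measurableT_comp mb m1).
Qed.

Lemma integ_level D f (c t : R) : measurable D -> bounded_set D -> Cc f ->
  integ leb D (fun x => (t < `|f x - c|)%R%:R).
Proof.
move=> mD bD hf; apply: (integ_le mD) (integ_cst_bounded 1 mD bD); first exact: measurable_level.
by move=> x _; case: (_ < _); rewrite ?normr1 ?normr0.
Qed.

Hypothesis vol_gt0 : forall s : R, 0 < s -> 0 < vol' s.

(** The translation by s along the i-th axis moves the cube off itself, so on the cube f is minus
    its own increment and [translation_estimate] bounds it by the energy. *)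
Lemma poincare_vanish (i : 'I_n) a (s : R) f : 0 < s -> vanish_off (cube a s) f ->
  \int[leb]_(x in cube a s) f x ^+ 2 <= n%:R * s ^+ 2 * genergy a s f.
Proof.
move=> s0 [hf Hf]; have mQ : measurable (cube a s) by exact: measurable_cube.
have mD : measurable (cube a (2 * s)) by exact: measurable_cube.
have hC := C1c_Cc hf.
pose h : 'rV[R]_n := s *: delta_mx 0 i.
have hs : `|h| <= s.
  apply: rV_norm_le; first exact: ltW.
  by move=> j; rewrite !mxE eqxx /=; case: eqP; rewrite ?mulr1 ?mulr0 ?normr0 ?gtr0_norm// ltW.
have hS := semi_ip_dot leb mQ.
have -> : \int[leb]_(x in cube a s) f x ^+ 2 = nrm (dot leb (cube a s)) (fun x => f (x + h) - f x) ^+ 2.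
  rewrite (nrm_sqr hS); last first.
    by apply: Cc_sqinteg => //; have := CcZD (-1) hC (Cc_shift h hC);
       under eq_fun do rewrite mulN1r addrC.
  rewrite dotE; apply: Rint_ext => x Qx.
  have [-> _] : f (x + h) = 0 /\ forall i, partial i f (x + h) = 0.
    apply: Hf => /cubeP /(_ i); have /cubeP /(_ i) := Qx.
    by rewrite !mxE !eqxx mulr1 => /andP[h1 h2] /andP[h3 h4]; lra.
  by rewrite sub0r sqrrN.
have Q2 : cube a s `<=` cube a (2 * s).
  move=> x /cubeP H; apply/cubeP => j; have := H j => /andP[h1 h2]; apply/andP; split; lra.
have te : nrm (dot leb (cube a s)) (fun x => f (x + h) - f x) <= nrm (dot leb (cube a (2 * s))) (dird f h).
  apply: translation_estimate => //; first exact: bounded_cube.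
  move=> t x /andP[t0 t1] /cubeP H; apply/cubeP => j; have := H j => /andP[h1 h2].
  have ts0 : 0 <= t * s by rewrite mulr_ge0// ltW.
  have ts1 : t * s <= s by rewrite ler_piMl// ltW.
  rewrite !mxE eqxx/=; case: eqP => _; rewrite ?mulr1 ?mulr0; apply/andP; split; lra.
apply: (@le_trans _ _ (nrm (dot leb (cube a (2 * s))) (dird f h) ^+ 2)).
  by rewrite ler_pXn2r ?nnegrE ?nrm_ge0.
apply: le_trans (nrm2_dird_le _ mD hf) _.
have -> : \int[leb]_(x in cube a (2 * s)) grad_sqr f x = genergy a s f.
  have HS x : cube a (2 * s) x -> ~ cube a s x -> grad_sqr f x = 0.
    by move=> _ /Hf[_ H]; rewrite /grad_sqr big1// => j _; rewrite H expr0n.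
  by rewrite /genergy -(@Rint_supp _ _ _ leb (cube a (2 * s)) (cube a s) (grad_sqr f) HS) setIC (setIidl Q2).
apply: ler_wpM2r; first exact: genergy_ge0.
by apply: ler_wpM2l => //; rewrite ler_pXn2r ?nnegrE// ltW.
Qed.

(** The bound that [avg_child_sub] gives, at energy at most 1, for the change of average from a cube
    of side s to one of its children; [steps] adds these changes over k generations. *)
Definition step (s : R) : R := Num.sqrt (n%:R * (s / 2) ^+ 2 / vol' (s / 2)).

Lemma step_half (s : R) : 0 <= s -> step (s / 2) ^+ 2 * 4 = (2 ^ n)%:R * step s ^+ 2.
Proof.
move=> s0; rewrite /step !sqr_sqrtr; last 2 first.
- by rewrite divr_ge0 ?vol_ge0// mulr_ge0 ?sqr_ge0.
- by rewrite divr_ge0 ?vol_ge0// mulr_ge0 ?sqr_ge0.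
have s2 : 0 <= s / 2 by rewrite divr_ge0.
rewrite (vol_half s2) invfM exprMn.
have N0 : (2 ^ n)%:R != 0 :> R by rewrite pnatr_eq0 expn_eq0.
rewrite mulrA [(2 ^ n)%:R * (n%:R * _)]mulrC; move: (vol' _)^-1 => v.
rewrite -[RHS]mulrA.
have -> : (2 ^ n)%:R * ((2 ^ n)%:R^-1 * v) = v by rewrite mulrA mulfV ?mul1r.
lra.
Qed.

Fixpoint steps k (s : R) : R := if k is m.+1 then step s + steps m (s / 2) else 0.

(** By [step_half] and the hypothesis on q, halving the side multiplies [step] by at most q, so
    [steps] is dominated by a geometric sum of ratio q. *)
Lemma steps_le (q s : R) k : 1 < q -> (2 ^ n)%:R <= 4 * q ^+ 2 -> 0 <= s ->
  (q - 1) * steps k s <= step s * (q ^+ k - 1).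
Proof.
move=> q1 qn; elim: k s => [|k IH] s s0 /=; first by rewrite expr0 subrr !mulr0.
have s2 : 0 <= s / 2 by rewrite divr_ge0.
have hq : step (s / 2) <= q * step s.
  have st0 t : 0 <= step t by exact: sqrtr_ge0.
  rewrite -(@ler_pXn2r _ 2)// ?nnegrE// ?mulr_ge0//; last by lra.
  have := step_half s0; have := ler_wpM2r (sqr_ge0 (step s)) qn; rewrite exprMn.
  move: (step (s / 2) ^+ 2) (step s ^+ 2) => u v; lra.
have hk : 0 <= q ^+ k - 1 by rewrite subr_ge0 exprn_ege1// ltW.
have := IH _ s2; have := ler_wpM2r hk hq; rewrite exprS.
move: (steps k (s / 2)) (step s) (step (s / 2)) (q ^+ k) => A B C D; lra.
Qed.

Lemma genergy_child_le a (s : R) (b : {ffun 'I_n -> bool}) f : 0 <= s -> C1c f ->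
  genergy (child a s b) (s / 2) f <= genergy a s f.
Proof.
move=> s0 hf; rewrite (genergy_children a s0 hf) (bigD1 b)//= lerDl.
by apply: sumr_ge0 => c _; exact: genergy_ge0.
Qed.

Lemma level_sqr_le (l c u : R) : 0 <= l -> l ^+ 2 * (l < `|u - c|)%R%:R <= (u - c) ^+ 2.
Proof.
move=> l0; case: ltP => h /=; rewrite ?mulr0 ?mulr1 ?sqr_ge0//.
by rewrite -(real_normK (num_real (u - c))) ler_pXn2r ?nnegrE// ltW.
Qed.

(** If f differs from its average over the cube by more than l + steps, then it differs by more than
    l from its average over the small cube k generations below, because the averages in between move
    by at most [steps]. Chebyshev's and Poincare's inequalities on the small cubes, of side s / 2^k,
    conclude. *)
Lemma level_steps k a (s l : R) f : 0 < s -> 0 < l -> C1c f -> genergy a s f <= 1 ->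
  l ^+ 2 * \int[leb]_(x in cube a s) (l + steps k s < `|f x - avg a s f|)%R%:R <=
  (2 ^ n * n)%:R * (s / 2 ^+ k) ^+ 2 * genergy a s f.
Proof.
move=> + l0 hf; elim: k a s => [|k IH] a s s0 g1; have hC := C1c_Cc hf.
  have mQ : measurable (cube a s) by exact: measurable_cube.
  rewrite expr0 divr1 /= addr0.
  have i1 : integ leb (cube a s) (fun x => (l < `|f x - avg a s f|)%R%:R).
    by apply: integ_level => //; exact: bounded_cube.
  have e1 := RintegralZl (l ^+ 2) mQ i1.
  apply: le_trans (poincare_cube vol_gt0 a s0 hf).
  rewrite -e1; apply: (Rint_le mQ); first exact: integZ.
  - have i0 := Cc_integ mQ hC; have ic := integ_cst_bounded (avg a s f) mQ (bounded_cube a s).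
    have is2 : integ leb (cube a s) (fun x => f x ^+ 2) by have [] := Cc_sqinteg mQ hC.
    have is1 := integD mQ (integD mQ is2 (integZ mQ (- 2 * avg a s f) i0))
       (integ_cst_bounded (avg a s f ^+ 2) mQ (bounded_cube a s)).
    apply: (integ_ext mQ) is1 => x _; lra.
  - by move=> x _; apply: level_sqr_le; exact: ltW.
have s2 : 0 < s / 2 by rewrite divr_gt0.
have mC b : measurable (cube (child a s b) (s / 2)) by exact: measurable_cube.
have avgb b : `|avg (child a s b) (s / 2) f - avg a s f| <= step s.
  rewrite /step -sqrtr_sqr ler_wsqrtr//.
  apply: le_trans (avg_child_sub vol_gt0 a b s0 hf) _.
  apply: ler_wpM2r; first by rewrite invr_ge0 vol_ge0.
  by rewrite ler_piMr// mulr_ge0 ?sqr_ge0.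
have gb b : genergy (child a s b) (s / 2) f <= 1.
  by apply: le_trans g1; apply: genergy_child_le => //; exact: ltW.
rewrite Rint_children ?(ltW s0)//; last first.
  by apply: integ_level => //; [exact: measurable_cube|exact: bounded_cube].
rewrite (genergy_children a (ltW s0) hf) !big_distrr/=; apply: ler_sum => b _.
have -> : s / 2 ^+ k.+1 = s / 2 / 2 ^+ k by rewrite exprS invfM mulrA.
apply: le_trans (IH _ _ s2 (gb b)); apply: ler_wpM2l; first exact: sqr_ge0.
have bb : bounded_set (cube (child a s b) (s / 2)) by exact: bounded_cube.
apply: (Rint_le (mC b)); try exact: integ_level.
move=> x _; rewrite ler_nat.
have := ler_normD (f x - avg (child a s b) (s / 2) f) (avg (child a s b) (s / 2) f - avg a s f).
rewrite addrA subrK; have := avgb b; move: (`|avg _ _ _ - _|) => A hA hB.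
case: (ltP _ `|f x - avg a s f|) => //= hs; suff -> : (l + steps k (s / 2) < `|f x - avg (child a s b) (s / 2) f|)%R by [].
lra.
Qed.

Lemma expr_unbounded (q x : R) : 1 < q -> exists k, x < q ^+ k.
Proof.
move=> q1; have q10 : 0 < q - 1 by lra.
have bern k : 1 + k%:R * (q - 1) <= q ^+ k.
  elim: k => [|k IH]; first by rewrite mul0r addr0 expr0.
  have qk0 : 0 <= k%:R * (q - 1) * (q - 1) by rewrite !mulr_ge0// ltW.
  have : q * (1 + k%:R * (q - 1)) <= q * q ^+ k by rewrite ler_wpM2l//; lra.
  rewrite -exprS; apply: le_trans; rewrite -addn1 natrD.
  by move: (k%:R : R) qk0 => z; lra.
exists (Num.bound (`|x| / (q - 1))).
apply: lt_le_trans (bern _).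
have := @archi_boundP _ (`|x| / (q - 1)); rewrite divr_ge0 ?(ltW q10)// => /(_ isT).
rewrite ltr_pdivrMr//; have := ler_norm x.
move: (_%:R * _) => z; lra.
Qed.

Lemma powRX (x r : R) k : 0 <= x -> (x ^+ k) `^ r = (x `^ r) ^+ k.
Proof.
move=> x0; elim: k => [|k IH]; first by rewrite !expr0 powR1.
by rewrite !exprS powRM ?exprn_ge0// IH.
Qed.

(** Levels t of order q^k are examined at the k-th dyadic generation, where [level_steps] gives t^2
    meas{|f| > t} <= C / 4^k; the remaining factor t^(r - 2) is of order q^(k (r - 2)) = 4^k. This
    is the origin of the relation between q and r. *)
Lemma weak_type (i : 'I_n) a (s q r : R) : 0 < s -> 1 < q -> (2 ^ n)%:R <= 4 * q ^+ 2 ->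
  2 < r -> q `^ (r - 2) = 4 ->
  exists2 C : R, 0 <= C & forall f (t : R), vanish_off (cube a s) f -> genergy a s f <= 1 -> 0 < t ->
    t `^ r * \int[leb]_(x in cube a s) (t < `|f x|)%R%:R <= C.
Proof.
move=> s0 q1 qn r2 q4; have v0 := vol_gt0 s0.
have mQ : measurable (cube a s) by exact: measurable_cube.
have bQ : bounded_set (cube a s) by exact: bounded_cube.
pose P0 : R := n%:R * s ^+ 2; pose P := Num.sqrt (P0 / vol' s).
have P00 : 0 <= P0 by rewrite mulr_ge0 ?sqr_ge0.
have q10 : 0 < q - 1 by lra.
have st0 : 0 <= step s by exact: sqrtr_ge0.
(* Then [D * q ^+ k] dominates [steps k s] plus the bound P on the average of f over the whole
   cube. *)
pose D := step s / (q - 1) + P + 1.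
have sd0 : 0 <= step s / (q - 1) by rewrite divr_ge0// ltW.
have D0 : 0 < D by have := sqrtr_ge0 (P0 / vol' s); rewrite /D /P; lra.
pose CP : R := (2 ^ n * n)%:R * s ^+ 2.
have CP0 : 0 <= CP by rewrite mulr_ge0 ?sqr_ge0.
pose E := (2 * D) `^ (r - 2).
have E0 : 0 <= E by exact: powR_ge0.
exists ((16 * CP + P0) * E); first by rewrite mulr_ge0//; lra.
move=> f t [hf Hf] g1 t0; have hC := C1c_Cc hf.
have il (c u : R) : integ leb (cube a s) (fun x => (u < `|f x - c|)%R%:R) by exact: integ_level.
have hl (u : R) : \int[leb]_(x in cube a s) (u < `|f x|)%R%:R =
    \int[leb]_(x in cube a s) (u < `|f x - 0|)%R%:R :> R.
  by apply: Rint_ext => x _; rewrite subr0.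
have f2 : \int[leb]_(x in cube a s) f x ^+ 2 <= P0.
  apply: le_trans (poincare_vanish i s0 (conj hf Hf)) _.
  by rewrite ler_piMr.
have if2 : integ leb (cube a s) (fun x => f x ^+ 2) by have [] := Cc_sqinteg mQ hC.
have av : `|avg a s f| <= P.
  rewrite /P -sqrtr_sqr ler_wsqrtr// ler_pdivlMr// mulrC.
  have := Rint_sqr_avg vol_gt0 a 0 s0 hC.
  have -> : \int[leb]_(x in cube a s) (f x - 0) ^+ 2 = \int[leb]_(x in cube a s) f x ^+ 2.
    by apply: Rint_ext => x _; rewrite subr0.
  have : 0 <= osc a s f by apply: Rint_ge0 => x _; exact: sqr_ge0.
  by rewrite subr0; move: f2; lra.
have -> : t `^ r = t ^+ 2 * t `^ (r - 2).
  rewrite -powR_mulrn ?(ltW t0)// -powRD; last by apply/implyP => _; exact: lt0r_neq0.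
  by congr (_ `^ _); lra.
set X := \int[leb]_(x in _) _.
have X0 : 0 <= X by apply: Rint_ge0 => x _; exact: ler0n.
have r20 : 0 <= r - 2 by lra.
(* For bounded levels Chebyshev's inequality with the L^2 bound P0 is enough. *)
have [tD|Dt] := leP t (2 * D).
  have h1 : t ^+ 2 * X <= P0.
    apply: le_trans f2; rewrite /X hl -(RintegralZl (t ^+ 2) mQ (il 0 t)).
    apply: (Rint_le mQ) => //; first exact: integZ.
    by move=> x _; have := level_sqr_le 0 (f x) (ltW t0); rewrite !subr0.
  have h2 : t `^ (r - 2) <= E.
    by apply: (ge0_ler_powR r20); rewrite ?nnegrE ?(ltW t0)// ?mulr_ge0// ltW.
  rewrite mulrAC; apply: ler_pM => //; rewrite ?powR_ge0//.
    by rewrite mulr_ge0 ?sqr_ge0.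
  by move: h1 CP0; lra.
(* The last generation whose accumulated steps and average stay below t / 2, which leaves l = t / 2
   for [level_steps]; the upper bound controls t^(r - 2) by a multiple of 4^k. *)
have [k /andP[hk1 hk2]] : exists k, D * q ^+ k <= t / 2 < D * q ^+ k.+1.
  have exk : exists k, t / 2 < D * q ^+ k.
    by have [k hk] := expr_unbounded (t / 2 / D) q1; exists k; rewrite [D * _]mulrC -ltr_pdivrMr.
  case: (ex_minnP exk) => -[|k] hk kmin; first by move: hk; rewrite expr0; lra.
  by exists k; rewrite hk andbT leNgt; apply/negP => /kmin; rewrite ltnn.
have t20 : 0 < t / 2 by rewrite divr_gt0.
have qk1 : 1 <= q ^+ k by rewrite exprn_ege1// ltW.
have Sk : steps k s + P <= D * q ^+ k.
  have : steps k s <= step s / (q - 1) * q ^+ k.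
    rewrite -[leRHS]mulrAC ler_pdivlMr// mulrC.
    by apply: le_trans (steps_le k q1 qn (ltW s0)) _; rewrite ler_wpM2l//; lra.
  have : P * 1 <= P * q ^+ k by rewrite ler_wpM2l// sqrtr_ge0.
  by rewrite /D; lra.
have h1 : (t / 2) ^+ 2 * X <= CP / 4 ^+ k.
  have hs := level_steps k s0 t20 hf g1.
  have h4 : (2 ^ n * n)%:R * (s / 2 ^+ k) ^+ 2 * genergy a s f <= CP / 4 ^+ k.
    have -> : CP / 4 ^+ k = (2 ^ n * n)%:R * (s / 2 ^+ k) ^+ 2.
      have -> : (4 : R) = 2 * 2 by lra.
      by rewrite exprMn -expr2 expr_div_n mulrA.
    by rewrite ler_piMr// mulr_ge0 ?sqr_ge0.
  apply: le_trans h4; apply: le_trans hs; apply: ler_wpM2l; first exact: sqr_ge0.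
  rewrite /X hl; apply: (Rint_le mQ) => // x _; rewrite subr0 ler_nat.
  have := ler_normD (f x - avg a s f) (avg a s f); rewrite subrK.
  case: (ltP t) => //= h hA.
  suff -> : (t / 2 + steps k s < `|f x - avg a s f|)%R by [].
  by move: av Sk hk1 h hA; move: (`|f x - _|) (`|f x|) (`|avg a s f|) => A B C'; lra.
have h2 : t `^ (r - 2) <= E * 4 ^+ k.+1.
  have -> : 4 ^+ k.+1 = (q ^+ k.+1) `^ (r - 2).
    by rewrite powRX ?q4//; lra.
  rewrite -powRM ?mulr_ge0 ?exprn_ge0//; try (by lra); try exact: ltW.
  apply: (ge0_ler_powR r20); rewrite ?nnegrE; [exact: ltW| |by lra].
  by rewrite mulr_ge0 ?exprn_ge0//; lra.
have -> : t ^+ 2 * t `^ (r - 2) * X = 4 * ((t / 2) ^+ 2 * X) * t `^ (r - 2) by lra.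
apply: (@le_trans _ _ (4 * (CP / 4 ^+ k) * (E * 4 ^+ k.+1))).
  apply: ler_pM; rewrite ?powR_ge0//; last by rewrite ler_wpM2l.
  by rewrite mulr_ge0// mulr_ge0// sqr_ge0.
have -> : 4 * (CP / 4 ^+ k) * (E * 4 ^+ k.+1) = 16 * CP * E.
  rewrite exprS; have : (4 ^+ k : R) != 0 by rewrite expf_neq0.
  move: (4 ^+ k) => v /mulVf; move: v^-1 => u uv.
  suff H (b d : R) : 4 * (b * u) * (d * (4 * v)) = 16 * b * d by exact: H.
  have -> : 4 * (b * u) * (d * (4 * v)) = 16 * b * d * (u * v) by lra.
  by rewrite uv mulr1.
by rewrite ler_wpM2r//; lra.
Qed.

(* A smooth substitute for Maz'ya's truncations: [cap c w] is at least [c / 2] above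
   the level [1 / w], and the energies of [cap c w \o f] at the levels [1 / w = 2 ^ k]
   telescope. *)
Definition cap (c w u : R) : R := c * (1 - (1 + (w * u) ^+ 2)^-1).

Lemma cap_denom (z : R) : 1 + z ^+ 2 != 0.
Proof. by apply: lt0r_neq0; have := sqr_ge0 z; lra. Qed.

Lemma cap_derive (c w u : R) :
  is_derive u (1 : R) (cap c w) (2 * c * w * (w * u) * (1 + (w * u) ^+ 2)^-1 ^+ 2).
Proof.
have D0 := is_deriveZ w (is_derive_id u (1 : R)).
have D1 : is_derive u (1 : R) (fun u => 1 + (w * u) ^+ 2) (2 * w * (w * u)).
  have D := is_deriveD (is_derive_cst (1 : R) u (1 : R)) (is_deriveX 2 D0).
  have -> : 2 * w * (w * u) = 0 + (2 * (w * u) ^+ 1) * (w * 1) by rewrite expr1 mulr1; lra.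
  exact: D.
have D2 := is_deriveV (f := fun u => 1 + (w * u) ^+ 2) (cap_denom (w * u)) D1.
have D3 := is_deriveZ c (is_deriveB (is_derive_cst (1 : R) u (1 : R)) D2).
apply: (is_derive_eq D3).
by rewrite /GRing.scale/= exprVn; lra.
Qed.

Lemma cap_derive1 (c w u : R) :
  derive1 (cap c w) u = 2 * c * w * (w * u) * (1 + (w * u) ^+ 2)^-1 ^+ 2.
Proof. by rewrite derive1E; have [_ ->] := cap_derive c w u. Qed.

Lemma cap_derivable (c w u : R) : derivable (cap c w) u 1.
Proof. by have [] := cap_derive c w u. Qed.

Lemma cap_continuous (c w : R) : continuous (derive1 (cap c w)).
Proof.
have -> : derive1 (cap c w) = (fun u => 2 * c * w * (w * u) * (1 + (w * u) ^+ 2)^-1 ^+ 2).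
  by apply/funext => u; exact: cap_derive1.
move=> u; apply: cvgM.
  by apply: cvgM; [exact: cvg_cst|apply: cvgM; [exact: cvg_cst|exact: cvg_id]].
have c1 : (1 + (w * x) ^+ 2)^-1 @[x --> u] --> (1 + (w * u) ^+ 2)^-1.
  apply: cvgV; first exact: cap_denom.
  have c0 : (w * x) @[x --> u] --> w * u by apply: cvgM; [exact: cvg_cst|exact: cvg_id].
  by apply: cvgD; [exact: cvg_cst|exact: (cvgM c0 c0)].
exact: (cvgM c1 c1).
Qed.

Lemma cap0 (c w : R) : cap c w 0 = 0.
Proof. by rewrite /cap mulr0 expr0n addr0 invr1 subrr mulr0. Qed.

Lemma cap_itv (w u : R) : 0 <= cap 1 w u <= 1.
Proof.
have h := sqr_ge0 (w * u).
have v1 : (1 + (w * u) ^+ 2)^-1 <= 1 by rewrite invf_le1; lra.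
have v0 : 0 <= (1 + (w * u) ^+ 2)^-1 by rewrite invr_ge0; lra.
by rewrite /cap mul1r; apply/andP; split; lra.
Qed.

Lemma cap_gt (c w u : R) : 0 < c -> 0 <= w -> 1 < w * `|u| -> c / 2 < `|cap c w u|.
Proof.
move=> c0 w0 h; rewrite /cap normrM gtr0_norm// ltr_pM2l//.
have h2 : 1 < (w * u) ^+ 2.
  rewrite -(real_normK (num_real _)) normrM ger0_norm//.
  by rewrite exprn_egt1.
apply: lt_le_trans (ler_norm _).
have : (1 + (w * u) ^+ 2)^-1 < 2^-1 by rewrite ltf_pV2 ?posrE; lra.
by lra.
Qed.

(** With z = w u, v = 1 / (1 + z^2) and v' = 1 / (1 + z^2 / 4), the difference of the two caps is v'
    - v = (3 / 4) z^2 v v', while the squared derivative is (c w)^2 4 z^2 v^4; and v^4 <= v v' as v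
    <= 1 and v <= v'. *)
Lemma cap_telescope (c w u : R) :
  derive1 (cap c w) u ^+ 2 <= (c * w) ^+ 2 * (16 / 3 * (cap 1 w u - cap 1 (w / 2) u)).
Proof.
rewrite cap_derive1 /cap !mul1r; have -> : w / 2 * u = w * u / 2 by lra.
move: (w * u) => z; have z0 := sqr_ge0 z; have z20 := sqr_ge0 (z / 2).
have e1 : (1 + z ^+ 2) * (1 + z ^+ 2)^-1 = 1 by rewrite mulfV// cap_denom.
have e2 : (1 + (z / 2) ^+ 2) * (1 + (z / 2) ^+ 2)^-1 = 1 by rewrite mulfV// cap_denom.
have v0 : 0 < (1 + z ^+ 2)^-1 by rewrite invr_gt0; lra.
have v1 : (1 + z ^+ 2)^-1 <= 1 by rewrite invf_le1; lra.
have vv : (1 + z ^+ 2)^-1 <= (1 + (z / 2) ^+ 2)^-1 by rewrite lef_pV2 ?posrE; lra.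
move: (1 + z ^+ 2)^-1 (1 + (z / 2) ^+ 2)^-1 e1 e2 v0 v1 vv => v v' e1 e2 v0 v1 vv.
have -> : (2 * c * w * z * v ^+ 2) ^+ 2 = (c * w) ^+ 2 * (4 * z ^+ 2 * v ^+ 4).
  by rewrite (exprM v 2 2) !exprMn; lra.
apply: ler_wpM2l; first exact: sqr_ge0.
have E : v' - v = v * v' * (3 / 4 * z ^+ 2).
  have -> : v' - v = v' * ((1 + z ^+ 2) * v) - v * ((1 + (z / 2) ^+ 2) * v') by rewrite e1 e2 !mulr1.
  by lra.
have -> : 1 - v - (1 - v') = v' - v by lra.
rewrite E.
have h1 : v * v <= v * v' by rewrite ler_pM2l.
have h2 : v ^+ 4 <= v * v.
  rewrite (exprD v 2 2) -expr2 ler_piMl ?sqr_ge0//.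
  by rewrite expr_le1// ltW.
have h3 : z ^+ 2 * v ^+ 4 <= z ^+ 2 * (v * v') by rewrite ler_wpM2l// (le_trans h2).
by lra.
Qed.

Lemma genergy_cap a (s c w : R) f : C1c f ->
  genergy a s (cap c w \o f) <= (c * w) ^+ 2 * (16 / 3 *
   (\int[leb]_(x in cube a s) (cap 1 w (f x) * grad_sqr f x) -
    \int[leb]_(x in cube a s) (cap 1 (w / 2) (f x) * grad_sqr f x))).
Proof.
move=> hf; have mQ : measurable (cube a s) by exact: measurable_cube.
have Ccap c' w' : C1c (cap c' w' \o f).
  by apply: C1c_comp; [exact: cap_derivable|exact: cap_continuous|exact: cap0|exact: hf].
have ic w' : integ leb (cube a s) (fun x => cap 1 w' (f x) * grad_sqr f x).
  by apply: (Cc_integ mQ); exact: (CcM (C1c_Cc (Ccap 1 w')) (Cc_grad_sqr hf)).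
have e1 := RintegralB mQ (ic w) (ic (w / 2)).
rewrite mulrA -e1; set k := _ * (16 / 3).
have ib := integB mQ (ic w) (ic (w / 2)).
have e2 := RintegralZl k mQ ib.
rewrite -e2; apply: (Rint_le mQ).
- by apply: (Cc_integ mQ); exact: Cc_grad_sqr.
- exact: integZ.
move=> x _; have -> : grad_sqr (cap c w \o f) x = derive1 (cap c w) (f x) ^+ 2 * grad_sqr f x.
  rewrite /grad_sqr big_distrr/=; apply: eq_bigr => i _.
  have [df _ _] := hf.
  have dc : derivable (cap c w) (f x) 1 by exact: cap_derivable.
  by rewrite (partial_comp i dc (df x)) exprMn.
rewrite -mulrBl mulrA; apply: ler_wpM2r; first exact: grad_sqr_ge0.
by rewrite /k -mulrA; exact: cap_telescope.
Qed.

End sobolev_inequality.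

Section mazya.
Context {R : realType} {n : nat}.
Local Notation leb := (lebesgue_rV R n).
Local Notation vol' := (@vol R n).
Implicit Types (D : set 'rV[R]_n) (f g : 'rV[R]_n -> R) (x y h a : 'rV[R]_n).
Hypothesis vol_gt0 : forall s : R, 0 < s -> 0 < vol' s.

Lemma powR_dyadic (r u : R) N : 0 < r -> `|u| <= 2 ^+ N ->
  `|u| `^ r <= 1 + \sum_(k < N) 2 `^ r * (2 `^ r) ^+ k * (2 ^+ k < `|u|)%R%:R.
Proof.
move=> r0; elim: N => [|N IH] uN.
  by rewrite big_ord0 addr0 -[leRHS](congr1 (@^~ r) (powR1 R)); apply: (ge0_ler_powR (ltW r0)); rewrite ?nnegrE//.
have t0 k : 0 <= 2 `^ r * (2 `^ r) ^+ k * (2 ^+ k < `|u|)%R%:R.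
  by rewrite !mulr_ge0 ?exprn_ge0 ?powR_ge0.
rewrite big_ord_recr/= addrA; have [{}/IH IH|h] := leP `|u| (2 ^+ N).
  by rewrite mulr0 addr0.
rewrite mulr1 -exprS -powRX// -[leLHS]add0r; apply: lerD.
  by rewrite addr_ge0// sumr_ge0.
by apply: (ge0_ler_powR (ltW r0)); rewrite ?nnegrE// exprn_ge0.
Qed.

Lemma integ_powR D f (r : R) : measurable D -> bounded_set D -> 0 < r -> Cc f ->
  integ leb D (fun x => `|f x| `^ r).
Proof.
move=> mD bD r0 hf; have [M M0 HM] := Cc_bounded hf.
apply: (integ_le mD) (integ_cst_bounded (M `^ r) mD bD).
  apply: (measurableT_comp (measurable_powR r)); apply: measurableT_comp.
    exact: normr_measurable.
  exact: Cc_measurable.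
move=> x _; rewrite ger0_norm ?powR_ge0//.
by apply: (ge0_ler_powR (ltW r0)); rewrite ?nnegrE.
Qed.

(* The weak type bound for the caps of f at the levels [2 ^ k], whose energies are
   summable, adds up to a strong type bound. *)
Lemma sobolev_C1c (i : 'I_n) a (s q r : R) : 0 < s -> 1 < q -> (2 ^ n)%:R <= 4 * q ^+ 2 ->
  2 < r -> q `^ (r - 2) = 4 ->
  exists2 C : R, 0 <= C & forall f, vanish_off (cube a s) f -> genergy a s f <= 1 ->
    \int[leb]_(x in cube a s) `|f x| `^ r <= C.
Proof.
move=> s0 q1 qn r2 q4.
have [C C0 HC] := weak_type vol_gt0 i a s0 q1 qn r2 q4.
have r0 : 0 < r by lra.
have h7 : (7 : R) <= 7 ^+ 2 by lra.
have mQ : measurable (cube a s) by exact: measurable_cube.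
have bQ : bounded_set (cube a s) by exact: bounded_cube.
pose T := 2 `^ r : R; have T0 : 0 <= T by exact: powR_ge0.
(* The normalizing constants [c k] below are at most 16 / 3 + 1 <= 7, so [Num.sqrt (c k)] to the
   power r is at most [E * c k]: linear in [c k], hence summable. *)
pose E := 7 `^ (r - 2) : R; have E0 : 0 <= E by exact: powR_ge0.
exists (vol' s + T * (C * (T * E)) * 8).
  by rewrite addr_ge0 ?vol_ge0// !mulr_ge0.
move=> f [hf Hf] g1; have hC := C1c_Cc hf.
pose A k := \int[leb]_(x in cube a s) (cap 1 (2 ^+ k)^-1 (f x) * grad_sqr f x).
have Ccap c' w' : C1c (cap c' w' \o f).
  by apply: C1c_comp; [exact: cap_derivable|exact: cap_continuous|exact: cap0|exact: hf].
have ic w' : integ leb (cube a s) (fun x => cap 1 w' (f x) * grad_sqr f x).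
  by apply: (Cc_integ mQ); exact: (CcM (C1c_Cc (Ccap 1 w')) (Cc_grad_sqr hf)).
have ig : integ leb (cube a s) (grad_sqr f) by apply: (Cc_integ mQ); exact: Cc_grad_sqr.
have A0 k : 0 <= A k.
  apply: Rint_ge0 => x _; rewrite mulr_ge0 ?grad_sqr_ge0//.
  by have /andP[] := cap_itv (2 ^+ k)^-1 (f x).
have A1 k : A k <= 1.
  apply: le_trans g1; apply: (Rint_le mQ) => // x _.
  by rewrite ler_piMl ?grad_sqr_ge0//; have /andP[] := cap_itv (2 ^+ k)^-1 (f x).
have AS k : A k.+1 <= A k.
  apply: (Rint_le mQ) => // x _; apply: ler_wpM2r; first exact: grad_sqr_ge0.
  have p1 (z : R) : 0 < 1 + z ^+ 2 by have := sqr_ge0 z; lra.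
  rewrite /cap !mul1r lerD2l lerN2 lef_pV2 ?posrE//.
  have -> : (2 ^+ k.+1)^-1 * f x = (2 ^+ k)^-1 * f x / 2 by rewrite exprS invfM; lra.
  by rewrite lerD2l; move: (_ * f x) => z; have := sqr_ge0 z; lra.
(* By [genergy_cap] the first term bounds the energy of the cap of height 2^k at the level 2^k. The
   second one is summable and keeps [c k] positive, for it is going to be a divisor. *)
pose c k := 16 / 3 * (A k - A k.+1) + 2^-1 ^+ k.
have h2k k : 0 < (2^-1 : R) ^+ k <= 1.
  by rewrite exprn_gt0 ?invr_gt0//= exprn_ile1// invf_le1// ler1n.
have c0 k : 0 < c k by rewrite /c; have := AS k; have /andP[] := h2k k; lra.
have c7 k : c k <= 7 by rewrite /c; have := A1 k; have := A0 k.+1; have /andP[] := h2k k; lra.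
have lev k : T ^+ k * \int[leb]_(x in cube a s) (2 ^+ k < `|f x|)%R%:R <= C * (T * E) * c k.
  pose w : R := (2 ^+ k)^-1.
  have k0 : 0 < 2 ^+ k :> R by rewrite exprn_gt0.
  have w0 : 0 < w by rewrite invr_gt0.
  have sc0 : 0 < Num.sqrt (c k) by rewrite sqrtr_gt0.
  (* The height for which the energy of the cap is at most 1, as [weak_type] requires. *)
  pose d : R := 2 ^+ k / Num.sqrt (c k).
  have d0 : 0 < d by rewrite divr_gt0.
  have g2 : genergy a s (cap d w \o f) <= 1.
    apply: le_trans (genergy_cap a s d w hf) _.
    have -> : w / 2 = (2 ^+ k.+1)^-1 by rewrite exprS invfM mulrC.
    rewrite -/(A k) -/(A k.+1).
    have -> : (d * w) ^+ 2 = (c k)^-1.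
      by rewrite /d /w mulrAC mulfV ?lt0r_neq0// mul1r exprVn sqr_sqrtr// ltW.
    rewrite mulrC ler_pdivrMr// mul1r /c lerDl.
    by have /andP[/ltW] := h2k k.
  have vg : vanish_off (cube a s) (cap d w \o f).
    apply: vanish_off_comp; [exact: cap_derivable|exact: cap_continuous|exact: cap0|].
    by split.
  have d20 : 0 < d / 2 by rewrite divr_gt0.
  have := HC _ _ vg g2 d20.
  set X := \int[leb]_(x in _) _; set Y := \int[leb]_(x in _) _ => hX.
  have YX : Y <= X.
    have il g t : Cc g -> integ leb (cube a s) (fun x => (t < `|g x|)%R%:R).
      move=> Cg; apply: (integ_ext mQ) (integ_level 0 t mQ bQ Cg) => x _.
      by rewrite subr0.
    apply: (Rint_le mQ); [exact: il|apply: il; exact: C1c_Cc|].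
    move=> x _; rewrite ler_nat; case: ltP => //= h.
    have -> // : (d / 2 < `|cap d w (f x)|)%R.
    by apply: cap_gt => //; [exact: ltW|rewrite mulrC ltr_pdivlMr// mul1r].
  have Y0 : 0 <= Y by apply: Rint_ge0 => x _; exact: ler0n.
  have dr : T ^+ k = (d / 2) `^ r * (2 * Num.sqrt (c k)) `^ r.
    rewrite -powRM ?mulr_ge0 ?(ltW sc0) ?(ltW d20)// /T -powRX//.
    congr (_ `^ _); rewrite /d.
    rewrite -[RHS]mulrA [2^-1 * _]mulrA mulVf// mul1r -mulrA mulVf ?mulr1//.
    exact: lt0r_neq0.
  have scE : (2 * Num.sqrt (c k)) `^ r <= T * E * c k.
    rewrite powRM ?(ltW sc0)// -mulrA; apply: ler_wpM2l => //.
    have -> : Num.sqrt (c k) `^ r = Num.sqrt (c k) `^ (r - 2 + 2) by rewrite subrK.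
    rewrite powRD; last by apply/implyP => _; exact: lt0r_neq0.
    rewrite (powR_mulrn 2 (ltW sc0)) sqr_sqrtr ?(ltW (c0 k))//.
    apply: ler_wpM2r; first exact: ltW.
    apply: ge0_ler_powR; rewrite ?nnegrE//; first by rewrite subr_ge0 ltW.
    rewrite -(@ler_pXn2r _ 2)// ?nnegrE// sqr_sqrtr ?(ltW (c0 k))//.
    exact: le_trans (c7 k) h7.
  have p0 : 0 <= (d / 2) `^ r by exact: powR_ge0.
  have hY : (d / 2) `^ r * Y <= C by apply: le_trans hX; rewrite ler_wpM2l.
  have -> : T ^+ k * Y = (d / 2) `^ r * Y * (2 * Num.sqrt (c k)) `^ r by rewrite dr mulrAC.
  rewrite -[leRHS]mulrA; apply: ler_pM => //; rewrite ?powR_ge0//.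
  by rewrite mulr_ge0.
have [M M0 HM] := Cc_bounded hC.
have [N hN] := expr_unbounded M (ltr1n R 2).
have il t : integ leb (cube a s) (fun x => (t < `|f x|)%R%:R).
  apply: (integ_ext mQ) (integ_level 0 t mQ bQ hC) => x _.
  by rewrite subr0.
have i1 := integ_cst_bounded 1 mQ bQ.
pose F (k : 'I_N) x : R := T * T ^+ k * (2 ^+ k < `|f x|)%R%:R.
have iF k : integ leb (cube a s) (F k) by apply: (integZ mQ); exact: il.
have iS := integ_sum mQ (index_enum 'I_N) iF.
have le1 : \int[leb]_(x in cube a s) `|f x| `^ r <=
    \int[leb]_(x in cube a s) (1 + \sum_(k < N) F k x).
  apply: (Rint_le mQ).
  - exact: integ_powR.
  - exact: (integD mQ i1 iS).
  - by move=> x _; apply: powR_dyadic => //; exact: le_trans (HM x) (ltW hN).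
apply: le_trans le1 _.
have e1 := RintegralD mQ i1 iS; have e2 := Rint_sum mQ (index_enum 'I_N) iF.
rewrite e1 e2 Rint_cst_cube mul1r lerD2l.
(* The energies telescope to at most 16 / 3 and the geometric part adds at most 2. *)
have S8 : \sum_(k < N) c k <= 8.
  have : \sum_(k < N) c k <= 16 / 3 * (A 0%N - A N) + 2 - 2 * 2^-1 ^+ N.
    elim: (N) => [|m IH]; first by rewrite big_ord0 subrr expr0; lra.
    rewrite big_ord_recr/= {2}/c exprS; move: IH.
    move: (2^-1 ^+ m : R) (A m.+1) (A m) (A 0%N) (\sum_(k < m) c k) => u A1' A2 A3 S; lra.
  by have := A1 0%N; have := A0 N; have /andP[] := h2k N; lra.
apply: (@le_trans _ _ (\sum_(k < N) T * (C * (T * E)) * c k)); last first.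
  by rewrite -mulr_sumr; apply: ler_wpM2l => //; rewrite !mulr_ge0.
apply: ler_sum => k _.
have := RintegralZl (T * T ^+ k) mQ (il (2 ^+ k)); rewrite -/(F k) => ->.
by rewrite -[leLHS]mulrA -[leRHS]mulrA; apply: ler_wpM2l => //; exact: lev.
Qed.

End mazya.

(** * Test functions *)

Section smooth_functions.
Context {R : realType} {n : nat}.
Implicit Types (f g : 'rV[R]_n -> R) (x : 'rV[R]_n).

(* Unlike the lists of indices in [smooth], the order N supports induction on products. *)
Fixpoint sm N f : Prop :=
  (forall x, differentiable f x) /\ if N is M.+1 then forall i, sm M (partial i f) else True.

Lemma sm_diff N f x : sm N f -> differentiable f x.
Proof. by case: N => [|N] []. Qed.

Lemma smoothP f : smooth f <-> forall N, sm N f.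
Proof.
split=> [hf N|].
  elim: N f hf => [|N IH] f hf /=; split=> //; try exact: (hf [::]).
  by move=> i; apply: IH => s x; have := hf (rcons s i) x; rewrite foldr_rcons.
move=> H s; elim/last_ind: s f H => [|s i IH] f H x; first exact: sm_diff (H 0%N).
by rewrite foldr_rcons; apply: IH => N; have [_] := H N.+1; exact.
Qed.

Lemma sm_pred N f : sm N.+1 f -> sm N f.
Proof.
elim: N f => [|N IH] f [df pf]; first by split.
by split => // i; apply: IH; exact: pf.
Qed.

Lemma partialM f g i x : differentiable f x -> differentiable g x ->
  partial i (fun y => f y * g y) x = f x * partial i g x + g x * partial i f x.
Proof. by move=> df dg; rewrite /partial (deriveM (diff_derivable df) (diff_derivable dg)). Qed.

Lemma partial_cst (c : R) i x : partial i (fun=> c) x = 0.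
Proof. by rewrite /partial derive_cst. Qed.

Lemma smZD N (c : R) f g : sm N f -> sm N g -> sm N (fun x => c * f x + g x).
Proof.
elim: N f g => [|N IH] f g hf hg; (split; [move=> x|]) => //.
1,2: apply: (differentiableD (f := fun x => c * f x)); last exact: sm_diff hg.
1,2: exact: (differentiableM (f := fun=> c) (differentiable_cst c x) (sm_diff x hf)).
move=> i; have -> : partial i (fun x => c * f x + g x) = (fun x => c * partial i f x + partial i g x).
  by apply/funext => x; rewrite partialZD//; [exact: sm_diff hf|exact: sm_diff hg].
by case: hf => _ pf; case: hg => _ pg; apply: IH; [exact: pf|exact: pg].
Qed.

Lemma sm_cst N (c : R) : sm N (fun=> c).
Proof.
elim: N c => [|N IH] c; split=> // i.
have -> : partial i (fun=> c : R) = fun=> 0 by apply/funext => x; exact: partial_cst.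
exact: IH.
Qed.

Lemma smM N f g : sm N f -> sm N g -> sm N (fun x => f x * g x).
Proof.
elim: N f g => [|N IH] f g hf hg; (split; [move=> x|]) => //.
1,2: by apply: differentiableM; [exact: sm_diff hf|exact: sm_diff hg].
move=> i; have -> : partial i (fun x => f x * g x) =
    (fun x => 1 * (f x * partial i g x) + g x * partial i f x).
  by apply/funext => x; rewrite partialM ?mul1r//; [exact: sm_diff hf|exact: sm_diff hg].
have hf' := sm_pred hf; have hg' := sm_pred hg.
by case: hf => _ pf; case: hg => _ pg; apply: smZD; apply: IH => //; [exact: pg|exact: pf].
Qed.

Lemma smoothZD (c : R) f g : smooth f -> smooth g -> smooth (fun x => c * f x + g x).
Proof. by move=> /smoothP hf /smoothP hg; apply/smoothP => N; exact: smZD. Qed.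

Lemma smoothM f g : smooth f -> smooth g -> smooth (fun x => f x * g x).
Proof. by move=> /smoothP hf /smoothP hg; apply/smoothP => N; exact: smM. Qed.

Lemma smooth_cst (c : R) : smooth (fun _ : 'rV[R]_n => c).
Proof. by apply/smoothP => N; exact: sm_cst. Qed.

Lemma smooth_partial f i : smooth f -> smooth (partial i f).
Proof. by move=> hf s x; have := hf (rcons s i) x; rewrite foldr_rcons. Qed.

Lemma smooth_prod (I : Type) (s : seq I) (F : I -> 'rV[R]_n -> R) :
  (forall i, smooth (F i)) -> smooth (fun x => \prod_(i <- s) F i x).
Proof.
move=> hF; elim: s => [|i s IH].
  by under eq_fun do rewrite big_nil; exact: smooth_cst.
by under eq_fun do rewrite big_cons; exact: smoothM.
Qed.

Lemma smooth_expr f k : smooth f -> smooth (fun x => f x ^+ k).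
Proof.
move=> hf; elim: k => [|k IH]; first by under eq_fun do rewrite expr0; exact: smooth_cst.
by under eq_fun do rewrite exprS; exact: smoothM.
Qed.

End smooth_functions.

(** * The flat function exp(- 1 / t) and its derivatives *)

Section flat.
Context {R : realType}.

(** The factor t^-k makes the family closed under differentiation up to linear combinations, so
    smoothness of all members follows by one induction. *)
Definition flat (k : nat) (t : R) : R := if 0 < t then t^-1 ^+ k * expR (- t^-1) else 0.

Lemma flat_le0 k t : t <= 0 -> flat k t = 0.
Proof. by rewrite /flat leNgt => /negbTE ->. Qed.

Lemma flat_ge0 k t : 0 <= flat k t.
Proof.
rewrite /flat; case: ifPn => // t0.
by rewrite mulr_ge0 ?expR_ge0// exprn_ge0// invr_ge0 ltW.
Qed.

Lemma flatS k t : flat k t = flat k.+1 t * t.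
Proof.
rewrite /flat; case: ifPn => [t0|_]; last by rewrite mul0r.
have : t^-1 * t = 1 by rewrite mulVf// lt0r_neq0.
rewrite exprS; move: (t^-1) (expR _) => u E; move: (u ^+ k) => a ut.
by rewrite -[LHS]mul1r -ut; lra.
Qed.

Lemma flat_bound k t : flat k t <= k`!%:R.
Proof.
rewrite /flat; case: ifPn => [t0|_]; last exact: ler0n.
have u0 : 0 <= t^-1 by rewrite invr_ge0 ltW.
rewrite expRN ler_pdivrMr ?expR_gt0//.
case: k => [|k]; first by rewrite expr0 mul1r; have := expR_ge1Dx t^-1; lra.
rewrite mulrC -ler_pdivrMr ?ltr0n ?fact_gt0//.
by have := expR_ge1Dxn k u0; lra.
Qed.

Lemma flat_derive k t : is_derive t (1 : R) (flat k) (flat k.+2 t - k%:R * flat k.+1 t).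
Proof.
have [t0|t0|->] := ltgtP t 0.
- rewrite !flat_le0 ?(ltW t0)// mulr0 subr0.
  apply: (near_eq_is_derive _ (is_derive_cst (0 : R) t (1 : R))).
  by near=> z; rewrite flat_le0//; near: z; by apply: filterS (lt_nbhsl t0) => z /ltW.
- have tn0 : t != 0 by exact: lt0r_neq0.
  have D1 := is_deriveV (f := id) tn0 (is_derive_id t (1 : R)).
  have D2 := is_deriveX k D1.
  have D3 : is_derive t (1 : R) (fun z => expR (- z^-1)) (expR (- t^-1) * - (- t ^- 2 *: 1)).
    have D0 := is_deriveN D1.
    exact: (is_derive1_comp (f := expR) (is_derive_expR _) D0).
  have D4 := is_deriveM D2 D3.
  have E : \forall z \near t, (((fun z : R => z^-1) ^+ k) * (fun z => expR (- z^-1))) z = flat k z.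
    near=> z; rewrite /flat ifT.
      congr (_ * _); elim: (k) => // m IH.
      by rewrite [RHS]exprS -IH exprS.
    by near: z; exact: lt_nbhsr.
  have D5 := near_eq_is_derive E D4.
  apply: (is_derive_eq D5); rewrite /flat t0 /GRing.scale/= mulr1.
  have -> : ((fun y : R => y^-1) ^+ k) t = t^-1 ^+ k by elim: (k) => //= m IH; rewrite !exprS -IH.
  rewrite -exprVn; move: (expR _) => w; move: t^-1 => u {D1 D2 D3 D4 D5 E}.
  case: k => [|k]; first by rewrite !expr1 !expr0; lra.
  rewrite [u ^+ k.+3]exprS [u ^+ k.+2]exprS [u ^+ k.+1]exprS /=.
  by move: (u ^+ k) (k.+1%:R : R) => a b; lra.
(* At 0 the slope function is [flat k.+1] by [flatS]; it is continuous there because it equals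
   [flat k.+2 z * z] with a bounded first factor. *)
- rewrite !flat_le0// mulr0 subr0; apply/is_derive1_caratheodory.
  exists (flat k.+1); split; last by rewrite flat_le0.
  + by move=> z; rewrite (flat_le0 k (lexx 0)) !subr0 -flatS.
  + rewrite /prop_for /continuous_at flat_le0//; apply/cvgr0Pnorm_le => e e0.
    pose c : R := k.+2`!%:R; have c0 : 0 < c by rewrite ltr0n fact_gt0.
    near=> z; rewrite flatS normrM ger0_norm ?flat_ge0//.
    apply: (@le_trans _ _ (c * (e / c))); last by rewrite mulrCA mulfV ?mulr1 ?lt0r_neq0.
    apply: ler_pM; rewrite ?flat_ge0 ?flat_bound//.
    by near: z; apply: cvgr0_norm_le; [exact: cvg_id|rewrite divr_gt0].
Unshelve. all: by end_near. Qed.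

End flat.

Section bumps.
Context {R : realType} {n : nat}.
Implicit Types (f g : 'rV[R]_n -> R) (x : 'rV[R]_n).

Lemma sm_flat N k (i : 'I_n) (c d : R) : sm N (fun x : 'rV[R]_n => flat k (c * x 0 i + d)).
Proof.
have dl (x : 'rV[R]_n) : differentiable (fun x : 'rV[R]_n => c * x 0 i + d) x.
  apply: (differentiableD (f := fun x : 'rV[R]_n => c * x 0 i)); last exact: differentiable_cst.
  exact: (differentiableM (f := fun=> c) (differentiable_cst c x) (differentiable_coord x 0 i)).
have dh (t : R) : derivable (flat k) t 1 by have [] := flat_derive k t.
elim: N k dh => [|N IH] k dh; (split; [move=> x|]) => //.
1,2: by apply: (differentiable_comp (g := flat k)); [exact: dl|exact/derivable1_diffP].
move=> j.
have -> : partial j (fun x : 'rV[R]_n => flat k (c * x 0 i + d)) =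
   (fun x => (- k%:R * (c * (j == i)%:R)) * flat k.+1 (c * x 0 i + d) +
             ((c * (j == i)%:R) * flat k.+2 (c * x 0 i + d) + 0)).
  apply/funext => x; rewrite (partial_comp (h := flat k) (f := fun x : 'rV[R]_n => c * x 0 i + d))//.
  rewrite derive1E; have [_ ->] := flat_derive k (c * x 0 i + d).
  have -> : partial j (fun x : 'rV[R]_n => c * x 0 i + d) x = c * (j == i)%:R.
    rewrite partialZD; [|exact: differentiable_coord|exact: differentiable_cst].
    rewrite partial_cst addr0; congr (_ * _).
    rewrite /partial /derive; apply: cvg_lim => //; apply: cvg_near_cst; near=> t.
    rewrite /= !mxE addrK /GRing.scale/= mulrA mulVf ?mul1r ?eqxx /= 1?[i == j]eq_sym//.
    by near: t; exact: nbhs_dnbhs_neq.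
  by lra.
apply: smZD; first by apply: IH => t; have [] := flat_derive k.+1 t.
apply: smZD; last exact: sm_cst.
by apply: IH => t; have [] := flat_derive k.+2 t.
Unshelve. all: by end_near. Qed.

End bumps.

(** * Smooth approximation of indicators of measurable sets *)

Section smooth_approximation.
Context {R : realType} {n : nat}.
Local Notation leb := (lebesgue_rV R n).
Implicit Types (D E : set 'rV[R]_n) (f g w : 'rV[R]_n -> R) (x y : 'rV[R]_n).

Lemma flat0_ge (t : R) : 0 < t -> 1 - t^-1 <= flat 0 t <= 1.
Proof.
move=> t0; rewrite (le_trans (flat_bound 0 t)) ?andbT//.
by rewrite /flat t0 expr0 mul1r; have := expR_ge1Dx (- t^-1).
Qed.

Lemma flat0_itv (t : R) : 0 <= flat 0 t <= 1.
Proof. by rewrite flat_ge0 (le_trans (flat_bound 0 t)). Qed.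

Lemma flat0_cvg1 (s_ : nat -> R) (c : R) : 0 < c -> (forall k, c * k.+1%:R <= s_ k) ->
  flat 0 (s_ k) @[k --> \oo] --> (1 : R).
Proof.
move=> c0 hs; apply/cvgrPdist_le => e e0.
have ec0 : 0 < e * c by rewrite mulr_gt0.
have [N _ HN] := near_infty_natSinv_lt (PosNum ec0).
exists N => // k /HN /= hk.
have ck0 : 0 < c * k.+1%:R by rewrite mulr_gt0// ltr0n.
have s0 : 0 < s_ k by apply: lt_le_trans (hs k).
have /andP[h1 h2] := flat0_ge s0.
have h3 : (s_ k)^-1 <= e.
  apply: (@le_trans _ _ (c * k.+1%:R)^-1); first by rewrite lef_pV2 ?posrE.
  by rewrite invfM mulrC ler_pdivrMr// ltW.
by rewrite ger0_norm ?subr_ge0//; lra.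
Qed.

Lemma unit_prod (I : Type) (s : seq I) (F : I -> R) : (forall i, 0 <= F i <= 1) ->
  0 <= \prod_(i <- s) F i <= 1.
Proof.
move=> hF; elim: s => [|i s /andP[h1 h2]]; first by rewrite big_nil ler01 lexx.
have /andP[h3 h4] := hF i.
by rewrite big_cons mulr_ge0//= mulr_ile1.
Qed.

(** With N = k + 1, the second factor is exp(- 1 / t) at t = N^2 (b_i - x_i) + N: the summand N
    makes it tend to 1 also on the face x_i = b_i, which belongs to the box, while N^2 wins beyond
    that face. *)
Definition bump (ab : 'rV[R]_n * 'rV[R]_n) k x : R := \prod_(i < n)
  (flat 0 (k.+1%:R * x 0 i + - (k.+1%:R * ab.1 0 i)) *
   flat 0 (- k.+1%:R ^+ 2 * x 0 i + (k.+1%:R ^+ 2 * ab.2 0 i + k.+1%:R))).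

Lemma smooth_flat k (i : 'I_n) (c d : R) : smooth (fun x : 'rV[R]_n => flat k (c * x 0 i + d)).
Proof. by apply/smoothP => N; exact: sm_flat. Qed.

Lemma smooth_bump ab k : smooth (bump ab k).
Proof. by apply: smooth_prod => i; apply: smoothM; exact: smooth_flat. Qed.

Lemma bump_itv ab k x : 0 <= bump ab k x <= 1.
Proof.
apply: unit_prod => i; set a := flat _ _; set b := flat _ _.
have /andP[h1 h2] : 0 <= a <= 1 by exact: flat0_itv.
have /andP[h3 h4] : 0 <= b <= 1 by exact: flat0_itv.
by rewrite mulr_ge0//= mulr_ile1.
Qed.

Lemma bump_cvg ab x : bump ab k x @[k --> \oo] --> (\1_(box ab) x : R).
Proof.
have -> : \1_(box ab) x = \prod_(i < n) ((ab.1 0 i < x 0 i)%R%:R * (x 0 i <= ab.2 0 i)%R%:R) :> R.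
  rewrite indicE; case: (boolP (x \in box ab)) => [/set_mem H|/negP H].
    by rewrite big1// => i _; have /andP[-> ->] := H i; rewrite mulr1.
  have : ~ forall i, ab.1 0 i < x 0 i <= ab.2 0 i by move=> h; apply: H; exact: mem_set.
  move=> /existsNP[i /negP]; rewrite negb_and => hi; rewrite (bigD1 i)//=.
  by case/orP : hi => /negbTE ->; rewrite ?mul0r ?mulr0 ?mul0r.
apply: cvg_big => [|i _]; first exact: mul_continuous.
apply: cvgM.
  have [h|h] := ltP (ab.1 0 i) (x 0 i).
    apply: (flat0_cvg1 (c := x 0 i - ab.1 0 i)); first by rewrite subr_gt0.
    by move=> k; move: (k.+1%:R : R) => u; lra.
  apply: cvg_near_cst; near=> k; apply: flat_le0.
  by rewrite -mulrBr pmulr_rle0 ?ltr0n// subr_le0.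
have [h|h] := leP (x 0 i) (ab.2 0 i).
  apply: (flat0_cvg1 (c := 1)) => // k.
  have : 0 <= k.+1%:R ^+ 2 * (ab.2 0 i - x 0 i) by rewrite mulr_ge0 ?sqr_ge0// subr_ge0.
  by move: (k.+1%:R : R) => u; lra.
have d0 : 0 < x 0 i - ab.2 0 i by rewrite subr_gt0.
apply: cvg_near_cst.
have [N _ HN] := near_infty_natSinv_lt (PosNum d0).
exists N => // k /HN /= hk; apply: flat_le0.
have k0 : 0 < k.+1%:R :> R by rewrite ltr0n.
have h1 : 1 <= k.+1%:R * (x 0 i - ab.2 0 i).
  by rewrite -ler_pdivrMl// mulr1 ltW.
have : k.+1%:R * 1 <= k.+1%:R * (k.+1%:R * (x 0 i - ab.2 0 i)) by rewrite ler_pM2l.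
by move: (k.+1%:R : R) => u; lra.
Unshelve. all: by end_near. Qed.

Lemma smooth_measurable D f : measurable D -> smooth f -> measurable_fun D f.
Proof.
move=> mD hf; apply: (@measurable_funS _ _ _ _ setT) => //; apply: continuous_measurable_rV => x.
exact: differentiable_continuous (hf [::] x).
Qed.

Section on_domain.
Variable D : set 'rV[R]_n.
Hypotheses (mD : measurable D) (bD : bounded_set D).

Lemma integ_bounded f (M : R) : measurable_fun D f -> (forall x, D x -> `|f x| <= M) -> integ leb D f.
Proof. by move=> mf hM; apply: (integ_le mD mf hM) (integ_cst_bounded M mD bD). Qed.

Lemma sqinteg_bounded f (M : R) : measurable_fun D f -> (forall x, D x -> `|f x| <= M) ->
  sqinteg leb D f.
Proof.
move=> mf hM; split => //; apply: (@integ_bounded _ (M ^+ 2)); first exact: measurable_funX.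
move=> x /hM h; rewrite ger0_norm ?sqr_ge0// -(real_normK (num_real (f x))).
by rewrite ler_pXn2r ?nnegrE// (le_trans _ h).
Qed.

(** Approximation in L^2(D). Keeping all values in [0, 1] makes the class closed under products and,
    by dominated convergence, under pointwise limits. *)
Definition smooth_approx w := [/\ measurable_fun D w, forall x, 0 <= w x <= 1 &
  forall e : R, 0 < e -> exists psi, [/\ smooth psi, forall x, 0 <= psi x <= 1 &
    \int[leb]_(x in D) (w x - psi x) ^+ 2 <= e]].

Lemma unit_diff (a b : R) : 0 <= a <= 1 -> 0 <= b <= 1 -> `|a - b| <= 1.
Proof. by move=> /andP[h1 h2] /andP[h3 h4]; rewrite ler_norml; apply/andP; split; lra. Qed.

Lemma integ_sqr_unit w w' : measurable_fun D w -> measurable_fun D w' ->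
  (forall x, 0 <= w x <= 1) -> (forall x, 0 <= w' x <= 1) ->
  integ leb D (fun x => (w x - w' x) ^+ 2).
Proof.
move=> mw mw' h h'; exact: (sqinteg_bounded (measurable_funB mw mw') (fun x _ => unit_diff (h x) (h' x))).2.
Qed.

Lemma approx_smooth psi : smooth psi -> (forall x, 0 <= psi x <= 1) -> smooth_approx psi.
Proof.
move=> sp hp; split => //; first exact: smooth_measurable.
move=> e e0; exists psi; split => //.
rewrite (@Rint_ext _ _ _ _ _ _ (fun=> 0)) ?Rintegral_cst ?mul0r ?(ltW e0)//.
by move=> x _; rewrite subrr expr0n.
Qed.

Lemma approx_compl w : smooth_approx w -> smooth_approx (fun x => 1 - w x).
Proof.
move=> [mw hw aw]; split; first by apply: measurable_funB => //; exact: measurable_cst.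
  by move=> x; have /andP[h1 h2] := hw x; apply/andP; split; lra.
move=> e /aw[psi [sp hp ip]]; exists (fun x => -1 * psi x + 1); split.
- by apply: smoothZD => //; exact: smooth_cst.
- by move=> x; have /andP[h1 h2] := hp x; apply/andP; split; lra.
- by apply: le_trans ip; rewrite le_eqVlt; apply/orP; left; apply/eqP; apply: Rint_ext => x _; lra.
Qed.

Lemma unit_mul (a b : R) : 0 <= a <= 1 -> 0 <= b <= 1 -> 0 <= a * b <= 1.
Proof. by move=> /andP[h1 h2] /andP[h3 h4]; rewrite mulr_ge0//= mulr_ile1. Qed.

Lemma unit_mul_diff (a b c d : R) : 0 <= a <= 1 -> 0 <= b <= 1 -> 0 <= c <= 1 -> 0 <= d <= 1 ->
  (a * b - c * d) ^+ 2 <= 2 * (a - c) ^+ 2 + 2 * (b - d) ^+ 2.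
Proof.
move=> /andP[a0 a1] /andP[b0 b1] /andP[c0 c1] /andP[d0 d1].
have b2 : b ^+ 2 <= 1 by rewrite expr_le1.
have c2 : c ^+ 2 <= 1 by rewrite expr_le1.
have h1 : (a - c) ^+ 2 * b ^+ 2 <= (a - c) ^+ 2 by rewrite ler_piMr ?sqr_ge0.
have h2 : (b - d) ^+ 2 * c ^+ 2 <= (b - d) ^+ 2 by rewrite ler_piMr ?sqr_ge0.
have := sqr_ge0 ((a - c) * b - c * (b - d)).
lra.
Qed.

Lemma Rint_unit_mul_diff (a b c d : 'rV[R]_n -> R) :
  measurable_fun D a -> measurable_fun D b -> measurable_fun D c -> measurable_fun D d ->
  (forall x, 0 <= a x <= 1) -> (forall x, 0 <= b x <= 1) ->
  (forall x, 0 <= c x <= 1) -> (forall x, 0 <= d x <= 1) ->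
  \int[leb]_(x in D) (a x * b x - c x * d x) ^+ 2 <=
  2 * \int[leb]_(x in D) (a x - c x) ^+ 2 + 2 * \int[leb]_(x in D) (b x - d x) ^+ 2.
Proof.
move=> ma mb mc md ha hb hc hd.
have i1 := integ_sqr_unit ma mc ha hc; have i2 := integ_sqr_unit mb md hb hd.
have e1 := RintegralZl 2 mD i1; have e2 := RintegralZl 2 mD i2.
have j1 := integZ mD 2 i1; have j2 := integZ mD 2 i2.
have e3 := RintegralD mD j1 j2.
rewrite -e1 -e2 -e3; apply: (Rint_le mD).
- by apply: integ_sqr_unit; try exact: measurable_funM; move=> x; exact: unit_mul.
- exact: (integD mD j1 j2).
- by move=> x _; exact: unit_mul_diff.
Qed.

Lemma approx_mul w w' : smooth_approx w -> smooth_approx w' -> smooth_approx (fun x => w x * w' x).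
Proof.
move=> [mw hw aw] [mw' hw' aw']; split; first exact: measurable_funM.
  by move=> x; exact: unit_mul.
move=> e e0; have e4 : 0 < e / 4 by rewrite divr_gt0.
have [p [sp hp ip]] := aw _ e4; have [p' [sp' hp' ip']] := aw' _ e4.
exists (fun x => p x * p' x); split; first exact: smoothM.
  by move=> x; exact: unit_mul.
have := Rint_unit_mul_diff mw mw' (smooth_measurable mD sp) (smooth_measurable mD sp') hw hw' hp hp'.
by move: ip ip'; lra.
Qed.

Lemma approx_lim (w_ : nat -> 'rV[R]_n -> R) w : (forall k, smooth_approx (w_ k)) ->
  (forall x, 0 <= w x <= 1) -> measurable_fun D w -> (forall x, D x -> w_ k x @[k --> \oo] --> w x) ->
  smooth_approx w.
Proof.
move=> aw hw mw cw; split => // e e0.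
have mw_ k : measurable_fun D (w_ k) by have [] := aw k.
have hw_ k x : 0 <= w_ k x <= 1 by have [] := aw k.
have [_ H] : integ leb D (fun=> 0) /\
    \int[leb]_(x in D) ((w x - w_ k x) ^+ 2) @[k --> \oo] --> \int[leb]_(x in D) (0 : R).
  apply: (dct mD (f_ := fun k x => (w x - w_ k x) ^+ 2) (g := fun=> 1)).
  - by move=> k; apply: measurable_funX; exact: measurable_funB.
  - exact: measurable_cst.
  - apply: aeW => x Dx; have c : (w x - w_ k x) @[k --> \oo] --> (0 : R).
      by rewrite -(subrr (w x)); apply: cvgB; [exact: cvg_cst|exact: cw].
    by rewrite -[X in _ --> X](mulr0 (0 : R)); exact: (cvgM c c).
  - exact: integ_cst_bounded.
  - apply: aeW => x k Dx; rewrite ger0_norm ?sqr_ge0//.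
    rewrite -(real_normK (num_real _)) expr_le1//; exact: unit_diff.
rewrite Rintegral_cst// mul0r in H.
have e4 : 0 < e / 4 by rewrite divr_gt0.
have /cvgr0_norm_le/(_ _ e4)[N _ HN] := H.
have [_ _ /(_ _ e4)[p [sp hp ip]]] := aw N.
exists p; split => //.
have mp := smooth_measurable mD sp.
have i1 := integ_sqr_unit mw (mw_ N) hw (hw_ N).
have i2 := integ_sqr_unit (mw_ N) mp (hw_ N) hp.
have e1 := RintegralZl 2 mD i1; have e2 := RintegralZl 2 mD i2.
have j1 := integZ mD 2 i1; have j2 := integZ mD 2 i2.
have e3 := RintegralD mD j1 j2.
have h1 := HN N (leqnn N); rewrite /= ger0_norm in h1; last first.
  by apply: Rint_ge0 => x _; exact: sqr_ge0.
apply: (@le_trans _ _ (\int[leb]_(x in D) (2 * (w x - w_ N x) ^+ 2 + 2 * (w_ N x - p x) ^+ 2))).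
  apply: (Rint_le mD).
  - exact: integ_sqr_unit.
  - exact: (integD mD j1 j2).
  - by move=> x _; have := sqr_ge0 ((w x - w_ N x) - (w_ N x - p x)); lra.
by rewrite e3 e1 e2; move: h1 ip; lra.
Unshelve. all: by end_near. Qed.

Lemma indic_itv (A : set 'rV[R]_n) x : 0 <= (\1_A x : R) <= 1.
Proof. by rewrite indicE; case: (x \in A); rewrite ?ler01 ?lexx. Qed.

Lemma approx_box ab : smooth_approx \1_(box ab).
Proof.
apply: (approx_lim (w_ := bump ab)).
- by move=> k; apply: approx_smooth; [exact: smooth_bump|exact: bump_itv].
- by move=> x; exact: indic_itv.
- by apply: measurable_indic; exact: measurable_box.
- by move=> x _; exact: bump_cvg.
Qed.

(** The indicator of the complement of the union is the limit of the finite products of the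
    indicators of the complements; overlapping boxes cause no trouble in this form. *)
Lemma approx_cover (P : pred nat) (ab : nat -> 'rV[R]_n * 'rV[R]_n) :
  smooth_approx \1_(\bigcup_(k in [set k | P k]) box (ab k)).
Proof.
set V := \bigcup_(k in _) _.
have mV : measurable V by apply: bigcup_measurable => k _; exact: measurable_box.
suff : smooth_approx (fun x => 1 - \1_V x).
  move=> /approx_compl; have -> // : (fun x => 1 - (1 - \1_V x)) = \1_V :> ('rV[R]_n -> R).
  by apply/funext => x; lra.
pose w_ N x : R := \prod_(k < N) (if P k then 1 - \1_(box (ab k)) x else 1).
have one : smooth_approx (fun=> 1).
  by apply: approx_smooth; [exact: smooth_cst|move=> x; rewrite ler01 lexx].
apply: (approx_lim (w_ := w_)).
- elim=> [|N IH]; first by rewrite /w_; under eq_fun do rewrite big_ord0.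
  rewrite /w_; under eq_fun do rewrite big_ord_recr/=; apply: approx_mul => //.
  by case: (P N); [apply: approx_compl; exact: approx_box|exact: one].
- by move=> x; have /andP[h1 h2] := indic_itv V x; apply/andP; split; lra.
- by apply: measurable_funB; [exact: measurable_cst|exact: measurable_indic].
- move=> x Dx; apply: cvg_near_cst; case: (pselect (V x)) => [Vx|nVx].
    have [k /= Pk bx] := Vx; exists k.+1 => // N /= kN; rewrite /w_ (bigD1 (Ordinal kN))//= Pk.
    by rewrite !indicE !mem_set// subrr mul0r.
  near=> N; rewrite /w_ big1 => [|k _].
    by rewrite indicE memNset// subr0.
  case: ifP => // Pk; rewrite indicE memNset ?subr0// => bx; apply: nVx.
  by exists k.
Unshelve. all: by end_near. Qed.

(** Lebesgue measure being an infimum over covers, E lies in a union of boxes that exceeds it by a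
    set of small measure, and indicators of such unions are covered by [approx_cover]. *)
Lemma approx_measurable E : measurable E -> E `<=` D -> smooth_approx \1_E.
Proof.
move=> mE ED; have Elt : (leb E < +oo)%E.
  apply: le_lt_trans (lebesgue_bounded_lty bD).
  by rewrite le_measure ?inE.
have Efin : leb E \is a fin_num by rewrite ge0_fin_numE.
have H (k : nat) : exists PB : pred nat * (nat -> 'rV[R]_n * 'rV[R]_n), E `<=` \bigcup_(k in [set k | PB.1 k]) box (PB.2 k) /\
    (leb (\bigcup_(k in [set k | PB.1 k]) box (PB.2 k)) <= leb E + (k.+1%:R^-1)%:E)%E.
  have k0 : 0 < k.+1%:R^-1 :> R by rewrite invr_gt0 ltr0n.
  have [_ [PB cov <-] lt] := lb_ereal_inf_adherent k0 Efin.
  exists PB; split => //; apply: le_trans (ltW lt); apply: ereal_inf_lbound; exists PB => //.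
have [PB HPB] := choice H.
pose V k := \bigcup_(j in [set j | (PB k).1 j]) box ((PB k).2 j).
have mV k : measurable (V k) by apply: bigcup_measurable => j _; exact: measurable_box.
have EV k : E `<=` V k by exact: (HPB k).1.
split; [exact: measurable_indic|by move=> x; exact: indic_itv|].
move=> e e0; have e4 : 0 < e / 4 by rewrite divr_gt0.
have [N _ /(_ N (leqnn N)) /= HN] := near_infty_natSinv_lt (PosNum e4).
have [_ _ /(_ _ e4)[p [sp hp ip]]] := approx_cover (PB N).1 (PB N).2.
exists p; split => //.
have mp := smooth_measurable mD sp.
have m1 : measurable_fun D (\1_E : 'rV[R]_n -> R) by exact: measurable_indic.
have m2 : measurable_fun D (\1_(V N) : 'rV[R]_n -> R) by exact: measurable_indic.
have i1 := integ_sqr_unit m1 m2 (indic_itv E) (indic_itv (V N)).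
have i2 := integ_sqr_unit m2 mp (indic_itv (V N)) hp.
have e1 := RintegralZl 2 mD i1; have e2 := RintegralZl 2 mD i2.
have j1 := integZ mD 2 i1; have j2 := integZ mD 2 i2.
have e3 := RintegralD mD j1 j2.
have h1 : \int[leb]_(x in D) (\1_E x - \1_(V N) x) ^+ 2 <= N.+1%:R^-1.
  have -> : \int[leb]_(x in D) (\1_E x - \1_(V N) x) ^+ 2 = \int[leb]_(x in D) (\1_(V N `\` E) x : R).
    apply: Rint_ext => x _; rewrite !indicE in_setD.
    case: (boolP (x \in E)) => [/set_mem xE|_].
      by have -> : x \in V N by [exact/mem_set/EV]; rewrite subrr expr0n.
    by rewrite sub0r sqrrN; case: (x \in V N); rewrite ?expr1n ?expr0n.
  have mVE : measurable (V N `\` E) by exact: measurableD.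
  rewrite /Rintegral integral_indic//.
  have -> : N.+1%:R^-1 = fine (N.+1%:R^-1)%:E by [].
  have le1 : (leb ((V N `\` E) `&` D) <= (N.+1%:R^-1)%:E)%E.
    apply: (@le_trans _ _ (leb (V N `\` E))).
      by rewrite le_measure ?inE//; exact: measurableI.
    have Vlt : (leb (V N) < +oo)%E.
      by apply: le_lt_trans (HPB N).2 _; rewrite -(fineK Efin) ltry.
    rewrite measureD// (setIidr (EV N)) leeBlDl//; exact: (HPB N).2.
  apply: fine_le => //; rewrite ge0_fin_numE//; exact: le_lt_trans le1 (ltry _).
apply: (@le_trans _ _ (\int[leb]_(x in D) (2 * (\1_E x - \1_(V N) x) ^+ 2 + 2 * (\1_(V N) x - p x) ^+ 2))).
  apply: (Rint_le mD).
  - by apply: integ_sqr_unit => //; exact: indic_itv.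
  - exact: (integD mD j1 j2).
  - by move=> x _; have := sqr_ge0 ((\1_E x - \1_(V N) x) - (\1_(V N) x - p x)); lra.
rewrite e3 e1 e2; move: h1 ip HN; rewrite -/(V N).
by move: (N.+1%:R^-1) => u; lra.
Qed.

End on_domain.
End smooth_approximation.

(** * Test functions of Omega and the fundamental lemma of the calculus of variations *)

Section test_functions.
Context {R : realType} {n : nat} (Omega : set 'rV[R]_n).
Local Notation leb := (lebesgue_rV R n).
Implicit Types (D E : set 'rV[R]_n) (f g w phi : 'rV[R]_n -> R) (x y c : 'rV[R]_n) (r : R).
Hypotheses (oO : open Omega) (bO : bounded_set Omega).

Local Notation test := (test_function Omega).

Lemma measurable_Omega : measurable Omega.
Proof. exact: open_measurable_rV. Qed.
Let mO := measurable_Omega.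

Lemma test_mul phi psi : test phi -> smooth psi -> test (fun x => phi x * psi x).
Proof.
move=> [sp [K [cK KO K0]]] sq; split; first exact: smoothM.
by exists K; split => // x /K0 ->; rewrite mul0r.
Qed.

Lemma test_ZD (c : R) phi psi : test phi -> test psi -> test (fun x => c * phi x + psi x).
Proof.
move=> [sp [K [cK KO K0]]] [sq [L [cL LO L0]]]; split; first exact: smoothZD.
exists (K `|` L); split; first exact: compactU.
  by move=> x [/KO|/LO].
by move=> x H; rewrite K0 ?L0 ?mulr0 ?addr0// => h; apply: H; [right|left].
Qed.

Lemma test0 : test (fun=> 0).
Proof. by split; [exact: smooth_cst|exists set0; split => //; exact: compact0]. Qed.

Lemma test_near0 phi x : test phi -> ~ Omega x -> \forall y \near x, phi y = 0.
Proof.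
move=> [sp [K [cK KO K0]]] nx.
have : nbhs x (~` K).
  apply: open_nbhs_nbhs; split; last by move=> /KO.
  by apply: closed_openC; apply: compact_closed => //; exact: norm_hausdorff.
by apply: filterS => y; exact: K0.
Qed.

Lemma test_vanish phi x i : test phi -> ~ Omega x -> phi x = 0 /\ partial i phi x = 0.
Proof.
move=> tp nx; have h := test_near0 tp nx; split; first exact: nbhs_singleton h.
exact: partial_local0.
Qed.

Lemma test_C1c phi : test phi -> C1c phi.
Proof.
move=> tp; have [sp _] := tp; split.
- exact: (sp [::]).
- by move=> i x; apply: differentiable_continuous; exact: (sp [:: i]).
- have [M [_ HM]] := bO; exists (M + 1) => x xM.
  have [Ox|nOx] := pselect (Omega x); last exact: nbhs_singleton (test_near0 tp nOx).
  have /(_ x Ox) : forall x, Omega x -> `|x| <= M + 1 by apply: HM; lra.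
  by rewrite leNgt xM.
Qed.

Lemma test_vanish_off phi Q : Omega `<=` Q -> test phi -> vanish_off Q phi.
Proof.
move=> OQ tp; split; first exact: test_C1c.
move=> x nQ; have nO : ~ Omega x by move=> /OQ.
by split; [exact: nbhs_singleton (test_near0 tp nO)|move=> i; have [] := test_vanish i tp nO].
Qed.

Lemma test_sqinteg phi : test phi -> sqinteg leb Omega phi.
Proof. by move=> /test_C1c/C1c_Cc hp; exact: Cc_sqinteg. Qed.

Lemma test_partial phi i : test phi -> test (partial i phi).
Proof.
move=> [sp [K [cK KO K0]]]; split; first exact: smooth_partial.
exists K; split => // x nK; apply: partial_local0.
have : nbhs x (~` K).
  apply: open_nbhs_nbhs; split => //.
  by apply: closed_openC; apply: compact_closed => //; exact: norm_hausdorff.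
by apply: filterS => y; exact: K0.
Qed.

Definition ball_bump (c : 'rV[R]_n) (r : R) x : R :=
  \prod_(i < n) (flat 0 (1 * x 0 i + (r - c 0 i)) * flat 0 (-1 * x 0 i + (c 0 i + r))).

Lemma smooth_ball_bump c r : smooth (ball_bump c r).
Proof. by apply: smooth_prod => i; apply: smoothM; exact: smooth_flat. Qed.

Lemma ball_bump_itv c r x : 0 <= ball_bump c r x <= 1.
Proof.
apply: unit_prod => i; set a := flat _ _; set b := flat _ _.
by apply: unit_mul; [exact: flat0_itv|exact: flat0_itv].
Qed.

Lemma ball_bump_eq0 c r x i : r <= `|x 0 i - c 0 i| -> ball_bump c r x = 0.
Proof.
move=> h; rewrite /ball_bump (bigD1 i)//=.
have [h1|h1] := leP (x 0 i) (c 0 i).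
  by rewrite ler0_norm ?subr_le0// in h; rewrite (@flat_le0 _ _ (1 * _ + _)) ?mul0r//; lra.
rewrite gtr0_norm ?subr_gt0// in h.
by rewrite (@flat_le0 _ _ (-1 * _ + _)) ?mulr0 ?mul0r//; lra.
Qed.

Lemma ball_bump_gt0 c r x : (forall i, `|x 0 i - c 0 i| < r) -> 0 < ball_bump c r x.
Proof.
move=> h; apply: prodr_gt0 => i _; have := h i; rewrite ltr_norml => /andP[h1 h2].
have p (t : R) : 0 < t -> 0 < flat 0 t.
  by move=> t0; rewrite /flat t0 expr0 mul1r expR_gt0.
by rewrite mulr_gt0// p//; lra.
Qed.

Lemma test_ball_bump c (r : R) : 0 < r -> [set x : 'rV[R]_n | `|x - c| <= r] `<=` Omega -> test (ball_bump c r).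
Proof.
move=> r0 KO; split; first exact: smooth_ball_bump.
exists [set x : 'rV[R]_n | `|x - c| <= r]; split => //.
  apply: bounded_closed_compact.
    exists (`|c| + r); split => [|M MN x /= h]; first exact: num_real.
    have := ler_normD (x - c) c; rewrite subrK => h2.
    by apply: le_trans h2 _; apply: le_trans (ltW MN); rewrite addrC lerD2l.
  apply: (closed_comp (f := fun x : 'rV[R]_n => `|x - c|) (D := [set z | z <= r])).
    move=> x _; apply: (continuous_comp (f := fun x : 'rV[R]_n => x - c)); last exact: norm_continuous.
    exact: (cvgB (@cvg_id _ (nbhs x)) (cvg_cst c)).
  exact: closed_le.
move=> x /negP; rewrite -ltNge => h.
have [i hi] : exists i, r <= `|x 0 i - c 0 i|.
  apply: contrapT => /forallNP H; move: h; rewrite ltNge => /negP; apply.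
  apply: rV_norm_le; first exact: ltW.
  by move=> i; rewrite !mxE; have /negP := H i; rewrite -ltNge => /ltW.
exact: ball_bump_eq0 hi.
Qed.

(** Bumps at the points of the grids of mesh 1 / (m + 1), with radius 2 / (m + 1), replaced by 0
    when their ball leaves Omega. A point x is within 1 / (m + 1) of the grid, and the ball of the
    nearby grid point lies within 3 / (m + 1) of x, hence in Omega for large m. *)
Lemma test_family : exists phi_ : nat -> 'rV[R]_n -> R, (forall k, test (phi_ k)) /\
  (forall k x, 0 <= phi_ k x <= 1) /\ forall x, Omega x -> exists k, 0 < phi_ k x.
Proof.
pose c (z : 'rV[int]_n * nat) : 'rV[R]_n := \row_i ((z.1 0 i)%:~R / z.2.+1%:R).
pose r (z : 'rV[int]_n * nat) : R := 2 / z.2.+1%:R.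
have r0 z : 0 < r z by rewrite divr_gt0// ltr0n.
pose K z := [set x : 'rV[R]_n | `|x - c z| <= r z].
pose phi_ (k : nat) : 'rV[R]_n -> R :=
  if unpickle k is Some z then (if `[< K z `<=` Omega >] then ball_bump (c z) (r z) else fun=> 0)
  else fun=> 0.
exists phi_; split; [|split].
- move=> k; rewrite /phi_; case: unpickle => [z|]; last exact: test0.
  by case: asboolP => h; [exact: test_ball_bump|exact: test0].
- move=> k x; rewrite /phi_; case: unpickle => [z|]; last by rewrite lexx ler01.
  by case: asboolP => h; [exact: ball_bump_itv|rewrite lexx ler01].
move=> x Ox; have /nbhs_ballP[e /= e0 eO] : nbhs x Omega by exact: open_nbhs_nbhs.
have e3 : 0 < e / 4 by rewrite divr_gt0.
have [m _ /(_ m (leqnn m)) /= Hm] := near_infty_natSinv_lt (PosNum e3).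
pose z : 'rV[int]_n * nat := (\row_i Num.ceil (x 0 i * m.+1%:R), m).
have m0 : 0 < m.+1%:R :> R by rewrite ltr0n.
have v0 : 0 < m.+1%:R^-1 :> R by rewrite invr_gt0.
have cz i : `|x 0 i - c z 0 i| <= m.+1%:R^-1.
  rewrite !mxE /=; have /andP[h1 h2] := ceil_itv (x 0 i * m.+1%:R).
  rewrite -ltr_pdivrMr// in h1; rewrite -ler_pdivlMr// in h2.
  move: h1 h2; rewrite intrD mulrBl div1r.
  set u := (Num.ceil _)%:~R / _; move: (m.+1%:R^-1) => v h1 h2.
  by rewrite ler_norml; apply/andP; split; lra.
exists (pickle z); rewrite /phi_ pickleK.
case: asboolP => [_|]; last first.
  case=> y /= hy; apply: eO; apply: rV_ball => // i.
  have h1 : `|y 0 i - c z 0 i| <= r z.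
    by apply: le_trans hy; have := rV_coord_le (y - c z) i; rewrite !mxE.
  have := cz i; move: h1 Hm; rewrite /r /=; move: (m.+1%:R^-1) => v.
  rewrite !ler_norml ltr_norml => h1 h2 /andP[h3 h4].
  by move: h1 => /andP[h5 h6]; apply/andP; split; lra.
apply: ball_bump_gt0 => i; apply: le_lt_trans (cz i) _.
by rewrite /r /=; move: (m.+1%:R^-1) v0 => v; lra.
Qed.

(** The functions are 1 minus the product over k < N of (1 - phi_k)^N. At a point of Omega some
    phi_k is positive and its factor tends to 0 geometrically; off the union of the first N supports
    the product is 1. *)
Lemma test_exhaustion : exists chi_ : nat -> 'rV[R]_n -> R, (forall k, test (chi_ k)) /\
  (forall k x, 0 <= chi_ k x <= 1) /\ forall x, Omega x -> chi_ k x @[k --> \oo] --> (1 : R).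
Proof.
have [phi_ [tphi [hphi pos]]] := test_family.
have one_itv (t : R) : 0 <= t <= 1 -> 0 <= 1 - t <= 1.
  by move=> /andP[h1 h2]; apply/andP; split; lra.
have exp_itv (t : R) k : 0 <= t <= 1 -> 0 <= t ^+ k <= 1.
  by move=> /andP[h1 h2]; rewrite exprn_ge0//= exprn_ile1.
pose P N x : R := \prod_(k < N) (1 - phi_ k x) ^+ N.
have Pitv N x : 0 <= P N x <= 1.
  by apply: unit_prod => k; apply: exp_itv; exact: one_itv.
exists (fun N x => 1 - P N x); split; [|split].
- move=> N; split.
    have -> : (fun x => 1 - P N x) = (fun x => -1 * P N x + 1) by apply/funext => x; lra.
    apply: smoothZD; last exact: smooth_cst.
    apply: smooth_prod => k; apply: smooth_expr.
    have -> : (fun x => 1 - phi_ k x) = (fun x => -1 * phi_ k x + 1) by apply/funext => x; lra.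
    by apply: smoothZD; [case: (tphi k)|exact: smooth_cst].
  have HK k : exists K, [/\ compact K, K `<=` Omega & forall x, ~ K x -> phi_ k x = 0].
    by have [] := tphi k.
  have [K HK'] := choice HK.
  exists (\bigcup_(k in [set` 'I_N]) K k); split.
  - rewrite -bigsetU_fset_set; last exact: finite_finset.
    by apply: bigsetU_compact => k _; have [] := HK' k.
  - by move=> x [k _]; have [_ + _] := HK' k; apply.
  - move=> x nK; rewrite /P big1 ?subrr// => k _.
    have [_ _ ->] := HK' k; first by rewrite subr0 expr1n.
    by move=> Kx; apply: nK; exists k.
- by move=> N x; exact: one_itv.
- move=> x Ox; have [k pk] := pos x Ox.
  have q1 : `|1 - phi_ k x| < 1.
    by have /andP[h1 h2] := hphi k x; rewrite ger0_norm ?subr_ge0// ltrBlDr ltrDl.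
  have c1 := cvg_expr q1.
  suff : P N x @[N --> \oo] --> (0 : R).
    by move=> c2; rewrite -[X in _ --> X](subr0 (1 : R)); apply: cvgB; [exact: cvg_cst|exact: c2].
  apply: (squeeze_cvgr _ (cvg_cst 0) c1).
  exists k.+1 => // N /= kN; have /andP[-> _] := Pitv N x => /=.
  rewrite /P (bigD1 (Ordinal kN))//= ler_piMr//.
    by have /andP[] := exp_itv (1 - phi_ k x) N (one_itv _ (hphi k x)).
  have /andP[] // : 0 <= \prod_(i < N | i != Ordinal kN) (1 - phi_ i x) ^+ N <= 1.
  rewrite big_mkcond/=; apply: unit_prod => i; case: ifP => _; last by rewrite lexx ler01.
  by apply: exp_itv; exact: one_itv.
Qed.

Lemma test_approx E : measurable E -> E `<=` Omega -> forall e : R, 0 < e ->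
  exists phi, [/\ test phi, forall x, 0 <= phi x <= 1 &
    \int[leb]_(x in Omega) (\1_E x - phi x) ^+ 2 <= e].
Proof.
move=> mE EO e e0; have e4 : 0 < e / 4 by rewrite divr_gt0.
have [mE1 hE aE] := approx_measurable mO bO mE EO.
have [psi [sp hp ip]] := aE _ e4.
have [chi_ [tchi [hchi cchi]]] := test_exhaustion.
have mchi k : measurable_fun Omega (chi_ k) by have [] := test_sqinteg (tchi k).
have m1 : measurable_fun Omega (fun _ : 'rV[R]_n => 1 : R) by exact: measurable_cst.
have [_ H] : integ leb Omega (fun=> 0) /\
    \int[leb]_(x in Omega) ((1 - chi_ k x) ^+ 2) @[k --> \oo] --> \int[leb]_(x in Omega) (0 : R).
  apply: (dct mO (f_ := fun k x => (1 - chi_ k x) ^+ 2) (g := fun=> 1)).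
  - by move=> k; apply: measurable_funX; exact: measurable_funB.
  - exact: measurable_cst.
  - apply: aeW => x Dx; have c : (1 - chi_ k x) @[k --> \oo] --> (0 : R).
      by rewrite -(subrr (1 : R)); apply: cvgB; [exact: cvg_cst|exact: cchi].
    by rewrite -[X in _ --> X](mulr0 (0 : R)); exact: (cvgM c c).
  - exact: integ_cst_bounded.
  - apply: aeW => x k Dx; rewrite ger0_norm ?sqr_ge0//.
    have /andP[h1 h2] := hchi k x.
    by rewrite expr_le1//; lra.
rewrite Rintegral_cst// mul0r in H.
have /cvgr0_norm_le/(_ _ e4)[N _ /(_ N (leqnn N))] := H.
rewrite /= ger0_norm; last by apply: Rint_ge0 => x _; exact: sqr_ge0.
move=> hN; exists (fun x => chi_ N x * psi x); split.
- exact: test_mul.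
- by move=> x; exact: unit_mul.
have o1 (x : 'rV[R]_n) : 0 <= (1 : R) <= 1 by rewrite ler01 lexx.
have mp := smooth_measurable mO sp.
have := Rint_unit_mul_diff mO bO m1 mE1 (mchi N) mp o1 hE (hchi N) hp.
under [X in X <= _]eq_Rintegral do rewrite mul1r.
by clear o1; move: hN ip; lra.
Qed.

Lemma test_orthogonal_Rint g E : sqinteg leb Omega g ->
  (forall phi, test phi -> \int[leb]_(x in Omega) (g x * phi x) = 0) ->
  measurable E -> E `<=` Omega -> \int[leb]_(x in Omega) (g x * \1_E x) = 0.
Proof.
move=> hg H mE EO; have hS := semi_ip_dot leb mO.
have sE : sqinteg leb Omega (\1_E : 'rV[R]_n -> R).
  apply: (sqinteg_bounded mO bO (M := 1)); first exact: measurable_indic.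
  by move=> x _; have /andP[h1 h2] := indic_itv (R := R) E x; rewrite ger0_norm.
apply/eqP; rewrite -normr_le0; apply/ler_addgt0Pl => e e0; rewrite addr0.
pose c := nrm (dot leb Omega) g + 1.
have c0 : 0 < c by rewrite /c ltr_wpDl// nrm_ge0.
have ec : 0 < (e / c) ^+ 2 by rewrite exprn_gt0// divr_gt0.
have [phi [tp hp ip]] := test_approx mE EO ec.
have sp := test_sqinteg tp.
have sd := ipB hS sE sp.
have -> : \int[leb]_(x in Omega) (g x * \1_E x) = dot leb Omega g ((\1_E : 'rV[R]_n -> R^o) - (phi : 'rV[R]_n -> R^o)).
  have -> := ipBr hS sE sp hg.
  by rewrite /dot (H phi tp) subr0.
apply: le_trans (cauchy_schwarz hS hg sd) _.
have nd : nrm (dot leb Omega) ((\1_E : 'rV[R]_n -> R^o) - (phi : 'rV[R]_n -> R^o)) <= e / c.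
  rewrite -(@ler_pXn2r _ 2)// ?nnegrE ?nrm_ge0//; last by rewrite divr_ge0// ltW.
  by rewrite (nrm_sqr hS)// dotE.
apply: (@le_trans _ _ (c * (e / c))); last by rewrite mulrCA mulfV ?mulr1// lt0r_neq0.
apply: ler_pM; rewrite ?nrm_ge0//.
by rewrite /c lerDl.
Qed.

(** Indicators are L^2 limits of test functions, so h is orthogonal to the indicator of {h > 0}: the
    integral of its positive part vanishes. This is applied to g and to - g. *)
Lemma fundamental_lemma g : sqinteg leb Omega g ->
  (forall phi, test phi -> \int[leb]_(x in Omega) (g x * phi x) = 0) -> ae_eq leb Omega g (cst 0).
Proof.
have half h : sqinteg leb Omega h ->
    (forall phi, test phi -> \int[leb]_(x in Omega) (h x * phi x) = 0) ->
    {ae leb, forall x, Omega x -> h x <= 0}.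
  move=> hh H; have [mh ih] := hh.
  pose E := Omega `&` [set x | 0 < h x].
  have mE : measurable E.
    have := mh mO `]0, +oo[%classic (measurable_itv _).
    by congr (measurable _); rewrite /E; apply/seteqP; split => x [Ox]; rewrite /= in_itv/= andbT.
  have E0 := test_orthogonal_Rint hh H mE (@subIsetl _ _ _).
  have hE x : Omega x -> h x * \1_E x = Num.max (h x) 0.
    move=> Ox; rewrite indicE; have [h0|h0] := leP (h x) 0.
      by rewrite memNset ?mulr0// => -[_] /=; rewrite ltNge h0.
    by rewrite mem_set ?mulr1//.
  have sE : sqinteg leb Omega (\1_E : 'rV[R]_n -> R).
    apply: (sqinteg_bounded mO bO (M := 1)); first exact: measurable_indic.
    by move=> x _; have /andP[h1 h2] := indic_itv (R := R) E x; rewrite ger0_norm.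
  have ge0 x : Omega x -> 0 <= h x * \1_E x.
    by move=> Ox; rewrite hE// le_max lexx orbT.
  have := Rint_eq0_ae mO ge0 (sqinteg_mul mO hh sE) E0.
  apply: filterS => x Hx Ox; have := Hx Ox; rewrite /= hE// => <-.
  by rewrite le_max lexx.
move=> hg H; have h1 := half g hg H.
have hN : sqinteg leb Omega (fun x => -1 * g x + 0) by apply: sqintegZD => //; exact: sqinteg0.
have h2 : {ae leb, forall x, Omega x -> -1 * g x + 0 <= 0}.
  apply: half => // phi tp; have ip := sqinteg_mul mO hg (test_sqinteg tp).
  have E := RintegralZl (-1) mO ip; rewrite (H phi tp) mulr0 in E; rewrite -[RHS]E.
  by apply: Rint_ext => x _; lra.
apply: filterS2 h1 h2 => x g1 g2 Ox /=; have := g1 Ox; have := g2 Ox.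
by move=> a b; apply/eqP; rewrite eq_le b /=; lra.
Qed.

End test_functions.

(** * The space H^1_0 *)

Section sobolev_space.
Context {R : realType} {n : nat} (Omega : set 'rV[R]_n).
Local Notation leb := (lebesgue_rV R n).
Local Notation V := ('rV[R]_n -> R^o).
Local Notation L2s := (sqinteg leb Omega).
Local Notation test := (test_function Omega).
Local Notation wp := (wpartial Omega).
Local Notation N2 := (nrm (dot leb Omega)).
Implicit Types (u v w g phi : V) (i : 'I_n) (a : R).
Hypotheses (oO : open Omega) (bO : bounded_set Omega).
Let mO : measurable Omega := measurable_Omega oO.
Let hS : semi_ip L2s (dot leb Omega) := semi_ip_dot leb mO.

Lemma L2P u : L2 Omega u <-> L2s u.
Proof.
split=> -[mu iu]; split=> //; last exact: (integ_lty mO iu).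
apply: ge0_integ; [exact: measurable_funX|by move=> x _; exact: sqr_ge0|exact: iu].
Qed.

Lemma L2normE u : L2s u -> L2norm_sqr Omega u = (dot leb Omega u u)%:E.
Proof. by move=> [mu iu]; rewrite dotE (EFin_Rint mO iu). Qed.

Lemma wpartialP i u : H1 Omega u -> L2s (wp i u) /\ weak_partial Omega i u (wp i u).
Proof.
move=> [_ /(_ i) h]; have [/L2P h1 h2] := xgetPex (fun=> 0) h.
by split.
Qed.

Lemma H1_L2 u : H1 Omega u -> L2s u. Proof. by move=> [/L2P]. Qed.

Lemma weak_partial_unique i u g g' : L2s g -> L2s g' -> weak_partial Omega i u g ->
  weak_partial Omega i u g' -> ae_eq leb Omega g g'.
Proof.
move=> sg sg' hg hg'.
have sd := ipB hS sg sg'.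
have : ae_eq leb Omega (g - g') (cst 0).
  apply: (fundamental_lemma oO bO sd) => phi tp.
  have := ipBl hS sg sg' (test_sqinteg oO bO tp); rewrite /dot => ->.
  by apply/eqP; rewrite subr_eq0; apply/eqP/oppr_inj; rewrite -hg// -hg'.
by apply: ae_eq_imp => x _ /= h; apply/eqP; rewrite -subr_eq0; apply/eqP.
Qed.

Lemma wpartial_ae i u g : H1 Omega u -> L2s g -> weak_partial Omega i u g ->
  ae_eq leb Omega (wp i u) g.
Proof. by move=> hu sg hg; have [s w] := wpartialP i hu; exact: weak_partial_unique w hg. Qed.

Lemma weak_partialZD i a u v g g' : L2s u -> L2s v -> L2s g -> L2s g' ->
  weak_partial Omega i u g -> weak_partial Omega i v g' ->
  weak_partial Omega i (a *: u + v) (a *: g + g').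
Proof.
move=> su sv sg sg' hg hg' phi tp.
have sp := test_sqinteg oO bO tp; have sd := test_sqinteg oO bO (test_partial i tp).
have := ipl hS a su sv sd; rewrite /dot => ->; have := ipl hS a sg sg' sp; rewrite /dot => ->.
by rewrite hg// hg'// opprD mulrN.
Qed.

Lemma H1ZD a u v : H1 Omega u -> H1 Omega v -> H1 Omega (a *: u + v).
Proof.
move=> hu hv; split; first by apply/L2P; apply: (ipP hS); exact: H1_L2.
move=> i; have [s w] := wpartialP i hu; have [s' w'] := wpartialP i hv.
exists (a *: wp i u + wp i v); split; first by apply/L2P; exact: (ipP hS).
by apply: weak_partialZD => //; exact: H1_L2.
Qed.

(** The representatives [wpartial] are chosen independently for each function, so they are linear
    only up to almost everywhere equality. *)
Lemma wpartialZD i a u v : H1 Omega u -> H1 Omega v ->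
  ae_eq leb Omega (wp i (a *: u + v)) (a *: wp i u + wp i v).
Proof.
move=> hu hv; have [s w] := wpartialP i hu; have [s' w'] := wpartialP i hv.
apply: wpartial_ae; [exact: H1ZD|exact: (ipP hS)|].
by apply: weak_partialZD => //; exact: H1_L2.
Qed.

Lemma test_weak_partial i phi : test phi -> weak_partial Omega i phi (partial i phi).
Proof.
move=> tp psi tq; have := integration_by_parts_C1c i (test_C1c bO tp) (test_C1c bO tq).
have e (h : 'rV[R]_n -> R) : (forall x, ~ Omega x -> h x = 0) -> \int[leb]_x h x = \int[leb]_(x in Omega) h x.
  by move=> h0; rewrite -(@Rint_supp _ _ _ leb setT Omega h (fun x _ => h0 x)) setTI.
rewrite !e// => x nx; first by have [_ ->] := test_vanish i tp nx; rewrite mul0r.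
by have [-> _] := test_vanish i tp nx; rewrite mul0r.
Qed.

Lemma test_H1 phi : test phi -> H1 Omega phi.
Proof.
move=> tp; split; first by apply/L2P; exact: test_sqinteg.
move=> i; exists (partial i phi); split; last exact: test_weak_partial.
by apply/L2P/test_sqinteg => //; exact: test_partial.
Qed.

Lemma test_wpartial i phi : test phi -> ae_eq leb Omega (wp i phi) (partial i phi).
Proof.
move=> tp; apply: wpartial_ae; [exact: test_H1| |exact: test_weak_partial].
by apply: test_sqinteg => //; exact: test_partial.
Qed.

Lemma dot_ae2 f f' : L2s f -> L2s f' -> ae_eq leb Omega f f' ->
  dot leb Omega f f = dot leb Omega f' f'.
Proof.
move=> sf sf' e; have e1 := dot_ae mO sf sf' sf e; have e2 := dot_ae mO sf sf' sf' e.
by rewrite e1 -e2; exact: (ipC hS).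
Qed.

Definition dirichlet u v : R := \int[leb]_(x in Omega) grad_dot Omega u v x.
Local Notation Dir := dirichlet.

Lemma dirichletE u v : H1 Omega u -> H1 Omega v ->
  Dir u v = \sum_(i < n) dot leb Omega (wp i u) (wp i v).
Proof.
move=> hu hv; rewrite /dirichlet /grad_dot (Rint_sum mO)// => i.
by apply: (sqinteg_mul mO); [case: (wpartialP i hu)|case: (wpartialP i hv)].
Qed.

Lemma H1_0 : H1 Omega (0 : V).
Proof. exact: (test_H1 (test0 Omega)). Qed.

Lemma semi_ip_dirichlet : semi_ip (H1 Omega : set V) Dir.
Proof.
split.
- exact: H1_0.
- exact: H1ZD.
- by move=> u v hu hv; apply: Rint_ext => x _; apply: eq_bigr => i _; rewrite mulrC.
- move=> a u v w hu hv hw; rewrite !dirichletE//; last exact: H1ZD.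
  rewrite big_distrr -big_split/=; apply: eq_bigr => i _.
  have [s _] := wpartialP i hu; have [s' _] := wpartialP i hv; have [s2 _] := wpartialP i hw.
  have [s3 _] := wpartialP i (H1ZD a hu hv).
  by rewrite (dot_ae mO s3 (ipP hS a s s') s2 (wpartialZD i a hu hv)) (ipl hS).
- move=> u hu; rewrite dirichletE//; apply: sumr_ge0 => i _; apply: (ip_ge0 hS).
  by case: (wpartialP i hu).
Qed.
Let hD := semi_ip_dirichlet.

Lemma N2_wpartial i u : H1 Omega u -> N2 (wp i u) <= nrm Dir u.
Proof.
move=> hu; rewrite /nrm ler_wsqrtr// dirichletE// (bigD1 i)//= lerDl.
by apply: sumr_ge0 => j _; apply: (ip_ge0 hS); case: (wpartialP j hu).
Qed.

Lemma nrm_ae f f' : L2s f -> L2s f' -> ae_eq leb Omega f f' -> N2 f = N2 f'.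
Proof. by move=> sf sf' /(dot_ae2 sf sf') e; rewrite /nrm e. Qed.

Lemma N2_wpartialB i u v : H1 Omega u -> H1 Omega v ->
  N2 ((wp i u : V) - wp i v) <= nrm Dir (u - v).
Proof.
move=> hu hv; have hd := ipB hD hu hv.
have [s _] := wpartialP i hu; have [s' _] := wpartialP i hv; have sd := ipB hS s s'.
have [sd' _] := wpartialP i hd.
have ea : ae_eq leb Omega (wp i (u - v)) ((wp i u : V) - wp i v).
  have := wpartialZD i (-1) hv hu.
  by rewrite !scaleN1r ![- _ + _]addrC.
by rewrite -(nrm_ae sd' sd ea); exact: N2_wpartial.
Qed.

Definition h1_ip u v : R := dot leb Omega u v + Dir u v.

Lemma semi_ip_h1 : semi_ip (H1 Omega : set V) h1_ip.
Proof.
split.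
- exact: H1_0.
- exact: H1ZD.
- move=> u v hu hv; have e1 := ipC hS (H1_L2 hu) (H1_L2 hv); have e2 := ipC hD hu hv.
  by rewrite /h1_ip e1 e2.
- move=> a u v w hu hv hw.
  have e1 := ipl hS a (H1_L2 hu) (H1_L2 hv) (H1_L2 hw); have e2 := ipl hD a hu hv hw.
  by rewrite /h1_ip e1 e2 mulrDr addrACA.
- by move=> u hu; rewrite addr_ge0 ?(ip_ge0 hD)// (ip_ge0 hS)//; exact: H1_L2.
Qed.
Let hH := semi_ip_h1.

Lemma nrm_h1_sqr u : H1 Omega u -> nrm h1_ip u ^+ 2 = N2 u ^+ 2 + nrm Dir u ^+ 2.
Proof. by move=> hu; rewrite (nrm_sqr hH)// (nrm_sqr hS) ?(nrm_sqr hD)//; exact: H1_L2. Qed.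

Lemma N2_le_h1 u : H1 Omega u -> N2 u <= nrm h1_ip u.
Proof.
by move=> hu; rewrite -(@ler_pXn2r _ 2)// ?nnegrE ?nrm_ge0// nrm_h1_sqr// lerDl sqr_ge0.
Qed.

Lemma Dir_le_h1 u : H1 Omega u -> nrm Dir u <= nrm h1_ip u.
Proof.
by move=> hu; rewrite -(@ler_pXn2r _ 2)// ?nnegrE ?nrm_ge0// nrm_h1_sqr// lerDr sqr_ge0.
Qed.

Lemma nrm_h1_le u : H1 Omega u -> nrm h1_ip u <= N2 u + nrm Dir u.
Proof.
move=> hu; rewrite -(@ler_pXn2r _ 2)// ?nnegrE ?addr_ge0 ?nrm_ge0// nrm_h1_sqr//.
have := mulr_ge0 (nrm_ge0 (dot leb Omega) u) (nrm_ge0 Dir u).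
rewrite sqrrD; move: (_ ^+ 2) (_ ^+ 2) (_ * _) => p q r h.
by rewrite -addrA lerD2l lerDr mulrn_wge0.
Qed.

Lemma H1normE u : H1 Omega u -> H1norm_sqr Omega u = (nrm h1_ip u ^+ 2)%:E.
Proof.
move=> hu; rewrite /H1norm_sqr L2normE ?(nrm_sqr hH)//; last exact: H1_L2.
rewrite /h1_ip dirichletE// EFinD; congr (_ + _)%E.
rewrite -sumEFin; apply: eq_bigr => i _; apply: L2normE.
by case: (wpartialP i hu).
Qed.

Lemma H10P u : H10 Omega u <-> H1 Omega u /\
  forall e : R, 0 < e -> exists phi, test phi /\ nrm h1_ip (u - phi) < e.
Proof.
split=> -[hu H]; split => // e e0.
- have [phi [tp h]] := H _ (exprn_gt0 2 e0); exists phi; split => //.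
  have hd : H1 Omega (u - (phi : V)) by apply: (ipB hH) => //; exact: test_H1.
  move: h; rewrite -[(u \- phi)%R]/(u - (phi : V)) H1normE// lte_fin.
  by rewrite ltr_pXn2r ?nnegrE ?nrm_ge0// ltW.
- have s0 : 0 < Num.sqrt e by rewrite sqrtr_gt0.
  have [phi [tp h]] := H _ s0; exists phi; split => //.
  have hd : H1 Omega (u - (phi : V)) by apply: (ipB hH) => //; exact: test_H1.
  rewrite -[(u \- phi)%R]/(u - (phi : V)) H1normE// lte_fin -(sqr_sqrtr (ltW e0)).
  by rewrite ltr_pXn2r ?nnegrE ?nrm_ge0// ltW.
Qed.

Lemma H10_H1 u : H10 Omega u -> H1 Omega u. Proof. by case. Qed.

Lemma test_H10 phi : test phi -> H10 Omega phi.
Proof.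
move=> tp; apply/H10P; split; first exact: test_H1.
by move=> e e0; exists phi; split => //; rewrite subrr (nrm0 hH).
Qed.

Lemma H10ZD a u v : H10 Omega u -> H10 Omega v -> H10 Omega (a *: u + v).
Proof.
move=> /H10P[hu Hu] /H10P[hv Hv]; apply/H10P; split; first exact: H1ZD.
move=> e e0; have e2 : 0 < e / 2 by rewrite divr_gt0.
have a0 : 0 < `|a| + 1 by rewrite ltr_wpDl.
have ea : 0 < e / 2 / (`|a| + 1) by rewrite divr_gt0.
have [phi [tp hp]] := Hu _ ea; have [psi [tq hq]] := Hv _ e2.
exists (a *: phi + psi); split; first exact: test_ZD.
have h1 : H1 Omega (u - phi) by apply: (ipB hH) => //; exact: test_H1.
have h2 : H1 Omega (v - psi) by apply: (ipB hH) => //; exact: test_H1.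
have -> : a *: u + v - (a *: phi + psi) = a *: (u - phi) + (v - psi).
  by rewrite scalerBr opprD addrACA.
apply: (@le_lt_trans _ _ (`|a| * nrm h1_ip (u - phi) + nrm h1_ip (v - psi))).
  by apply: le_trans (nrmD hH _ h2) _; rewrite ?(nrmZ hH)//; exact: (ipZ hH).
rewrite [ltRHS](splitr e); apply: ler_ltD => //.
apply: (@le_trans _ _ ((`|a| + 1) * (e / 2 / (`|a| + 1)))).
  by apply: ler_pM; rewrite ?nrm_ge0 ?lerDl// ltW.
by rewrite mulrCA mulfV ?mulr1// lt0r_neq0.
Qed.

Lemma semi_ip_H10 : semi_ip (H10 Omega : set V) Dir.
Proof.
have h10 := H10_H1; split.
- exact: (test_H10 (test0 Omega)).
- exact: H10ZD.
- by move=> u v /h10 hu /h10 hv; exact: (ipC hD).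
- by move=> a u v w /h10 hu /h10 hv /h10 hw; exact: (ipl hD).
- by move=> u /h10; exact: (ip_ge0 hD).
Qed.
Let h0 := semi_ip_H10.

Lemma semi_ip_dot_H10 : semi_ip (H10 Omega : set V) (dot leb Omega).
Proof.
have h10 u : H10 Omega u -> L2s u by move=> /H10_H1/H1_L2.
split.
- exact: (test_H10 (test0 Omega)).
- exact: H10ZD.
- by move=> u v /h10 hu /h10 hv; exact: (ipC hS).
- by move=> a u v w /h10 hu /h10 hv /h10 hw; exact: (ipl hS).
- by move=> u /h10; exact: (ip_ge0 hS).
Qed.

Lemma dirichlet_test phi (a0 : 'rV[R]_n) (s : R) : Omega `<=` cube a0 s -> test phi ->
  nrm Dir phi ^+ 2 = genergy a0 s phi.
Proof.
move=> OQ tp; have hp := test_H1 tp; rewrite (nrm_sqr hD)//.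
have [_ vo] := test_vanish_off bO OQ tp.
have -> : genergy a0 s phi = \int[leb]_(x in Omega) grad_sqr phi x.
  have HS x : cube a0 s x -> ~ Omega x -> grad_sqr phi x = 0.
    by move=> _ nx; rewrite /grad_sqr big1// => i _; have [_ ->] := test_vanish i tp nx; rewrite expr0n.
  by rewrite /genergy -(@Rint_supp _ _ _ leb (cube a0 s) Omega (grad_sqr phi) HS) (setIidr OQ).
rewrite dirichletE//.
have sp i : L2s (partial i phi) by apply: test_sqinteg => //; exact: test_partial.
have e i : dot leb Omega (wp i phi) (wp i phi) = \int[leb]_(x in Omega) (partial i phi x ^+ 2).
  have [s1 _] := wpartialP i hp.
  by rewrite (dot_ae2 s1 (sp i) (test_wpartial i tp)) dotE.
rewrite (eq_bigr (fun i => \int[leb]_(x in Omega) (partial i phi x ^+ 2))); last by move=> i _; exact: e.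
by rewrite -(Rint_sum mO)// => i; have [] := sp i.
Qed.

Section poincare.
Variables (i0 : 'I_n) (a0 : 'rV[R]_n) (s0 : R).
Hypotheses (s00 : 0 < s0) (OQ : Omega `<=` cube a0 s0).

Lemma N2_test phi : test phi -> N2 phi ^+ 2 = \int[leb]_(x in cube a0 s0) phi x ^+ 2.
Proof.
move=> tp; rewrite (nrm_sqr hS); last exact: test_sqinteg.
have HS x : cube a0 s0 x -> ~ Omega x -> phi x ^+ 2 = 0.
  by move=> _ nx; have [-> _] := test_vanish i0 tp nx; rewrite expr0n.
by rewrite dotE -(@Rint_supp _ _ _ leb (cube a0 s0) Omega _ HS) (setIidr OQ).
Qed.

Definition poincare_cst : R := Num.sqrt (n%:R * s0 ^+ 2).

Lemma poincare_H10 u : H10 Omega u -> N2 u <= poincare_cst * nrm Dir u.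
Proof.
move=> Hu; have /H10P[hu Au] := Hu.
have P0 : 0 <= poincare_cst by exact: sqrtr_ge0.
apply/ler_addgt0Pr => e e0; pose c := poincare_cst + 1.
have c0 : 0 < c by rewrite /c ltr_wpDl.
have ec : 0 < e / c by rewrite divr_gt0.
have [phi [tp hp]] := Au _ ec; have h1 := test_H1 tp.
have hd : H1 Omega (u - phi) := ipB hH hu h1.
have pt : N2 phi <= poincare_cst * nrm Dir phi.
  rewrite -(@ler_pXn2r _ 2)// ?nnegrE ?mulr_ge0 ?nrm_ge0// exprMn.
  have -> : poincare_cst ^+ 2 = n%:R * s0 ^+ 2.
    by rewrite /poincare_cst sqr_sqrtr// mulr_ge0 ?sqr_ge0.
  rewrite N2_test// (dirichlet_test OQ tp).
  exact: (poincare_vanish i0 s00 (test_vanish_off bO OQ tp)).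
have a1 : N2 u <= N2 phi + N2 (u - phi) by apply: (nrm_leDB hS); exact: H1_L2.
have a2 : nrm Dir phi <= nrm Dir u + nrm Dir (u - phi).
  by have e1 := nrmBC hD hu h1; rewrite e1; exact: (nrm_leDB hD h1 hu).
have a3 := N2_le_h1 hd; have a4 := Dir_le_h1 hd.
have a5 : c * nrm h1_ip (u - phi) <= e.
  by rewrite mulrC -ler_pdivlMr//; exact: ltW.
have a6 := ler_wpM2l P0 (le_trans a2 (lerD (lexx _) a4)).
rewrite mulrDr in a6; rewrite mulrDl mul1r in a5.
apply: le_trans a1 _; apply: le_trans (lerD (le_trans pt a6) a3) _.
by rewrite -addrA lerD2l.
Qed.

(** By Poincare's inequality the functions and their weak derivatives are Cauchy in L^2. The
    identity that defines weak derivatives is continuous in L^2, so it passes to the limits, and so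
    does approximability by test functions. *)
Lemma H10_complete : ip_complete (H10 Omega : set V) Dir.
Proof.
move=> u_ Hu cau.
have hu k : H1 Omega (u_ k) := H10_H1 (Hu k).
have su k : L2s (u_ k) := H1_L2 (hu k).
have c0 : 0 < poincare_cst + 1 by rewrite ltr_wpDl// sqrtr_ge0.
have cau0 (e : R) : 0 < e -> exists N, forall i j : nat, (N <= i)%N -> (N <= j)%N -> N2 (u_ i - u_ j) < e.
  move=> e0; have ec : 0 < e / (poincare_cst + 1) by rewrite divr_gt0.
  have [N HN] := cau _ ec; exists N => i j Ni Nj.
  apply: le_lt_trans (poincare_H10 (ipB h0 (Hu i) (Hu j))) _.
  have := HN i j Ni Nj; rewrite ltr_pdivlMr// mulrC; apply: le_lt_trans.
  by rewrite ler_wpM2r ?nrm_ge0// lerDl.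
have [u sU cu] := nrm2_complete mO su cau0.
have sw i k : L2s (wp i (u_ k)) by case: (wpartialP i (hu k)).
have cauw i (e : R) : 0 < e -> exists N, forall k l, (N <= k)%N -> (N <= l)%N ->
    N2 ((wp i (u_ k) : V) - wp i (u_ l)) < e.
  move=> /cau[N HN]; exists N => k l Nk Nl; apply: le_lt_trans (HN k l Nk Nl).
  exact: N2_wpartialB.
have Hg i : exists g, L2s g /\ N2 ((wp i (u_ k) : V) - g) @[k --> \oo] --> 0.
  by have [g sg cg] := nrm2_complete mO (sw i) (cauw i); exists g.
have [g Hg'] := choice Hg.
have wg i : weak_partial Omega i u (g i).
  move=> phi tp; have [sg cg] := Hg' i.
  have sp := test_sqinteg oO bO tp; have sd := test_sqinteg oO bO (test_partial i tp).
  have c1 := cvg_ip hS su sU sd cu.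
  have c2 := cvg_ip hS (sw i) sg sp cg.
  have c3 : dot leb Omega (u_ k) (partial i phi) @[k --> \oo] --> - dot leb Omega (g i) phi.
    have -> : (fun k => dot leb Omega (u_ k) (partial i phi)) = (fun k => - dot leb Omega (wp i (u_ k)) phi).
      by apply/funext => k; have [_ H] := wpartialP i (hu k); exact: H phi tp.
    exact: (cvgN c2).
  exact: (cvg_unique _ c1 c3).
have HU : H1 Omega u.
  split; first exact/L2P.
  by move=> i; exists (g i); split; [apply/L2P; case: (Hg' i)|exact: wg].
have cd : nrm Dir (u_ k - u) @[k --> \oo] --> 0.
  have e k : nrm Dir (u_ k - u) = Num.sqrt (\sum_(i < n) N2 ((wp i (u_ k) : V) - g i) ^+ 2).
    have hd := ipB hD (hu k) HU; rewrite /nrm dirichletE//; congr Num.sqrt.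
    apply: eq_bigr => i _; have [sg _] := Hg' i; have sd := ipB hS (sw i k) sg.
    have [sd' _] := wpartialP i hd.
    rewrite (nrm_sqr hS sd); apply: dot_ae2 => //.
    have ea : ae_eq leb Omega (wp i (u_ k - u)) ((wp i (u_ k) : V) - g i).
      have a1 := wpartialZD i (-1) HU (hu k); have a2 := wpartial_ae HU sg (wg i).
      rewrite scaleN1r [- _ + _]addrC in a1; apply: filterS2 a1 a2 => x h1 h2 Ox.
      by rewrite (h1 Ox) /= scaleN1r -[LHS]/(- wp i u x + wp i (u_ k) x) h2// addrC.
    exact: ea.
  have c : (\sum_(i < n) N2 ((wp i (u_ k) : V) - g i) ^+ 2) @[k --> \oo] --> (0 : R).
    have c' : (\sum_(i < n) N2 ((wp i (u_ k) : V) - g i) ^+ 2) @[k --> \oo] --> \sum_(i < n) (0 : R).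
      apply: (cvg_big (op := +%R)) => [|i _]; first exact: add_continuous.
      have [_ cg] := Hg' i; rewrite -[X in _ --> X](mulr0 (0 : R)); exact: (cvgM cg cg).
    by rewrite big1 in c'.
  have -> : (fun k => nrm Dir (u_ k - u)) = (fun k => Num.sqrt (\sum_(i < n) N2 ((wp i (u_ k) : V) - g i) ^+ 2)).
    by apply/funext.
  by have := cvg_comp _ _ c (@sqrt_continuous R 0); rewrite sqrtr0; exact.
exists u => //; apply/H10P; split => // e e0.
have e4 : 0 < e / 4 by rewrite divr_gt0.
have /cvgr0_norm_le/(_ _ e4)[N1 _ HN1] := cu.
have /cvgr0_norm_le/(_ _ e4)[N2' _ HN2] := cd.
pose k := maxn N1 N2'.
have hk1 := HN1 k (leq_maxl _ _); have hk2 := HN2 k (leq_maxr _ _).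
rewrite /= ger0_norm ?nrm_ge0// in hk1; rewrite /= ger0_norm ?nrm_ge0// in hk2.
have /H10P[_ /(_ _ e4)[phi [tp hp]]] := Hu k.
exists phi; split => //; have hphi := test_H1 tp.
have := nrmB_trans hH HU (hu k) hphi.
have := nrm_h1_le (ipB hH HU (hu k)).
rewrite (nrmBC hS)// (nrmBC hD)//.
move: hk1 hk2 hp; move: (N2 _) (nrm Dir _) (nrm h1_ip (u_ k - phi)) (nrm h1_ip (u - u_ k))
  (nrm h1_ip (u - phi)) => p q r s t.
by lra.
Qed.

End poincare.
End sobolev_space.

Lemma rayleigh_arith {R : realType} (e mu p q t w : R) : p < e / 2 -> q <= mu + p ->
  0 <= q - t - (t - w) -> - (e / 2 / 2) <= w - t -> w - t <= e / 2 / 2 -> w <= mu + e.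
Proof. by lra. Qed.

Lemma quarters_arith {R : realType} (e p q r s w : R) : 0 < e -> p <= q + r -> r <= s + w ->
  q <= e / 4 -> s <= e / 4 -> w <= e / 4 -> p < e.
Proof. by lra. Qed.

Lemma form_arith {R : realType} (a mu p q r s : R) :
  a * p + q - mu * (a * r + s) = a * (p - mu * r) + (q - mu * s).
Proof. by lra. Qed.

Lemma norm_scale_inv {R : realType} (d t : R) : 0 < d -> `|t| = d * `|d^-1 * t|.
Proof.
move=> d0; rewrite normrM gtr0_norm ?invr_gt0// mulrA mulfV ?mul1r//.
exact: lt0r_neq0.
Qed.

(** * Compact and Sobolev embeddings of H^1_0, and the first eigenvalue *)

Section embeddings.
Context {R : realType} {n : nat} (Omega : set 'rV[R]_n).
Local Notation leb := (lebesgue_rV R n).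
Local Notation vol' := (@vol R n).
Local Notation V := ('rV[R]_n -> R^o).
Local Notation L2s := (sqinteg leb Omega).
Local Notation test := (test_function Omega).
Local Notation wp := (wpartial Omega).
Local Notation N2 := (nrm (dot leb Omega)).
Local Notation Dir := (dirichlet Omega).
Local Notation H10 := (H10 Omega).
Implicit Types (u v w g phi : V) (a : R).

Lemma bounded_sub_cube : bounded_set Omega -> exists (a0 : 'rV[R]_n) (s0 : R), 0 < s0 /\ Omega `<=` cube a0 s0.
Proof.
move=> [M [_ HM]]; pose b := `|M| + 1.
have h x : Omega x -> `|x| <= b.
  by apply: HM; rewrite /b; have := ler_norm M; lra.
exists (const_mx (- b - 1)), (2 * b + 2).
have b0 : 0 < b by rewrite /b ltr_wpDl.
split; first by lra.
move=> x /h xb; apply/cubeP => i; have := le_trans (rV_coord_le x i) xb.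
by rewrite !mxE ler_norml => /andP[h1 h2]; apply/andP; split; lra.
Qed.

Lemma vol_gt0_of_cube (a0 : 'rV[R]_n) (s0 : R) : 0 < s0 -> (0 < leb (cube a0 s0))%E ->
  forall s : R, 0 < s -> 0 < vol' s.
Proof.
move=> s00; rewrite leb_cube lte_fin => v0 s sgt0.
have vk k : 0 < vol' (s0 / 2 ^+ k).
  elim: k => [|k IH]; first by rewrite expr0 divr1.
  have h : 0 <= s0 / 2 ^+ k by rewrite divr_ge0 ?exprn_ge0// ltW.
  rewrite exprS invfM mulrCA mulrC.
  have N0 : 0 < (2 ^ n)%:R :> R by rewrite ltr0n expn_gt0.
  by move: IH; rewrite (vol_half h) pmulr_rgt0.
have [k hk] := expr_unbounded (s0 / s) (ltr1n R 2).
apply: lt_le_trans (vk k) _; rewrite -lee_fin -!(leb_cube 0).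
rewrite le_measure ?inE; [|exact: measurable_cube|exact: measurable_cube|] => //.
move=> x /cubeP H; apply/cubeP => i; have /andP[-> h] := H i => /=.
apply: le_trans h _; rewrite lerD2l ler_pdivrMr ?exprn_gt0//.
by rewrite mulrC -ler_pdivrMr// ltW.
Qed.

Lemma continuous_norm_powR (r : R) : 0 < r -> continuous (fun t : R => `|t| `^ r).
Proof.
move=> r0 t; have [->|t0] := eqVneq t 0.
  rewrite /continuous_at normr0 powR0 ?lt0r_neq0//; apply/cvgr0Pnorm_le => e e0.
  have er : 0 < e `^ r^-1 by rewrite powR_gt0.
  have eE : (e `^ r^-1) `^ r = e by rewrite -powRrM mulVf ?powRr1 ?ltW ?lt0r_neq0.
  near=> z; have hz : `|z| <= e `^ r^-1.
    by near: z; apply: cvgr0_norm_le; [exact: cvg_id|exact: er].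
  rewrite ger0_norm ?powR_ge0// -[leRHS]eE.
  by apply: (ge0_ler_powR (ltW r0)); rewrite ?nnegrE ?powR_ge0.
have nt : 0 < `|t| by rewrite normr_gt0.
have c1 : (fun t : R => `|t|) @ t --> `|t| by exact: norm_continuous.
have c2 (b : R) : 0 < b -> {for b, continuous (fun t : R => t `^ r)}.
  move=> b0; apply: differentiable_continuous; apply/derivable1_diffP.
  by have [] := is_derive1_powR r b0.
exact: (cvg_comp _ _ c1 (c2 _ nt)).
Unshelve. all: by end_near. Qed.

Hypotheses (oO : open Omega) (bO : bounded_set Omega).
Let mO : measurable Omega := measurable_Omega oO.
Let hS : semi_ip L2s (dot leb Omega) := semi_ip_dot leb mO.
Let hD := semi_ip_dirichlet oO bO.
Let h0 := semi_ip_H10 oO bO.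
Let hC := semi_ip_dot_H10 oO bO.

Variables (i0 : 'I_n) (a0 : 'rV[R]_n) (s0 : R).
Hypotheses (s00 : 0 < s0) (OQ : Omega `<=` cube a0 s0).
Hypothesis vol_gt0 : forall s : R, 0 < s -> 0 < vol' s.

Let H10_L2 u : H10 u -> L2s u. Proof. by move=> /H10_H1/(H1_L2 oO). Qed.

(** The k-th term is replaced by a test function at distance less than 1 / (k + 1), to which
    [rellich_C1c] applies; the replacement does not alter the Cauchy property. *)
Lemma H10_precompact (u_ : nat -> V) (M : R) : (forall k, H10 (u_ k)) -> (forall k, nrm Dir (u_ k) <= M) ->
  exists s, subsequence s /\ forall e : R, 0 < e -> exists N, forall i j, (N <= i)%N -> (N <= j)%N ->
    N2 (u_ (s i) - u_ (s j)) < e.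
Proof.
move=> Hu uM.
have Hphi k : exists phi, test phi /\ nrm (h1_ip Omega) (u_ k - phi) < k.+1%:R^-1.
  by have /(H10P oO bO)[_] := Hu k; apply; rewrite invr_gt0.
have [phi Hp] := choice Hphi.
have tp k : test (phi k) by case: (Hp k).
have hu k := H10_H1 (Hu k); have hp k := test_H1 oO bO (tp k).
have hd k : H1 Omega (u_ k - phi k) := ipB hD (hu k) (hp k).
have hk k : nrm (h1_ip Omega) (u_ k - phi k) < k.+1%:R^-1 by case: (Hp k).
have k1 k : k.+1%:R^-1 <= 1 :> R by rewrite invf_le1 ?ler1n// ltr0n.
have M0 : 0 <= M by apply: le_trans (uM 0%N); exact: nrm_ge0.
have pM k : nrm Dir (phi k) <= M + 1.
  have e1 := nrm_leDB hD (hp k) (hu k); have e2 := nrmBC hD (hp k) (hu k).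
  rewrite e2 in e1; apply: le_trans e1 (lerD (uM k) _).
  by apply: le_trans (Dir_le_h1 oO bO (hd k)) _; apply: le_trans (ltW (hk k)) (k1 k).
pose P := @poincare_cst R n s0; have P0 : 0 <= P by exact: sqrtr_ge0.
pose M' := (P * (M + 1)) ^+ 2 + (M + 1) ^+ 2.
have b1 k : \int[leb]_(x in cube a0 s0) phi k x ^+ 2 <= M'.
  rewrite -(N2_test oO bO i0 OQ (tp k)); apply: (@le_trans _ _ ((P * (M + 1)) ^+ 2)).
    have h := poincare_H10 oO bO i0 s00 OQ (test_H10 oO bO (tp k)).
    rewrite ler_pXn2r ?nnegrE ?nrm_ge0 ?mulr_ge0 ?addr_ge0//.
    by apply: le_trans h _; rewrite ler_wpM2l.
  by rewrite lerDl sqr_ge0.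
have b2 k : genergy a0 s0 (phi k) <= M'.
  rewrite -(dirichlet_test oO bO OQ (tp k)); apply: (@le_trans _ _ ((M + 1) ^+ 2)).
    by rewrite ler_pXn2r ?nnegrE ?nrm_ge0 ?addr_ge0.
  by rewrite lerDr sqr_ge0.
have [t [ht Ht]] := rellich_C1c vol_gt0 s00 (fun k => test_C1c bO (tp k)) b1 b2.
exists t; split => // e e0; have e4 : 0 < e / 4 by rewrite divr_gt0.
have e42 : 0 < (e / 4) ^+ 2 by rewrite exprn_gt0.
have [N1 HN1] := Ht _ e42.
have [N2' _ HN2] := near_infty_natSinv_lt (PosNum e4).
exists (maxn N1 N2') => i j; rewrite !geq_max => /andP[i1 i2] /andP[j1 j2].
have small l : (N2' <= l)%N -> N2 (u_ (t l) - phi (t l)) <= e / 4.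
  move=> hl; apply: le_trans (N2_le_h1 oO bO (hd _)) _.
  by apply: le_trans (ltW (hk _)) _; apply: ltW; apply: HN2 => /=; exact: leq_trans hl (subsequence_ge ht l).
have mid : N2 (phi (t i) - phi (t j)) <= e / 4.
  have tB : test (phi (t i) - phi (t j)).
    have := test_ZD (-1) (tp (t j)) (tp (t i)).
    have -> // : (fun x => -1 * phi (t j) x + phi (t i) x) = phi (t i) - phi (t j).
    by apply/funext => x; rewrite mulN1r addrC.
  rewrite -(@ler_pXn2r _ 2)// ?nnegrE ?nrm_ge0 ?(ltW e4)//.
  by rewrite (N2_test oO bO i0 OQ tB); exact: HN1.
have su k := H1_L2 oO (hu k); have sp k := H1_L2 oO (hp k).
have t1 := nrmB_trans hS (su (t i)) (sp (t i)) (su (t j)).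
have t2 := nrmB_trans hS (sp (t i)) (sp (t j)) (su (t j)).
have t3 := nrmBC hS (sp (t j)) (su (t j)).
have hj := small j j2; rewrite -t3 in hj.
exact: quarters_arith e0 t1 t2 (small i i2) mid hj.
Qed.

(** The compatibility of the two seminorms that [tail_weak_cvg] asks for: a function vanishing
    almost everywhere has 0 as weak derivatives. *)
Lemma dirichlet0 x : H10 x -> N2 x = 0 -> nrm Dir x = 0.
Proof.
move=> Hx /(nrm2_eq0 mO (H10_L2 Hx)) ae0; have hx := H10_H1 Hx.
rewrite /nrm (dirichletE oO hx hx) big1 ?sqrtr0// => i _.
have [s1 _] := wpartialP oO i hx; have sz := ip0 hS.
have ea : ae_eq leb Omega (wp i x) (0 : V).
  apply: (wpartial_ae oO bO hx sz) => phi tphi.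
  have sd := test_sqinteg oO bO (test_partial i tphi).
  have := dot_ae mO (H10_L2 Hx) sz sd ae0; rewrite /dot => ->.
  have := ip0l hS sd; rewrite /dot => ->.
  by have := ip0l hS (test_sqinteg oO bO tphi); rewrite /dot => ->; rewrite oppr0.
by rewrite (dot_ae2 oO s1 sz ea); exact: (ip0l hS).
Qed.

(** Rellich gives a subsequence that is Cauchy in L^2. Since its Dirichlet norms are bounded,
    [tail_limit] places the limit in H^1_0 and [tail_weak_cvg] upgrades the convergence to weak
    convergence for the Dirichlet form. *)
Lemma H10_compact (u_ : nat -> V) : (forall k, H10 (u_ k)) -> nbounded Dir u_ ->
  exists s u, [/\ subsequence s, weak_cvg (H10 : set V) Dir (u_ \o s) u &
    N2 (u_ (s k) - u) @[k --> \oo] --> 0].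
Proof.
move=> Hu [M uM]; have [s [hs cau]] := H10_precompact Hu uM.
have cE := H10_complete oO bO i0 s00 OQ.
have HP : exists P, forall x, H10 x -> N2 x <= P * nrm Dir x.
  by exists (@poincare_cst R n s0) => x Hx; exact: (poincare_H10 oO bO i0 s00 OQ Hx).
have [u [Eu uM' cu]] := tail_limit (x_ := u_ \o s) h0 hC cE (fun k => Hu (s k)) (fun k => uM (s k)) HP cau.
exists s, u; split => //.
exact: (tail_weak_cvg h0 hC cE (fun k => Hu (s k)) (fun k => uM (s k)) HP dirichlet0 Eu cu).
Qed.

Lemma H10_weak_compact : weak_compact (H10 : set V) Dir.
Proof. by move=> u_ Hu bu; have [s [u [hs w _]]] := H10_compact Hu bu; exists s, u. Qed.

Lemma H10_weak_L2 (u_ : nat -> V) u : (forall k, H10 (u_ k)) -> nbounded Dir u_ ->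
  weak_cvg (H10 : set V) Dir u_ u -> N2 (u_ k - u) @[k --> \oo] --> 0.
Proof.
move=> Hu bu w; have [Eu _] := w; apply/cvgr0Pnorm_le => e e0; apply: contrapT => /not_eventually H.
have [s [hs Hs]] := exists_subsequence (P := fun k i => ~ `|N2 (u_ i - u)| <= e) (fun k => H).
have bs : nbounded Dir (u_ \o s) by have [M HM] := bu; exists M => k; exact: HM.
have [t [x [ht wx cx]]] := H10_compact (u_ := u_ \o s) (fun k => Hu (s k)) bs.
have wu := weak_cvg_subseq ht (weak_cvg_subseq hs w).
have [Ex _] := wx.
have z := weak_cvg_unique h0 wx wu.
have z2 : N2 (x - u) <= 0.
  by have := poincare_H10 oO bO i0 s00 OQ (ipB h0 Ex Eu); rewrite z mulr0.
have /cvgr0Pnorm_le/(_ _ e0)[N _ /(_ N (leqnn N))] := cx.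
rewrite /= ger0_norm ?nrm_ge0// => hN.
apply: (Hs (t N)); rewrite ger0_norm ?nrm_ge0//.
have t1 := nrmB_trans hC (Hu (s (t N))) Ex Eu.
by apply: le_trans t1 _; rewrite -[leRHS]addr0; apply: lerD.
Qed.

Lemma sobolev_H10 (q r : R) : 1 < q -> (2 ^ n)%:R <= 4 * q ^+ 2 -> 2 < r -> q `^ (r - 2) = 4 ->
  exists2 C : R, 0 <= C & forall u (M : R), H10 u -> 0 < M -> nrm Dir u <= M ->
    integ leb Omega (fun x => `|u x| `^ r) /\ \int[leb]_(x in Omega) `|u x| `^ r <= C * M `^ r.
Proof.
move=> q1 qn r2 q4; have r0 : 0 < r by lra.
have [C C0 HC] := sobolev_C1c vol_gt0 i0 a0 s00 q1 qn r2 q4.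
exists (C * 2 `^ r); first by rewrite mulr_ge0 ?powR_ge0.
move=> u M Hu M0 uM.
(* The rescaled function has Dirichlet norm at most 1 / 2, so test functions within 1 / 2 of it have
   energy at most 1, as [sobolev_C1c] demands; Fatou's lemma then passes to the limit. *)
pose c := (2 * M)^-1; have c0 : 0 < c by rewrite invr_gt0 mulr_gt0.
pose v : V := c *: u; have Hv : H10 v := ipZ h0 c Hu.
have vM : nrm Dir v <= 1 / 2.
  rewrite (nrmZ h0 c Hu) gtr0_norm// /c invfM -mulrA div1r ler_piMr ?invr_ge0//.
  by rewrite mulrC ler_pdivrMr// mul1r.
have Hphi k : exists phi, test phi /\ nrm (h1_ip Omega) (v - phi) < Num.min (1 / 2) k.+1%:R^-1.
  have /(H10P oO bO)[_] := Hv; apply.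
  by rewrite lt_min divr_gt0//= invr_gt0 ltr0n.
have [phi Hp] := choice Hphi.
have tp k : test (phi k) by case: (Hp k).
have hv := H10_H1 Hv; have hp k := test_H1 oO bO (tp k).
have sv := H1_L2 oO hv; have sp k := H1_L2 oO (hp k).
have hd k : H1 Omega (v - phi k) := ipB hD hv (hp k).
have pM k : nrm Dir (phi k) <= 1.
  have e1 := nrm_leDB hD (hp k) hv; have e2 := nrmBC hD (hp k) hv.
  apply: le_trans e1 _; rewrite e2.
  have [_] := Hp k; rewrite lt_min => /andP[h _].
  apply: le_trans (lerD vM (le_trans (Dir_le_h1 oO bO (hd k)) (ltW h))) _.
  by rewrite -splitr.
have cp : N2 ((phi k : V) - v) @[k --> \oo] --> 0.
  apply/cvgr0Pnorm_le => e e0; have [N _ HN] := near_infty_natSinv_lt (PosNum e0).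
  exists N => // k /HN /= hk; rewrite ger0_norm ?nrm_ge0//.
  have e2 := nrmBC hS (sp k) sv; rewrite e2.
  apply: le_trans (N2_le_h1 oO bO (hd k)) _; have [_] := Hp k.
  by rewrite lt_min => /andP[_ h]; apply: ltW; exact: lt_trans hk.
have [s [hs cae]] := nrm2_cvg_ae mO sp sv cp.
have mphi k : measurable_fun Omega (fun x => `|phi (s k) x| `^ r).
  apply: (measurableT_comp (measurable_powR r)); apply: measurableT_comp.
    exact: normr_measurable.
  by case: (sp (s k)).
have mv : measurable_fun Omega (fun x => `|v x| `^ r).
  apply: (measurableT_comp (measurable_powR r)); apply: measurableT_comp.
    exact: normr_measurable.
  by case: sv.
have Ip k : integ leb Omega (fun x => `|phi (s k) x| `^ r).
  exact: integ_powR mO bO r0 (C1c_Cc (test_C1c bO (tp (s k)))).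
have [iv vC] : integ leb Omega (fun x => `|v x| `^ r) /\ \int[leb]_(x in Omega) `|v x| `^ r <= C.
  apply: (fatou_ae mO mphi mv).
  - by move=> k x _; exact: powR_ge0.
  - by move=> x _; exact: powR_ge0.
  - apply: filterS cae => x H Ox.
    have c1 : (phi (s k) x : R) @[k --> \oo] --> (v x : R) by exact: H.
    have c2 : (fun t : R => `|t| `^ r) @ (v x : R) --> `|v x : R| `^ r by exact: continuous_norm_powR.
    exact: (cvg_comp _ _ c1 c2).
  - move=> k; rewrite -(EFin_Rint mO (Ip k)) lee_fin.
    have HSp x : cube a0 s0 x -> ~ Omega x -> `|phi (s k) x| `^ r = 0.
      by move=> _ nx; have [-> _] := test_vanish i0 (tp (s k)) nx; rewrite normr0 powR0// lt0r_neq0.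
    have e1 : \int[leb]_(x in cube a0 s0) `|phi (s k) x| `^ r = \int[leb]_(x in Omega) `|phi (s k) x| `^ r.
      by rewrite -(@Rint_supp _ _ _ leb (cube a0 s0) Omega _ HSp) (setIidr OQ).
    rewrite -e1; apply: HC; first exact: (test_vanish_off bO OQ (tp (s k))).
    rewrite -(dirichlet_test oO bO OQ (tp (s k))).
    by rewrite expr_le1 ?nrm_ge0.
have d0 : 0 < 2 * M by rewrite mulr_gt0.
have e x : `|u x| `^ r = (2 * M) `^ r * `|v x| `^ r.
  rewrite -powRM ?(ltW d0)//; congr (_ `^ _).
  exact: norm_scale_inv.
split.
  by apply: (integ_ext mO) (integZ mO ((2 * M) `^ r) iv) => x _; rewrite e.
have -> : \int[leb]_(x in Omega) `|u x| `^ r = (2 * M) `^ r * \int[leb]_(x in Omega) `|v x| `^ r.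
  have e1 := RintegralZl ((2 * M) `^ r) mO iv; rewrite -e1.
  by apply: Rint_ext => x _; rewrite e.
rewrite powRM ?(ltW M0)// mulrC mulrA; apply: ler_wpM2r; first exact: powR_ge0.
by apply: ler_wpM2r => //; exact: powR_ge0.
Qed.

Lemma eigenvalue_ge0 (l : R) : dirichlet_eigenvalue Omega l -> 0 <= l.
Proof.
move=> [u [Hu nu H]]; have := H u Hu; rewrite -/(Dir u u) => E.
have d0 : 0 < dot leb Omega u u.
  rewrite lt_neqAle (ip_ge0 hC Hu) andbT; apply/eqP => z; apply: nu.
  by apply: (nrm2_eq0 mO (H10_L2 Hu)); rewrite /nrm -z sqrtr0.
have := ip_ge0 h0 Hu; rewrite E -/(dot leb Omega u u).
by rewrite pmulr_lge0.
Qed.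

(** As [lambda1] is an infimum of eigenvalues, the infimum mu of the Rayleigh quotient has to be
    shown to be one. A minimizing sequence converges weakly in H^1_0 and strongly in L^2, so mu is
    attained. *)
Lemma lambda1_le u : H10 u -> lambda1 Omega * dot leb Omega u u <= Dir u u.
Proof.
move=> Hu0; case: (pselect (exists u1, H10 u1 /\ dot leb Omega u1 u1 != 0)) => [[u1 [Hu1 nz]]|]; last first.
  move=> /forallNP/(_ u) /not_andP[//|/negP]; rewrite negbK => /eqP ->.
  by rewrite mulr0; exact: (ip_ge0 h0 Hu0).
pose S := [set t : R | exists v, [/\ H10 v, dot leb Omega v v = 1 & t = Dir v v]].
have norm1 v : H10 v -> dot leb Omega v v != 0 ->
    exists w, [/\ H10 w, dot leb Omega w w = 1 & Dir w w = Dir v v / dot leb Omega v v].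
  move=> Hv nv; have d0 : 0 < dot leb Omega v v by rewrite lt_neqAle eq_sym nv (ip_ge0 hC Hv).
  pose c := (Num.sqrt (dot leb Omega v v))^-1.
  have c2 : c ^+ 2 = (dot leb Omega v v)^-1 by rewrite /c exprVn sqr_sqrtr ?ltW.
  exists (c *: v); split; first exact: (ipZ h0).
    have e1 := ipZl hC c Hv (ipZ hC c Hv); have e2 := ipZr hC c Hv Hv.
    by rewrite e1 e2 mulrA -expr2 c2 mulVf.
  have e1 := ipZl h0 c Hv (ipZ h0 c Hv); have e2 := ipZr h0 c Hv Hv.
  by rewrite e1 e2 mulrA -expr2 c2 mulrC.
have S0 : has_inf S.
  split; last by exists 0 => t [v [Hv _ ->]]; exact: (ip_ge0 h0 Hv).
  by have [w [Hw w1 _]] := norm1 _ Hu1 nz; exists (Dir w w); exists w.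
pose mu := inf S.
have muS v : H10 v -> mu * dot leb Omega v v <= Dir v v.
  move=> Hv; have [->|nv] := eqVneq (dot leb Omega v v) 0.
    by rewrite mulr0; exact: (ip_ge0 h0 Hv).
  have d0 : 0 < dot leb Omega v v by rewrite lt_neqAle eq_sym nv (ip_ge0 hC Hv).
  have [w [Hw w1 e]] := norm1 v Hv nv.
  have : mu <= Dir w w by apply: ge_inf; [exact: S0.2|exists w].
  by rewrite e ler_pdivlMr.
have Hseq (k : nat) : exists v, [/\ H10 v, dot leb Omega v v = 1 & Dir v v <= mu + k.+1%:R^-1].
  have k0 : 0 < k.+1%:R^-1 :> R by rewrite invr_gt0.
  have [_ [v [Hv v1 ->]] lt] := inf_adherent k0 S0.
  by exists v; split => //; exact: ltW.
have [v_ Hv_] := choice Hseq.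
have Ev k : H10 (v_ k) by case: (Hv_ k).
have bv : nbounded Dir v_.
  exists (Num.sqrt (mu + 1)) => k; rewrite /nrm ler_wsqrtr//; have [_ _ h] := Hv_ k.
  by apply: le_trans h _; rewrite lerD2l invf_le1 ?ler1n// ltr0n.
have [s [x [hs wx cx]]] := H10_compact Ev bv.
have [Ex wx'] := wx.
have x1 : dot leb Omega x x = 1.
  have c1 := cvg_nrm hC (fun k => Ev (s k)) Ex cx.
  have c2 : N2 (v_ (s k)) @[k --> \oo] --> (1 : R).
    apply: cvg_near_cst; apply: nearW => k; have [_ h _] := Hv_ (s k).
    by rewrite /nrm h sqrtr1.
  have e1 : N2 x = 1 by exact: (cvg_unique _ c1 c2).
  by rewrite -(nrm_sqr hC Ex) e1 expr1n.
have xmu : Dir x x <= mu.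
  apply/ler_addgt0Pr => e e0; have e2 : 0 < e / 2 by rewrite divr_gt0.
  have c := wx' x Ex; have /cvgrPdist_le/(_ _ (divr_gt0 e2 (ltr0Sn _ 1)))[N1 _ HN1] := c.
  have [N2' _ HN2] := near_infty_natSinv_lt (PosNum e2).
  pose k := maxn N1 N2'.
  have h1 := HN1 k (leq_maxl _ _); rewrite /= in h1.
  have h2 : (s k).+1%:R^-1 < e / 2.
    by apply: HN2 => /=; apply: leq_trans (subsequence_ge hs k); exact: leq_maxr.
  have [_ _ h3] := Hv_ (s k).
  have h4 := ip_ge0 h0 (ipB h0 (Ev (s k)) Ex).
  have h5 := ipBl h0 (Ev (s k)) Ex (ipB h0 (Ev (s k)) Ex).
  have h6 := ipBr h0 (Ev (s k)) Ex (Ev (s k)); have h7 := ipBr h0 (Ev (s k)) Ex Ex.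
  have h8 := ipC h0 Ex (Ev (s k)).
  move: h1; rewrite ler_norml => /andP[h1 h1'].
  rewrite h5 h6 h7 h8 in h4.
  exact: rayleigh_arith h2 h3 h4 h1 h1'.
have xE : Dir x x = mu.
  by apply/eqP; rewrite eq_le xmu; have := muS x Ex; rewrite x1 mulr1.
(* This form is positive semidefinite by the choice of mu and vanishes at (x, x), so Cauchy-Schwarz
   gives Q(x, phi) = 0 for all phi, which is the eigenvalue equation. *)
pose Q (v w : V) : R := Dir v w - mu * dot leb Omega v w.
have hQ : semi_ip (H10 : set V) Q.
  split.
  - exact: (ip0 h0).
  - exact: (ipP h0).
  - move=> v w Hv Hw; have e1 := ipC h0 Hv Hw; have e2 := ipC hC Hv Hw.
    by rewrite /Q e1 e2.
  - move=> a v w z Hv Hw Hz; have e1 := ipl h0 a Hv Hw Hz; have e2 := ipl hC a Hv Hw Hz.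
    by rewrite /Q e1 e2; exact: form_arith.
  - by move=> v Hv; rewrite /Q subr_ge0; exact: muS.
have eig : dirichlet_eigenvalue Omega mu.
  exists x; split => //.
    move=> ae0; have sz := ip0 hS.
    have := dot_ae2 oO (H10_L2 Ex) sz ae0; rewrite x1.
    have e0 := ip0l hS sz; rewrite e0 => /eqP; by rewrite oner_eq0.
  move=> phi Hphi; have := cauchy_schwarz hQ Ex Hphi.
  have -> : nrm Q x = 0 by rewrite /nrm /Q xE x1 mulr1 subrr sqrtr0.
  by rewrite mul0r normr_le0 /Q subr_eq0 => /eqP.
have l1 : lambda1 Omega <= mu.
  by apply: ge_inf => //; exists 0 => l; exact: eigenvalue_ge0.
apply: le_trans (muS u Hu0); apply: ler_wpM2r => //; exact: (ip_ge0 hC Hu0).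
Qed.

End embeddings.

(** * The square of a semi-inner-product space *)

Section square.
Context {R : realType} {V : lmodType R} (E : set V) (B : V -> V -> R).
Implicit Types (w z : V * V).

Definition sq_set : set (V * V) := [set w | E w.1 /\ E w.2].
Definition sq_ip w z : R := B w.1 z.1 + B w.2 z.2.

Hypothesis hB : semi_ip E B.

Lemma semi_ip_sq : semi_ip sq_set sq_ip.
Proof.
split.
- by split; exact: (ip0 hB).
- by move=> a x y [x1 x2] [y1 y2]; split; exact: (ipP hB).
- move=> x y [x1 x2] [y1 y2]; have e1 := ipC hB x1 y1; have e2 := ipC hB x2 y2.
  by rewrite /sq_ip e1 e2.
- move=> a x y z [x1 x2] [y1 y2] [z1 z2].
  have e1 := ipl hB a x1 y1 z1; have e2 := ipl hB a x2 y2 z2.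
  by rewrite /sq_ip /= e1 e2 mulrDr addrACA.
- by move=> x [x1 x2]; rewrite /sq_ip addr_ge0// (ip_ge0 hB).
Qed.
Let h2 := semi_ip_sq.

Lemma nrm_sq_ip w : sq_set w -> nrm sq_ip w ^+ 2 = nrm B w.1 ^+ 2 + nrm B w.2 ^+ 2.
Proof. by move=> Ew; have [E1 E2] := Ew; rewrite (nrm_sqr h2)// (nrm_sqr hB)// (nrm_sqr hB). Qed.

Lemma nrm_fst_le w : sq_set w -> nrm B w.1 <= nrm sq_ip w.
Proof.
by move=> Ew; rewrite -(@ler_pXn2r _ 2)// ?nnegrE ?nrm_ge0// nrm_sq_ip// lerDl sqr_ge0.
Qed.

Lemma nrm_snd_le w : sq_set w -> nrm B w.2 <= nrm sq_ip w.
Proof.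
by move=> Ew; rewrite -(@ler_pXn2r _ 2)// ?nnegrE ?nrm_ge0// nrm_sq_ip// lerDr sqr_ge0.
Qed.

Lemma nrm_sq_le w : sq_set w -> nrm sq_ip w <= nrm B w.1 + nrm B w.2.
Proof.
move=> Ew; rewrite -(@ler_pXn2r _ 2)// ?nnegrE ?addr_ge0 ?nrm_ge0// nrm_sq_ip//.
have := mulr_ge0 (nrm_ge0 B w.1) (nrm_ge0 B w.2).
by rewrite sqrrD -addrA lerD2l lerDr => h; rewrite mulrn_wge0.
Qed.

Lemma ip_complete_sq : ip_complete E B -> ip_complete sq_set sq_ip.
Proof.
move=> cE w_ Ew cau.
have [|u Eu cu] := cE (fun k => (w_ k).1) (fun k => (Ew k).1).
  move=> e /cau[N HN]; exists N => i j Ni Nj.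
  exact: le_lt_trans (nrm_fst_le (ipB h2 (Ew i) (Ew j))) (HN i j Ni Nj).
have [|v Ev cv] := cE (fun k => (w_ k).2) (fun k => (Ew k).2).
  move=> e /cau[N HN]; exists N => i j Ni Nj.
  exact: le_lt_trans (nrm_snd_le (ipB h2 (Ew i) (Ew j))) (HN i j Ni Nj).
have Ex : sq_set (u, v) by [].
exists (u, v) => //; have c : (nrm B ((w_ k).1 - u) + nrm B ((w_ k).2 - v)) @[k --> \oo] --> (0 : R).
  by rewrite -[X in _ --> X](addr0 (0 : R)); exact: (cvgD cu cv).
apply: (squeeze_cvgr _ (cvg_cst 0) c); near=> k.
by rewrite nrm_ge0 /=; exact: nrm_sq_le (ipB h2 (Ew k) Ex).
Unshelve. all: by end_near. Qed.

Lemma ip0r (x : V) : E x -> B x 0 = 0.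
Proof. by move=> Ex; rewrite (ipC hB)//; [exact: (ip0l hB)|exact: (ip0 hB)]. Qed.

Lemma weak_cvg_fst (w_ : nat -> V * V) w : (forall k, sq_set (w_ k)) -> weak_cvg sq_set sq_ip w_ w ->
  weak_cvg E B (fun k => (w_ k).1) w.1.
Proof.
move=> Ew [[E1 E2] H]; split => // z Ez.
have Ez0 : sq_set (z, 0) by split => //; exact: (ip0 hB).
have := H _ Ez0; rewrite /sq_ip /= (ip0r E2) addr0; apply: cvg_trans.
by apply: near_eq_cvg; apply: nearW => k; rewrite (ip0r (Ew k).2) addr0.
Qed.

Lemma weak_cvg_snd (w_ : nat -> V * V) w : (forall k, sq_set (w_ k)) -> weak_cvg sq_set sq_ip w_ w ->
  weak_cvg E B (fun k => (w_ k).2) w.2.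
Proof.
move=> Ew [[E1 E2] H]; split => // z Ez.
have Ez0 : sq_set (0, z) by split => //; exact: (ip0 hB).
have := H _ Ez0; rewrite /sq_ip /= (ip0r E1) add0r; apply: cvg_trans.
by apply: near_eq_cvg; apply: nearW => k; rewrite (ip0r (Ew k).1) add0r.
Qed.

Lemma weak_compact_sq : weak_compact E B -> weak_compact sq_set sq_ip.
Proof.
move=> wc w_ Ew [M HM].
have [|s [u [hs wu]]] := wc (fun k => (w_ k).1) (fun k => (Ew k).1).
  by exists M => k; exact: le_trans (nrm_fst_le (Ew k)) (HM k).
have [|t [v [ht wv]]] := wc (fun k => (w_ (s k)).2) (fun k => (Ew (s k)).2).
  by exists M => k; exact: le_trans (nrm_snd_le (Ew (s k))) (HM (s k)).
have {}wu := weak_cvg_subseq ht wu.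
exists (s \o t), (u, v); split; first exact: subsequence_comp.
have [Eu Hu] := wu; have [Ev Hv] := wv; split => // z [z1 z2].
exact: (cvgD (Hu _ z1) (Hv _ z2)).
Qed.

End square.

(** * Nemytskii operators *)

Section growth_class.
Context {d : measure_display} {T : measurableType d} {R : realType} (mu : {measure set T -> \bar R}) (D : set T).
Hypothesis mD : measurable D.
Implicit Types (H : T -> R -> R -> R) (u v : T -> R).

(** Rounding u and v down to the grid of mesh 1 / (k + 1) makes the composition measurable, as there
    are countably many pairs of values; continuity of g in its last two variables gives the limit in
    k. *)
Lemma caratheodory_comp_measurable (g : T -> R -> R -> R) u v :
  (forall s t, measurable_fun D (fun x => g x s t)) ->
  (forall x, D x -> continuous (fun z : R * R => g x z.1 z.2)) ->
  measurable_fun D u -> measurable_fun D v -> measurable_fun D (fun x => g x (u x) (v x)).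
Proof.
move=> mg cg mu' mv.
pose grid (k : nat) (t : R) : int := Num.floor (t * k.+1%:R).
pose val (k : nat) (i : int) : R := i%:~R / k.+1%:R.
have mgrid k (w : T -> R) (i : int) : measurable_fun D w -> measurable (D `&` [set x | grid k (w x) = i]).
  move=> mw; have -> : D `&` [set x | grid k (w x) = i] =
      D `&` w @^-1` `[val k i, val k (i + 1)[%classic.
    apply/seteqP; split=> x [Dx /= h]; split=> //.
      have := floor_itv (w x * k.+1%:R); rewrite -/(grid k (w x)) h in_itv/= => /andP[h1 h2].
      by rewrite /val ler_pdivrMr ?ltr0n// ltr_pdivlMr ?ltr0n// h1.
    move: h; rewrite in_itv/= /val ler_pdivrMr ?ltr0n// ltr_pdivlMr ?ltr0n// => h.
    exact: floor_def.
  by apply: mw => //; exact: measurable_itv.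
pose g_ k x := g x (val k (grid k (u x))) (val k (grid k (v x))).
have mg_ k : measurable_fun D (g_ k).
  move=> _ B mB; pose A (z : int * int) := (D `&` [set x | grid k (u x) = z.1]) `&`
    (D `&` [set x | grid k (v x) = z.2]) `&` (D `&` (fun x => g x (val k z.1) (val k z.2)) @^-1` B).
  have -> : D `&` g_ k @^-1` B = \bigcup_z A z.
    apply/seteqP; split=> x.
      by move=> [Dx Bx]; exists (grid k (u x), grid k (v x)).
    by move=> [[i j] _ [[[Dx /= <-] [_ /= <-]] [_ h]]].
  have mA z : measurable (A z).
    by apply: measurableI; [apply: measurableI; exact: mgrid|exact: mg].
  have -> : \bigcup_z A z = \bigcup_j (if unpickle j is Some z then A z else set0).
    apply/seteqP; split=> x [z _ h]; first by exists (pickle z); [exact: Logic.I|rewrite pickleK; exact: h].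
    by move: h; case: unpickle => // z' h; exists z'.
  by apply: bigcup_measurable => j _; case: unpickle.
apply: (measurable_fun_cvg mg_) => x Dx.
have cval (t : R) : val k (grid k t) @[k --> \oo] --> t.
  apply/cvgrPdist_le => e e0; have [N _ HN] := near_infty_natSinv_lt (PosNum e0).
  exists N => // k /HN /= hk; have := floor_itv (t * k.+1%:R); rewrite -/(grid k t) => /andP[h1 h2].
  have k0 : 0 < k.+1%:R :> R by rewrite ltr0n.
  have h3 : val k (grid k t) <= t by rewrite /val ler_pdivrMr.
  have h4 : t - val k (grid k t) <= k.+1%:R^-1.
    rewrite lerBlDr -div1r /val -mulrDl ler_pdivlMr// addrC.
    by move: h2; rewrite intrD => /ltW.
  by rewrite ger0_norm ?subr_ge0//; apply: le_trans h4 (ltW hk).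
exact: (cvg_comp _ _ (cvg_pair (cval (u x)) (cval (v x))) (cg x Dx (u x, v x))).
Qed.

Lemma integ_cst (c : R) : (mu D < +oo)%E -> integ mu D (fun=> c).
Proof.
move=> fD; apply: (integ_ext mD (f := fun x => c * 1)); first by move=> x _; rewrite mulr1.
apply: (integZ mD); apply: ge0_integ => //.
by rewrite integral_cst// mul1e.
Qed.

(* Dominated convergence handles [A_ k <= t]; where [A_ k > t] the bound [A_ k ^ m] is
   at most [t ^ (m - r)] times [A_ k ^ r]. *)
Lemma vitali (g_ A_ : nat -> T -> R) (C m r K : R) : 0 < m -> m < r -> 0 <= C -> (mu D < +oo)%E ->
  (forall k, measurable_fun D (g_ k)) ->
  (forall k x, D x -> 1 <= A_ k x) -> (forall k x, D x -> `|g_ k x| <= C * A_ k x `^ m) ->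
  (forall k, integ mu D (fun x => A_ k x `^ r)) ->
  (forall k, \int[mu]_(x in D) A_ k x `^ r <= K) ->
  {ae mu, forall x, D x -> g_ k x @[k --> \oo] --> 0} ->
  \int[mu]_(x in D) `|g_ k x| @[k --> \oo] --> (0 : R).
Proof.
move=> m0 mr C0 fD mg A1 gA iA AK g0.
have K0 : 0 <= K by apply: le_trans (AK 0%N); apply: Rint_ge0 => x _; exact: powR_ge0.
apply/cvgr0Pnorm_le => e e0.
have rm : 0 < r - m by lra.
pose CK := C * K + 1; have CK0 : 0 < CK by rewrite /CK ltr_wpDl// mulr_ge0.
(* With eps = e / (2 CK), any A >= t satisfies 1 <= eps A^(r - m), so the part above t contributes
   at most eps C K <= e / 2. *)
pose t := Num.max 1 ((2 * CK / e) `^ (r - m)^-1).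
have t1 : 1 <= t by rewrite /t le_max lexx.
have t0 : 0 < t by lra.
have tb : 2 * CK / e <= t `^ (r - m).
  have q0 : 0 <= 2 * CK / e by rewrite divr_ge0 ?mulr_ge0// ltW.
  apply: (@le_trans _ _ (((2 * CK / e) `^ (r - m)^-1) `^ (r - m))).
    by rewrite -powRrM mulVf ?powRr1// lt0r_neq0.
  apply: (ge0_ler_powR (ltW rm)); rewrite ?nnegrE ?powR_ge0 ?(ltW t0)//.
  by rewrite /t le_max lexx orbT.
pose P := C * t `^ m.
have P0 : 0 <= P by rewrite mulr_ge0 ?powR_ge0.
pose f_ k x := Num.min `|g_ k x| P.
have mf_ k : measurable_fun D (f_ k).
  by apply: measurable_minr; [apply: measurableT_comp => //; exact: mg|exact: measurable_cst].
have iP : integ mu D (fun=> P) by exact: integ_cst.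
have fP k x : `|f_ k x| <= P.
  by rewrite ger0_norm ?le_min ?normr_ge0//= ge_min lexx orbT.
have [_ cf] : integ mu D (fun=> 0) /\ \int[mu]_(x in D) f_ k x @[k --> \oo] --> \int[mu]_(x in D) (0 : R).
  apply: (dct mD (g := fun=> P)) => //.
  - apply: filterS g0 => x H Dx; apply/cvgr0Pnorm_le => e' e'0.
    have /cvgr0Pnorm_le/(_ _ e'0) := H Dx; apply: filterS => k h.
    by rewrite ger0_norm ?le_min ?normr_ge0//= ge_min h.
  - by apply: aeW => x k _; exact: fP.
rewrite Rintegral_cst// mul0r in cf.
have if_ k : integ mu D (f_ k) by apply: (integ_le mD (mf_ k)) iP => x _; exact: fP.
have e2 : 0 < e / 2 by rewrite divr_gt0.
pose eps : R := e / (2 * CK).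
have eps0 : 0 < eps by rewrite divr_gt0// mulr_gt0.
have split_bd k x : D x -> `|g_ k x| <= f_ k x + eps * C * A_ k x `^ r.
  move=> Dx; have A1x := A1 k x Dx; have gAx := gA k x Dx.
  have A0 : 0 < A_ k x by lra.
  have pr0 : 0 <= eps * C * A_ k x `^ r by rewrite mulr_ge0 ?powR_ge0// mulr_ge0// ltW.
  have [At|tA] := leP (A_ k x) t.
    have gP : `|g_ k x| <= P.
      apply: le_trans gAx _; apply: ler_wpM2l => //.
      by apply: (ge0_ler_powR (ltW m0)); rewrite ?nnegrE ?(ltW A0) ?(ltW t0).
    by rewrite /f_ (min_idPl gP) lerDl.
  have f0 : 0 <= f_ k x by rewrite le_min normr_ge0.
  apply: (@le_trans _ _ (eps * C * A_ k x `^ r)); last by rewrite lerDr.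
  apply: le_trans gAx _; rewrite [eps * C]mulrC -mulrA; apply: ler_wpM2l => //.
  have -> : A_ k x `^ r = A_ k x `^ m * A_ k x `^ (r - m).
    rewrite -powRD; last by apply/implyP => _; exact: lt0r_neq0.
    by congr (_ `^ _); lra.
  have h1 : 1 <= eps * A_ k x `^ (r - m).
    have : 2 * CK / e <= A_ k x `^ (r - m).
      apply: le_trans tb _; apply: (ge0_ler_powR (ltW rm)); rewrite ?nnegrE ?(ltW A0) ?(ltW t0)//.
      exact: ltW.
    move=> /(ler_wpM2l (ltW eps0)); apply: le_trans.
    have CK20 : 2 * CK != 0 by rewrite lt0r_neq0// mulr_gt0.
    by rewrite /eps mulrA (divfK CK20) mulfV// lt0r_neq0.
  by rewrite mulrCA ler_peMr// powR_ge0.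
have ig k : integ mu D (fun x => `|g_ k x|).
  apply: (integ_le mD) (integZ mD C (iA k)).
    by apply: measurableT_comp => //; exact: mg.
  move=> x Dx; rewrite normr_id; apply: le_trans (gA k x Dx) _; apply: ler_wpM2l => //.
  by apply: ler_powR; [exact: A1|exact: ltW].
have /cvgr0Pnorm_le/(_ _ e2) := cf; apply: filterS => k.
rewrite ger0_norm; last by apply: Rint_ge0 => x _; rewrite le_min normr_ge0.
move=> hk; rewrite ger0_norm; last by apply: Rint_ge0 => x _; exact: normr_ge0.
have iZ := integZ mD (eps * C) (iA k).
apply: (@le_trans _ _ (\int[mu]_(x in D) (f_ k x + eps * C * A_ k x `^ r))).
  apply: (Rint_le mD) => //; last by move=> x Dx; exact: split_bd.
  exact: (integD mD (if_ k) iZ).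
have e1 := RintegralD mD (if_ k) iZ; have e3 := RintegralZl (eps * C) mD (iA k).
rewrite e1 e3 [leRHS](splitr e); apply: lerD => //.
apply: (@le_trans _ _ (eps * CK)).
  rewrite -mulrA; apply: ler_wpM2l; first exact: ltW.
  apply: (@le_trans _ _ (C * K)); last by rewrite /CK lerDl.
  exact: ler_wpM2l.
by rewrite /eps invfM -!mulrA mulVf ?mulr1// lt0r_neq0.
Qed.

End growth_class.

Lemma mean_value1 {R : realType} (f : R -> R) (s h : R) : (forall s, derivable f s 1) ->
  exists2 xi, `|xi - s| <= `|h| & f (s + h) - f s = derive1 f xi * h.
Proof.
move=> df; have isd x : is_derive x (1 : R) f (derive1 f x).
  by rewrite derive1E; apply/derivableP; exact: df.
have cf (a b : R) : {within `[a, b], continuous f}.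
  by apply: derivable_within_continuous => x _; exact: df.
have [h0|h0] := leP 0 h.
  have sh : s <= s + h by rewrite lerDl.
  have [c] := MVT_segment sh (fun x _ => isd x) (cf _ _).
  rewrite in_itv/= => /andP[h1 h2] e; exists c.
    by rewrite (ger0_norm h0) ger0_norm; lra.
  by rewrite e; congr (_ * _); lra.
have sh : s + h <= s by lra.
have [c] := MVT_segment sh (fun x _ => isd x) (cf _ _).
rewrite in_itv/= => /andP[h1 h2] e; exists c.
  by rewrite (ltr0_norm h0) ler0_norm; lra.
by rewrite -opprB e; lra.
Qed.

Section nice_functions.
Context {R : realType} {n : nat} (Omega : set 'rV[R]_n).
Hypothesis mO : measurable Omega.
Implicit Types (H F : 'rV[R]_n -> R -> R -> R) (x : 'rV[R]_n) (s t h l p C : R).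

(** The form in which class A is used: pointwise bounds with one constant, valid at every point of
    Omega. The bound at the origin gives H itself, and not only its derivatives, growth of order p +
    1. *)
Record nice p C H : Prop := Nice {
  nice_meas : forall s t, measurable_fun Omega (fun x => H x s t);
  nice_C1 : forall x, Omega x -> C1 (H x);
  nice_growth : forall x s t, Omega x ->
    `|D_u H x s t| + `|D_v H x s t| <= C * (1 + `|s| + `|t|) `^ p;
  nice_zero : forall x, Omega x -> `|H x 0 0| <= C }.

Section pointwise.
Variables (H : 'rV[R]_n -> R -> R -> R) (p C : R).
Hypotheses (p0 : 0 < p) (C0 : 0 <= C) (nH : nice p C H).

Lemma nice_diff x s t h l : Omega x -> exists xi eta, [/\ `|xi - s| <= `|h|, `|eta - t| <= `|l| &
  H x (s + h) (t + l) - H x s t = D_u H x xi (t + l) * h + D_v H x s eta * l].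
Proof.
move=> Ox; have [dH _ _] := nice_C1 nH Ox.
have [xi h1 e1] := mean_value1 s h (fun s => (dH s (t + l)).1).
have [eta h2 e2] := mean_value1 t l (fun t => (dH s t).2).
exists xi, eta; split=> //; rewrite /D_u /D_v -e1 -e2.
by rewrite addrA subrK.
Qed.

Lemma amp_ge0 s t : 0 <= 1 + `|s| + `|t|.
Proof. by rewrite addr_ge0// addr_ge0. Qed.

Lemma nice_bound x s t h l : Omega x ->
  `|H x (s + h) (t + l) - H x s t| <= C * (1 + `|s| + `|t| + `|h| + `|l|) `^ p * (`|h| + `|l|).
Proof.
move=> Ox; have [xi [eta [h1 h2 ->]]] := nice_diff s t h l Ox.
have A0 : 0 <= 1 + `|s| + `|t| + `|h| + `|l| by rewrite !addr_ge0.
have bd (a b : R) : `|a| <= `|s| + `|h| -> `|b| <= `|t| + `|l| ->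
    (1 + `|a| + `|b|) `^ p <= (1 + `|s| + `|t| + `|h| + `|l|) `^ p.
  move=> ha hb; apply: (ge0_ler_powR (ltW p0)); rewrite ?nnegrE ?amp_ge0//.
  by move: ha hb; move: `|a| `|b| `|s| `|t| `|h| `|l| => *; lra.
have ha : `|xi| <= `|s| + `|h|.
  by have := ler_normD (xi - s) s; rewrite subrK; lra.
have hb : `|eta| <= `|t| + `|l|.
  by have := ler_normD (eta - t) t; rewrite subrK; lra.
have hs : `|s| <= `|s| + `|h| by rewrite lerDl.
have ht : `|t + l| <= `|t| + `|l| by exact: ler_normD.
have g1 := nice_growth nH xi (t + l) Ox; have g2 := nice_growth nH s eta Ox.
have b1 := ler_wpM2l C0 (bd _ _ ha ht); have b2 := ler_wpM2l C0 (bd _ _ hs hb).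
have k1 : `|D_u H x xi (t + l)| <= C * (1 + `|s| + `|t| + `|h| + `|l|) `^ p.
  by apply: le_trans b1; apply: le_trans g1; rewrite lerDl.
have k2 : `|D_v H x s eta| <= C * (1 + `|s| + `|t| + `|h| + `|l|) `^ p.
  by apply: le_trans b2; apply: le_trans g2; rewrite lerDr.
apply: le_trans (ler_normD _ _) _; rewrite !normrM mulrDr.
by apply: lerD; apply: ler_wpM2r.
Qed.

Lemma nice_le x s t : Omega x -> `|H x s t| <= 2 * C * (1 + `|s| + `|t|) `^ (p + 1).
Proof.
move=> Ox; have := nice_bound 0 0 s t Ox; rewrite !add0r normr0 !addr0 => hb.
have A1 : 1 <= 1 + `|s| + `|t| by have := normr_ge0 s; have := normr_ge0 t; lra.
have A0 : 0 < 1 + `|s| + `|t| by lra.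
have e : (1 + `|s| + `|t|) `^ (p + 1) = (1 + `|s| + `|t|) `^ p * (1 + `|s| + `|t|).
  rewrite powRD; last by apply/implyP => _; exact: lt0r_neq0.
  by rewrite powRr1// ltW.
have P1 : 1 <= (1 + `|s| + `|t|) `^ (p + 1).
  have p1 : 0 <= p + 1 := addr_ge0 (ltW p0) ler01.
  by have := ler_powR A1 p1; rewrite powRr0.
have h1 : C * (1 + `|s| + `|t|) `^ p * (`|s| + `|t|) <= C * (1 + `|s| + `|t|) `^ (p + 1).
  rewrite e mulrA; apply: ler_wpM2l; first by rewrite mulr_ge0 ?powR_ge0.
  by lra.
have h2 : C <= C * (1 + `|s| + `|t|) `^ (p + 1) by rewrite ler_peMr.
have := ler_normD (H x s t - H x 0 0) (H x 0 0); rewrite subrK.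
have := nice_zero nH Ox; rewrite -mulrA; move: hb h1 h2; move: (C * _ `^ (p + 1)) (C * _ * _) (`|_ - _|) => a b c.
by move=> *; lra.
Qed.

Lemma nice_cvg x (s_ t_ : nat -> R) s t : Omega x -> s_ @ \oo --> s -> t_ @ \oo --> t ->
  H x (s_ k) (t_ k) @[k --> \oo] --> H x s t.
Proof.
move=> Ox cs ct.
have ch : `|s_ k - s| + `|t_ k - t| @[k --> \oo] --> (0 : R).
  have c1 : `|s_ k - s| @[k --> \oo] --> (0 : R).
    rewrite -(normr0 R) -(subrr s); apply: cvg_norm; apply: cvgB cs (cvg_cst s).
  have c2 : `|t_ k - t| @[k --> \oo] --> (0 : R).
    rewrite -(normr0 R) -(subrr t); apply: cvg_norm; apply: cvgB ct (cvg_cst t).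
  by rewrite -[X in _ --> X](addr0 (0 : R)); exact: (cvgD c1 c2).
pose P := C * (1 + `|s| + `|t| + 1) `^ p.
have P0 : 0 <= P by rewrite mulr_ge0 ?powR_ge0.
have cP : P * (`|s_ k - s| + `|t_ k - t|) @[k --> \oo] --> (0 : R).
  by rewrite -(mulr0 P); apply: cvgM ch; exact: cvg_cst.
have small : \forall k \near \oo, `|s_ k - s| + `|t_ k - t| <= 1.
  have /cvgr0_norm_le/(_ _ ltr01) := ch; apply: filterS => k.
  by rewrite ger0_norm// addr_ge0.
apply/cvgrPdist_le => e e0; have /cvgr0_norm_le/(_ _ e0) := cP.
apply: filterS2 small => k hk; rewrite ger0_norm ?mulr_ge0 ?addr_ge0// => hP.
rewrite distrC; apply: le_trans hP.
have hb := nice_bound s t (s_ k - s) (t_ k - t) Ox; rewrite !subrKC in hb.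
apply: le_trans hb _.
apply: ler_wpM2r; first by rewrite addr_ge0.
apply: ler_wpM2l => //; apply: (ge0_ler_powR (ltW p0)); rewrite ?nnegrE.
- by rewrite !addr_ge0.
- by rewrite !addr_ge0.
- by rewrite -addrA lerD2l.
Qed.

Lemma nice_continuous x : Omega x -> continuous (fun z : R * R => H x z.1 z.2).
Proof.
move=> Ox z; apply/cvgrPdist_le => e e0; apply: contrapT => nz.
have far k : exists w : R * R, `|w.1 - z.1| <= k.+1%:R^-1 /\ `|w.2 - z.2| <= k.+1%:R^-1 /\
    ~ `|H x z.1 z.2 - H x w.1 w.2| <= e.
  apply: contrapT => /forallNP h; apply: nz.
  have k0 : 0 < k.+1%:R^-1 :> R by rewrite invr_gt0.
  exists (ball z.1 k.+1%:R^-1, ball z.2 k.+1%:R^-1).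
    by split; exact: nbhsx_ballx.
  move=> w [/= b1 b2]; apply: contrapT => nw; apply: (h w); split; last split => //.
    by rewrite distrC ltW.
  by rewrite distrC ltW.
have [w Hw] := choice far.
have cw (f : R * R -> R) : (forall k, `|f (w k) - f z| <= k.+1%:R^-1) -> f (w k) @[k --> \oo] --> f z.
  move=> hf; apply/cvgrPdist_le => d d0; have [N _ HN] := near_infty_natSinv_lt (PosNum d0).
  by exists N => // k /HN /= hk; rewrite distrC; exact: le_trans (hf k) (ltW hk).
have c1 := cw fst (fun k => (Hw k).1); have c2 := cw snd (fun k => (Hw k).2.1).
have /cvgrPdist_le/(_ _ e0)[N _ /(_ N (leqnn N))] := nice_cvg Ox c1 c2.
exact: (Hw N).2.2.
Qed.

Lemma D_u_continuous x : Omega x -> continuous (fun z : R * R => D_u H x z.1 z.2).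
Proof. by move=> Ox; have [_ ? _] := nice_C1 nH Ox. Qed.

Lemma D_v_continuous x : Omega x -> continuous (fun z : R * R => D_v H x z.1 z.2).
Proof. by move=> Ox; have [_ _ ?] := nice_C1 nH Ox. Qed.

Lemma cont2_cvg (g : R -> R -> R) (s_ t_ : nat -> R) s t : continuous (fun z : R * R => g z.1 z.2) ->
  s_ @ \oo --> s -> t_ @ \oo --> t -> g (s_ k) (t_ k) @[k --> \oo] --> g s t.
Proof. by move=> cg cs ct; exact: (cvg_comp _ _ (cvg_pair cs ct) (cg (s, t))). Qed.

Lemma near_seq (s_ xi_ d_ : nat -> R) s : (forall k, `|xi_ k - s_ k| <= `|d_ k|) -> s_ @ \oo --> s ->
  d_ @ \oo --> (0 : R) -> xi_ @ \oo --> s.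
Proof.
move=> hx cs cd; have c0 : (xi_ k - s_ k) @[k --> \oo] --> (0 : R).
  apply/cvgr0Pnorm_le => e e0; have /cvgr0_norm_le/(_ _ e0) := cd.
  by apply: filterS => k; exact: le_trans.
have -> : xi_ = (fun k => xi_ k - s_ k + s_ k) by apply/funext => k; rewrite subrK.
by rewrite -[X in _ --> X](add0r s); exact: (cvgD c0 cs).
Qed.

Lemma inv_seq_cvg0 : k.+1%:R^-1 @[k --> \oo] --> (0 : R).
Proof.
apply/cvgr0Pnorm_le => e e0; have [N _ HN] := near_infty_natSinv_lt (PosNum e0).
by exists N => // k /HN /= hk; rewrite ger0_norm ?invr_ge0//; exact: ltW.
Qed.

Lemma D_u_meas s t : measurable_fun Omega (fun x => D_u H x s t).
Proof.
pose q k x := (H x (s + k.+1%:R^-1) t - H x s t) * k.+1%:R.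
apply: (measurable_fun_cvg (h := q)).
  move=> k; apply: measurable_funM; last exact: measurable_cst.
  by apply: measurable_funB; exact: (nice_meas nH).
move=> x Ox; have [dH _ _] := nice_C1 nH Ox.
have hx k : exists xi, `|xi - s| <= `|k.+1%:R^-1 : R| /\ q k x = D_u H x xi t.
  have [xi h1 h2] := mean_value1 s k.+1%:R^-1 (fun s => (dH s t).1).
  by exists xi; split => //; rewrite /q h2 -mulrA mulVf ?mulr1.
have [xi Hxi] := choice hx.
have -> : (fun k => q k x) = (fun k => D_u H x (xi k) t) by apply/funext => k; case: (Hxi k).
apply: (cont2_cvg (D_u_continuous Ox)) (cvg_cst t).
by apply: (near_seq (fun k => (Hxi k).1) (cvg_cst s)); exact: inv_seq_cvg0.
Qed.

Lemma D_v_meas s t : measurable_fun Omega (fun x => D_v H x s t).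
Proof.
pose q k x := (H x s (t + k.+1%:R^-1) - H x s t) * k.+1%:R.
apply: (measurable_fun_cvg (h := q)).
  move=> k; apply: measurable_funM; last exact: measurable_cst.
  by apply: measurable_funB; exact: (nice_meas nH).
move=> x Ox; have [dH _ _] := nice_C1 nH Ox.
have hx k : exists xi, `|xi - t| <= `|k.+1%:R^-1 : R| /\ q k x = D_v H x s xi.
  have [xi h1 h2] := mean_value1 t k.+1%:R^-1 (fun t => (dH s t).2).
  by exists xi; split => //; rewrite /q h2 -mulrA mulVf ?mulr1.
have [xi Hxi] := choice hx.
have -> : (fun k => q k x) = (fun k => D_v H x s (xi k)) by apply/funext => k; case: (Hxi k).
apply: (cont2_cvg (D_v_continuous Ox) (cvg_cst s)).
by apply: (near_seq (fun k => (Hxi k).1) (cvg_cst t)); exact: inv_seq_cvg0.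
Qed.

Lemma nice_meas_comp (u v : 'rV[R]_n -> R) : measurable_fun Omega u -> measurable_fun Omega v ->
  [/\ measurable_fun Omega (fun x => H x (u x) (v x)),
      measurable_fun Omega (fun x => D_u H x (u x) (v x)) &
      measurable_fun Omega (fun x => D_v H x (u x) (v x))].
Proof.
move=> mu mv; split.
- exact: (caratheodory_comp_measurable mO (nice_meas nH) nice_continuous mu mv).
- exact: (caratheodory_comp_measurable mO D_u_meas D_u_continuous mu mv).
- exact: (caratheodory_comp_measurable mO D_v_meas D_v_continuous mu mv).
Qed.

(** Differentiability along varying base points and directions: the increment is written with
    derivatives at intermediate points, whose differences from the derivatives at the base point
    tend to 0 by continuity. *)
Lemma frechet_quotient x (s_ t_ c_ a_ b_ : nat -> R) s t (a b : R) : Omega x ->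
  s_ @ \oo --> s -> t_ @ \oo --> t -> a_ @ \oo --> a -> b_ @ \oo --> b -> c_ @ \oo --> (0 : R) ->
  (forall k, 0 < c_ k) ->
  (H x (s_ k + c_ k * a_ k) (t_ k + c_ k * b_ k) - H x (s_ k) (t_ k) -
   (D_u H x (s_ k) (t_ k) * (c_ k * a_ k) + D_v H x (s_ k) (t_ k) * (c_ k * b_ k))) / c_ k
   @[k --> \oo] --> (0 : R).
Proof.
move=> Ox cs ct ca cb cc c0.
have ha : c_ k * a_ k @[k --> \oo] --> (0 : R) by rewrite -(mul0r a); exact: cvgM.
have hb : c_ k * b_ k @[k --> \oo] --> (0 : R) by rewrite -(mul0r b); exact: cvgM.
have HX k : exists z : R * R, [/\ `|z.1 - s_ k| <= `|c_ k * a_ k|, `|z.2 - t_ k| <= `|c_ k * b_ k| &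
    H x (s_ k + c_ k * a_ k) (t_ k + c_ k * b_ k) - H x (s_ k) (t_ k) =
    D_u H x z.1 (t_ k + c_ k * b_ k) * (c_ k * a_ k) + D_v H x (s_ k) z.2 * (c_ k * b_ k)].
  by have [xi [eta [h1 h2 h3]]] := nice_diff (s_ k) (t_ k) (c_ k * a_ k) (c_ k * b_ k) Ox; exists (xi, eta).
have [z Hz] := choice HX.
have cx : (z k).1 @[k --> \oo] --> s by apply: near_seq cs ha => k; case: (Hz k).
have ce : (z k).2 @[k --> \oo] --> t by apply: near_seq ct hb => k; case: (Hz k).
have ct' : (t_ k + c_ k * b_ k) @[k --> \oo] --> t by rewrite -(addr0 t); exact: cvgD.
have c1 := cont2_cvg (D_u_continuous Ox) cx ct'; have c2 := cont2_cvg (D_u_continuous Ox) cs ct.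
have c3 := cont2_cvg (D_v_continuous Ox) cs ce; have c4 := cont2_cvg (D_v_continuous Ox) cs ct.
have c5 := cvgD (cvgM (cvgB c1 c2) ca) (cvgM (cvgB c3 c4) cb).
have z0 : (D_u H x s t - D_u H x s t) * a + (D_v H x s t - D_v H x s t) * b = 0.
  by rewrite !subrr !mul0r addr0.
rewrite -[X in _ --> X]z0.
suff -> : (fun k => (H x (s_ k + c_ k * a_ k) (t_ k + c_ k * b_ k) - H x (s_ k) (t_ k) -
    (D_u H x (s_ k) (t_ k) * (c_ k * a_ k) + D_v H x (s_ k) (t_ k) * (c_ k * b_ k))) / c_ k) =
  (fun k => (D_u H x (z k).1 (t_ k + c_ k * b_ k) - D_u H x (s_ k) (t_ k)) * a_ k +
     (D_v H x (s_ k) (z k).2 - D_v H x (s_ k) (t_ k)) * b_ k) by exact: c5.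
apply/funext => k.
have [_ _ ->] := Hz k; have ck := lt0r_neq0 (c0 k).
move: (D_u H x _ (t_ k + _)) (D_u H x _ (t_ k)) (D_v H x _ (z k).2) (D_v H x _ (t_ k)) => d1 d2 d3 d4.
have -> : d1 * (c_ k * a_ k) + d3 * (c_ k * b_ k) - (d2 * (c_ k * a_ k) + d4 * (c_ k * b_ k)) =
  ((d1 - d2) * a_ k + (d3 - d4) * b_ k) * c_ k by lra.
by rewrite mulfK.
Qed.

End pointwise.
End nice_functions.

Lemma cvg_subsubseq {R : realType} (g : nat -> R) (l : R) :
  (forall s, subsequence s -> exists t, subsequence t /\ g (s (t k)) @[k --> \oo] --> l) ->
  g @ \oo --> l.
Proof.
move=> H; apply/cvgrPdist_le => e e0; apply: contrapT => /not_eventually ne.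
have [s [hs Hs]] := exists_subsequence (P := fun k i => ~ `|l - g i| <= e) (fun k => ne).
have [t [_ /cvgrPdist_le/(_ _ e0)[N _ /(_ N (leqnn N))]]] := H s hs.
exact: (Hs (t N)).
Qed.

Lemma powR_sum3 {R : realType} (a b c r : R) : 0 <= a -> 0 <= b -> 0 <= c -> 0 <= r ->
  (a + b + c) `^ r <= 3 `^ r * (a `^ r + b `^ r + c `^ r).
Proof.
move=> a0 b0 c0 r0.
have pa := powR_ge0 a r; have pb := powR_ge0 b r; have pc := powR_ge0 c r.
pose m := Num.max a (Num.max b c).
have ma : a <= m by rewrite /m le_max lexx.
have mb : b <= m by rewrite /m !le_max lexx orbT.
have mc : c <= m by rewrite /m !le_max lexx !orbT.
have m0 : 0 <= m by exact: le_trans ma.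
apply: (@le_trans _ _ ((3 * m) `^ r)).
  by apply: (ge0_ler_powR r0); rewrite ?nnegrE ?mulr_ge0 ?addr_ge0//; lra.
rewrite powRM//; apply: ler_wpM2l; first exact: powR_ge0.
have [->|[->|->]] : m = a \/ (m = b \/ m = c).
  rewrite /m; case: (leP a (Num.max b c)) => _; last by left.
  by case: (leP b c) => _; [right; right|right; left].
- by rewrite -addrA lerDl addr_ge0.
- by rewrite addrAC lerDr addr_ge0.
- by rewrite lerDr addr_ge0.
Qed.

Lemma powR_dominate {R : realType} (C p A S y : R) : 0 < p -> 0 <= C -> 0 <= A -> A <= S -> 0 <= y -> y <= S ->
  0 < S -> C * A `^ p * y <= C * S `^ (p + 1).
Proof.
move=> p0 C0 A0 AS y0 yS S0; rewrite -mulrA; apply: ler_wpM2l => //.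
rewrite powRD; last by apply/implyP => _; exact: lt0r_neq0.
rewrite (powRr1 (ltW S0)); apply: ler_pM => //; first exact: powR_ge0.
by apply: (ge0_ler_powR (ltW p0)); rewrite ?nnegrE// ltW.
Qed.

(** * The energy space and domination by powers of its elements *)

Section energy_space.
Context {R : realType} {n : nat} (Omega : set 'rV[R]_n).
Local Notation leb := (lebesgue_rV R n).
Local Notation vol' := (@vol R n).
Local Notation V := ('rV[R]_n -> R^o).
Local Notation Dir := (dirichlet Omega).
Local Notation H10 := (H10 Omega).
Local Notation E2 := (sq_set (H10 : set V)).
Local Notation B2 := (sq_ip Dir).
Local Notation I f := (\int[leb]_(x in Omega) f x).
Implicit Types (w z h : V * V) (x : 'rV[R]_n).
Hypotheses (oO : open Omega) (bO : bounded_set Omega).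
Let mO : measurable Omega := measurable_Omega oO.
Let fO : (leb Omega < +oo)%E := lebesgue_bounded_lty bO.
Let h0 := semi_ip_H10 oO bO.
Let hS := semi_ip_dot leb mO.
Variables (i0 : 'I_n) (a0 : 'rV[R]_n) (s0 : R).
Hypotheses (s00 : 0 < s0) (OQ : Omega `<=` cube a0 s0).
Hypothesis vol_gt0 : forall s : R, 0 < s -> 0 < vol' s.
Variables (r Cs : R).
Hypothesis r2 : 2 < r.
Hypothesis sob : forall (u : V) (M : R), H10 u -> 0 < M -> nrm Dir u <= M ->
    integ leb Omega (fun x => `|u x| `^ r) /\ \int[leb]_(x in Omega) `|u x| `^ r <= Cs * M `^ r.

Lemma sq_compact : weak_compact E2 B2.
Proof. exact: (weak_compact_sq h0 (H10_weak_compact oO bO i0 s00 OQ vol_gt0)). Qed.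

Lemma sq_complete : ip_complete E2 B2.
Proof. exact: (ip_complete_sq h0 (H10_complete oO bO i0 s00 OQ)). Qed.

Lemma H10_sqinteg (u : V) : H10 u -> sqinteg leb Omega u.
Proof. by move=> Hu; exact: (H1_L2 oO (H10_H1 Hu)). Qed.

Lemma H10_meas (u : V) : H10 u -> measurable_fun Omega u.
Proof. by move=> /H10_sqinteg[]. Qed.

Lemma H10_weak_ae (u_ : nat -> V) u : (forall k, H10 (u_ k)) -> nbounded Dir u_ ->
  weak_cvg (H10 : set V) Dir u_ u ->
  exists s, subsequence s /\ {ae leb, forall x, Omega x -> u_ (s k) x @[k --> \oo] --> u x}.
Proof.
move=> Hu bu wu; have c := H10_weak_L2 oO bO i0 s00 OQ vol_gt0 Hu bu wu; have [Eu _] := wu.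
exact: (nrm2_cvg_ae mO (fun k => H10_sqinteg (Hu k)) (H10_sqinteg Eu) c).
Qed.

Definition ae_cvg2 (w_ : nat -> V * V) w :=
  {ae leb, forall x, Omega x -> (w_ k).1 x @[k --> \oo] --> w.1 x /\ (w_ k).2 x @[k --> \oo] --> w.2 x}.

Lemma ae_cvg2_subseq (w_ : nat -> V * V) w s : subsequence s -> ae_cvg2 w_ w -> ae_cvg2 (w_ \o s) w.
Proof.
move=> hs; apply: filterS => x h Ox; have [h1 h2] := h Ox.
by split; [exact: (cvg_subsequence hs h1)|exact: (cvg_subsequence hs h2)].
Qed.

Lemma sq_weak_ae (w_ : nat -> V * V) w : (forall k, E2 (w_ k)) -> nbounded B2 w_ ->
  weak_cvg E2 B2 w_ w -> exists s, subsequence s /\ ae_cvg2 (w_ \o s) w.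
Proof.
move=> Ew [M HM] ww.
have b1 : nbounded Dir (fun k => (w_ k).1).
  by exists M => k; exact: le_trans (nrm_fst_le h0 (Ew k)) (HM k).
have b2 : nbounded Dir (fun k => (w_ k).2).
  by exists M => k; exact: le_trans (nrm_snd_le h0 (Ew k)) (HM k).
have [s [hs cs]] := H10_weak_ae (fun k => (Ew k).1) b1 (weak_cvg_fst h0 Ew ww).
have w2 := weak_cvg_subseq hs (weak_cvg_snd h0 Ew ww).
have [t [ht ct]] := H10_weak_ae (fun k => (Ew (s k)).2) (nbounded_comp s b2) w2.
exists (s \o t); split; first exact: subsequence_comp.
apply: filterS2 cs ct => x h1 h2 Ox; split; last exact: h2.
exact: (cvg_subsequence ht (h1 Ox)).
Qed.

Lemma sq_bounded_ae (w_ : nat -> V * V) : (forall k, E2 (w_ k)) -> nbounded B2 w_ ->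
  exists s w, [/\ subsequence s, E2 w, weak_cvg E2 B2 (w_ \o s) w & ae_cvg2 (w_ \o s) w].
Proof.
move=> Ew bw; have [s [w [hs ww]]] := sq_compact Ew bw.
have [t [ht ct]] := sq_weak_ae (fun k => Ew (s k)) (nbounded_comp s bw) ww.
have [Ex _] := ww.
exists (s \o t), w; split; [exact: subsequence_comp|exact: Ex|exact: (weak_cvg_subseq ht ww)|exact: ct].
Qed.

Definition amp w x : R := 1 + `|w.1 x| + `|w.2 x|.

Lemma amp_ge1 w x : 1 <= amp w x.
Proof. by rewrite /amp -addrA lerDl addr_ge0. Qed.

Lemma amp_gt0 w x : 0 < amp w x.
Proof. exact: lt_le_trans ltr01 (amp_ge1 w x). Qed.

Lemma amp_meas w : E2 w -> measurable_fun Omega (amp w).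
Proof.
move=> [H1 H2]; apply: measurable_funD; first apply: measurable_funD.
- exact: measurable_cst.
- exact: (measurableT_comp (@normr_measurable R setT) (H10_meas H1)).
- exact: (measurableT_comp (@normr_measurable R setT) (H10_meas H2)).
Qed.

Let r0 : 0 < r. Proof. by apply: lt_trans r2. Qed.

Lemma amp_bound (M : R) : exists K, forall w, E2 w -> nrm B2 w <= M ->
  integ leb Omega (fun x => amp w x `^ r) /\ I (fun x => amp w x `^ r) <= K.
Proof.
pose M' := Num.max M 1; have M'0 : 0 < M' by rewrite lt_max ltr01 orbT.
pose K0 := I (fun=> (1 : R)).
exists (3 `^ r * (K0 + Cs * M' `^ r + Cs * M' `^ r)) => w Ew wM; have [Eu Ev] := Ew.
have wM' : nrm B2 w <= M' by rewrite le_max wM.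
have [i1 b1] := sob Eu M'0 (le_trans (nrm_fst_le h0 Ew) wM').
have [i2 b2] := sob Ev M'0 (le_trans (nrm_snd_le h0 Ew) wM').
have i00 : integ leb Omega (fun=> (1 : R)) by exact: (integ_cst mO 1 fO).
have j1 := integD mO i00 i1; have j2 := integD mO j1 i2.
have j3 := integZ mO (3 `^ r) j2.
have le1 x : amp w x `^ r <= 3 `^ r * (1 + `|w.1 x| `^ r + `|w.2 x| `^ r).
  by have := powR_sum3 ler01 (normr_ge0 (w.1 x)) (normr_ge0 (w.2 x)) (ltW r0); rewrite powR1.
have ia : integ leb Omega (fun x => amp w x `^ r).
  apply: (integ_le mO _ _ j3).
    by apply: (measurableT_comp (measurable_powR r)); exact: amp_meas.
  by move=> x _; rewrite ger0_norm ?powR_ge0.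
split => //; apply: le_trans (Rint_le mO ia j3 (fun x _ => le1 x)) _.
have e1 := RintegralZl (3 `^ r) mO j2; have e2 := RintegralD mO j1 i2; have e3 := RintegralD mO i00 i1.
rewrite e1 e2 e3; apply: ler_wpM2l; first exact: powR_ge0.
by apply: lerD => //; apply: lerD.
Qed.

(** A single dominating function for expressions that involve a point, its weak limit and a
    direction at once. *)
Definition amp3 (w1 w2 w3 : V * V) x : R := amp w1 x + amp w2 x + amp w3 x.

Lemma amp3_ge1 w1 w2 w3 x : 1 <= amp3 w1 w2 w3 x.
Proof.
rewrite /amp3 -addrA; have h := amp_ge1 w1 x; have h2 := amp_gt0 w2 x; have h3 := amp_gt0 w3 x.
by apply: ler_wpDr h; apply: addr_ge0; exact: ltW.
Qed.

Lemma amp3_bound (M1 M2 M3 : R) : exists K, forall w1 w2 w3, E2 w1 -> E2 w2 -> E2 w3 ->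
  nrm B2 w1 <= M1 -> nrm B2 w2 <= M2 -> nrm B2 w3 <= M3 ->
  integ leb Omega (fun x => amp3 w1 w2 w3 x `^ r) /\ I (fun x => amp3 w1 w2 w3 x `^ r) <= K.
Proof.
have [Ka HKa] := amp_bound M1; have [Kb HKb] := amp_bound M2; have [Kc HKc] := amp_bound M3.
exists (3 `^ r * (Ka + Kb + Kc)) => w1 w2 w3 E_1 E_2 E_3 N_1 N_2 N_3.
have [ia ja] := HKa _ E_1 N_1; have [ib jb] := HKb _ E_2 N_2.
have [ic jc] := HKc _ E_3 N_3.
have i1 := integD mO ia ib; have i2 := integD mO i1 ic; have i3 := integZ mO (3 `^ r) i2.
have le1 x : amp3 w1 w2 w3 x `^ r <= 3 `^ r * (amp w1 x `^ r + amp w2 x `^ r + amp w3 x `^ r).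
  exact: (powR_sum3 (ltW (amp_gt0 _ _)) (ltW (amp_gt0 _ _)) (ltW (amp_gt0 _ _)) (ltW r0)).
have iS : integ leb Omega (fun x => amp3 w1 w2 w3 x `^ r).
  apply: (integ_le mO _ _ i3); last by move=> x _; rewrite ger0_norm ?powR_ge0.
  apply: (measurableT_comp (measurable_powR r)).
  apply: measurable_funD; last exact: amp_meas.
  by apply: measurable_funD; exact: amp_meas.
split => //; apply: le_trans (Rint_le mO iS i3 (fun x _ => le1 x)) _.
have e1 := RintegralZl (3 `^ r) mO i2; have e2 := RintegralD mO i1 ic; have e3 := RintegralD mO ia ib.
rewrite e1 e2 e3; apply: ler_wpM2l; first exact: powR_ge0.
by apply: lerD => //; apply: lerD.
Qed.

Lemma amp3_dominated (M1 M2 M3 : R) : exists K, forall w1 w2 w3 (g : 'rV[R]_n -> R) (C m : R), E2 w1 -> E2 w2 -> E2 w3 ->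
  nrm B2 w1 <= M1 -> nrm B2 w2 <= M2 -> nrm B2 w3 <= M3 -> 0 <= C -> m <= r ->
  measurable_fun Omega g -> (forall x, Omega x -> `|g x| <= C * amp3 w1 w2 w3 x `^ m) ->
  integ leb Omega g /\ I (fun x => `|g x|) <= C * K.
Proof.
have [K HK] := amp3_bound M1 M2 M3.
exists K => w1 w2 w3 g C m E_1 E_2 E_3 N_1 N_2 N_3 C0 mr mg gA.
have [iS bS] := HK _ _ _ E_1 E_2 E_3 N_1 N_2 N_3; have iZ := integZ mO C iS.
have le1 x : Omega x -> `|g x| <= C * amp3 w1 w2 w3 x `^ r.
  move=> Ox; apply: le_trans (gA x Ox) _; apply: ler_wpM2l => //.
  by apply: ler_powR => //; exact: amp3_ge1.
have ig := integ_le mO mg le1 iZ; split => //.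
have b1 : I (fun x => `|g x|) <= I (fun x => C * amp3 w1 w2 w3 x `^ r).
  apply: (Rint_le mO _ iZ le1); exact: (integ_norm mO ig).
apply: le_trans b1 _.
by have e := RintegralZl C mO iS; rewrite e; apply: ler_wpM2l.
Qed.

Lemma vitali3 (a_ b_ c_ : nat -> V * V) (g_ : nat -> 'rV[R]_n -> R) (C m : R) : 0 < m -> m < r -> 0 <= C ->
  (forall k, E2 (a_ k)) -> (forall k, E2 (b_ k)) -> (forall k, E2 (c_ k)) ->
  nbounded B2 a_ -> nbounded B2 b_ -> nbounded B2 c_ ->
  (forall k, measurable_fun Omega (g_ k)) ->
  (forall k x, Omega x -> `|g_ k x| <= C * amp3 (a_ k) (b_ k) (c_ k) x `^ m) ->
  {ae leb, forall x, Omega x -> g_ k x @[k --> \oo] --> 0} ->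
  (forall k, integ leb Omega (g_ k)) /\ I (fun x => `|g_ k x|) @[k --> \oo] --> (0 : R).
Proof.
move=> m0 mr C0 Ea Eb Ec [Ma Ha] [Mb Hb] [Mc Hc] mg gA g0.
have [K HK] := amp3_bound Ma Mb Mc; have [K' HK'] := amp3_dominated Ma Mb Mc.
have main k := HK _ _ _ (Ea k) (Eb k) (Ec k) (Ha k) (Hb k) (Hc k).
split; last exact: (vitali mO m0 mr C0 fO mg (fun k x _ => amp3_ge1 _ _ _ x) gA (fun k => (main k).1) (fun k => (main k).2) g0).
by move=> k; have [] := HK' _ _ _ _ _ _ (Ea k) (Eb k) (Ec k) (Ha k) (Hb k) (Hc k) C0 (ltW mr) (mg k) (gA k).
Qed.

Lemma sq_null w : E2 w -> nrm B2 w = 0 -> ae_eq leb Omega w.1 (cst 0) /\ ae_eq leb Omega w.2 (cst 0).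
Proof.
move=> Ew w0; have [Eu Ev] := Ew.
have null (u : V) : H10 u -> nrm Dir u <= 0 -> ae_eq leb Omega u (cst 0).
  move=> Hu u0; apply: (nrm2_eq0 mO (H10_sqinteg Hu)); apply/eqP; rewrite eq_le nrm_ge0 andbT.
  apply: le_trans (poincare_H10 oO bO i0 s00 OQ Hu) _.
  by rewrite mulr_ge0_le0// sqrtr_ge0.
have n1 := nrm_fst_le h0 Ew; have n2 := nrm_snd_le h0 Ew; rewrite w0 in n1 n2.
exact: (conj (null _ Eu n1) (null _ Ev n2)).
Qed.

Lemma sq_null_of_ae w : E2 w -> ae_eq leb Omega w.1 (cst 0) -> ae_eq leb Omega w.2 (cst 0) ->
  nrm B2 w = 0.
Proof.
move=> Ew z1 z2; have [Eu Ev] := Ew.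
have null (u : V) : H10 u -> ae_eq leb Omega u (cst 0) -> nrm Dir u = 0.
  move=> Hu u0; apply: (dirichlet0 oO bO) => //.
  rewrite (nrm_ae oO (H10_sqinteg Hu) (sqinteg0 leb mO) u0).
  exact: (nrm0 hS).
apply/eqP; rewrite eq_le nrm_ge0 andbT; apply: le_trans (nrm_sq_le h0 Ew) _.
by rewrite (null _ Eu z1) (null _ Ev z2) addr0.
Qed.

End energy_space.

Lemma lin_arith {R : realType} (d1 d2 a z1 z2 y1 y2 : R) :
  d1 * (a * z1 + y1) + d2 * (a * z2 + y2) = a * (d1 * z1 + d2 * z2) + (d1 * y1 + d2 * y2).
Proof. lra. Qed.

Lemma cvg_dist_squeeze {R : realType} (f h : nat -> R) (l : R) :
  (forall k, `|f k - l| <= h k) -> h @ \oo --> (0 : R) -> f @ \oo --> l.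
Proof.
move=> fh ch; apply/cvgrPdist_le => e e0; have /cvgr0_norm_le/(_ _ e0) := ch.
apply: filterS => k; rewrite distrC; apply: le_trans; apply: le_trans (fh k) _; exact: ler_norm.
Qed.

Lemma cvg_sqr0 {R : realType} (f h : nat -> R) : (forall k, 0 <= f k) -> (forall k, f k ^+ 2 <= h k) ->
  h @ \oo --> (0 : R) -> f @ \oo --> (0 : R).
Proof.
move=> f0 fh ch; apply/cvgr0Pnorm_le => e e0; have e2 : 0 < e ^+ 2 by rewrite exprn_gt0.
have /cvgr0_norm_le/(_ _ e2) := ch; apply: filterS => k hk.
rewrite ger0_norm// -(@ler_pXn2r _ 2)// ?nnegrE ?(ltW e0)//.
by apply: le_trans (fh k) _; apply: le_trans (ler_norm _) hk.
Qed.

Lemma le_of_sqr_le {R : realType} (a K : R) : 0 <= a -> a ^+ 2 <= K * a -> a <= `|K|.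
Proof.
rewrite le_eqVlt => /orP[/eqP <- _|a0]; first exact: normr_ge0.
by rewrite expr2 ler_pM2r// => /le_trans; apply; exact: ler_norm.
Qed.

Section nemytskii.
Context {R : realType} {n : nat} (Omega : set 'rV[R]_n).
Local Notation leb := (lebesgue_rV R n).
Local Notation vol' := (@vol R n).
Local Notation V := ('rV[R]_n -> R^o).
Local Notation Dir := (dirichlet Omega).
Local Notation H10 := (H10 Omega).
Local Notation E2 := (sq_set (H10 : set V)).
Local Notation B2 := (sq_ip Dir).
Local Notation I f := (\int[leb]_(x in Omega) f x).
Implicit Types (w z h : V * V) (x : 'rV[R]_n).
Hypotheses (oO : open Omega) (bO : bounded_set Omega).
Let mO : measurable Omega := measurable_Omega oO.
Let h0 := semi_ip_H10 oO bO.
Let hB := semi_ip_sq h0.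
Variables (i0 : 'I_n) (a0 : 'rV[R]_n) (s0 : R).
Hypotheses (s00 : 0 < s0) (OQ : Omega `<=` cube a0 s0).
Hypothesis vol_gt0 : forall s : R, 0 < s -> 0 < vol' s.
Variables (r Cs : R).
Hypotheses (r2 : 2 < r).
Hypothesis sob : forall (u : V) (M : R), H10 u -> 0 < M -> nrm Dir u <= M ->
    integ leb Omega (fun x => `|u x| `^ r) /\ \int[leb]_(x in Omega) `|u x| `^ r <= Cs * M `^ r.
Variables (H : 'rV[R]_n -> R -> R -> R) (p C : R).
Hypotheses (p0 : 0 < p) (pr : p + 1 < r) (C0 : 0 <= C) (nH : nice Omega p C H).

Definition potential w : R := I (fun x => H x (w.1 x) (w.2 x)).
Definition dpotential_at w z x : R := D_u H x (w.1 x) (w.2 x) * z.1 x + D_v H x (w.1 x) (w.2 x) * z.2 x.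
Definition dpotential w z : R := I (dpotential_at w z).

Let pgt0 : 0 < p + 1. Proof. exact: addr_gt0 p0 ltr01. Qed.
Let ple : p + 1 <= r. Proof. exact: ltW. Qed.

Let bdE := amp3_dominated oO bO r2 sob.
Let vitE := vitali3 oO bO r2 sob.
Let bd_ae := sq_bounded_ae oO bO i0 s00 OQ vol_gt0.

Lemma meas_comp w : E2 w -> [/\ measurable_fun Omega (fun x => H x (w.1 x) (w.2 x)),
      measurable_fun Omega (fun x => D_u H x (w.1 x) (w.2 x)) &
      measurable_fun Omega (fun x => D_v H x (w.1 x) (w.2 x))].
Proof. by move=> [Eu Ev]; exact: (nice_meas_comp mO p0 C0 nH (H10_meas oO Eu) (H10_meas oO Ev)). Qed.

Lemma dpotential_meas w z : E2 w -> E2 z -> measurable_fun Omega (dpotential_at w z).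
Proof.
move=> Ew [z1 z2]; have [_ m1 m2] := meas_comp Ew.
exact: (measurable_funD (measurable_funM m1 (H10_meas oO z1)) (measurable_funM m2 (H10_meas oO z2))).
Qed.

Lemma amp_le3 w1 w2 w3 x : [/\ amp w1 x <= amp3 w1 w2 w3 x, amp w2 x <= amp3 w1 w2 w3 x & amp w3 x <= amp3 w1 w2 w3 x].
Proof.
have := amp_gt0 w1 x; have := amp_gt0 w2 x; have := amp_gt0 w3 x; rewrite /amp3.
by move: (amp w1 x) (amp w2 x) (amp w3 x) => a b c *; split; lra.
Qed.

Lemma sum_le_amp w x : `|w.1 x| + `|w.2 x| <= amp w x.
Proof. by rewrite /amp -addrA lerDr. Qed.

Lemma dpotential_le w z w1 w2 w3 x : Omega x -> amp w x <= amp3 w1 w2 w3 x -> amp z x <= amp3 w1 w2 w3 x ->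
  `|dpotential_at w z x| <= C * amp3 w1 w2 w3 x `^ (p + 1).
Proof.
move=> Ox lw lz; have S0 := lt_le_trans ltr01 (amp3_ge1 w1 w2 w3 x).
have lz' := le_trans (sum_le_amp z x) lz.
have z0 : 0 <= `|z.1 x| + `|z.2 x| by exact: addr_ge0.
apply: le_trans (powR_dominate p0 C0 (ltW (amp_gt0 w x)) lw z0 lz' S0).
have g := nice_growth nH (w.1 x) (w.2 x) Ox; rewrite -/(amp w x) in g.
apply: le_trans (ler_normD _ _) _; rewrite !normrM mulrDr; apply: lerD.
  by apply: ler_wpM2r => //; apply: le_trans g; rewrite lerDl.
by apply: ler_wpM2r => //; apply: le_trans g; rewrite lerDr.
Qed.

Lemma potential_le w w1 w2 w3 x : Omega x -> amp w x <= amp3 w1 w2 w3 x ->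
  `|H x (w.1 x) (w.2 x)| <= 2 * C * amp3 w1 w2 w3 x `^ (p + 1).
Proof.
move=> Ox lw; have S0 := lt_le_trans ltr01 (amp3_ge1 w1 w2 w3 x).
apply: le_trans (nice_le p0 C0 nH _ _ Ox) _; apply: ler_wpM2l; first by rewrite mulr_ge0.
by apply: (ge0_ler_powR (ltW pgt0)); rewrite ?nnegrE; [exact: (ltW (amp_gt0 w x))|exact: ltW|].
Qed.

Lemma potential_integ w : E2 w -> integ leb Omega (fun x => H x (w.1 x) (w.2 x)).
Proof.
move=> Ew; have [K HK] := bdE (nrm B2 w) (nrm B2 w) (nrm B2 w); have [m1 _ _] := meas_comp Ew.
have C2 : 0 <= 2 * C by rewrite mulr_ge0.
have hb x : Omega x -> `|H x (w.1 x) (w.2 x)| <= 2 * C * amp3 w w w x `^ (p + 1).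
  by move=> Ox; have [l1 _ _] := amp_le3 w w w x; exact: (potential_le Ox l1).
by have [h _] := HK w w w _ (2 * C) (p + 1) Ew Ew Ew (lexx _) (lexx _) (lexx _) C2 ple m1 hb.
Qed.

Lemma dpotential_bound (M1 M2 : R) : exists K, forall w z, E2 w -> E2 z -> nrm B2 w <= M1 -> nrm B2 z <= M2 ->
  integ leb Omega (dpotential_at w z) /\ `|dpotential w z| <= K.
Proof.
have [K HK] := bdE M1 M1 M2; exists (C * K) => w z Ew Ez N1 N2'.
have [l1 _ l3] : [/\ forall x, amp w x <= amp3 w w z x, True & forall x, amp z x <= amp3 w w z x].
  by split => // x; have [] := amp_le3 w w z x.
have [ig b] := HK w w z _ C (p + 1) Ew Ew Ez N1 N1 N2' C0 ple (dpotential_meas Ew Ez)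
  (fun x Ox => dpotential_le Ox (l1 x) (l3 x)).
by split => //; apply: le_trans (le_normr_Rintegral mO ig) b.
Qed.

Lemma dpotential_integ w z : E2 w -> E2 z -> integ leb Omega (dpotential_at w z).
Proof.
move=> Ew Ez; have [K HK] := dpotential_bound (nrm B2 w) (nrm B2 z).
by have [] := HK w z Ew Ez (lexx _) (lexx _).
Qed.

Lemma dpotentialZD w (a : R) z z' : E2 w -> E2 z -> E2 z' ->
  dpotential w (a *: z + z') = a * dpotential w z + dpotential w z'.
Proof.
move=> Ew Ez Ez'; have i1 := dpotential_integ Ew Ez; have i2 := dpotential_integ Ew Ez'.
have e1 := RintegralD mO (integZ mO a i1) i2; have e2 := RintegralZl a mO i1.
rewrite /dpotential -e2 -e1; apply: Rint_ext => x _.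
rewrite /dpotential_at /= !fctE.
move: (D_u H _ _ _) (D_v H _ _ _) => d1 d2.
exact: (lin_arith d1 d2 a (z.1 x) (z.2 x) (z'.1 x) (z'.2 x)).
Qed.

Lemma dpotential_lip (M : R) : exists K, forall w z, E2 w -> E2 z -> nrm B2 w <= M ->
  `|dpotential w z| <= K * nrm B2 z.
Proof.
have [K HK] := dpotential_bound M 1; exists K => w z Ew Ez wM.
have main e : 0 < e -> `|dpotential w z| <= K * (nrm B2 z + e).
  (* Homogeneity reduces to norm at most 1; adding e avoids dividing by a norm that may be 0. *)
  move=> e0; pose c := nrm B2 z + e; have c0 : 0 < c by rewrite /c ltr_wpDl// nrm_ge0.
  have Ez' := ipZ hB c^-1 Ez.
  have n1 : nrm B2 (c^-1 *: z) <= 1.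
    rewrite (nrmZ hB _ Ez) ger0_norm ?invr_ge0 ?(ltW c0)// mulrC ler_pdivrMr// mul1r /c.
    by rewrite lerDl ltW.
  have [_ b] := HK w _ Ew Ez' wM n1.
  have e1 : dpotential w z = c * dpotential w (c^-1 *: z).
    have E0 := ip0 hB; have := dpotentialZD c Ew Ez' E0.
    rewrite addr0 scalerA mulfV ?lt0r_neq0// scale1r => ->.
    have := dpotentialZD 1 Ew E0 E0; rewrite scale1r addr0 mul1r.
    move=> e2; have -> : dpotential w 0 = 0 by apply: (addrI (dpotential w 0)); rewrite addr0 -e2.
    by rewrite addr0.
  rewrite e1 normrM (ger0_norm (ltW c0)) mulrC; apply: ler_wpM2r => //; exact: ltW.
have K0 : 0 <= K.
  have n01 : nrm B2 0 <= 1 by rewrite (nrm0 hB) ler01.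
  by have [_] := HK w 0 Ew (ip0 hB) wM n01; exact: le_trans.
apply/ler_addgt0Pr => e e0; pose d := e / (K + 1).
have K1 : 0 < K + 1 by rewrite ltr_wpDl.
have d0 : 0 < d by rewrite divr_gt0.
apply: le_trans (main d d0) _; rewrite mulrDr lerD2l.
apply: (@le_trans _ _ ((K + 1) * d)); first by apply: ler_wpM2r; rewrite ?lerDl// ltW.
by rewrite /d mulrC divfK// lt0r_neq0.
Qed.

(** Every subsequence has a further one that converges almost everywhere, by Rellich, and there
    [vitali3] applies since the integrand has growth p + 1 < r. *)
Lemma potential_weak : weakly_continuous E2 B2 potential.
Proof.
move=> w_ w Ew bw ww; have [Ex _] := ww.
apply: cvg_subsubseq => s hs.
have [t [ht ct]] := sq_weak_ae oO bO i0 s00 OQ vol_gt0 (fun k => Ew (s k)) (nbounded_comp s bw) (weak_cvg_subseq hs ww).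
exists t; split => //.
pose v k := w_ (s (t k)).
have Ev k : E2 (v k) by exact: Ew.
have bv : nbounded B2 v by exact: (nbounded_comp (s \o t) bw).
have bc : nbounded B2 (fun=> w) by exists (nrm B2 w) => k.
pose g k x := H x ((v k).1 x) ((v k).2 x) - H x (w.1 x) (w.2 x).
have C4 : 0 <= 2 * C + 2 * C by rewrite addr_ge0 ?mulr_ge0.
have mg k : measurable_fun Omega (g k).
  by have [m1 _ _] := meas_comp (Ev k); have [m2 _ _] := meas_comp Ex; exact: (measurable_funB m1 m2).
have gb k x : Omega x -> `|g k x| <= (2 * C + 2 * C) * amp3 (v k) w w x `^ (p + 1).
  move=> Ox; have [l1 l2 _] := amp_le3 (v k) w w x.
  rewrite mulrDl; apply: le_trans (ler_normB _ _) _.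
  by apply: lerD; [exact: (potential_le Ox l1)|exact: (potential_le Ox l2)].
have g0 : {ae leb, forall x, Omega x -> g k x @[k --> \oo] --> 0}.
  apply: filterS ct => x h Ox; have [h1 h2] := h Ox.
  have c := nice_cvg p0 C0 nH Ox h1 h2.
  by rewrite -(subrr (H x (w.1 x) (w.2 x))); exact: (cvgB c (cvg_cst _)).
have [ig cg] := vitE pgt0 pr C4 Ev (fun=> Ex) (fun=> Ex) bv bc bc mg gb g0.
apply: cvg_dist_squeeze cg => k.
have e := RintegralB mO (potential_integ (Ev k)) (potential_integ Ex).
by rewrite /potential -e; exact: (le_normr_Rintegral mO (ig k)).
Qed.

Lemma riesz_gradient : exists T : V * V -> V * V, forall w, E2 w ->
  E2 (T w) /\ forall z, E2 z -> dpotential w z = B2 (T w) z.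
Proof.
have ex w : exists y, E2 w -> E2 y /\ forall z, E2 z -> dpotential w z = B2 y z.
  have [Ew|nE] := pselect (E2 w); last by exists 0.
  have [K HK] := dpotential_lip (nrm B2 w).
  have [y Ey hy] := riesz hB (sq_complete oO bO i0 s00 OQ) (fun a z z' => @dpotentialZD w a z z' Ew)
    (fun z Ez => HK w z Ew Ez (lexx _)).
  by exists y => _; split.
by have [T HT] := choice ex; exists T.
Qed.

Variable T : V * V -> V * V.
Hypothesis HT : forall w, E2 w -> E2 (T w) /\ forall z, E2 z -> dpotential w z = B2 (T w) z.

Lemma gradient_bounded (M : R) : exists K, forall w, E2 w -> nrm B2 w <= M -> nrm B2 (T w) <= K.
Proof.
have [K HK] := dpotential_lip M; exists `|K| => w Ew wM; have [ET HTw] := HT Ew.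
apply: le_of_sqr_le; first exact: nrm_ge0.
rewrite (nrm_sqr hB ET) -(HTw _ ET); apply: le_trans (HK w (T w) Ew ET wM).
exact: ler_norm.
Qed.

(** With z_k = T w_k - T w, the squared norm of z_k is the difference of the differentials at w_k
    and at w, both applied to z_k. As z_k is bounded, it also converges almost everywhere along a
    subsequence, and Vitali's theorem makes the difference tend to 0. *)
Lemma gradient_compact (w_ : nat -> V * V) w : (forall k, E2 (w_ k)) -> nbounded B2 w_ ->
  weak_cvg E2 B2 w_ w -> nrm B2 (T (w_ k) - T w) @[k --> \oo] --> 0.
Proof.
move=> Ew bw ww; have [Ex _] := ww.
pose z_ k := T (w_ k) - T w; have ETx := (HT Ex).1.
have Ez k : E2 (z_ k) by exact: (ipB hB (HT (Ew k)).1 ETx).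
have bz : nbounded B2 z_.
  have [M HM] := bw; have [K HK] := gradient_bounded M.
  exists (K + nrm B2 (T w)) => k.
  have b1 := nrmD hB (HT (Ew k)).1 (ipN hB ETx); rewrite (nrmN hB ETx) in b1.
  by apply: le_trans b1 _; apply: lerD => //; exact: (HK _ (Ew k) (HM k)).
apply: cvg_subsubseq => s hs.
have [t1 [ht1 ct1]] := sq_weak_ae oO bO i0 s00 OQ vol_gt0 (fun k => Ew (s k)) (nbounded_comp s bw) (weak_cvg_subseq hs ww).
have [t2 [z [ht2 Ezz _ ct2]]] := bd_ae (fun k => Ez (s (t1 k))) (nbounded_comp (s \o t1) bz).
exists (t1 \o t2); split; first exact: subsequence_comp.
have {}ct1 := ae_cvg2_subseq ht2 ct1.
pose v k := w_ (s (t1 (t2 k))); pose y k := z_ (s (t1 (t2 k))).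
have Ev k : E2 (v k) by exact: Ew.
have Ey k : E2 (y k) by exact: Ez.
have bv : nbounded B2 v by exact: (nbounded_comp (s \o (t1 \o t2)) bw).
have by_ : nbounded B2 y by exact: (nbounded_comp (s \o (t1 \o t2)) bz).
have bc : nbounded B2 (fun=> w) by exists (nrm B2 w) => k.
pose g k x := dpotential_at (v k) (y k) x - dpotential_at w (y k) x.
have CC : 0 <= C + C by exact: addr_ge0.
have mg k : measurable_fun Omega (g k).
  exact: (measurable_funB (dpotential_meas (Ev k) (Ey k)) (dpotential_meas Ex (Ey k))).
have gb k x : Omega x -> `|g k x| <= (C + C) * amp3 (v k) w (y k) x `^ (p + 1).
  move=> Ox; have [l1 l2 l3] := amp_le3 (v k) w (y k) x.
  rewrite mulrDl; apply: le_trans (ler_normB _ _) _.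
  by apply: lerD; [exact: (dpotential_le Ox l1 l3)|exact: (dpotential_le Ox l2 l3)].
have g0 : {ae leb, forall x, Omega x -> g k x @[k --> \oo] --> 0}.
  apply: filterS2 ct1 ct2 => x h h' Ox; have [h1 h2] := h Ox; have [h3 h4] := h' Ox.
  have c1 := cont2_cvg (D_u_continuous nH Ox) h1 h2.
  have c2 := cont2_cvg (D_v_continuous nH Ox) h1 h2.
  have c3 : dpotential_at (v k) (y k) x @[k --> \oo] -->
      D_u H x (w.1 x) (w.2 x) * z.1 x + D_v H x (w.1 x) (w.2 x) * z.2 x.
    exact: (cvgD (cvgM c1 h3) (cvgM c2 h4)).
  have c4 : dpotential_at w (y k) x @[k --> \oo] -->
      D_u H x (w.1 x) (w.2 x) * z.1 x + D_v H x (w.1 x) (w.2 x) * z.2 x.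
    exact: (cvgD (cvgM (cvg_cst (D_u H x (w.1 x) (w.2 x))) h3) (cvgM (cvg_cst (D_v H x (w.1 x) (w.2 x))) h4)).
  rewrite -(subrr (D_u H x (w.1 x) (w.2 x) * z.1 x + D_v H x (w.1 x) (w.2 x) * z.2 x)).
  exact: (cvgB c3 c4).
have [ig cg] := vitE pgt0 pr CC Ev (fun=> Ex) Ey bv bc by_ mg gb g0.
apply: (cvg_sqr0 (fun k => nrm_ge0 B2 _) _ cg) => k.
rewrite (nrm_sqr hB (Ey k)) (ipBl hB (HT (Ev k)).1 ETx (Ey k)).
rewrite -((HT (Ev k)).2 _ (Ey k)) -((HT Ex).2 _ (Ey k)).
have e := RintegralB mO (dpotential_integ (Ev k) (Ey k)) (dpotential_integ Ex (Ey k)).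
rewrite /dpotential -e; apply: le_trans (ler_norm _) _; exact: (le_normr_Rintegral mO (ig k)).
Qed.

Definition remainder w h (c : R) x : R :=
  (H x (w.1 x + c * h.1 x) (w.2 x + c * h.2 x) - H x (w.1 x) (w.2 x) - dpotential_at w (c *: h) x) / c.

Lemma remainder_le w h (c : R) w' x : Omega x -> 0 < c -> c <= 1 ->
  `|remainder w h c x| <= (C + C) * amp3 w h w' x `^ (p + 1).
Proof.
move=> Ox c0 c1; rewrite /remainder normrM normfV (gtr0_norm c0) ler_pdivrMr//.
have S0 := lt_le_trans ltr01 (amp3_ge1 w h w' x).
have [l1 l2 _] := amp_le3 w h w' x.
have zz := le_trans (sum_le_amp h x) l2; have z0 : 0 <= `|h.1 x| + `|h.2 x| by exact: addr_ge0.
have Sx : 1 + `|w.1 x| + `|w.2 x| + `|c * h.1 x| + `|c * h.2 x| <= amp3 w h w' x.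
  have s1 : `|c * h.1 x| <= `|h.1 x| by rewrite normrM (gtr0_norm c0) ler_piMl.
  have s2 : `|c * h.2 x| <= `|h.2 x| by rewrite normrM (gtr0_norm c0) ler_piMl.
  rewrite -addrA; apply: (@le_trans _ _ (amp w x + amp h x)).
    by apply: lerD => //; apply: le_trans (lerD s1 s2) _; exact: sum_le_amp.
  by rewrite /amp3 lerDl ltW// amp_gt0.
have A0 : 0 <= 1 + `|w.1 x| + `|w.2 x| + `|c * h.1 x| + `|c * h.2 x| by rewrite !addr_ge0.
apply: le_trans (ler_normB _ _) _; rewrite mulrDl mulrDl; apply: lerD.
  apply: le_trans (nice_bound p0 C0 nH _ _ _ _ Ox) _.
  rewrite !normrM (gtr0_norm c0) -mulrDr [c * (_ + _)]mulrC mulrA.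
  apply: ler_wpM2r; first exact: ltW.
  have := powR_dominate p0 C0 A0 Sx z0 zz S0.
  by rewrite !normrM (gtr0_norm c0).
have -> : dpotential_at w (c *: h) x = dpotential_at w h x * c.
  rewrite /dpotential_at; move: (D_u H _ _ _) (D_v H _ _ _) => d1 d2.
  by rewrite [RHS]mulrC; have := lin_arith d1 d2 c (h.1 x) (h.2 x) 0 0; rewrite !mulr0 !addr0 => e; exact: e.
rewrite normrM (gtr0_norm c0); apply: ler_wpM2r; first exact: ltW.
exact: (dpotential_le Ox l1 l2).
Qed.

Lemma remainder_meas w h (c : R) : E2 w -> E2 h -> measurable_fun Omega (remainder w h c).
Proof.
move=> Ew Eh; have Ech := ipZ hB c Eh; have [m1 _ _] := meas_comp Ew.
have [m2 _ _] := meas_comp (ipA hB Ew Ech).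
exact: (measurable_funM (measurable_funB (measurable_funB m2 m1) (dpotential_meas Ew Ech)) (measurable_cst _)).
Qed.

Lemma potential_remainder w h (c : R) : E2 w -> E2 h -> 0 < c -> c <= 1 ->
  potential (w + c *: h) - potential w - B2 (T w) (c *: h) = c * I (remainder w h c).
Proof.
move=> Ew Eh c0 c1; have Ech := ipZ hB c Eh; have Es := ipA hB Ew Ech.
have i1 := potential_integ Es; have i2 := potential_integ Ew; have i3 := dpotential_integ Ew Ech.
have i4 := integB mO i1 i2; have i5 := integB mO i4 i3.
have e1 := RintegralB mO i4 i3; have e2 := RintegralB mO i1 i2.
rewrite -((HT Ew).2 _ Ech) /potential /dpotential -e2 -e1.
have i6 := integZ mO c^-1 i5; have e3 := RintegralZl c mO i6.
have -> : I (remainder w h c) = I (fun x => c^-1 * (H x ((w + c *: h).1 x) ((w + c *: h).2 x) -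
    H x (w.1 x) (w.2 x) - dpotential_at w (c *: h) x)).
  by apply: Rint_ext => x _; rewrite mulrC.
rewrite -e3; apply: Rint_ext => x _.
by rewrite mulrA mulfV ?lt0r_neq0// mul1r.
Qed.

(** By contradiction: from increments h_k tending to 0 one extracts almost everywhere limits of the
    base points and of the normalized directions h_k / |h_k|. The remainder divided by |h_k| then
    tends to 0 pointwise by [frechet_quotient], and in mean by Vitali's theorem. *)
Lemma potential_frechet (M e : R) : 0 < e -> exists2 d, 0 < d & forall w h, E2 w -> E2 h ->
  nrm B2 w <= M -> nrm B2 h <= d ->
  `|potential (w + h) - potential w - B2 (T w) h| <= e * nrm B2 h.
Proof.
move=> e0; apply: contrapT => nH'.
have far k : exists wh : (V * V) * (V * V), [/\ E2 wh.1, E2 wh.2, nrm B2 wh.1 <= M, nrm B2 wh.2 <= k.+1%:R^-1 &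
    e * nrm B2 wh.2 < `|potential (wh.1 + wh.2) - potential wh.1 - B2 (T wh.1) wh.2| ].
  apply: contrapT => H'; apply: nH'; exists k.+1%:R^-1; first by rewrite invr_gt0.
  move=> w h Ew Eh wM hd; rewrite leNgt; apply/negP => lt; apply: H'; exists (w, h).
  by split; [exact: Ew|exact: Eh|exact: wM|exact: hd|exact: lt].
have [wh Hwh] := choice far.
pose w k := (wh k).1; pose h k := (wh k).2; pose c k := nrm B2 (h k).
have Ew k : E2 (w k) by have [? _ _ _ _] := Hwh k.
have Eh k : E2 (h k) by have [_ ? _ _ _] := Hwh k.
have bw : nbounded B2 w by exists M => k; have [_ _ ? _ _] := Hwh k.
have cb k : c k <= k.+1%:R^-1 by have [_ _ _ ? _] := Hwh k.
have lt k : e * c k < `|potential (w k + h k) - potential (w k) - B2 (T (w k)) (h k)|.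
  by have [_ _ _ _ ?] := Hwh k.
have c1 k : c k <= 1 by apply: le_trans (cb k) _; rewrite invf_le1// ler1n.
(* An increment of norm 0 vanishes almost everywhere and leaves the potential unchanged, against the
   strict inequality [lt]. *)
have c0 k : 0 < c k.
  rewrite lt_neqAle nrm_ge0 andbT; apply/eqP => /esym z.
  have [n1 n2] := sq_null oO bO i0 s00 OQ (Eh k) z.
  have [m1 _ _] := meas_comp (Ew k); have [m2 _ _] := meas_comp (ipA hB (Ew k) (Eh k)).
  have e1 : potential (w k + h k) = potential (w k).
    apply: (Rint_ae mO m2 m1); apply: filterS2 n1 n2 => x x1 x2 Ox /=.
    by rewrite !fctE (x1 Ox) (x2 Ox) !addr0.
  have e2 : B2 (T (w k)) (h k) = 0.
    by rewrite (ipC hB (HT (Ew k)).1 (Eh k)); exact: (nrm0_ip hB (Eh k) (HT (Ew k)).1 z).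
  by have := lt k; rewrite e1 e2 z subrr subr0 normr0 mulr0 ltxx.
pose a k := (c k)^-1 *: h k.
have Ea k : E2 (a k) by exact: (ipZ hB).
have hca k : h k = c k *: a k by rewrite /a scalerA mulfV ?scale1r// lt0r_neq0.
have ba : nbounded B2 a.
  exists 1 => k; rewrite /a (nrmZ hB _ (Eh k)) ger0_norm ?invr_ge0 ?(ltW (c0 k))//.
  by rewrite mulVf// lt0r_neq0.
have [s [x [hs Ex _ cx]]] := bd_ae Ew bw.
have [t [y [ht Ey _ cy]]] := bd_ae (fun k => Ea (s k)) (nbounded_comp s ba).
have {}cx := ae_cvg2_subseq ht cx.
pose st := s \o t; have hst : subsequence st by exact: subsequence_comp.
have CC : 0 <= C + C by exact: addr_ge0.
pose g k := remainder (w (st k)) (a (st k)) (c (st k)).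
have cc : c k @[k --> \oo] --> (0 : R).
  apply: (squeeze_cvgr _ (cvg_cst 0) (@cvg_harmonic R)); near=> k.
  by rewrite nrm_ge0 /=; exact: cb.
have g0 : {ae leb, forall x, Omega x -> g k x @[k --> \oo] --> 0}.
  apply: filterS2 cx cy => x0 h1 h2 Ox; have [h3 h4] := h1 Ox; have [h5 h6] := h2 Ox.
  exact: (frechet_quotient nH Ox h3 h4 h5 h6 (cvg_subsequence hst cc) (fun k => c0 (st k))).
have [ig cg] := vitE pgt0 pr CC (fun k => Ew (st k)) (fun k => Ea (st k)) (fun k => Ew (st k))
  (nbounded_comp st bw) (nbounded_comp st ba) (nbounded_comp st bw)
  (fun k => remainder_meas _ (Ew (st k)) (Ea (st k)))
  (fun k x Ox => remainder_le _ _ _ Ox (c0 (st k)) (c1 (st k))) g0.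
have e2 : 0 < e / 2 by rewrite divr_gt0.
have /cvgr0_norm_le/(_ _ e2)[N _ /(_ N (leqnn N))] := cg.
apply/negP; rewrite -ltNge; apply: (@lt_le_trans _ _ e).
  by rewrite ltr_pdivrMr// mulr_natr mulr2n ltrDl.
apply: le_trans (ler_norm _); apply: le_trans (le_normr_Rintegral mO (ig N)).
have := ltW (lt (st N)); rewrite hca (potential_remainder (Ew _) (Ea _) (c0 _) (c1 _)).
by rewrite normrM (ger0_norm (ltW (c0 _))) mulrC ler_pM2l.
Unshelve. all: by end_near. Qed.

End nemytskii.

(** * Critical points and weak solutions *)

Definition three_solutions {R : realType} {n : nat} (Omega : set 'rV[R]_n) (H : 'rV[R]_n -> R -> R -> R) :=
  exists w1 w2 w3 : ('rV[R]_n -> R) * ('rV[R]_n -> R),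
    [/\ weak_solution Omega H w1, weak_solution Omega H w2 & weak_solution Omega H w3] /\
    [/\ ~ ae_equal Omega w1 w2, ~ ae_equal Omega w1 w3 & ~ ae_equal Omega w2 w3] /\
    global_minimum Omega H w1 /\ global_minimum Omega H w2.

Section solutions.
Context {R : realType} {n : nat} (Omega : set 'rV[R]_n).
Local Notation leb := (lebesgue_rV R n).
Local Notation vol' := (@vol R n).
Local Notation V := ('rV[R]_n -> R^o).
Local Notation Dir := (dirichlet Omega).
Local Notation H10 := (H10 Omega).
Local Notation E2 := (sq_set (H10 : set V)).
Local Notation B2 := (sq_ip Dir).
Implicit Types (w z h : V * V) (x : 'rV[R]_n).
Hypotheses (oO : open Omega) (bO : bounded_set Omega).
Let h0 := semi_ip_H10 oO bO.
Let hB := semi_ip_sq h0.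

Lemma not_ae_equal w1 w2 : E2 w1 -> E2 w2 -> nrm B2 (w1 - w2) != 0 -> ~ ae_equal Omega w1 w2.
Proof.
move=> E_1 E_2 /eqP nz [e1 e2]; apply: nz; apply: (sq_null_of_ae oO bO (ipB hB E_1 E_2)).
  by apply: filterS e1 => x h Ox /=; rewrite !fctE (h Ox) subrr.
by apply: filterS e2 => x h Ox /=; rewrite !fctE (h Ox) subrr.
Qed.

Lemma energyE H w : E2 w -> energy Omega H w = half_sq_minus B2 (potential Omega H) w.
Proof.
move=> Ew; rewrite /half_sq_minus (nrm_sqr hB Ew); case: w Ew => u v Ew.
by rewrite mulrC.
Qed.

Variables (i0 : 'I_n) (a0 : 'rV[R]_n) (s0 : R).
Hypotheses (s00 : 0 < s0) (OQ : Omega `<=` cube a0 s0).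
Hypothesis vol_gt0 : forall s : R, 0 < s -> 0 < vol' s.
Variables (r Cs : R).
Hypotheses (r2 : 2 < r).
Hypothesis sob : forall (u : V) (M : R), H10 u -> 0 < M -> nrm Dir u <= M ->
    integ leb Omega (fun x => `|u x| `^ r) /\ \int[leb]_(x in Omega) `|u x| `^ r <= Cs * M `^ r.
Variables (H : 'rV[R]_n -> R -> R -> R) (p C : R).
Hypotheses (p0 : 0 < p) (pr : p + 1 < r) (C0 : 0 <= C) (nH : nice Omega p C H).

Lemma critical_weak_solution (T : V * V -> V * V) w :
  (forall w, E2 w -> E2 (T w) /\ forall z, E2 z -> dpotential Omega H w z = B2 (T w) z) ->
  E2 w -> critical B2 T w -> weak_solution Omega H w.
Proof.
move=> HT Ew cw; have [ET hT] := HT w Ew.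
have eq z : E2 z -> B2 w z = dpotential Omega H w z.
  by move=> Ez; rewrite (hT z Ez); exact: (nrmB0_ip hB Ew ET Ez cw).
case: w Ew {cw ET hT} eq => u v [/= Eu Ev] eq; split=> // phi Ep.
  have Ez : E2 (phi, 0) := conj Ep (ip0 h0).
  have := eq _ Ez; rewrite /sq_ip /= (ip0r h0 Ev) addr0 => e; apply: (etrans e).
  by apply: Rint_ext => x _; rewrite /dpotential_at /= mulr0 addr0.
have Ez : E2 (0, phi) := conj (ip0 h0) Ep.
have := eq _ Ez; rewrite /sq_ip /= (ip0r h0 Eu) add0r => e; apply: (etrans e).
by apply: Rint_ext => x _; rewrite /dpotential_at /= mulr0 add0r.
Qed.

Lemma two_minima w1 w2 : coercive_on E2 B2 (half_sq_minus B2 (potential Omega H)) ->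
  E2 w1 -> E2 w2 ->
  (forall y, E2 y -> half_sq_minus B2 (potential Omega H) w1 <= half_sq_minus B2 (potential Omega H) y) ->
  (forall y, E2 y -> half_sq_minus B2 (potential Omega H) w2 <= half_sq_minus B2 (potential Omega H) y) ->
  nrm B2 (w1 - w2) != 0 -> three_solutions Omega H.
Proof.
move=> Jc E_1 E_2 m1 m2 n12.
have cpt := sq_compact oO bO i0 s00 OQ vol_gt0.
have pw := potential_weak oO bO i0 s00 OQ vol_gt0 r2 sob p0 pr C0 nH.
have [T HT] := riesz_gradient oO bO i0 s00 OQ r2 sob p0 pr C0 nH.
have ET w : E2 w -> E2 (T w) by move=> Ew; exact: (HT w Ew).1.
have Tw := gradient_compact oO bO i0 s00 OQ vol_gt0 r2 sob p0 pr C0 nH HT.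
have Pd := potential_frechet oO bO i0 s00 OQ vol_gt0 r2 sob p0 pr C0 nH HT.
have [w3 [E_3 c3 n13 n23]] := third_critical_point hB cpt pw Jc ET Tw Pd E_1 E_2 m1 m2 n12.
have c1 := minimum_critical hB cpt ET Tw Pd E_1 m1.
have c2 := minimum_critical hB cpt ET Tw Pd E_2 m2.
have gm w : E2 w -> (forall y, E2 y -> half_sq_minus B2 (potential Omega H) w <= half_sq_minus B2 (potential Omega H) y) ->
    global_minimum Omega H w.
  move=> Ew mw; have [Eu Ev] := Ew; split; [exact: Eu|exact: Ev|move=> w' Eu' Ev'].
  have Ew' : E2 w' := conj Eu' Ev'.
  by rewrite (energyE H Ew) (energyE H Ew'); exact: mw.
exists w1, w2, w3; split.
  by split; [exact: (critical_weak_solution HT E_1 c1)|exact: (critical_weak_solution HT E_2 c2)|exact: (critical_weak_solution HT E_3 c3)].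
split.
  by split; [exact: (not_ae_equal E_1 E_2 n12)|exact: (not_ae_equal E_1 E_3 n13)|exact: (not_ae_equal E_2 E_3 n23)].
by split; [exact: (gm w1 E_1 m1)|exact: (gm w2 E_2 m2)].
Qed.

End solutions.

(** * Changing the nonlinearity on a null set *)

Section almost_everywhere_change.
Context {R : realType} {n : nat} (Omega : set 'rV[R]_n).
Local Notation leb := (lebesgue_rV R n).
Hypothesis oO : open Omega.
Let mO : measurable Omega := measurable_Omega oO.

(** The Caratheodory measure is complete, so f, which is not assumed to be measurable, inherits
    measurability from g. *)
Lemma Rint_ae_meas (f g : 'rV[R]_n -> R) : measurable_fun Omega g ->
  {ae leb, forall x, Omega x -> f x = g x} ->
  \int[leb]_(x in Omega) f x = \int[leb]_(x in Omega) g x.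
Proof.
move=> mg fg; have cmu : measure_is_complete leb by exact: measure_is_complete_caratheodory.
have gf : ae_eq leb Omega (EFin \o g) (EFin \o f) by apply: filterS fg => x h Ox /=; rewrite h.
have mf : measurable_fun Omega f.
  by apply/measurable_EFinP; apply: (ae_measurable_fun cmu gf); apply/measurable_EFinP.
exact: (Rint_ae mO mf mg fg).
Qed.

Variables (H H' : 'rV[R]_n -> R -> R -> R) (p C : R).
Hypotheses (p0 : 0 < p) (C0 : 0 <= C) (nH : nice Omega p C H').
Hypothesis eqH : {ae leb, forall x, Omega x -> H x = H' x}.

Lemma three_solutions_ae : three_solutions Omega H' -> three_solutions Omega H.
Proof.
have sol w : weak_solution Omega H' w -> weak_solution Omega H w.
  case: w => u v [Hu Hv e1 e2].
  have [_ m1 m2] := nice_meas_comp mO p0 C0 nH (H10_meas oO Hu) (H10_meas oO Hv).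
  split; [exact: Hu|exact: Hv|move=> phi Hp|move=> phi Hp].
    rewrite (e1 phi Hp); symmetry; apply: Rint_ae_meas.
      exact: (measurable_funM m1 (H10_meas oO Hp)).
    by apply: filterS eqH => x h Ox; rewrite /D_u (h Ox).
  rewrite (e2 phi Hp); symmetry; apply: Rint_ae_meas.
    exact: (measurable_funM m2 (H10_meas oO Hp)).
  by apply: filterS eqH => x h Ox; rewrite /D_v (h Ox).
have en w : H10 Omega w.1 -> H10 Omega w.2 -> energy Omega H w = energy Omega H' w.
  case: w => u v /= Hu Hv.
  have [m _ _] := nice_meas_comp mO p0 C0 nH (H10_meas oO Hu) (H10_meas oO Hv).
  congr (_ - _); apply: (Rint_ae_meas m).
  by apply: filterS eqH => x h Ox; rewrite (h Ox).
have gm w : global_minimum Omega H' w -> global_minimum Omega H w.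
  move=> [H1 H2 h]; split; [exact: H1|exact: H2|move=> w' H1' H2'].
  by rewrite (en w H1 H2) (en w' H1' H2'); exact: h.
move=> [w1 [w2 [w3 [[s1 s2 s3] [n123 [g1 g2]]]]]]; exists w1, w2, w3.
split; first by split; [exact: (sol _ s1)|exact: (sol _ s2)|exact: (sol _ s3)].
by split; [exact: n123|split; [exact: (gm _ g1)|exact: (gm _ g2)]].
Qed.

End almost_everywhere_change.

(** * Growth conditions *)

Section growth.
Context {R : realType} {n : nat} (Omega : set 'rV[R]_n).
Local Notation leb := (lebesgue_rV R n).
Implicit Types (H F G K : 'rV[R]_n -> R -> R -> R) (p C s t : R) (x : 'rV[R]_n).

Lemma amp_ge1' s t : 1 <= 1 + `|s| + `|t|.
Proof. by rewrite -addrA lerDl addr_ge0. Qed.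

Lemma growth_bound H p : 0 < p -> growth Omega H p -> exists2 C, 0 <= C &
  forall x s t, Omega x -> `|D_u H x s t| + `|D_v H x s t| <= C * (1 + `|s| + `|t|) `^ p.
Proof.
move=> p0; rewrite /growth; set A := [set _ | _ in _]; move=> fA.
have [C C0 HC] : exists2 C, 0 <= C & forall y : R, A y%:E -> y <= C.
  case E : (ereal_sup A) fA => [c| |] // _.
    exists (Num.max c 0); first by rewrite le_max lexx orbT.
    by move=> y /ereal_sup_ubound; rewrite E lee_fin le_max => ->.
  exists 0 => // y /ereal_sup_ubound; rewrite E leeNy_eq => /eqP.
  by [].
exists (C * 3); first by rewrite mulr_ge0.
move=> x s t Ox; set a := `|D_u H x s t| + _; pose d := 1 + `|s| `^ p + `|t| `^ p.
have d0 : 0 < d by rewrite /d -addrA ltr_wpDr ?addr_ge0 ?powR_ge0.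
have h1 : a / d <= C by apply: HC; exists (x, (s, t)) => //; split.
rewrite ler_pdivrMr// in h1; apply: le_trans h1 _; rewrite -mulrA; apply: ler_wpM2l => //.
have A1 := amp_ge1' s t; have A0 : 0 <= 1 + `|s| + `|t| by exact: le_trans A1.
have b0 : 1 <= (1 + `|s| + `|t|) `^ p by have := ler_powR A1 (ltW p0); rewrite powRr0.
have b1 : `|s| `^ p <= (1 + `|s| + `|t|) `^ p.
  by apply: (ge0_ler_powR (ltW p0)); rewrite ?nnegrE// addrAC lerDr addr_ge0.
have b2 : `|t| `^ p <= (1 + `|s| + `|t|) `^ p.
  by apply: (ge0_ler_powR (ltW p0)); rewrite ?nnegrE// lerDr addr_ge0.
by rewrite /d; move: b0 b1 b2; move: (_ `^ p) (`|s| `^ p) (`|t| `^ p) => b c e *; lra.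
Qed.

Lemma nice_weaken p p' C C' H : 0 <= C -> p <= p' -> C <= C' -> nice Omega p C H -> nice Omega p' C' H.
Proof.
move=> C0 pp CC [h1 h2 h3 h4]; split; [exact: h1|exact: h2| |].
  move=> x s t Ox; apply: le_trans (h3 x s t Ox) _; apply: ler_pM; [exact: C0|exact: powR_ge0|exact: CC|].
  by apply: ler_powR => //; exact: amp_ge1'.
by move=> x Ox; exact: le_trans (h4 x Ox) CC.
Qed.

Lemma derive1_comb (f g k : R -> R) (a b s : R) : derivable f s 1 -> derivable g s 1 -> derivable k s 1 ->
  derivable (fun s => a * f s + b * g s + k s) s 1 /\
  derive1 (fun s => a * f s + b * g s + k s) s = a * derive1 f s + b * derive1 g s + derive1 k s.
Proof.
move=> /derivableP df /derivableP dg /derivableP dk.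
have h := is_deriveD (is_deriveD (is_deriveZ a df) (is_deriveZ b dg)) dk.
have -> : (fun s => a * f s + b * g s + k s) = a \*: f + b \*: g + k by [].
split; first by case: h.
by rewrite !derive1E; exact: derive_val.
Qed.

Lemma C1_comb (f g k : R -> R -> R) (a b : R) : C1 f -> C1 g -> C1 k ->
  C1 (fun s t => a * f s t + b * g s t + k s t).
Proof.
move=> [df cf1 cf2] [dg cg1 cg2] [dk ck1 ck2].
have e1 z : derive1 ((fun s t => a * f s t + b * g s t + k s t) ^~ z.2) z.1 =
    a * derive1 (f ^~ z.2) z.1 + b * derive1 (g ^~ z.2) z.1 + derive1 (k ^~ z.2) z.1.
  exact: (derive1_comb a b (df z.1 z.2).1 (dg z.1 z.2).1 (dk z.1 z.2).1).2.
have e2 z : derive1 (fun t => a * f z.1 t + b * g z.1 t + k z.1 t) z.2 =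
    a * derive1 (f z.1) z.2 + b * derive1 (g z.1) z.2 + derive1 (k z.1) z.2.
  exact: (derive1_comb a b (df z.1 z.2).2 (dg z.1 z.2).2 (dk z.1 z.2).2).2.
split.
- move=> s t; split.
    exact: (derive1_comb a b (df s t).1 (dg s t).1 (dk s t).1).1.
  exact: (derive1_comb a b (df s t).2 (dg s t).2 (dk s t).2).1.
- move=> z; rewrite (_ : (fun _ => _) = (fun z : R * R => a * derive1 (f ^~ z.2) z.1 + b * derive1 (g ^~ z.2) z.1 + derive1 (k ^~ z.2) z.1)).
    apply: cvgD; last exact: ck1.
    by apply: cvgD; apply: cvgM; [exact: cvg_cst|exact: cf1|exact: cvg_cst|exact: cg1].
  by apply/funext => w; exact: e1.
- move=> z; rewrite (_ : (fun _ => _) = (fun z : R * R => a * derive1 (f z.1) z.2 + b * derive1 (g z.1) z.2 + derive1 (k z.1) z.2)).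
    apply: cvgD; last exact: ck2.
    by apply: cvgD; apply: cvgM; [exact: cvg_cst|exact: cf2|exact: cvg_cst|exact: cg2].
  by apply/funext => w; exact: e2.
Qed.

Lemma comb_arith (a b M f g k fu fv gu gv ku kv A C : R) : `|a| <= M -> `|b| <= M ->
  `|fu| + `|fv| <= C * A -> `|gu| + `|gv| <= C * A -> `|ku| + `|kv| <= C * A ->
  `|a * fu + b * gu + ku| + `|a * fv + b * gv + kv| <= (M * C + M * C + C) * A.
Proof.
move=> ha hb hf hg hk.
have m0 : 0 <= M by apply: le_trans ha.
have q1 : `|a * fu + b * gu + ku| <= M * `|fu| + M * `|gu| + `|ku|.
  apply: le_trans (ler_normD _ _) _; rewrite lerD2r; apply: le_trans (ler_normD _ _) _; rewrite !normrM.
  by apply: lerD; exact: ler_wpM2r.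
have q2 : `|a * fv + b * gv + kv| <= M * `|fv| + M * `|gv| + `|kv|.
  apply: le_trans (ler_normD _ _) _; rewrite lerD2r; apply: le_trans (ler_normD _ _) _; rewrite !normrM.
  by apply: lerD; exact: ler_wpM2r.
apply: le_trans (lerD q1 q2) _.
have r1 := ler_wpM2l m0 hf; have r2 := ler_wpM2l m0 hg.
by move: r1 r2 hk; clear; lra.
Qed.

Lemma nice_comb p C F G K (alpha beta : 'rV[R]_n -> R) (M : R) : 0 <= C ->
  nice Omega p C F -> nice Omega p C G -> nice Omega p C K ->
  measurable_fun Omega alpha -> measurable_fun Omega beta ->
  (forall x, Omega x -> `|alpha x| <= M /\ `|beta x| <= M) ->
  nice Omega p (M * C + M * C + C) (fun x s t => alpha x * F x s t + beta x * G x s t + K x s t).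
Proof.
move=> C0 nF nG nK ma mb hM; split.
- move=> s t; have mF := nice_meas nF s t; have mG := nice_meas nG s t; have mK := nice_meas nK s t.
  exact: (measurable_funD (measurable_funD (measurable_funM ma mF) (measurable_funM mb mG)) mK).
- by move=> x Ox; exact: (C1_comb (alpha x) (beta x) (nice_C1 nF Ox) (nice_C1 nG Ox) (nice_C1 nK Ox)).
- move=> x s t Ox; have [ha hb] := hM x Ox.
  have [dF _ _] := nice_C1 nF Ox; have [dG _ _] := nice_C1 nG Ox; have [dK _ _] := nice_C1 nK Ox.
  rewrite /D_u /D_v.
  rewrite (derive1_comb (alpha x) (beta x) (dF s t).1 (dG s t).1 (dK s t).1).2.
  rewrite (derive1_comb (alpha x) (beta x) (dF s t).2 (dG s t).2 (dK s t).2).2.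
  exact: (comb_arith 0 0 0 ha hb (nice_growth nF s t Ox) (nice_growth nG s t Ox) (nice_growth nK s t Ox)).
- move=> x Ox; have [ha hb] := hM x Ox.
  have hF := nice_zero nF Ox; have hG := nice_zero nG Ox; have hK := nice_zero nK Ox.
  apply: le_trans (ler_normD _ _) _; apply: lerD => //; apply: le_trans (ler_normD _ _) _.
  by rewrite !normrM; apply: lerD; apply: ler_pM.
Qed.

Lemma truncation (alpha : 'rV[R]_n -> R) : Linfty Omega alpha -> exists (alpha' : 'rV[R]_n -> R) (M : R),
  [/\ measurable_fun Omega alpha', forall x, `|alpha' x| <= M & {ae leb, forall x, Omega x -> alpha x = alpha' x}].
Proof.
move=> [ma [M hM]]; pose M' := Num.max M 0; exists (fun x => Num.max (- M') (Num.min M' (alpha x))), M'.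
have M0 : 0 <= M' by rewrite le_max lexx orbT.
split.
- exact: (measurable_maxr (measurable_cst _) (measurable_minr (measurable_cst _) ma)).
- move=> x; rewrite ler_norml le_max lexx /= ge_max ge_min lexx /= andbT.
  by apply: (le_trans _ M0); rewrite oppr_le0.
- apply: filterS hM => x h Ox; have := h Ox => hx.
  have : `|alpha x| <= M' by rewrite le_max hx.
  by rewrite ler_norml => /andP[h1 h2]; rewrite (min_idPr h2) (max_idPr h1).
Qed.

Lemma vanishing_quotient F G (a1 : (ereal_sup [set (`|F x z.1 z.2| + `|G x z.1 z.2|)%R%:E | x in Omega] *
            ((z.1 ^+ 2 + z.2 ^+ 2)^-1)%R%:E)%E @[z --> sqr_norm_pinfty R] --> 0%E) (e : R) : 0 < e ->
  exists2 m, 0 <= m & forall x s t, Omega x -> m < s ^+ 2 + t ^+ 2 -> `|F x s t| + `|G x s t| <= e * (s ^+ 2 + t ^+ 2).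
Proof.
move=> e0; have nb : nbhs (0%E : \bar R) [set y : \bar R | (y < e%:E)%E].
  by apply: open_nbhs_nbhs; split; [exact: open_ereal_lt_ereal|rewrite /= lte_fin].
have [m _ Hm] := a1 _ nb; exists (Num.max m 0); first by rewrite le_max lexx orbT.
move=> x s t Ox; rewrite gt_max => /andP[hm h0].
have := Hm (s, t) hm; rewrite /= => lt.
have i0 : (0 <= ((s ^+ 2 + t ^+ 2)^-1)%:E)%E by rewrite lee_fin invr_ge0 ltW.
have hin : [set (`|F x s t| + `|G x s t|)%R%:E | x in Omega] (`|F x s t| + `|G x s t|)%R%:E by exists x.
have := le_lt_trans (lee_wpmul2r i0 (ereal_sup_ubound hin)) lt.
by rewrite -EFinM lte_fin ltr_pdivrMr// => /ltW.
Qed.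

Definition gradient_bound H p C := forall x s t, Omega x ->
  `|D_u H x s t| + `|D_v H x s t| <= C * (1 + `|s| + `|t|) `^ p.

Lemma gradient_bound_weaken H p p' C C' : 0 <= C -> p <= p' -> C <= C' -> gradient_bound H p C -> gradient_bound H p' C'.
Proof.
move=> C0 pp CC h x s t Ox; apply: le_trans (h x s t Ox) _; apply: ler_pM; [exact: C0|exact: powR_ge0|exact: CC|].
by apply: ler_powR => //; exact: amp_ge1'.
Qed.

(** Class A does not bound F(x, 0, 0) uniformly in x. Condition (a_1) bounds F(x, s, 0) at the fixed
    point s = m + 1, whose square exceeds m, and the growth of the derivative carries this bound to
    the origin. *)
Lemma bounded_zero F G p C (e m : R) : 0 < p -> 0 <= C -> 0 <= m -> gradient_bound F p C ->
  (forall x, Omega x -> C1 (F x)) ->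
  (forall x s t, Omega x -> m < s ^+ 2 + t ^+ 2 -> `|F x s t| + `|G x s t| <= e * (s ^+ 2 + t ^+ 2)) ->
  exists C', forall x, Omega x -> `|F x 0 0| <= C'.
Proof.
move=> p0 C0 m0 gF cF small; pose s := m + 1; have s0 : 0 < s by rewrite /s ltr_wpDl.
exists (e * (s ^+ 2 + 0 ^+ 2) + C * (1 + s) `^ p * s) => x Ox.
have ms : m < s ^+ 2 + 0 ^+ 2.
  rewrite expr0n addr0 expr2 /s mulrDr mulr1 -[ltLHS]add0r; apply: ler_ltD; last by rewrite ltrDl.
  by rewrite mulr_ge0// addr_ge0.
have h1 := small x s 0 Ox ms; have [dF _ _] := cF x Ox.
have [xi hx e1] := mean_value1 0 s (fun s => (dF s 0).1).
rewrite add0r subr0 (gtr0_norm s0) in hx e1.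
have h2 : `|F x s 0 - F x 0 0| <= C * (1 + s) `^ p * s.
  rewrite e1 normrM (gtr0_norm s0); apply: ler_wpM2r; first exact: ltW.
  apply: (@le_trans _ _ (C * (1 + `|xi| + `|0|) `^ p)).
    by apply: le_trans (gF x xi 0 Ox); rewrite lerDl.
  apply: ler_wpM2l => //; rewrite normr0 addr0.
  by apply: (ge0_ler_powR (ltW p0)); rewrite ?nnegrE ?addr_ge0// ?(ltW s0)// lerD2l.
have h3 : `|F x s 0| <= e * (s ^+ 2 + 0 ^+ 2) by apply: le_trans h1; rewrite lerDl.
have -> : F x 0 0 = F x s 0 - (F x s 0 - F x 0 0) by rewrite subKr.
by apply: le_trans (ler_normB _ _) _; exact: lerD.
Qed.

Lemma sobolev_base (r : R) (q := 4 `^ (r - 2)^-1) : 2 < r -> 1 < q /\ q `^ (r - 2) = 4.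
Proof.
move=> r2; have h0 : 0 < r - 2 by rewrite subr_gt0.
have e1 : q `^ (r - 2) = 4 by rewrite /q -powRrM mulVf ?powRr1// lt0r_neq0.
split => //; rewrite ltNge; apply/negP => q1.
have := ge0_ler_powR (ltW h0) (powR_ge0 4 _ : q \is Num.nneg) (ler01 : (1 : R) \is Num.nneg) q1.
by rewrite e1 powR1; lra.
Qed.

(** For n > 2, r = 2 + 4 / (n - 2) = 2n / (n - 2) is the critical exponent: 2 (pF + 1) = r with pF =
    2 / (n - 2), p < (n + 2) / (n - 2) is exactly p + 1 < r, and q^(r - 2) = 4 means 4 q^2 = 2^n.
    For n = 2 the condition on q is just q > 1, so r may be taken as large as the growth of F, G and
    K requires. *)
Lemma critical_exponents F G K : (2 <= n)%N -> classA_crit Omega F -> classA_crit Omega G -> classA Omega K ->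
  exists r q pF p C : R, [/\ 2 < r, 1 < q, (2 ^ n)%:R <= 4 * q ^+ 2 & q `^ (r - 2) = 4] /\
    [/\ 0 < pF, pF <= p, 2 * (pF + 1) <= r & p + 1 < r] /\
    [/\ 0 <= C, gradient_bound F pF C, gradient_bound G pF C & gradient_bound K p C].
Proof.
move=> hn [[_ _ [p1 [p10 _ g1]]] cF] [[_ _ [p2 [p20 _ g2]]] cG] [_ _ [p3 [p30 l3 g3]]].
have [C3 C30 b3] := growth_bound p30 g3.
have conclude pF r : 2 < r -> 2 * (pF + 1) <= r -> p3 + 1 < r -> pF + 1 < r -> 0 < pF ->
    (exists2 C, 0 <= C & gradient_bound F pF C) -> (exists2 C, 0 <= C & gradient_bound G pF C) ->
    (2 ^ n)%:R <= 4 * (4 `^ (r - 2)^-1) ^+ 2 :> R ->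
  exists r q pF p C : R, [/\ 2 < r, 1 < q, (2 ^ n)%:R <= 4 * q ^+ 2 & q `^ (r - 2) = 4] /\
    [/\ 0 < pF, pF <= p, 2 * (pF + 1) <= r & p + 1 < r] /\
    [/\ 0 <= C, gradient_bound F pF C, gradient_bound G pF C & gradient_bound K p C].
  move=> r2 hr h3 h1 pF0 [Ca Ca0 ba] [Cb Cb0 bb] hq; have [q1 q2] := sobolev_base r2.
  exists r, (4 `^ (r - 2)^-1), pF, (Num.max pF p3), (Ca + Cb + C3); split; first by split.
  split; first split; [exact: pF0|by rewrite le_max lexx|exact: hr| |].
    by case: (leP pF p3).
  split.
  - by rewrite !addr_ge0.
  - by apply: (gradient_bound_weaken Ca0 (lexx _) _ ba); rewrite -addrA lerDl addr_ge0.
  - by apply: (gradient_bound_weaken Cb0 (lexx _) _ bb); rewrite addrAC lerDr addr_ge0.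
  - by apply: (gradient_bound_weaken C30 _ _ b3); rewrite ?le_max ?lexx ?orbT// lerDr addr_ge0.
have [n2|n2] := leqP n 2.
  have [C1' C10 b1] := growth_bound p10 g1; have [C2 C20 b2] := growth_bound p20 g2.
  pose pF := Num.max p1 p2; pose r := 2 * (pF + 1) + p3.
  have pF0 : 0 < pF by rewrite lt_max p10.
  have r2 : 2 < r by rewrite /r; lra.
  apply: (conclude pF r) => //; try (by rewrite /r; lra).
  - by exists C1' => //; apply: (gradient_bound_weaken C10 _ (lexx _) b1); rewrite le_max lexx.
  - by exists C2 => //; apply: (gradient_bound_weaken C20 _ (lexx _) b2); rewrite le_max lexx orbT.
  - have -> : n = 2 by apply/eqP; rewrite eqn_leq n2 hn.
    rewrite (_ : (2 ^ 2)%:R = 4)// ler_peMr// exprn_ege1//; apply: ltW.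
    by have [] := sobolev_base r2.
pose N : R := n%:R - 2; have N0 : 0 < N by rewrite /N subr_gt0 (ltr_nat R 2 n).
pose i := N^-1; have i0 : 0 < i by rewrite invr_gt0.
have Ni : N * i = 1 by rewrite mulfV// lt0r_neq0.
have pF0 : 0 < 2 / N by rewrite divr_gt0.
have [C1' C10 b1] := growth_bound pF0 (cF n2); have [C2 C20 b2] := growth_bound pF0 (cG n2).
have h3 : p3 < 1 + 4 * i.
  have := l3 n2; rewrite -/N -/i => h; apply: lt_le_trans h _.
  have -> : n%:R + 2 = N + 4 :> R by rewrite /N; lra.
  by rewrite mulrDl Ni.
apply: (conclude (2 / N) (2 + 4 * i)); rewrite -?/i.
- by lra.
- by lra.
- by lra.
- by lra.
- by lra.
- by exists C1'.
- by exists C2.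
- have -> : (2 + 4 * i - 2)^-1 = N / 4 by rewrite addrAC subrr add0r invfM /i invrK mulrC.
  rewrite -powR_mulrn ?powR_ge0// -powRrM.
  have e4 : 4 `^ (N / 4 * 2%:R) = (2 `^ 2%:R) `^ (N / 4 * 2%:R) :> R by rewrite powR_mulrn// -natrX.
  rewrite e4 -powRrM; have -> : 2%:R * (N / 4 * 2%:R) = N by lra.
  have -> : N = (n - 2)%:R by rewrite /N natrB// ltnW.
  rewrite powR_mulrn// -[in leLHS](subnK hn) expnD natrM natrX.
  by rewrite mulrC.
Qed.

End growth.

Lemma quadratic_arith {R : realType} (a b d1 d2 l th : R) : 0 < l -> 0 <= th -> l * a <= d1 -> l * b <= d2 ->
  th * (a + b) <= th / l * (d1 + d2).
Proof.
move=> l0 th0 h1 h2; rewrite -mulrA; apply: ler_wpM2l => //.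
by rewrite mulrC ler_pdivlMr// mulrC mulrDr; exact: lerD.
Qed.

Lemma coercive_arith {R : realType} (N a c d : R) : 0 < d -> N ^+ 2 / 2 - ((2^-1 - d) * N ^+ 2 + c) <= a ->
  N <= 1 + (a + c) / d.
Proof.
move=> d0 h; apply: (@le_trans _ _ (1 + N ^+ 2)).
  by have := sqr_ge0 (N - 2^-1); rewrite !expr2; lra.
rewrite lerD2l ler_pdivlMr//; move: h; rewrite !expr2; lra.
Qed.

(** * Coercivity of the functional *)

Section variational.
Context {R : realType} {n : nat} (Omega : set 'rV[R]_n).
Local Notation leb := (lebesgue_rV R n).
Local Notation vol' := (@vol R n).
Local Notation V := ('rV[R]_n -> R^o).
Local Notation Dir := (dirichlet Omega).
Local Notation H10 := (H10 Omega).
Local Notation E2 := (sq_set (H10 : set V)).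
Local Notation B2 := (sq_ip Dir).
Local Notation I f := (\int[leb]_(x in Omega) f x).
Local Notation l1 := (lambda1 Omega).
Implicit Types (w z h : V * V) (x : 'rV[R]_n).
Hypotheses (oO : open Omega) (bO : bounded_set Omega).
Let mO : measurable Omega := measurable_Omega oO.
Let fO : (leb Omega < +oo)%E := lebesgue_bounded_lty bO.
Let h0 := semi_ip_H10 oO bO.
Let hB := semi_ip_sq h0.
Variables (i0 : 'I_n) (a0 : 'rV[R]_n) (s0 : R).
Hypotheses (s00 : 0 < s0) (OQ : Omega `<=` cube a0 s0).
Hypothesis vol_gt0 : forall s : R, 0 < s -> 0 < vol' s.
Hypothesis l0 : 0 < l1.

Lemma potential_quadratic H (th c : R) w : 0 <= th -> E2 w ->
  integ leb Omega (fun x => H x (w.1 x) (w.2 x)) ->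
  (forall x s t, Omega x -> H x s t <= th * (s ^+ 2 + t ^+ 2) + c) ->
  potential Omega H w <= th / l1 * nrm B2 w ^+ 2 + c * I (fun=> 1).
Proof.
move=> th0 Ew iH hH; have [Eu Ev] := Ew.
have [_ iu] := H10_sqinteg oO Eu; have [_ iv] := H10_sqinteg oO Ev.
have i1 := integD mO iu iv; have i2 := integZ mO th i1; have ic := integ_cst mO 1 fO.
have i3 := integZ mO c ic; have i4 := integD mO i2 i3.
have le1 x : Omega x -> H x (w.1 x) (w.2 x) <= th * (w.1 x ^+ 2 + w.2 x ^+ 2) + c * 1.
  by move=> Ox; rewrite mulr1; exact: hH.
apply: le_trans (Rint_le mO iH i4 le1) _.
have e1 := RintegralD mO i2 i3; have e2 := RintegralZl th mO i1; have e3 := RintegralZl c mO ic.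
have e4 := RintegralD mO iu iv.
rewrite e1 e2 e3 e4 (nrm_sqr hB Ew) lerD2r.
have q1 := lambda1_le oO bO i0 s00 OQ vol_gt0 Eu; have q2 := lambda1_le oO bO i0 s00 OQ vol_gt0 Ev.
rewrite dotE in q1; rewrite dotE in q2; exact: (quadratic_arith l0 th0 q1 q2).
Qed.

Lemma potential_coercive H (th c : R) : 0 <= th -> th < l1 / 2 ->
  (forall w, E2 w -> integ leb Omega (fun x => H x (w.1 x) (w.2 x))) ->
  (forall x s t, Omega x -> H x s t <= th * (s ^+ 2 + t ^+ 2) + c) ->
  coercive_on E2 B2 (half_sq_minus B2 (potential Omega H)).
Proof.
move=> th0 thl iH hH a; pose d := 2^-1 - th / l1.
have d0 : 0 < d by rewrite subr_gt0 ltr_pdivrMr// mulrC.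
exists (1 + (a + c * I (fun=> 1)) / d) => w Ew ha; apply: coercive_arith => //.
have -> : 2^-1 - d = th / l1 by rewrite /d subKr.
apply: le_trans ha; rewrite /half_sq_minus lerD2l lerN2.
exact: (potential_quadratic th0 Ew (iH w Ew) hH).
Qed.

Lemma potential_nonneg H (th : R) : 0 <= th -> th < l1 / 2 ->
  (forall w, E2 w -> integ leb Omega (fun x => H x (w.1 x) (w.2 x))) ->
  (forall x s t, Omega x -> H x s t <= th * (s ^+ 2 + t ^+ 2)) ->
  forall w, E2 w -> 0 <= half_sq_minus B2 (potential Omega H) w.
Proof.
move=> th0 thl iH hH w Ew; rewrite /half_sq_minus subr_ge0.
have hH' x s t : Omega x -> H x s t <= th * (s ^+ 2 + t ^+ 2) + 0 by rewrite addr0; exact: hH.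
apply: le_trans (potential_quadratic th0 Ew (iH w Ew) hH') _; rewrite mul0r addr0 mulrC.
apply: ler_wpM2l; first exact: sqr_ge0.
by rewrite ler_pdivrMr// mulrC ltW.
Qed.

End variational.

Section small_perturbation.
Context {R : realType} {n : nat} (Omega : set 'rV[R]_n).
Implicit Types (F G K : 'rV[R]_n -> R -> R -> R) (x : 'rV[R]_n).

Lemma sublevel_amp (s t m : R) : 0 <= m -> s ^+ 2 + t ^+ 2 <= m -> 1 + `|s| + `|t| <= 3 + m.
Proof.
move=> m0 h; have h1 := sqr_ge0 (`|s| - 2^-1); have h2 := sqr_ge0 (`|t| - 2^-1).
have e1 : `|s| ^+ 2 = s ^+ 2 by rewrite real_normK// num_real.
have e2 : `|t| ^+ 2 = t ^+ 2 by rewrite real_normK// num_real.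
by move: h1 h2 h; rewrite -e1 -e2; move: `|s| `|t| => a b; rewrite !expr2; lra.
Qed.

Lemma small_bound F G p C : 0 < p -> 0 <= C -> nice Omega p C F -> nice Omega p C G ->
  (forall e : R, 0 < e -> exists2 m, 0 <= m &
    forall x s t, Omega x -> m < s ^+ 2 + t ^+ 2 -> `|F x s t| + `|G x s t| <= e * (s ^+ 2 + t ^+ 2)) ->
  forall e : R, 0 < e -> exists2 c, 0 <= c &
    forall x s t, Omega x -> `|F x s t| + `|G x s t| <= e * (s ^+ 2 + t ^+ 2) + c.
Proof.
move=> p0 C0 nF nG small e e0; have [m m0 hm] := small e e0.
have p1 : 0 <= p + 1 := addr_ge0 (ltW p0) ler01.
pose c := 2 * C * (3 + m) `^ (p + 1); have c0 : 0 <= c by rewrite mulr_ge0 ?powR_ge0// mulr_ge0.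
exists (c + c); first exact: addr_ge0.
move=> x s t Ox; have [h|h] := leP (s ^+ 2 + t ^+ 2) m; last first.
  by apply: le_trans (hm x s t Ox h) _; rewrite lerDl addr_ge0.
have q : 2 * C * (1 + `|s| + `|t|) `^ (p + 1) <= c.
  apply: ler_wpM2l; first by rewrite mulr_ge0.
  apply: (ge0_ler_powR p1); rewrite ?nnegrE ?amp_ge0 ?addr_ge0//.
  exact: sublevel_amp.
have h1 := le_trans (nice_le p0 C0 nF s t Ox) q; have h2 := le_trans (nice_le p0 C0 nG s t Ox) q.
apply: le_trans (lerD h1 h2) _; rewrite lerDr; apply: mulr_ge0; first exact: ltW.
by rewrite addr_ge0 ?sqr_ge0.
Qed.

Lemma comb_bound F G K (alpha beta : 'rV[R]_n -> R) (M eta l : R) : 0 <= M -> eta < l ->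
  (forall x, Omega x -> `|alpha x| <= M /\ `|beta x| <= M) ->
  (forall e : R, 0 < e -> exists2 c, 0 <= c &
    forall x s t, Omega x -> `|F x s t| + `|G x s t| <= e * (s ^+ 2 + t ^+ 2) + c) ->
  (forall x s t, Omega x -> K x s t <= eta * (s ^+ 2 + t ^+ 2)) ->
  exists th c : R, [/\ eta <= th, th < l & forall x s t, Omega x ->
    alpha x * F x s t + beta x * G x s t + K x s t <= th * (s ^+ 2 + t ^+ 2) + c].
Proof.
move=> M0 el hM small hK; have M1 : 0 < M + 1 by rewrite ltr_wpDl.
(* Half of the gap between eta and l is granted to the terms in F and G, whose coefficients are at
   most M; this fixes the precision d / (M + 1) asked of the smallness assumption. *)
pose d := (l - eta) / 2; have d0 : 0 < d by rewrite divr_gt0// subr_gt0.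
have e0 : 0 < d / (M + 1) by rewrite divr_gt0.
have [c c0 hc] := small _ e0.
exists (eta + d), (M * c); split.
- by rewrite lerDl ltW.
- by rewrite /d; lra.
move=> x s t Ox; have [ha hb] := hM x Ox; have q := hc x s t Ox; have qK := hK x s t Ox.
have f1 : alpha x * F x s t <= M * `|F x s t|.
  by apply: le_trans (ler_norm _) _; rewrite normrM; exact: ler_wpM2r.
have f2 : beta x * G x s t <= M * `|G x s t|.
  by apply: le_trans (ler_norm _) _; rewrite normrM; exact: ler_wpM2r.
have f3 := ler_wpM2l M0 q.
have S0 : 0 <= s ^+ 2 + t ^+ 2 by rewrite addr_ge0 ?sqr_ge0.
have f4 : M * (d / (M + 1) * (s ^+ 2 + t ^+ 2)) <= d * (s ^+ 2 + t ^+ 2).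
  rewrite mulrA; apply: ler_wpM2r => //; rewrite mulrA ler_pdivrMr// mulrC; apply: ler_wpM2l; [exact: ltW|].
  by rewrite lerDl.
move: f1 f2 f3 f4 qK; move: (s ^+ 2 + t ^+ 2) => S; rewrite !mulrDr mulrDl.
by clear; lra.
Qed.

End small_perturbation.

(** * Minimax *)

Lemma unit_segment_compact {R : realType} (t_ : nat -> R) : (forall k, 0 <= t_ k <= 1) ->
  exists s (t : R), [/\ subsequence s, 0 <= t <= 1 & t_ (s k) @[k --> \oo] --> t].
Proof.
move=> ht; have [|t [t01 ct]] := @segment_compact R 0 1 (t_ @ \oo) _.
  by exists 0%N => // k _ /=; rewrite in_itv /=; exact: ht.
have far k N : exists i, (N <= i)%N /\ `|t - t_ i| <= k.+1%:R^-1.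
  have k0 : 0 < k.+1%:R^-1 :> R by rewrite invr_gt0.
  have hA : (t_ @ \oo) (t_ @` [set i | (N <= i)%N]) by exists N => // i Ni; exists i.
  have [x [[i Ni <-] b]] := ct _ _ hA (nbhsx_ballx t _ k0).
  by exists i; split; [exact: Ni|exact: ltW b].
have [s [hs Hs]] := exists_subsequence far.
exists s, t; split; [exact: hs|by move: t01; rewrite /= in_itv|].
apply/cvgrPdist_le => e e0; have [N _ HN] := near_infty_natSinv_lt (PosNum e0).
by exists N => // k /HN /= hk; exact: le_trans (Hs k) (ltW hk).
Qed.

Lemma zmod_arith {Z : zmodType} (a b c d e : Z) : a + (b + c) - ((d + e) + b) = a - d + (c - e).
Proof. by rewrite [b + c]addrC addrA opprD addrACA subrr addr0 opprD addrACA. Qed.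

Section arithmetic.
Context {R : realType}.
Implicit Types (a b c d t m : R).

Lemma danskin_arith1 a b c t : 0 < t -> (1 - t) * a + t * b <= c -> c <= a -> t <= 1 -> b <= c.
Proof.
move=> t0 h ca t1; rewrite -(ler_pM2l t0).
have : (1 - t) * c <= (1 - t) * a by apply: ler_wpM2l; rewrite ?subr_ge0.
lra.
Qed.

Lemma danskin_arith2 a b c d (u : R) : 0 < u -> (1 - (1 + u)^-1) * a + (1 + u)^-1 * b <= c -> d <= b ->
  a <= c + u^-1 * (c - d).
Proof.
move=> u0 h db; have u1 : 0 < 1 + u by lra.
have e1 : (1 + u) * (1 + u)^-1 = 1 by rewrite mulfV// lt0r_neq0.
have : (1 + u) * ((1 - (1 + u)^-1) * a + (1 + u)^-1 * b) <= (1 + u) * c by rewrite ler_pM2l.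
have -> : (1 + u) * ((1 - (1 + u)^-1) * a + (1 + u)^-1 * b) =
    (1 + u) * a - ((1 + u) * (1 + u)^-1) * a + ((1 + u) * (1 + u)^-1) * b by lra.
rewrite e1 !mul1r => h1; rewrite -(ler_pM2l u0) mulrDr mulrA mulfV ?lt0r_neq0// mul1r.
lra.
Qed.

Lemma concave_arith a b c d (e : R) t m : (1 - t) * (a - b - m * c) + t * (a - d - m * e) =
  a - ((1 - t) * b + t * d) - m * ((1 - t) * c + t * e).
Proof. lra. Qed.

Lemma square_arith a b c t m : 0 <= m -> 0 <= t <= 1 -> 0 <= a - 2 * b + c ->
  - (m * ((1 - t) * a + t * c)) <= - (m * ((1 - t) ^+ 2 * a + 2 * (t * (1 - t)) * b + t ^+ 2 * c)).
Proof.
move=> m0 /andP[t0 t1] h; rewrite lerN2; apply: ler_wpM2l => //.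
have : 0 <= t * (1 - t) * (a - 2 * b + c) by rewrite mulr_ge0// mulr_ge0// subr_ge0.
rewrite !expr2; lra.
Qed.

Lemma far_arith (m p q n h : R) : 0 < m -> p / m / 2 - h <= 0 - q - m / 2 * n ->
  n - 2 * (- m^-1 * q) + m^-1 ^+ 2 * p <= 2 / m * h.
Proof.
move=> m0 H; have e1 : m * m^-1 = 1 by rewrite mulfV// lt0r_neq0.
rewrite -(ler_pM2l m0) expr2.
have -> : m * (2 / m * h) = (m * m^-1) * (2 * h) by lra.
have -> : m * (n - 2 * (- m^-1 * q) + m^-1 * m^-1 * p) = m * n + 2 * (m * m^-1) * q + (m * m^-1) * (m^-1 * p) by lra.
by rewrite e1; move: H; rewrite [p / m]mulrC; lra.
Qed.

Lemma limit_arith (m p q i : R) : 0 < m -> p / m / 2 <= i - - m^-1 * q - m / 2 * (m^-1 ^+ 2 * p) ->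
  p - q <= m * i.
Proof.
move=> m0; have e1 : m * m^-1 = 1 by rewrite mulfV// lt0r_neq0.
rewrite -(ler_pM2l m0) expr2.
have -> : m * (p / m / 2) = (m * m^-1) * (p / 2) by lra.
have -> : m * (i - - m^-1 * q - m / 2 * (m^-1 * m^-1 * p)) =
  m * i + (m * m^-1) * q - (m * m^-1) * (m * m^-1) * (p / 2) by lra.
rewrite e1; lra.
Qed.

Lemma mixed_arith t d : 2 * ((1 - t) * (t * d)) = 2 * (t * (1 - t)) * d.
Proof. lra. Qed.

Lemma penalty_arith m d : 0 < m -> m / 2 * (m^-1 * (m^-1 * d)) = m^-1 * d / 2.
Proof.
move=> m0; have e1 : m * m^-1 = 1 by rewrite mulfV// lt0r_neq0.
have -> : m / 2 * (m^-1 * (m^-1 * d)) = (m * m^-1) * (m^-1 * d / 2) by lra.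
by rewrite e1 mul1r.
Qed.

End arithmetic.

Section minimax.
Context {R : realType} {V Y : lmodType R}.
Variables (E : set V) (B : V -> V -> R) (L : set Y) (D : Y -> Y -> R).
Hypotheses (hB : semi_ip E B) (cpt : weak_compact E B) (hD : semi_ip L D).
Variables (PK : V -> R) (phi zeta : V -> Y) (S : set Y).
Implicit Types (x : V) (y z : Y) (P : set Y).
Hypothesis PKw : weakly_continuous E B PK.
Hypotheses (phiL : forall x, E x -> L (phi x)) (zetaL : forall x, E x -> L (zeta x)).
Hypotheses (SL : forall y, S y -> L y).
Hypothesis S_cvx : forall y z (t : R), S y -> S z -> 0 <= t <= 1 -> S ((1 - t) *: y + t *: z).
Hypothesis S_dns : forall y (e : R), L y -> 0 < e -> exists2 z, S z & nrm D (z - y) < e.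
Hypothesis phi_w : forall y, S y -> weakly_continuous E B (fun x => D (phi x) y).
Let J y := half_sq_minus B (fun x => PK x + D (phi x) y).
Hypothesis J_coer : forall y, S y -> coercive_on E B (J y).
Let I0 := half_sq_minus B PK.
Hypotheses (I_ge0 : forall x, E x -> 0 <= I0 x) (I_0 : I0 0 = 0).
Let rho := D (phi 0) (phi 0).
Hypothesis zeta1 : forall x, E x -> D (zeta x) (zeta x) = rho.
Hypothesis zeta2 : forall x, E x -> rho <= D (phi x) (zeta x).
(** Strong compactness is assumed of zeta; for phi only the pairings with a fixed element of S are
    taken to be weakly continuous, which leaves room for critical growth. *)
Hypothesis zeta3 : forall x_ : nat -> V, (forall k, E (x_ k)) -> nbounded B x_ ->
  exists s x, [/\ subsequence s, weak_cvg E B (x_ \o s) x & nrm D (zeta (x_ (s k)) - zeta x) @[k --> \oo] --> 0].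
Hypothesis uniq : forall y x1 x2, S y -> E x1 -> E x2 -> (forall x, E x -> J y x1 <= J y x) ->
  (forall x, E x -> J y x2 <= J y x) -> nrm B (x1 - x2) = 0.

Let E0 := ip0 hB.

Lemma Jw y : S y -> weakly_continuous E B (fun x => PK x + D (phi x) y).
Proof. by move=> Sy x_ x Ex bx wx; exact: (cvgD (PKw Ex bx wx) (phi_w Sy Ex bx wx)). Qed.

Lemma JE y x : J y x = I0 x - D (phi x) y.
Proof. by rewrite /J /I0 /half_sq_minus opprD addrA. Qed.

Section parameter.
Variable mu : R.
Hypothesis mu0 : 0 < mu.

Definition saddle x y : R := I0 x - D (phi x) y - mu / 2 * D y y.
Local Notation g := saddle.

Lemma saddleE x y : g x y = J y x - mu / 2 * D y y.
Proof. by rewrite /saddle JE. Qed.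

Lemma saddle_cvg x (y_ : nat -> Y) y : E x -> (forall k, L (y_ k)) -> L y ->
  nrm D (y_ k - y) @[k --> \oo] --> 0 -> g x (y_ k) @[k --> \oo] --> g x y.
Proof.
move=> Ex Ly_ Ly c; have Lx := phiL Ex.
have c1 : D (phi x) (y_ k) @[k --> \oo] --> D (phi x) y.
  have h := cvg_ip hD Ly_ Ly Lx c.
  have -> : (fun k => D (phi x) (y_ k)) = (fun k => D (y_ k) (phi x)).
    by apply/funext => k; exact: (ipC hD Lx (Ly_ k)).
  by rewrite (ipC hD Lx Ly).
have c2 : D (y_ k) (y_ k) @[k --> \oo] --> D y y.
  have h := cvg_nrm hD Ly_ Ly c.
  have -> : (fun k => D (y_ k) (y_ k)) = (fun k => nrm D (y_ k) * nrm D (y_ k)).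
    by apply/funext => k; rewrite -expr2 (nrm_sqr hD (Ly_ k)).
  by rewrite -(nrm_sqr hD Ly) expr2; exact: (cvgM h h).
by apply: cvgB; [apply: cvgB c1; exact: cvg_cst|apply: cvgM c2; exact: cvg_cst].
Qed.

Lemma saddle_concave x y z (t : R) : E x -> L y -> L z -> 0 <= t <= 1 ->
  (1 - t) * g x y + t * g x z <= g x ((1 - t) *: y + t *: z).
Proof.
move=> Ex Ly Lz t01; have Lx := phiL Ex; have L1 := ipZ hD (1 - t) Ly; have L2 := ipZ hD t Lz.
have e1 := ipDr hD L1 L2 Lx; have e2 := ipZr hD (1 - t) Ly Lx; have e3 := ipZr hD t Lz Lx.
have e4 := ip_sqrD hD L1 L2; have e5 := ip_sqrZ hD (1 - t) Ly; have e6 := ip_sqrZ hD t Lz.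
have e7 := ipZl hD (1 - t) Ly L2; have e8 := ipZr hD t Lz Ly.
rewrite /saddle concave_arith e1 e2 e3 e4 e5 e6 e7 e8 lerD2l.
have h : 0 <= D y y - 2 * D y z + D z z by rewrite -(ip_sqrB hD Ly Lz); exact: (ip_ge0 hD (ipB hD Ly Lz)).
have m2 : 0 <= mu / 2 by rewrite divr_ge0 // ltW.
apply: le_trans (square_arith m2 t01 h) _; rewrite lerN2 ler_wpM2l//.
by rewrite mixed_arith.
Qed.

Lemma saddle_lsc z (x_ : nat -> V) x (a_ : nat -> R) a : S z -> (forall k, E (x_ k)) -> nbounded B x_ ->
  weak_cvg E B x_ x -> (forall k, g (x_ k) z <= a_ k) -> a_ @ \oo --> a -> g x z <= a.
Proof.
move=> Sz Ex bx wx h ca; pose q := mu / 2 * D z z.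
have h' k : J z (x_ k) <= a_ k + q by rewrite -lerBlDr -saddleE.
have c' : (a_ k + q) @[k --> \oo] --> a + q by apply: cvgD ca _; exact: cvg_cst.
by rewrite saddleE lerBlDr; exact: (J_lsc hB (Jw Sz) Ex bx wx h' c').
Qed.

Lemma saddle_equiv z x x' : S z -> E x -> E x' -> nrm B (x - x') = 0 -> g x' z <= g x z.
Proof.
move=> Sz Ex Ex' n0.
have c : nrm B (x - x') @[k --> \oo] --> (0 : R) by rewrite n0; exact: cvg_cst.
have w := strong_weak_cvg hB (fun _ : nat => Ex) Ex' c.
apply: (saddle_lsc Sz (fun _ => Ex) _ w (fun _ => lexx _) (cvg_cst _)).
by exists (nrm B x).
Qed.

Lemma minimizer_choice : exists X : Y -> V, forall y, S y -> E (X y) /\ forall x, E x -> J y (X y) <= J y x.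
Proof.
have ex y : exists x0, S y -> E x0 /\ forall x, E x -> J y x0 <= J y x.
  have [Sy|nS] := pselect (S y); last by exists 0.
  by have [x0 Ex0 h] := J_min hB cpt (Jw Sy) (J_coer Sy); exists x0.
by have [X HX] := choice ex; exists X.
Qed.

Definition cpt_cvx P := [/\ P !=set0, forall y, P y -> S y,
  forall y z (t : R), P y -> P z -> 0 <= t <= 1 -> P ((1 - t) *: y + t *: z) &
  forall y_ : nat -> Y, (forall k, P (y_ k)) -> exists s y, [/\ subsequence s, P y & nrm D (y_ (s k) - y) @[k --> \oo] --> 0]].

Section bounded_value.
Variables (X : Y -> V) (r : R).
Hypothesis HX : forall y, S y -> E (X y) /\ forall x, E x -> J y (X y) <= J y x.
Let v y := g (X y) y.
Hypothesis vr : forall y, S y -> v y <= r.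

Lemma value_le y x : S y -> E x -> v y <= g x y.
Proof. by move=> Sy Ex; rewrite /v !saddleE lerD2r; exact: (HX Sy).2. Qed.

(** The value v is an infimum of functions of y that are continuous for [nrm D], hence upper
    semicontinuous, and it is bounded above by r. *)
Lemma value_max P : cpt_cvx P -> exists2 y, P y & forall z, P z -> v z <= v y.
Proof.
move=> [[p Pp] PS _ Pc].
have supA : has_sup [set v y | y in P].
  by split; [exists (v p), p|exists r => _ [y Py <-]; exact: vr (PS _ Py)].
set A := [set v y | y in P] in supA.
have far k : exists y, P y /\ sup A - harmonic k < v y.
  by have [_ [y Py <-] h] := sup_adherent (harmonic_gt0 k) supA; exists y.
have [y_ Hy] := choice far; have [s [y [hs Py cy]]] := Pc y_ (fun k => (Hy k).1).
have Ex := (HX (PS _ Py)).1.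
have cg := saddle_cvg Ex (fun k => SL (PS _ (Hy (s k)).1)) (SL (PS _ Py)) cy.
have ch : sup A - harmonic (s k) @[k --> \oo] --> sup A.
  rewrite -[X in _ --> X]subr0; apply: cvgB; first exact: cvg_cst.
  by apply: (cvg_subsequence hs); exact: cvg_harmonic.
have vy : sup A <= v y.
  apply: (ler_cvg_to ch cg); near=> k.
  exact: le_trans (ltW (Hy (s k)).2) (value_le (PS _ (Hy (s k)).1) Ex).
exists y => // z Pz; apply: le_trans vy; apply: sup_ubound; first by case: supA.
by exists z.
Unshelve. all: by end_near. Qed.

(* Compare the maximizer y of the value with [(1 - t) *: y + t *: z] and let t tend to
   0; uniqueness of the minimizer at y makes the limit point independent of z. *)
Lemma danskin P : cpt_cvx P -> exists2 x, E x & forall z, P z -> g x z <= r.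
Proof.
move=> cP; have [y Py ymax] := value_max cP; have [_ PS Pcv _] := cP.
have Sy := PS _ Py; have [Ex xmin] := HX Sy.
exists (X y) => // z Pz; apply: le_trans (vr Sy); have Sz := PS _ Pz.
(* Then t / (1 - t) = 1 / (k + 1), so concavity gives v y <= g(x_k, y) <= v y + (v y - v z) / (k +
   1): the minimizers at y_k are nearly minimal at y. *)
pose t k : R := (1 + k.+1%:R)^-1.
have u0 k : 0 < k.+1%:R :> R by rewrite ltr0n.
have t0 k : 0 < t k by rewrite invr_gt0 addr_gt0.
have t1 k : t k <= 1 by rewrite invf_le1 ?addr_gt0// lerDl ltW.
have t01 k : 0 <= t k <= 1 by rewrite t1 ltW.
pose y_ k := (1 - t k) *: y + t k *: z.
have Py_ k : P (y_ k) by exact: Pcv.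
pose x_ k := X (y_ k); have Ex_ k : E (x_ k) := (HX (PS _ (Py_ k))).1.
have key k : (1 - t k) * g (x_ k) y + t k * g (x_ k) z <= v y.
  apply: le_trans (saddle_concave (Ex_ k) (SL Sy) (SL Sz) (t01 k)) _.
  exact: (ymax _ (Py_ k)).
have gz k : g (x_ k) z <= v y.
  exact: (danskin_arith1 (t0 k) (key k) (value_le Sy (Ex_ k)) (t1 k)).
have gy k : g (x_ k) y <= v y + k.+1%:R^-1 * (v y - v z).
  exact: (danskin_arith2 (u0 k) (key k) (value_le Sz (Ex_ k))).
have bx : nbounded B x_.
  have [M HM] := J_coer Sz (v y + mu / 2 * D z z); exists M => k.
  by apply: (HM _ (Ex_ k)); rewrite -lerBlDr -saddleE.
have [s [x [hs wx]]] := cpt Ex_ bx; have [Exx _] := wx.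
have ca : v y + (s k).+1%:R^-1 * (v y - v z) @[k --> \oo] --> v y.
  rewrite -[X in _ --> X]addr0 -(mul0r (v y - v z)); apply: cvgD; first exact: cvg_cst.
  apply: cvgM; last exact: cvg_cst.
  exact: (cvg_subsequence hs (@cvg_harmonic R)).
have g1 := saddle_lsc Sy (fun k => Ex_ (s k)) (nbounded_comp s bx) wx (fun k => gy (s k)) ca.
have g2 : g x z <= v y := saddle_lsc Sz (fun k => Ex_ (s k)) (nbounded_comp s bx) wx (fun k => gz (s k)) (cvg_cst _).
have n0 : nrm B (x - X y) = 0.
  apply: (uniq Sy Exx Ex) => // x' Ex'; apply: le_trans (xmin _ Ex').
  by move: g1; rewrite /v !saddleE lerD2r.
exact: le_trans (saddle_equiv Sz Exx Ex n0) (g2 _).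
Qed.

End bounded_value.

(** For convex nonempty P, the convex hull of P and z. Polytopes are grown by one vertex at a time,
    so their compactness reduces to that of a segment. *)
Definition cone P z : set Y := [set w | exists y (t : R), [/\ P y, 0 <= t <= 1 & w = (1 - t) *: y + t *: z]].

Lemma cone_sub P z y : P y -> cone P z y.
Proof. by move=> Py; exists y, 0; rewrite lexx ler01 subr0 scale1r scale0r addr0. Qed.

Lemma cone_apex P z : P !=set0 -> cone P z z.
Proof. by move=> [y Py]; exists y, 1; rewrite lexx ler01 subrr scale0r scale1r add0r. Qed.

Lemma cpt_cvx1 z : S z -> cpt_cvx [set z].
Proof.
move=> Sz; split; [by exists z|by move=> y ->|move=> y y' t -> -> _|move=> y_ Hy].
  by rewrite /= -scalerDl subrK scale1r.
exists id, z; split => //.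
have -> : (fun k => nrm D (y_ (id k) - z)) = (fun=> 0) by apply/funext => k; rewrite (Hy k) subrr (nrm0 hD).
exact: cvg_cst.
Qed.

Lemma cone_arith (a t u : R) y y' z (s := (1 - a) * (1 - t) + a * (1 - u)) : s != 0 ->
  (1 - a) *: ((1 - t) *: y + t *: z) + a *: ((1 - u) *: y' + u *: z) =
  s *: ((1 - a * (1 - u) / s) *: y + (a * (1 - u) / s) *: y') + (1 - s) *: z.
Proof.
move=> s0; have sb b : s * (b / s) = b by rewrite mulrCA mulfV// mulr1.
rewrite !scalerDr !scalerA addrACA -scalerDl; congr (_ *: _ + _ *: _ + _ *: _).
- by rewrite [RHS]mulrBr mulr1 sb /s addrK.
- by rewrite sb.
- by rewrite /s; lra.
Qed.

Lemma cpt_cvx_cone P z : cpt_cvx P -> S z -> cpt_cvx (cone P z).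
Proof.
move=> [Pn PS Pcv Pc] Sz; split.
- by exists z; exact: cone_apex.
- by move=> _ [y [t [Py t01 ->]]]; exact: S_cvx (PS _ Py) Sz t01.
- move=> _ _ a [y [t [Py /andP[t0 t1] ->]]] [y' [u [Py' /andP[u0 u1] ->]]] /andP[a0 a1].
  pose s := (1 - a) * (1 - t) + a * (1 - u).
  have p1 : 0 <= (1 - a) * (1 - t) by rewrite mulr_ge0// subr_ge0.
  have p2 : 0 <= a * (1 - u) by rewrite mulr_ge0// subr_ge0.
  have s0 : 0 <= s by exact: addr_ge0.
  have s1 : s <= 1.
    have q1 : (1 - a) * (1 - t) <= (1 - a) * 1 by apply: ler_wpM2l; rewrite ?subr_ge0// lerBlDr lerDl.
    have q2 : a * (1 - u) <= a * 1 by apply: ler_wpM2l => //; rewrite lerBlDr lerDl.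
    by rewrite /s; move: q1 q2; rewrite !mulr1; lra.
  (* The total weight s of the points of P may vanish, in which case the combination is the apex
     z. *)
  have [sz|sn] := eqVneq s 0.
    have z1 : (1 - a) * (1 - t) = 0 by apply/eqP; rewrite eq_le p1 -sz lerDl p2.
    have z2 : a * (1 - u) = 0 by apply/eqP; rewrite eq_le p2 -sz lerDr p1.
    have -> : (1 - a) *: ((1 - t) *: y + t *: z) + a *: ((1 - u) *: y' + u *: z) = z.
      rewrite !scalerDr !scalerA z1 z2 !scale0r !add0r -scalerDl.
      by rewrite (_ : _ + _ = 1) ?scale1r//; move: z1 z2; lra.
    exact: cone_apex.
  have sp : 0 < s by rewrite lt_neqAle eq_sym sn.
  rewrite (cone_arith _ _ _ sn); exists ((1 - a * (1 - u) / s) *: y + (a * (1 - u) / s) *: y'), (1 - s).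
  split; last by rewrite subKr.
    apply: Pcv => //; rewrite divr_ge0//= ler_pdivrMr// mul1r /s lerDr//.
  by rewrite subr_ge0 s1 lerBlDr lerDl.
move=> w_ Hw; have [y_ Hy] := choice Hw; have [t_ Ht] := choice Hy.
have [s [y [hs Py cy]]] := Pc y_ (fun k => let: And3 h _ _ := Ht k in h).
have tt k : 0 <= t_ (s k) <= 1 by have [] := Ht (s k).
have [s' [t [hs' t01 ct]]] := unit_segment_compact (t_ := t_ \o s) (fun k => tt k).
have Ly_ k : L (y_ k) by case: (Ht k) => h _ _; exact: SL (PS _ h).
have Ly := SL (PS _ Py); have Lz := SL Sz.
pose st := s \o s'; exists st, ((1 - t) *: y + t *: z); split; first exact: subsequence_comp.
  by exists y, t.
pose dk k := 1 * nrm D (y_ (st k) - y) + `|t_ (st k) - t| * nrm D (z - y).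
have cd : dk k @[k --> \oo] --> (0 : R).
  have c1 : 1 * nrm D (y_ (st k) - y) @[k --> \oo] --> 1 * (0 : R).
    by apply: cvgM (cvg_subsequence hs' cy); exact: cvg_cst.
  have c2 : `|t_ (st k) - t| @[k --> \oo] --> (0 : R).
    by rewrite -(normr0 R) -(subrr t); apply: cvg_norm; apply: cvgB ct (cvg_cst t).
  have c3 : `|t_ (st k) - t| * nrm D (z - y) @[k --> \oo] --> 0 * nrm D (z - y).
    by apply: cvgM c2 _; exact: cvg_cst.
  rewrite mulr0 in c1; rewrite mul0r in c3.
  by rewrite -[X in _ --> X](addr0 (0 : R)); exact: (cvgD c1 c3).
apply: (squeeze_cvgr _ (cvg_cst 0) cd); near=> k; rewrite nrm_ge0 /=.
have [_ /andP[k0 k1] ->] := Ht (st k).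
have -> : (1 - t_ (st k)) *: y_ (st k) + t_ (st k) *: z - ((1 - t) *: y + t *: z) =
    (1 - t_ (st k)) *: (y_ (st k) - y) + (t_ (st k) - t) *: (z - y).
  move: (y_ _) (t_ _) => y1 t1.
  have -> : (1 - t) *: y = (1 - t1) *: y + (t1 - t) *: y by rewrite -scalerDl; congr (_ *: _); lra.
  have -> : t1 *: z = t *: z + (t1 - t) *: z by rewrite -scalerDl; congr (_ *: _); lra.
  by rewrite !(scalerBr _ _ y) zmod_arith.
have Ld1 := ipB hD (Ly_ (st k)) Ly; have Ld2 := ipB hD Lz Ly.
apply: le_trans (nrmD hD (ipZ hD _ Ld1) (ipZ hD _ Ld2)) _; rewrite (nrmZ hD _ Ld1) (nrmZ hD _ Ld2).
rewrite /dk lerD2r; apply: ler_wpM2r; first exact: nrm_ge0.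
by rewrite ger0_norm ?subr_ge0// lerBlDr lerDl.
Unshelve. all: by end_near. Qed.

Let M : R := rho / mu / 2.

(** At this y the coupling term is at least rho / mu and the penalty is exactly rho / (2 mu),
    because |zeta x|^2 = rho for every x. *)
Lemma saddle_zeta x : E x -> M <= g x (- mu^-1 *: zeta x).
Proof.
move=> Ex; have Lz := zetaL Ex; have Lx := phiL Ex; have i0 : 0 < mu^-1 by rewrite invr_gt0.
have e1 := ipZr hD (- mu^-1) Lz Lx; have e2 := ip_sqrZ hD (- mu^-1) Lz.
rewrite /saddle e1 e2 (zeta1 Ex) sqrrN.
have h : mu^-1 * rho <= mu^-1 * D (phi x) (zeta x) by rewrite ler_pM2l//; exact: zeta2.
have e3 : mu / 2 * (mu^-1 ^+ 2 * rho) = mu^-1 * rho / 2.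
  by rewrite expr2 -[_ * _ * rho]mulrA; exact: penalty_arith.
rewrite e3 /M [rho / mu]mulrC mulNr opprK; have := I_ge0 Ex.
by move: h; move: (mu^-1 * rho) (mu^-1 * D _ _) (I0 x) => p q i *; lra.
Qed.

Section low_value.
Variables (X : Y -> V) (r : R).
Hypothesis HX : forall y, S y -> E (X y) /\ forall x, E x -> J y (X y) <= J y x.
Hypothesis vr : forall y, S y -> g (X y) y <= r.

(** Each polytope P k has a point x_k with g <= r on P k, by [danskin], and the next polytope
    acquires a vertex z_k of S close to - zeta(x_k) / mu. A weak limit x satisfies g(x, z_j) <= r
    for all j, and since zeta is compact the z_j accumulate at - zeta(x) / mu, where g is at least
    M. *)
Lemma low_value_contra : M <= r.
Proof.
have [z0 Sz0 _] := S_dns (ip0 hD) ltr01.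
have exX P : exists x, cpt_cvx P -> E x /\ forall z, P z -> g x z <= r.
  have [cP|nP] := pselect (cpt_cvx P); last by exists 0.
  by have [x Ex h] := danskin HX vr cP; exists x.
have [XP HXP] := choice exX.
have exZ k : exists Z : V -> Y, forall x, E x -> S (Z x) /\ nrm D (Z x - - mu^-1 *: zeta x) < harmonic k.
  have ex x : exists z, E x -> S z /\ nrm D (z - - mu^-1 *: zeta x) < harmonic k.
    have [Ex|nE] := pselect (E x); last by exists 0.
    by have [z Sz h] := S_dns (ipZ hD (- mu^-1) (zetaL Ex)) (harmonic_gt0 k); exists z.
  by have [Z HZ] := choice ex; exists Z.
have [Z HZ] := choice exZ.
(* The new vertex depends on the point found for the previous polytope. The initial vertex z0 stays
   in all of them and bounds the x_k by coercivity. *)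
pose P := fix P (k : nat) : set Y := if k is k'.+1 then cone (P k') (Z k' (XP (P k'))) else [set z0].
have cP k : cpt_cvx (P k).
  elim: k => [|k IH] /=; first exact: cpt_cvx1.
  have [Ex _] := HXP _ IH; exact: cpt_cvx_cone IH (HZ k _ Ex).1.
pose x_ k := XP (P k); pose z_ k := Z k (x_ k).
have Ex_ k : E (x_ k) := (HXP _ (cP k)).1.
have Sz_ k : S (z_ k) := (HZ k _ (Ex_ k)).1.
have mono j k : (j <= k)%N -> P j `<=` P k.
  move=> /subnKC <-; elim: (k - j)%N => [|i IH]; first by rewrite addn0.
  by rewrite addnS => y /IH h; exact: cone_sub.
have zP j k : (j < k)%N -> P k (z_ j).
  move=> jk; apply: (mono _ _ jk); have [ne _ _ _] := cP j; exact: (cone_apex _ ne).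
have gz j k : (j < k)%N -> g (x_ k) (z_ j) <= r by move=> jk; exact: ((HXP _ (cP k)).2 _ (zP _ _ jk)).
have g0 k : g (x_ k) z0 <= r by apply: ((HXP _ (cP k)).2 z0); exact: (mono 0%N k (leq0n k)).
have bx : nbounded B x_.
  have [M' HM] := J_coer Sz0 (r + mu / 2 * D z0 z0); exists M' => k.
  by apply: (HM _ (Ex_ k)); rewrite -lerBlDr -saddleE.
have [s [x [hs wx cz]]] := zeta3 Ex_ bx; have [Ex _] := wx.
have gx j : g x (z_ j) <= r.
  have ha : subsequence (fun k => (k + j.+1)%N) by move=> a b; rewrite ltn_add2r.
  have sj k : (j < s (k + j.+1))%N.
    by apply: leq_trans (subsequence_ge hs _); rewrite addnS ltnS leq_addl.
  apply: (saddle_lsc (Sz_ j) (fun k => Ex_ (s (k + j.+1)%N)) _ (weak_cvg_subseq ha wx) (fun k => gz _ _ (sj k)) (cvg_cst _)).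
  exact: (nbounded_comp (s \o (fun k => (k + j.+1)%N)) bx).
have Lt := ipZ hD (- mu^-1) (zetaL Ex).
have cy : nrm D (z_ (s k) - - mu^-1 *: zeta x) @[k --> \oo] --> 0.
  have ch := cvg_subsequence hs (@cvg_harmonic R).
  have c2 : mu^-1 * nrm D (zeta (x_ (s k)) - zeta x) @[k --> \oo] --> mu^-1 * 0.
    by apply: cvgM cz; exact: cvg_cst.
  rewrite mulr0 in c2.
  have c : harmonic (s k) + mu^-1 * nrm D (zeta (x_ (s k)) - zeta x) @[k --> \oo] --> (0 : R).
    by rewrite -[X in _ --> X](addr0 (0 : R)); exact: (cvgD ch c2).
  apply: (squeeze_cvgr _ (cvg_cst 0) c); near=> k; rewrite nrm_ge0 /=.
  have Lk := ipZ hD (- mu^-1) (zetaL (Ex_ (s k))).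
  apply: le_trans (nrmB_trans hD (SL (Sz_ (s k))) Lk Lt) _.
  rewrite -scalerBr (nrmZ hD _ (ipB hD (zetaL (Ex_ (s k))) (zetaL Ex))) normrN.
  rewrite (ger0_norm (ltW (_ : 0 < mu^-1))) ?invr_gt0// lerD2r.
  exact: (ltW (HZ (s k) _ (Ex_ (s k))).2).
have cg := saddle_cvg Ex (fun k => SL (Sz_ (s k))) Lt cy.
apply: le_trans (saddle_zeta Ex) _.
by apply: (ler_cvg_to cg (cvg_cst r)); near=> k; exact: gx.
Unshelve. all: by end_near. Qed.

End low_value.

(** Completing the square, g(0, y) = M - (mu / 2) |y + phi(0) / mu|^2. Elements y_k of S whose value
    tends to at least M therefore converge to - phi(0) / mu, and g(x, y_k) >= M - 1 / (k + 1) passes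
    to the limit for every x. *)
Lemma parameter_bound x : E x -> rho - D (phi x) (phi 0) <= mu * I0 x.
Proof.
move=> Ex; have [X HX] := minimizer_choice; have i0 : 0 < mu^-1 by rewrite invr_gt0.
have far k : exists y, S y /\ M - harmonic k < g (X y) y.
  apply: contrapT => H; have := low_value_contra HX (r := M - harmonic k).
  have vr y : S y -> g (X y) y <= M - harmonic k.
    by move=> Sy; rewrite leNgt; apply/negP => h; apply: H; exists y.
  by move=> /(_ vr); have := harmonic_gt0 (R := R) k; move: (harmonic k) M => h m *; lra.
have [y_ Hy] := choice far.
have Sy k := (Hy k).1; have Ly k := SL (Sy k).
have L0 := phiL E0; pose yy := - mu^-1 *: phi 0; have Lyy : L yy := ipZ hD _ L0.
have gy k x' : E x' -> M - harmonic k <= g x' (y_ k).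
  move=> Ex'; apply: le_trans (ltW (Hy k).2) _.
  by rewrite !saddleE lerD2r; exact: ((HX _ (Sy k)).2).
have e0 k : nrm D (y_ k - yy) ^+ 2 <= 2 / mu * harmonic k.
  have Ld := ipB hD (Ly k) Lyy; rewrite (nrm_sqr hD Ld) (ip_sqrB hD (Ly k) Lyy).
  have a1 := ipZr hD (- mu^-1) L0 (Ly k); have a2 := ip_sqrZ hD (- mu^-1) L0.
  have a3 := ipC hD L0 (Ly k); rewrite -/yy in a1 a2; rewrite a1 a2 sqrrN -/rho.
  have := gy k 0 E0; rewrite /saddle I_0 a3 /M.
  exact: (far_arith mu0).
have cy : nrm D (y_ k - yy) @[k --> \oo] --> (0 : R).
  have c : 2 / mu * harmonic k @[k --> \oo] --> 2 / mu * 0.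
    by apply: cvgM (@cvg_harmonic R); exact: cvg_cst.
  apply/cvgr0Pnorm_le => e ee; have e2 : 0 < e ^+ 2 by rewrite exprn_gt0.
  rewrite mulr0 in c; have /cvgr0_norm_le/(_ _ e2) := c; apply: filterS => k hk.
  rewrite ger0_norm ?nrm_ge0// -(@ler_pXn2r _ 2)// ?nnegrE ?nrm_ge0 ?(ltW ee)//.
  by apply: le_trans (e0 k) _; apply: le_trans (ler_norm _) hk.
have cg := saddle_cvg Ex Ly Lyy cy.
have cM : M - harmonic k @[k --> \oo] --> M.
  by rewrite -[X in _ --> X]subr0; apply: cvgB (@cvg_harmonic R); exact: cvg_cst.
have : M <= g x yy by apply: (ler_cvg_to cM cg); near=> k; exact: gy.
have a1 := ipZr hD (- mu^-1) L0 (phiL Ex); have a2 := ip_sqrZ hD (- mu^-1) L0.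
rewrite -/yy in a1 a2; rewrite /saddle a1 a2 sqrrN -/rho /M.
exact: (limit_arith mu0).
Unshelve. all: by end_near. Qed.

End parameter.

Theorem minimax_alignment x : E x -> D (phi 0) (phi 0) <= D (phi x) (phi 0).
Proof.
move=> Ex; apply/ler_addgt0Pr => e e0; have I1 : 0 < I0 x + 1 by apply: ltr_wpDl; [exact: I_ge0|].
have m0 : 0 < e / (I0 x + 1) by rewrite divr_gt0.
have := parameter_bound m0 Ex; rewrite -/rho lerBlDl => h; apply: le_trans h _; rewrite lerD2l.
apply: (@le_trans _ _ (e / (I0 x + 1) * (I0 x + 1))); last by rewrite divfK// lt0r_neq0.
by apply: ler_wpM2l; [exact: ltW|rewrite lerDl].
Qed.

End minimax.

(** * Alignment of the nonlinearities *)

Section rescaling.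
Context {R : realType}.
Implicit Types (f g a b : R).

(* [rescale a 0 = 0], as [x / 0 = 0]. *)
Definition rescale a b : R := Num.sqrt a / Num.sqrt b.

Lemma rescale_norm f g a : 0 <= a -> a <= f ^+ 2 + g ^+ 2 ->
  (rescale a (f ^+ 2 + g ^+ 2) * f) ^+ 2 + (rescale a (f ^+ 2 + g ^+ 2) * g) ^+ 2 = a.
Proof.
move=> ha hle; have b0 : 0 <= f ^+ 2 + g ^+ 2 by exact: le_trans hle.
have e : rescale a (f ^+ 2 + g ^+ 2) ^+ 2 = a / (f ^+ 2 + g ^+ 2) by rewrite /rescale expr_div_n !sqr_sqrtr.
move: (rescale _ _) e => c e; rewrite !exprMn -mulrDr e.
have [bz|bn] := eqVneq (f ^+ 2 + g ^+ 2) 0; last by rewrite divfK.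
by rewrite bz mulr0; apply/eqP; rewrite eq_le ha -bz hle.
Qed.

Lemma rescale_dot f g a : 0 <= a -> a <= f ^+ 2 + g ^+ 2 ->
  a <= f * (rescale a (f ^+ 2 + g ^+ 2) * f) + g * (rescale a (f ^+ 2 + g ^+ 2) * g).
Proof.
move=> ha hle; have b0 : 0 <= f ^+ 2 + g ^+ 2 by exact: le_trans hle.
rewrite mulrCA [g * _]mulrCA -mulrDr -!expr2 /rescale.
have [bz|bn] := eqVneq (f ^+ 2 + g ^+ 2) 0; first by rewrite bz mulr0 -bz.
have s0 : Num.sqrt (f ^+ 2 + g ^+ 2) != 0 by rewrite sqrtr_eq0 -ltNge lt_neqAle eq_sym bn.
rewrite -{2}(sqr_sqrtr b0) expr2 mulrA divfK// -{1}(sqr_sqrtr ha) expr2.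
apply: ler_wpM2l; first exact: sqrtr_ge0.
exact: ler_wsqrtr.
Qed.

Lemma rescale_le f g a : 0 <= a -> a <= f ^+ 2 + g ^+ 2 ->
  `|rescale a (f ^+ 2 + g ^+ 2) * f| <= Num.sqrt a /\ `|rescale a (f ^+ 2 + g ^+ 2) * g| <= Num.sqrt a.
Proof.
move=> ha hle; have e := rescale_norm ha hle; move: e; set u := _ * f; set v := _ * g => e.
split.
  by rewrite -sqrtr_sqr; apply: ler_wsqrtr; rewrite -e lerDl sqr_ge0.
by rewrite -sqrtr_sqr; apply: ler_wsqrtr; rewrite -e lerDr sqr_ge0.
Qed.

(** For a = 0 the factor is identically 0; for a > 0 the denominator is positive at the limit. The
    discontinuity of [rescale a] at 0 is thus never met, which is the use of the minimality in
    (a_3). *)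
Lemma rescale_cvg (f_ g_ : nat -> R) f g a : 0 <= a -> a <= f ^+ 2 + g ^+ 2 ->
  f_ @ \oo --> f -> g_ @ \oo --> g ->
  rescale a (f_ k ^+ 2 + g_ k ^+ 2) * f_ k @[k --> \oo] --> rescale a (f ^+ 2 + g ^+ 2) * f /\
  rescale a (f_ k ^+ 2 + g_ k ^+ 2) * g_ k @[k --> \oo] --> rescale a (f ^+ 2 + g ^+ 2) * g.
Proof.
move=> ha hle cf cg.
have [az|an] := eqVneq a 0.
  rewrite az; have r0 b : rescale 0 b = 0 by rewrite /rescale sqrtr0 mul0r.
  split.
    have -> : (fun k => rescale 0 (f_ k ^+ 2 + g_ k ^+ 2) * f_ k) = (fun=> 0) by apply/funext => k; rewrite r0 mul0r.
    by rewrite r0 mul0r; exact: cvg_cst.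
  have -> : (fun k => rescale 0 (f_ k ^+ 2 + g_ k ^+ 2) * g_ k) = (fun=> 0) by apply/funext => k; rewrite r0 mul0r.
  by rewrite r0 mul0r; exact: cvg_cst.
have a0 : 0 < a by rewrite lt_neqAle eq_sym an.
have b0 : 0 < f ^+ 2 + g ^+ 2 by exact: lt_le_trans hle.
have c1 : f_ k ^+ 2 + g_ k ^+ 2 @[k --> \oo] --> f ^+ 2 + g ^+ 2.
  by rewrite !expr2; exact: (cvgD (cvgM cf cf) (cvgM cg cg)).
have c2 : Num.sqrt (f_ k ^+ 2 + g_ k ^+ 2) @[k --> \oo] --> Num.sqrt (f ^+ 2 + g ^+ 2).
  by apply: (cvg_comp _ _ c1); exact: sqrt_continuous.
have c3 : (Num.sqrt (f_ k ^+ 2 + g_ k ^+ 2))^-1 @[k --> \oo] --> (Num.sqrt (f ^+ 2 + g ^+ 2))^-1.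
  by apply: cvgV c2; rewrite sqrtr_eq0 -ltNge.
have c4 : rescale a (f_ k ^+ 2 + g_ k ^+ 2) @[k --> \oo] --> rescale a (f ^+ 2 + g ^+ 2).
  by apply: cvgM c3; exact: cvg_cst.
by split; [exact: (cvgM c4 cf)|exact: (cvgM c4 cg)].
Qed.

(** Gives the measurability of [rescaled] from that of real powers; at b = 0 both sides are 0. *)
Lemma rescale_powR a b : 0 <= a -> 0 <= b -> rescale a b = a `^ 2^-1 * b `^ (- 2^-1).
Proof. by move=> ha hb; rewrite /rescale powRN !powR12_sqrt. Qed.

End rescaling.

Section alignment.
Context {R : realType} {n : nat} (Omega : set 'rV[R]_n).
Local Notation leb := (lebesgue_rV R n).
Local Notation vol' := (@vol R n).
Local Notation V := ('rV[R]_n -> R^o).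
Local Notation Dir := (dirichlet Omega).
Local Notation H10 := (H10 Omega).
Local Notation E2 := (sq_set (H10 : set V)).
Local Notation B2 := (sq_ip Dir).
Local Notation L2s := (sqinteg leb Omega).
Local Notation LL := (sq_set (L2s : set V)).
Local Notation DD := (sq_ip (dot leb Omega : V -> V -> R)).
Local Notation I f := (\int[leb]_(x in Omega) f x).
Local Notation l1 := (lambda1 Omega).
Implicit Types (w z h y : V * V) (x : 'rV[R]_n).
Hypotheses (oO : open Omega) (bO : bounded_set Omega).
Let mO : measurable Omega := measurable_Omega oO.
Let fO : (leb Omega < +oo)%E := lebesgue_bounded_lty bO.
Let h0 := semi_ip_H10 oO bO.
Let hB := semi_ip_sq h0.
Let hS : semi_ip (L2s : set V) (dot leb Omega) := semi_ip_dot leb mO.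
Let hD := semi_ip_sq hS.
Variables (i0 : 'I_n) (a0 : 'rV[R]_n) (s0 : R).
Hypotheses (s00 : 0 < s0) (OQ : Omega `<=` cube a0 s0).
Hypothesis vol_gt0 : forall s : R, 0 < s -> 0 < vol' s.
Variables (r Cs : R).
Hypotheses (r2 : 2 < r).
Hypothesis sob : forall (u : V) (M : R), H10 u -> 0 < M -> nrm Dir u <= M ->
    integ leb Omega (fun x => `|u x| `^ r) /\ \int[leb]_(x in Omega) `|u x| `^ r <= Cs * M `^ r.
Variables (F G K : 'rV[R]_n -> R -> R -> R) (pF p C eta : R).
Hypotheses (pF0 : 0 < pF) (pFp : pF <= p) (pFr : 2 * (pF + 1) <= r) (pr : p + 1 < r) (C0 : 0 <= C).
Hypotheses (nF : nice Omega pF C F) (nG : nice Omega pF C G) (nK : nice Omega p C K).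
Hypotheses (eta0 : 0 < eta) (etal : eta < l1 / 2).
Hypothesis K_le : forall x s t, Omega x -> K x s t <= eta * (s ^+ 2 + t ^+ 2).
Hypothesis K_0 : forall x, Omega x -> K x 0 0 = 0.
Hypothesis small : forall e : R, 0 < e -> exists2 m, 0 <= m &
    forall x s t, Omega x -> m < s ^+ 2 + t ^+ 2 -> `|F x s t| + `|G x s t| <= e * (s ^+ 2 + t ^+ 2).
Hypothesis F_min : forall x s t, Omega x -> F x 0 0 ^+ 2 + G x 0 0 ^+ 2 <= F x s t ^+ 2 + G x s t ^+ 2.

Let p0 : 0 < p := lt_le_trans pF0 pFp.
Let l0 : 0 < l1. Proof. by have := lt_trans eta0 etal; rewrite pmulr_lgt0 ?invr_gt0. Qed.

Definition nemytskii w : V * V := (fun x => F x (w.1 x) (w.2 x), fun x => G x (w.1 x) (w.2 x)).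
Definition sqr_at w x : R := F x (w.1 x) (w.2 x) ^+ 2 + G x (w.1 x) (w.2 x) ^+ 2.
Definition rescaled w : V * V :=
  (fun x => rescale (sqr_at 0 x) (sqr_at w x) * F x (w.1 x) (w.2 x),
   fun x => rescale (sqr_at 0 x) (sqr_at w x) * G x (w.1 x) (w.2 x)).

Lemma sqr_at_ge0 w x : 0 <= sqr_at w x. Proof. by rewrite addr_ge0 ?sqr_ge0. Qed.

Lemma nem_meas w : E2 w -> measurable_fun Omega (nemytskii w).1 /\ measurable_fun Omega (nemytskii w).2.
Proof.
move=> [Eu Ev].
have [m1 _ _] := nice_meas_comp mO pF0 C0 nF (H10_meas oO Eu) (H10_meas oO Ev).
have [m2 _ _] := nice_meas_comp mO pF0 C0 nG (H10_meas oO Eu) (H10_meas oO Ev).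
by split; [exact: m1|exact: m2].
Qed.

(** The square has growth 2 (pF + 1) <= r, and equality is allowed: integrability, unlike
    compactness, holds at the critical exponent. *)
Lemma nice_sqinteg H w : nice Omega pF C H -> E2 w -> sqinteg leb Omega (fun x => H x (w.1 x) (w.2 x)).
Proof.
move=> nH Ew; have [Eu Ev] := Ew.
have [m1 _ _] := nice_meas_comp mO pF0 C0 nH (H10_meas oO Eu) (H10_meas oO Ev).
have [K' HK] := amp_bound oO bO r2 sob (nrm B2 w); have [ia _] := HK w Ew (lexx _).
split; first exact: m1.
apply: (integ_le mO _ _ (integZ mO ((2 * C) ^+ 2) ia)); first exact: measurable_funX.
move=> x Ox; rewrite ger0_norm ?sqr_ge0//.
have A1 := amp_ge1 w x; have C2 : 0 <= 2 * C by rewrite mulr_ge0.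
have h := nice_le pF0 C0 nH (w.1 x) (w.2 x) Ox; rewrite -/(amp w x) in h.
rewrite -(real_normK (num_real _)).
apply: (@le_trans _ _ ((2 * C * amp w x `^ (pF + 1)) ^+ 2)).
  by rewrite ler_pXn2r ?nnegrE// mulr_ge0 ?powR_ge0.
rewrite exprMn; apply: ler_wpM2l; first exact: sqr_ge0.
rewrite -powR_mulrn ?powR_ge0// -powRrM; apply: ler_powR => //.
by rewrite mulrC.
Qed.

Lemma nem_L2 w : E2 w -> LL (nemytskii w).
Proof. by move=> Ew; exact: (conj (nice_sqinteg nF Ew) (nice_sqinteg nG Ew)). Qed.

Let E0 : E2 0 := ip0 hB.

Lemma sqr_at_meas w : E2 w -> measurable_fun Omega (sqr_at w).
Proof.
move=> Ew; have [m1 m2] := nem_meas Ew.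
exact: (measurable_funD (measurable_funX 2 m1) (measurable_funX 2 m2)).
Qed.

Lemma rescaled_meas w : E2 w -> measurable_fun Omega (rescaled w).1 /\ measurable_fun Omega (rescaled w).2.
Proof.
move=> Ew; have [m1 m2] := nem_meas Ew.
have mr : measurable_fun Omega (fun x => rescale (sqr_at 0 x) (sqr_at w x)).
  have -> : (fun x => rescale (sqr_at 0 x) (sqr_at w x)) = (fun x => sqr_at 0 x `^ 2^-1 * sqr_at w x `^ (- 2^-1)).
    by apply/funext => x; rewrite rescale_powR ?sqr_at_ge0.
  exact: (measurable_funM (measurableT_comp (measurable_powR _) (sqr_at_meas E0)) (measurableT_comp (measurable_powR _) (sqr_at_meas Ew))).
by split; [exact: (measurable_funM mr m1)|exact: (measurable_funM mr m2)].
Qed.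

Lemma sqr_at0_le w x : Omega x -> sqr_at 0 x <= sqr_at w x.
Proof. by move=> Ox; exact: F_min. Qed.

Lemma sqrt_at0_le x : Omega x -> Num.sqrt (sqr_at 0 x) <= 2 * C.
Proof.
move=> Ox; have C2 : 0 <= 2 * C by rewrite mulr_ge0.
rewrite -(ger0_norm C2) -sqrtr_sqr; apply: ler_wsqrtr.
have q (a : R) : `|a| <= C -> a ^+ 2 <= C ^+ 2.
  by move=> ha; rewrite -(real_normK (num_real a)) ler_pXn2r ?nnegrE.
have q1 := q _ (nice_zero nF Ox); have q2 := q _ (nice_zero nG Ox).
apply: le_trans (lerD q1 q2) _; have := sqr_ge0 C; rewrite exprMn; move: (C ^+ 2) => c c0.
by rewrite expr2; lra.
Qed.

Lemma rescaled_bound w x : Omega x -> `|(rescaled w).1 x : R| <= 2 * C /\ `|(rescaled w).2 x : R| <= 2 * C.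
Proof.
move=> Ox; have [b1 b2] := rescale_le (sqr_at_ge0 0 x) (sqr_at0_le w Ox).
by split; [exact: le_trans b1 (sqrt_at0_le Ox)|exact: le_trans b2 (sqrt_at0_le Ox)].
Qed.

Lemma rescaled_L2 w : E2 w -> LL (rescaled w).
Proof.
move=> Ew; have [m1 m2] := rescaled_meas Ew.
split; apply: (sqinteg_bounded mO bO (M := 2 * C)).
- exact: m1.
- by move=> x Ox; have [? _] := rescaled_bound w Ox.
- exact: m2.
- by move=> x Ox; have [_ ?] := rescaled_bound w Ox.
Qed.

Lemma rescaled_norm w : E2 w -> DD (rescaled w) (rescaled w) = DD (nemytskii 0) (nemytskii 0).
Proof.
move=> Ew; have [[_ i1] [_ i2]] := rescaled_L2 Ew; have [[_ i3] [_ i4]] := nem_L2 E0.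
have e1 := RintegralD mO i1 i2; have e2 := RintegralD mO i3 i4.
rewrite /sq_ip !dotE -e1 -e2; apply: Rint_ext => x Ox.
exact: (rescale_norm (sqr_at_ge0 0 x) (sqr_at0_le w Ox)).
Qed.

Lemma rescaled_dot w : E2 w -> DD (nemytskii 0) (nemytskii 0) <= DD (nemytskii w) (rescaled w).
Proof.
move=> Ew; have [n1 n2] := nem_L2 Ew; have [z1 z2] := rescaled_L2 Ew; have [[_ i3] [_ i4]] := nem_L2 E0.
have j1 := sqinteg_mul mO n1 z1; have j2 := sqinteg_mul mO n2 z2.
have e1 := RintegralD mO j1 j2; have e2 := RintegralD mO i3 i4.
rewrite /sq_ip !dotE -e2 /dot -e1; apply: (Rint_le mO (integD mO i3 i4) (integD mO j1 j2)) => x Ox.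
exact: (rescale_dot (sqr_at_ge0 0 x) (sqr_at0_le w Ox)).
Qed.

Lemma bounded_cvg_L2 (f_ : nat -> V) (f : V) (M : R) : (forall k, measurable_fun Omega (f_ k : 'rV[R]_n -> R)) ->
  measurable_fun Omega (f : 'rV[R]_n -> R) -> (forall k x, Omega x -> `|f_ k x : R| <= M) -> (forall x, Omega x -> `|f x : R| <= M) ->
  {ae leb, forall x, Omega x -> (f_ k x : R) @[k --> \oo] --> (f x : R)} ->
  nrm (dot leb Omega : V -> V -> R) (f_ k - f) @[k --> \oo] --> (0 : R).
Proof.
move=> mf_ mf bf_ bf cf.
have md k : measurable_fun Omega (fun x => (f_ k x - f x : R) ^+ 2).
  exact: (measurable_funX 2 (measurable_funB (mf_ k) mf)).
have sd k : sqinteg leb Omega (f_ k - f).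
  apply: (sqinteg_bounded mO bO (M := M + M)); first exact: (measurable_funB (mf_ k) mf).
  by move=> x Ox; apply: le_trans (ler_normB _ _) _; apply: lerD; [exact: bf_|exact: bf].
have [_ c] : integ leb Omega (fun=> 0) /\ I (fun x => (f_ k x - f x : R) ^+ 2) @[k --> \oo] --> I (fun=> (0 : R)).
  apply: (dct mO (g := fun=> (M + M) ^+ 2)) => //.
  - apply: filterS cf => x h Ox; have c := cvgB (h Ox) (cvg_cst (f x : R)).
    have c1 : (f_ k x - f x : R) @[k --> \oo] --> (0 : R) by rewrite -(subrr (f x : R)); exact: c.
    by rewrite -(mul0r (0 : R)); exact: (cvgM c1 c1).
  - exact: (integ_cst mO _ fO).
  - apply: aeW => x k Ox; rewrite ger0_norm ?sqr_ge0// -(real_normK (num_real (_ - _))).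
    rewrite ler_pXn2r ?nnegrE//; last first.
      by have := normr_ge0 (f x : R); have := bf x Ox; move=> h1 h2; rewrite addr_ge0// (le_trans h2).
    by apply: le_trans (ler_normB _ _) _; apply: lerD; [exact: bf_|exact: bf].
rewrite Rintegral_cst// mul0r in c.
apply: (cvg_sqr0 (fun k => nrm_ge0 _ _) _ c) => k.
by rewrite (nrm_sqr hS (sd k)) dotE.
Qed.

(** The rescaled pairs are bounded by 2 C everywhere on Omega, so almost everywhere convergence of a
    subsequence of w_k is enough for convergence in L^2, whatever the growth of F and G. *)
Lemma rescaled_compact (w_ : nat -> V * V) : (forall k, E2 (w_ k)) -> nbounded B2 w_ ->
  exists s w, [/\ subsequence s, weak_cvg E2 B2 (w_ \o s) w &
    nrm DD (rescaled (w_ (s k)) - rescaled w) @[k --> \oo] --> 0].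
Proof.
move=> Ew bw; have [s [w [hs Ex ww cw]]] := sq_bounded_ae oO bO i0 s00 OQ vol_gt0 Ew bw.
exists s, w; split; [exact: hs|exact: ww|].
have pt : {ae leb, forall x, Omega x -> ((rescaled (w_ (s k))).1 x : R) @[k --> \oo] --> ((rescaled w).1 x : R) /\
    ((rescaled (w_ (s k))).2 x : R) @[k --> \oo] --> ((rescaled w).2 x : R)}.
  apply: filterS cw => x h Ox; have [h1 h2] := h Ox.
  have cF := nice_cvg pF0 C0 nF Ox h1 h2; have cG := nice_cvg pF0 C0 nG Ox h1 h2.
  exact: (rescale_cvg (sqr_at_ge0 0 x) (sqr_at0_le w Ox) cF cG).
have c1 : nrm (dot leb Omega : V -> V -> R) ((rescaled (w_ (s k))).1 - (rescaled w).1) @[k --> \oo] --> (0 : R).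
  apply: (bounded_cvg_L2 (M := 2 * C)).
  - by move=> k; exact: (rescaled_meas (Ew (s k))).1.
  - exact: (rescaled_meas Ex).1.
  - by move=> k x Ox; exact: (rescaled_bound _ Ox).1.
  - by move=> x Ox; exact: (rescaled_bound _ Ox).1.
  - by apply: filterS pt => x h Ox; exact: (h Ox).1.
have c2 : nrm (dot leb Omega : V -> V -> R) ((rescaled (w_ (s k))).2 - (rescaled w).2) @[k --> \oo] --> (0 : R).
  apply: (bounded_cvg_L2 (M := 2 * C)).
  - by move=> k; exact: (rescaled_meas (Ew (s k))).2.
  - exact: (rescaled_meas Ex).2.
  - by move=> k x Ox; exact: (rescaled_bound _ Ox).2.
  - by move=> x Ox; exact: (rescaled_bound _ Ox).2.
  - by apply: filterS pt => x h Ox; exact: (h Ox).2.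
have c : nrm (dot leb Omega : V -> V -> R) ((rescaled (w_ (s k))).1 - (rescaled w).1) +
    nrm (dot leb Omega : V -> V -> R) ((rescaled (w_ (s k))).2 - (rescaled w).2) @[k --> \oo] --> (0 : R).
  by rewrite -[X in _ --> X](addr0 (0 : R)); exact: (cvgD c1 c2).
apply: (squeeze_cvgr _ (cvg_cst 0) c); near=> k; rewrite nrm_ge0 /=.
exact: (nrm_sq_le hS (ipB hD (rescaled_L2 (Ew (s k))) (rescaled_L2 Ex))).
Unshelve. all: by end_near. Qed.

Variable S : set (V * V).
Hypothesis S_Linf : forall y, S y -> Linfty Omega y.1 /\ Linfty Omega y.2.
Hypothesis S_cvx : forall y z (t : R), S y -> S z -> 0 <= t <= 1 -> S ((1 - t) *: y + t *: z).
Hypothesis S_dns : forall y (e : R), LL y -> 0 < e -> exists2 z, S z & nrm DD (z - y) < e.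

Definition combined y x (s t : R) : R := y.1 x * F x s t + y.2 x * G x s t + K x s t.

Hypothesis no_three : forall y, S y -> ~ three_solutions Omega (combined y).

Lemma Linfty_L2 (u : V) : Linfty Omega u -> L2s u.
Proof.
move=> hu; have [u' [M [mu' bu' e]]] := truncation hu; have [mu0 _] := hu.
have su' : sqinteg leb Omega u' by apply: (sqinteg_bounded mO bO (M := M) mu') => x _; exact: bu'.
by apply: (sqinteg_ae mO su' mu0); apply: filterS e => x h Ox; exact: h.
Qed.

Lemma S_L2 y : S y -> LL y.
Proof. by move=> /S_Linf[h1 h2]; exact: (conj (Linfty_L2 h1) (Linfty_L2 h2)). Qed.

Lemma potential_K_integ w : E2 w -> integ leb Omega (fun x => K x (w.1 x) (w.2 x)).
Proof. by move=> Ew; exact: (potential_integ oO bO r2 sob p0 pr C0 nK Ew). Qed.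

(** Coefficients in S are bounded only almost everywhere, whereas [nice] asks for bounds at every
    point of Omega; truncating them changes the nonlinearity on a null set of x. *)
Lemma combined_truncation y : S y -> exists H' C', [/\ 0 <= C', nice Omega p C' H',
  {ae leb, forall x, Omega x -> combined y x = H' x},
  coercive_on E2 B2 (half_sq_minus B2 (potential Omega H')) &
  forall w, E2 w -> potential Omega H' w = potential Omega K w + DD (nemytskii w) y].
Proof.
move=> Sy; have [hal hbe] := S_Linf Sy.
have [al [M1 [mal bal eal]]] := truncation hal; have [be [M2 [mbe bbe ebe]]] := truncation hbe.
pose M := `|M1| + `|M2|; have M0 : 0 <= M by rewrite addr_ge0.
have bM x : Omega x -> `|al x| <= M /\ `|be x| <= M.
  move=> _; split.
    by apply: le_trans (bal x) _; apply: le_trans (ler_norm M1) _; rewrite lerDl.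
  by apply: le_trans (bbe x) _; apply: le_trans (ler_norm M2) _; rewrite lerDr.
pose H' x s t : R := al x * F x s t + be x * G x s t + K x s t.
have C'0 : 0 <= M * C + M * C + C by rewrite !addr_ge0 ?mulr_ge0.
have nF' := nice_weaken C0 pFp (lexx C) nF; have nG' := nice_weaken C0 pFp (lexx C) nG.
have nH : nice Omega p (M * C + M * C + C) H' by exact: (nice_comb C0 nF' nG' nK mal mbe bM).
exists H', (M * C + M * C + C); split.
- exact: C'0.
- exact: nH.
- by apply: filterS2 eal ebe => x h1 h2 Ox; rewrite /combined /H' (h1 Ox) (h2 Ox).
- have sm := small_bound pF0 C0 nF nG small.
  have [th [c [th1 th2 hth]]] := comb_bound M0 etal bM sm K_le.
  apply: (potential_coercive oO bO i0 s00 OQ vol_gt0 l0 (le_trans (ltW eta0) th1) th2 _ hth).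
  by move=> w Ew; exact: (potential_integ oO bO r2 sob p0 pr C'0 nH Ew).
- move=> w Ew; have [n1 n2] := nem_L2 Ew; have [y1 y2] := S_L2 Sy.
  have sal : sqinteg leb Omega al by apply: (sqinteg_bounded mO bO (M := M1) mal) => x _; exact: bal.
  have sbe : sqinteg leb Omega be by apply: (sqinteg_bounded mO bO (M := M2) mbe) => x _; exact: bbe.
  have j1 := sqinteg_mul mO sal n1; have j2 := sqinteg_mul mO sbe n2; have j3 := potential_K_integ Ew.
  have j4 := integD mO j1 j2.
  have e1 := RintegralD mO j4 j3; have e2 := RintegralD mO j1 j2.
  have -> : potential Omega H' w = I (fun x => al x * F x (w.1 x) (w.2 x)) + I (fun x => be x * G x (w.1 x) (w.2 x)) + potential Omega K w.
    by rewrite -e2 -e1.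
  rewrite addrC; congr (_ + _); rewrite /sq_ip /dot; congr (_ + _).
    symmetry; apply: (Rint_ae_meas oO (integ_measurable j1)).
    by apply: filterS eal => x h Ox; rewrite mulrC (h Ox).
  symmetry; apply: (Rint_ae_meas oO (integ_measurable j2)).
  by apply: filterS ebe => x h Ox; rewrite mulrC (h Ox).
Qed.

Lemma alignment w : E2 w -> DD (nemytskii 0) (nemytskii 0) <= DD (nemytskii w) (nemytskii 0).
Proof.
have cpt := sq_compact oO bO i0 s00 OQ vol_gt0.
have PKw : weakly_continuous E2 B2 (potential Omega K).
  exact: (potential_weak oO bO i0 s00 OQ vol_gt0 r2 sob p0 pr C0 nK).
(* For y in S this pairing is the difference of two potentials with growth p + 1 < r, hence weakly
   continuous even though [nemytskii] need not be compact. *)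
have phi_w y : S y -> weakly_continuous E2 B2 (fun z => DD (nemytskii z) y).
  move=> Sy; have [H' [C' [C'0 nH _ _ eH]]] := combined_truncation Sy.
  have Hw := potential_weak oO bO i0 s00 OQ vol_gt0 r2 sob p0 pr C'0 nH.
  have de z : E2 z -> DD (nemytskii z) y = potential Omega H' z - potential Omega K z.
    by move=> Ex; rewrite (eH z Ex) addrC addKr.
  move=> z_ z Ex bx wx; have [Exx _] := wx; rewrite (de z Exx).
  have -> : (fun k => DD (nemytskii (z_ k)) y) = (fun k => potential Omega H' (z_ k) - potential Omega K (z_ k)).
    by apply/funext => k; exact: (de _ (Ex k)).
  exact: (cvgB (Hw _ _ Ex bx wx) (PKw _ _ Ex bx wx)).
have JE y H' : (forall w, E2 w -> potential Omega H' w = potential Omega K w + DD (nemytskii w) y) -> forall z, E2 z ->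
    half_sq_minus B2 (fun z => potential Omega K z + DD (nemytskii z) y) z = half_sq_minus B2 (potential Omega H') z.
  by move=> eH z Ex; rewrite /half_sq_minus (eH z Ex).
have J_coer y : S y -> coercive_on E2 B2 (half_sq_minus B2 (fun z => potential Omega K z + DD (nemytskii z) y)).
  move=> Sy; have [H' [C' [C'0 nH _ cH eH]]] := combined_truncation Sy.
  move=> a; have [M HM] := cH a; exists M => z Ex; rewrite (JE y H' eH z Ex); exact: HM.
have I_ge0 := potential_nonneg oO bO i0 s00 OQ vol_gt0 l0 (ltW eta0) etal potential_K_integ K_le.
have I_0 : half_sq_minus B2 (potential Omega K) 0 = 0.
  rewrite /half_sq_minus (nrm0 hB) expr0n mul0r sub0r; apply/eqP; rewrite oppr_eq0; apply/eqP.
  rewrite -(mul0r (fine (leb Omega))) -(Rintegral_cst leb mO).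
  by apply: Rint_ext => x Ox; exact: K_0.
have uniq y z1 z2 : S y -> E2 z1 -> E2 z2 ->
    (forall z, E2 z -> half_sq_minus B2 (fun z => potential Omega K z + DD (nemytskii z) y) z1 <= half_sq_minus B2 (fun z => potential Omega K z + DD (nemytskii z) y) z) ->
    (forall z, E2 z -> half_sq_minus B2 (fun z => potential Omega K z + DD (nemytskii z) y) z2 <= half_sq_minus B2 (fun z => potential Omega K z + DD (nemytskii z) y) z) ->
    nrm B2 (z1 - z2) = 0.
  move=> Sy E_1 E_2 m1 m2; have [H' [C' [C'0 nH eqH cH eH]]] := combined_truncation Sy.
  apply: contrapT => /eqP ne; apply: (no_three Sy).
  apply: (three_solutions_ae oO p0 C'0 nH eqH).
  apply: (two_minima oO bO i0 s00 OQ vol_gt0 r2 sob p0 pr C'0 nH cH E_1 E_2 _ _ ne) => z Ex.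
    by rewrite -(JE y H' eH z Ex) -(JE y H' eH z1 E_1); exact: m1.
  by rewrite -(JE y H' eH z Ex) -(JE y H' eH z2 E_2); exact: m2.
exact: (minimax_alignment hB cpt hD PKw nem_L2 rescaled_L2 S_L2 S_cvx S_dns phi_w J_coer I_ge0 I_0
  rescaled_norm rescaled_dot rescaled_compact uniq).
Qed.

End alignment.

(** * Localization of the alignment inequality *)

Section alignment_contradiction.
Context {R : realType} {n : nat} (Omega : set 'rV[R]_n).
Local Notation leb := (lebesgue_rV R n).
Local Notation V := ('rV[R]_n -> R^o).
Local Notation H10 := (H10 Omega).
Local Notation I f := (\int[leb]_(x in Omega) f x).
Implicit Types (w : V * V) (x : 'rV[R]_n) (s t : R).
Hypotheses (oO : open Omega) (bO : bounded_set Omega).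
Let mO : measurable Omega := measurable_Omega oO.
Let fO : (leb Omega < +oo)%E := lebesgue_bounded_lty bO.
Variables (F G : 'rV[R]_n -> R -> R -> R) (p C : R).
Hypotheses (p0 : 0 < p) (C0 : 0 <= C) (nF : nice Omega p C F) (nG : nice Omega p C G).

Definition defect s t x : R := F x s t * F x 0 0 + G x s t * G x 0 0 - (F x 0 0 * F x 0 0 + G x 0 0 * G x 0 0).

Hypothesis aligned : forall u : V, H10 u -> forall s t, 0 <= I (fun x => defect (s * u x) (t * u x) x).

Lemma defect_meas (u v : 'rV[R]_n -> R) : measurable_fun Omega u -> measurable_fun Omega v ->
  measurable_fun Omega (fun x => defect (u x) (v x) x).
Proof.
move=> mu' mv; have [m1 _ _] := nice_meas_comp mO p0 C0 nF mu' mv.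
have [m2 _ _] := nice_meas_comp mO p0 C0 nG mu' mv.
have z1 := nice_meas nF 0 0; have z2 := nice_meas nG 0 0.
exact: (measurable_funB (measurable_funD (measurable_funM m1 z1) (measurable_funM m2 z2))
  (measurable_funD (measurable_funM z1 z1) (measurable_funM z2 z2))).
Qed.

Lemma defect_cvg x (s_ t_ : nat -> R) s t : Omega x -> s_ @ \oo --> s -> t_ @ \oo --> t ->
  defect (s_ k) (t_ k) x @[k --> \oo] --> defect s t x.
Proof.
move=> Ox cs ct; have cF := nice_cvg p0 C0 nF Ox cs ct; have cG := nice_cvg p0 C0 nG Ox cs ct.
have c1 : F x (s_ k) (t_ k) * F x 0 0 @[k --> \oo] --> F x s t * F x 0 0 by apply: cvgM cF _; exact: cvg_cst.
have c2 : G x (s_ k) (t_ k) * G x 0 0 @[k --> \oo] --> G x s t * G x 0 0 by apply: cvgM cG _; exact: cvg_cst.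
by apply: cvgB; [exact: (cvgD c1 c2)|exact: cvg_cst].
Qed.

Lemma defect_bounded s t : exists M, forall x (a : R), Omega x -> `|a| <= 1 -> `|defect (s * a) (t * a) x| <= M.
Proof.
pose P := 2 * C * (1 + `|s| + `|t|) `^ (p + 1).
exists (P * C + P * C + (C * C + C * C)) => x a Ox ha.
have p1 : 0 <= p + 1 := addr_ge0 (ltW p0) ler01.
have bd H : nice Omega p C H -> `|H x (s * a) (t * a)| <= P.
  move=> nH; apply: le_trans (nice_le p0 C0 nH _ _ Ox) _; apply: ler_wpM2l; first by rewrite mulr_ge0.
  apply: (ge0_ler_powR p1); rewrite ?nnegrE ?amp_ge0//.
  by rewrite !normrM; apply: lerD; [apply: lerD|]; rewrite // ler_piMr.
have q1 := bd _ nF; have q2 := bd _ nG; have z1 := nice_zero nF Ox; have z2 := nice_zero nG Ox.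
apply: le_trans (ler_normB _ _) _; apply: lerD.
  by apply: le_trans (ler_normD _ _) _; rewrite !normrM; apply: lerD; apply: ler_pM.
by apply: le_trans (ler_normD _ _) _; rewrite !normrM; apply: lerD; apply: ler_pM.
Qed.

Lemma defect_negligible s t : leb.-negligible (Omega `&` [set x | defect s t x < 0]).
Proof.
set A := Omega `&` _.
have mA : measurable A.
  have md := defect_meas (measurable_cst s) (measurable_cst t).
  have -> : A = Omega `&` (fun x => defect s t x) @^-1` `]-oo, 0[%classic.
    by apply/seteqP; split => x [Ox /= h]; split => //=; move: h; rewrite in_itv.
  by apply: md => //; exact: measurable_itv.
have AO : A `<=` Omega by move=> x [].
pose theta : V := \1_A; have mt : measurable_fun Omega (theta : 'rV[R]_n -> R) by exact: measurable_indic.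
have t1 x : `|theta x : R| <= 1 by rewrite /theta indicE; case: (_ \in _); rewrite ?normr1 ?normr0.
have st : sqinteg leb Omega theta by apply: (sqinteg_bounded mO bO (M := 1) mt) => x _; exact: t1.
have [phi Hphi] := choice (fun k => test_approx oO bO mA AO (harmonic_gt0 (R := R) k)).
have Hp k : H10 (phi k) by have [h _ _] := Hphi k; exact: (test_H10 oO bO h).
have p1 k x : `|phi k x : R| <= 1 by have [_ h _] := Hphi k; have /andP[h1 h2] := h x; rewrite ger0_norm.
have hS : semi_ip (sqinteg leb Omega : set V) (dot leb Omega) := semi_ip_dot leb mO.
have sp k : sqinteg leb Omega (phi k) := H10_sqinteg oO (Hp k).
have cN : nrm (dot leb Omega) ((phi k : V) - theta) @[k --> \oo] --> (0 : R).
  apply: (cvg_sqr0 (fun k => nrm_ge0 _ _) _ (@cvg_harmonic R)) => k.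
  rewrite (nrm_sqr hS (ipB hS (sp k) st)) dotE; have [_ _ h] := Hphi k; apply: le_trans h.
  by rewrite le_eqVlt; apply/orP; left; apply/eqP; apply: Rint_ext => x _; rewrite -sqrrN opprB.
have [sg [hs cae]] := nrm2_cvg_ae mO sp st cN.
have [M HM] := defect_bounded s t.
have mf_ k : measurable_fun Omega (fun x => defect (s * phi (sg k) x) (t * phi (sg k) x) x).
  have mp := H10_meas oO (Hp (sg k)).
  exact: (defect_meas (measurable_funM (measurable_cst s) mp) (measurable_funM (measurable_cst t) mp)).
have mf : measurable_fun Omega (fun x => defect (s * theta x) (t * theta x) x).
  exact: (defect_meas (measurable_funM (measurable_cst s) mt) (measurable_funM (measurable_cst t) mt)).
have [ig ci] : integ leb Omega (fun x => defect (s * theta x) (t * theta x) x) /\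
    I (fun x => defect (s * phi (sg k) x) (t * phi (sg k) x) x) @[k --> \oo] --> I (fun x => defect (s * theta x) (t * theta x) x).
  apply: (dct mO (g := fun=> M) mf_ mf).
  - apply: filterS cae => x h Ox; have c := h Ox; apply: (defect_cvg Ox); apply: cvgM c; exact: cvg_cst.
  - exact: (integ_cst mO M fO).
  - by apply: aeW => x k Ox; exact: (HM x _ Ox (p1 _ x)).
have I0 : 0 <= I (fun x => defect (s * theta x) (t * theta x) x).
  by apply: (ler_cvg_to (cvg_cst 0) ci); near=> k; exact: (aligned (Hp (sg k)) s t).
have on x : A x -> defect (s * theta x) (t * theta x) x = defect s t x.
  by move=> Ax; rewrite /theta indicE mem_set// !mulr1.
(* Off A the arguments are (0, 0), where [defect] vanishes; so the integral reduces to one over A,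
   of a negative function. *)
have off x : ~ A x -> defect (s * theta x) (t * theta x) x = 0.
  by move=> Ax; rewrite /theta indicE memNset// !mulr0 /defect subrr.
have le0 x : Omega x -> 0 <= - 1 * defect (s * theta x) (t * theta x) x.
  move=> Ox; rewrite mulN1r oppr_ge0; have [Ax|Ax] := pselect (A x); last by rewrite off.
  by rewrite on//; case: Ax => _ /ltW.
have ig' := integZ mO (-1) ig; have e := RintegralZl (-1) mO ig.
have Ie : I (fun x => - 1 * defect (s * theta x) (t * theta x) x) = 0.
  have I1 : 0 <= I (fun x => - 1 * defect (s * theta x) (t * theta x) x).
    by apply: Rint_ge0 => x Ox; exact: le0.
  apply/eqP; rewrite eq_le I1 andbT e mulN1r oppr_le0; exact: I0.
have := Rint_eq0_ae mO le0 ig' Ie.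
move=> [N [mN N0 hN]]; exists N; split => // x Ax; apply: hN => /= h.
have := h (AO _ Ax); rewrite on// mulN1r => /eqP; rewrite oppr_eq0 => /eqP d0.
by case: Ax => _ /=; rewrite d0 ltxx.
Unshelve. all: by end_near. Qed.

(** By continuity in (s, t), a negative value is also taken at a rational pair, and countably many
    null sets remain. *)
Lemma defect_ge0_ae : leb.-negligible (Omega `&` [set x | exists s t, defect s t x < 0]).
Proof.
pose A (k : nat) : set 'rV[R]_n := if unpickle k is Some (q1, q2) then
  Omega `&` [set x | defect (ratr q1) (ratr q2) x < 0] else set0.
apply: (@negligibleS _ _ _ _ (\bigcup_k A k)); last first.
  apply: negligible_bigcup => k; rewrite /A; case: unpickle => [[q1 q2]|]; first exact: defect_negligible.
  exact: negligible_set0.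
move=> x [Ox [s [t h]]].
have rc (a : R) : exists q_ : nat -> rat, ratr (q_ k) @[k --> \oo] --> a.
  have far k : exists q : rat, ratr q \in `]a, a + k.+1%:R^-1[ by apply: rat_in_itvoo; rewrite ltrDl invr_gt0.
  have [q_ Hq] := choice far; exists q_; apply/cvgrPdist_le => e e0.
  have [N _ HN] := near_infty_natSinv_lt (PosNum e0); exists N => // k /HN /= hk.
  have := Hq k; rewrite in_itv /= => /andP[h1 h2]; rewrite distrC ger0_norm ?subr_ge0 ?(ltW h1)//.
  by rewrite lerBlDl; apply: le_trans (ltW h2) _; rewrite lerD2l ltW.
have [q1 c1] := rc s; have [q2 c2] := rc t.
have /cvgr_lt/(_ _ h)[N _ /(_ N (leqnn N)) hN] := defect_cvg Ox c1 c2.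
have e : A (pickle (q1 N, q2 N)) = Omega `&` [set x | defect (ratr (q1 N)) (ratr (q2 N)) x < 0].
  by rewrite /A pickleK.
exists (pickle (q1 N, q2 N)); first exact: Logic.I.
by rewrite e; exact: (conj Ox hN).
Qed.

End alignment_contradiction.

Lemma convex_set_segment {R : realType} {Y : lmodType R} (S : set Y) : convex_set (S : set (convex_lmodType Y)) ->
  forall y z (t : R), S y -> S z -> 0 <= t <= 1 -> S ((1 - t) *: y + t *: z).
Proof.
move=> cS y z t Sy Sz /andP[t0 t1].
have := cS z y (Itv01 t0 t1) (mem_set Sz) (mem_set Sy) => /set_mem; rewrite addrC.
by [].
Qed.

Lemma dense_approx {R : realType} {n : nat} (Omega : set 'rV[R]_n) (S : set (('rV[R]_n -> R^o) * ('rV[R]_n -> R^o))) :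
  open Omega -> dense_in_L2xL2 Omega S -> (forall y, S y -> sq_set (sqinteg (lebesgue_rV R n) Omega : set ('rV[R]_n -> R^o)) y) ->
  forall y (e : R), sq_set (sqinteg (lebesgue_rV R n) Omega : set ('rV[R]_n -> R^o)) y -> 0 < e ->
  exists2 z, S z & nrm (sq_ip (dot (lebesgue_rV R n) Omega : ('rV[R]_n -> R^o) -> ('rV[R]_n -> R^o) -> R)) (z - y) < e.
Proof.
move=> oO Sd SL y e Ly e0; have mO := measurable_Omega oO; have [y1 y2] := Ly.
have hS : semi_ip (sqinteg (lebesgue_rV R n) Omega : set ('rV[R]_n -> R^o)) (dot (lebesgue_rV R n) Omega) := semi_ip_dot _ mO.
have hD := semi_ip_sq hS; have e2 : 0 < e ^+ 2 by rewrite exprn_gt0.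
have [z [Sz hz]] := Sd _ _ ((L2P oO y.1).2 y1) ((L2P oO y.2).2 y2) _ e2.
have Lz := SL _ Sz; have [d1 d2] := ipB hD Ly Lz.
exists z => //; rewrite (nrmBC hD Lz Ly) -(@ltr_pXn2r _ 2)// ?nnegrE ?nrm_ge0 ?(ltW e0)//.
rewrite (nrm_sqr hD (ipB hD Ly Lz)).
by move: hz; rewrite (L2normE oO d1) (L2normE oO d2) -EFinD lte_fin.
Qed.

Theorem theorem2p2 (R : realType) (n : nat) (hn : (2 <= n)%N)
    (Omega : set 'rV[R]_n)
    (Omega_domain : domain Omega) (Omega_bounded : bounded_set Omega)
    (Omega_smooth : smooth_boundary Omega)
    (F G K : 'rV[R]_n -> R -> R -> R)
    (FA : classA_crit Omega F) (GA : classA_crit Omega G) (KA : classA Omega K)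
    (K0 : forall x, Omega x -> K x 0 0 = 0)
    (a1 : (ereal_sup [set (`|F x z.1 z.2| + `|G x z.1 z.2|)%R%:E | x in Omega] *
            ((z.1 ^+ 2 + z.2 ^+ 2)^-1)%R%:E)%E
          @[z --> sqr_norm_pinfty R] --> 0%E)
    (a2 : exists eta : R, 0 < eta < lambda1 Omega / 2 /\
      forall x s t, Omega x -> K x s t <= eta * (s ^+ 2 + t ^+ 2))
    (a3 : (0 < lebesgue_rV R n
                 [set x | Omega x /\
                   (0 < `|F x 0 0| ^+ 2 + `|G x 0 0| ^+ 2)%R])%E)
    (a3' : forall x s t, Omega x ->
      `|F x 0 0| ^+ 2 + `|G x 0 0| ^+ 2 <= `|F x s t| ^+ 2 + `|G x s t| ^+ 2)
    (a4 : (0 < lebesgue_rV R n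
                 [set x | Omega x /\
                   (ereal_inf [set (F x 0 0 * F x z.1 z.2 +
                                    G x 0 0 * G x z.1 z.2)%R%:E
                              | z in [set: R * R]] <
                    (`|F x 0 0| ^+ 2 + `|G x 0 0| ^+ 2)%R%:E)%E])%E)
    (S : set (('rV[R]_n -> R^o) * ('rV[R]_n -> R^o)))
    (S_Linfty : forall ab, S ab -> Linfty Omega ab.1 /\ Linfty Omega ab.2)
    (S_convex : convex_set S)
    (S_dense : dense_in_L2xL2 Omega S) :
  exists alpha beta : 'rV[R]_n -> R, S (alpha, beta) /\
    let H := fun x s t =>
      alpha x * F x s t + beta x * G x s t + K x s t in
    exists w1 w2 w3 : ('rV[R]_n -> R) * ('rV[R]_n -> R),
      [/\ weak_solution Omega H w1, weak_solution Omega H w2 &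
          weak_solution Omega H w3] /\
      [/\ ~ ae_equal Omega w1 w2, ~ ae_equal Omega w1 w3 &
          ~ ae_equal Omega w2 w3] /\
      global_minimum Omega H w1 /\ global_minimum Omega H w2.
Proof.
have [oO _ _] := Omega_domain; have mO := measurable_Omega oO.
have i0 : 'I_n := Ordinal (leq_trans (ltnSn 0) (ltnW hn)).
have [c0 [s0 [s00 OQ]]] := bounded_sub_cube Omega_bounded.
(* The cube contains the set of positive measure in (a_3); every other cube inherits positivity of
   its volume by halving. *)
have cube_gt0 : (0 < lebesgue_rV R n (cube c0 s0))%E.
  by apply: (lt_le_trans a3); apply: le_lebesgue_outer => x [Ox _]; exact: OQ.
have vol_gt0 := vol_gt0_of_cube s00 cube_gt0.
have [r [q [pF [p [C [[r2 q1 hq qr] [[pF0 pFp pFr pr] [C0 gF gG gK]]]]]]]] := critical_exponents hn FA GA KA.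
have [Cs Cs0 sob] := sobolev_H10 oO Omega_bounded i0 s00 OQ vol_gt0 q1 hq r2 qr.
have [[mF cF _] _] := FA; have [[mG cG _] _] := GA; have [mK cK _] := KA.
have small := vanishing_quotient a1.
(* Any fixed precision serves here; it only yields the bounds of F and G at the origin that [nice]
   requires. *)
have [m m0 hm] := small _ ltr01.
have [CF hCF] := bounded_zero pF0 C0 m0 gF cF hm.
have [CG hCG] : exists C', forall x, Omega x -> `|G x 0 0| <= C'.
  apply: (bounded_zero pF0 C0 m0 gG cG (e := 1)) => x s t Ox h.
  by rewrite addrC; exact: hm.
pose C' := C + `|CF| + `|CG|.
have C'0 : 0 <= C' by rewrite !addr_ge0.
have CC' : C <= C' by rewrite /C' -addrA lerDl addr_ge0.
have nF : nice Omega pF C' F.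
  split; [exact: mF|exact: cF|exact: (gradient_bound_weaken C0 (lexx pF) CC' gF)|move=> x Ox].
  apply: le_trans (hCF x Ox) _; apply: le_trans (ler_norm CF) _.
  by rewrite /C' addrAC lerDr addr_ge0.
have nG : nice Omega pF C' G.
  split; [exact: mG|exact: cG|exact: (gradient_bound_weaken C0 (lexx pF) CC' gG)|move=> x Ox].
  apply: le_trans (hCG x Ox) _; apply: le_trans (ler_norm CG) _.
  by rewrite /C' lerDr addr_ge0.
have nK : nice Omega p C' K.
  split; [exact: mK|exact: cK|exact: (gradient_bound_weaken C0 (lexx p) CC' gK)|move=> x Ox].
  by rewrite K0// normr0.
have [eta [/andP[eta0 etal] K_le]] := a2.
have sq (a : R) : `|a| ^+ 2 = a ^+ 2 by rewrite real_normK// num_real.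
have F_min x s t : Omega x -> F x 0 0 ^+ 2 + G x 0 0 ^+ 2 <= F x s t ^+ 2 + G x s t ^+ 2.
  by move=> Ox; have := a3' x s t Ox; rewrite !sq.
apply: contrapT => NC.
have no_three y : S y -> ~ three_solutions Omega (combined F G K y).
  by move=> Sy h; apply: NC; exists y.1, y.2; split; [case: (y) Sy|exact: h].
have SL := S_L2 oO Omega_bounded S_Linfty.
have S_dns := dense_approx oO S_dense SL.
have S_cvx := convex_set_segment S_convex.
have al := alignment oO Omega_bounded i0 s00 OQ vol_gt0 r2 sob pF0 pFp pFr pr C'0 nF nG nK eta0 etal
  K_le K0 small F_min S_Linfty S_cvx S_dns no_three.
have h0 := semi_ip_H10 oO Omega_bounded.
have aligned (u : 'rV[R]_n -> R^o) : H10 Omega u -> forall s t : R,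
    0 <= \int[lebesgue_rV R n]_(x in Omega) defect F G (s * u x) (t * u x) x.
  move=> Hu s t; pose w : ('rV[R]_n -> R^o) * ('rV[R]_n -> R^o) := (s *: u, t *: u).
  have Ew : sq_set (H10 Omega : set ('rV[R]_n -> R^o)) w := conj (ipZ h0 s Hu) (ipZ h0 t Hu).
  have E0 := ip0 (semi_ip_sq h0).
  have [n1 n2] := nem_L2 oO Omega_bounded r2 sob pF0 pFr C'0 nF nG Ew.
  have [z1 z2] := nem_L2 oO Omega_bounded r2 sob pF0 pFr C'0 nF nG E0.
  have j1 := sqinteg_mul mO n1 z1; have j2 := sqinteg_mul mO n2 z2.
  have j3 := sqinteg_mul mO z1 z1; have j4 := sqinteg_mul mO z2 z2.
  have j5 := integD mO j1 j2; have j6 := integD mO j3 j4.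
  have e1 := RintegralB mO j5 j6; have e2 := RintegralD mO j1 j2; have e3 := RintegralD mO j3 j4.
  have := al w Ew; rewrite /sq_ip /dot -e2 -e3 -subr_ge0 -e1.
  by [].
have neg := defect_ge0_ae oO Omega_bounded pF0 C'0 nF nG aligned.
have [N [mN N0 hN]] := neg.
move: a4; apply/negP; rewrite -leNgt -N0; apply: le_lebesgue_outer => x [Ox lt].
apply: hN; split => //.
have [_ [z _ <-] hz] := ereal_inf_lt lt.
exists z.1, z.2; rewrite lte_fin !sq !expr2 in hz; rewrite /defect.
by rewrite subr_lt0 [F x z.1 _ * _]mulrC [G x z.1 _ * _]mulrC.
Qed.
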